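(* Let $X\subset\mathbb P^{n-1}$ be the projective Stanley-Reisner scheme over $\mathbb C$ of a polyhedral equivelar triangulated torus $T$ with $n$ vertices. Then the main components $S_\rho$ are the only smoothing components of $\mathrm{Def}^a_X$, and the discriminant of $\widetilde S$ is $\widetilde S\setminus T_M$.
   Context: Let $\mathbb T\subset\mathbb R^2$ be the lattice generated by $\tau_1=(1,0)$, $\tau_2=\frac12(-1,\sqrt3)$, $\tau_3=\frac12(-1,-\sqrt3)$ (so $\tau_1+\tau_2+\tau_3=0$). $\{3,6\}$ is the tessellation of $\mathbb R^2$ by equilateral triangles with vertex set $\mathbb T$ and edges $\{p,p+\tau_k\}$. Let $\Gamma\subseteq\mathbb T$ be a sublattice of index $n$, $T=\{3,6\}/\Gamma$, $G=\mathbb T/\Gamma$. $T$ is assumed polyhedral: the intersection of two triangles is a common face. $G$ acts simply transitively on $\mathrm{vert}\,T$ by translations; $\pm\tau_k(p)$ means $p\pm\tau_k$. $T$ has $3n$ edges $\{p,\tau_k(p)\}$. Convention: $\{i,j,k\}=\{1,2,3\}$. $X=\mathrm{Proj}\,\mathbb C[x_p:p\in\mathrm{vert}\,T]/I_T$, where $I_T$ is generated by the squarefree monomials of non-faces of $T$. $\mathrm{Def}^a_X$ is the functor of deformations of the pair $(X,\mathcal O_X(1))$ over local Artinian $\mathbb C$-algebras, and also denotes its versal base space. By a known theorem (Altmann-Christophersen) the versal base space is the germ at $0\in\mathbb C^{3n}$, with coordinates $t_{p,q}=t_{q,p}$ indexed by edges of $T$, defined by the ideal $I$ generated by the $2\times2$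 minors of the matrices $$\begin{bmatrix}t_{p,\tau_1(p)}&t_{p,\tau_2(p)}&t_{p,\tau_3(p)}\\t_{p,-\tau_1(p)}&t_{p,-\tau_2(p)}&t_{p,-\tau_3(p)}\end{bmatrix},\quad p\in\mathrm{vert}\,T.$$ Here $t_{p,\tau_k(p)}$ is dual to the first order deformation $x_m\mapsto x_mx_px_{\tau_k(p)}/(x_{-\tau_i(p)}x_{-\tau_j(p)})$ if $\{-\tau_i(p),-\tau_j(p)\}\subseteq m$, and $x_m\mapsto0$ otherwise (for squarefree monomials $x_m\in I_T$). Let $L\subset\mathbb Z^{3n}$ be the lattice spanned by the exponent vectors $v-w$ of these binomials $t^v-t^w$, and $\mathrm{Sat}\,L=\{v\in\mathbb Z^{3n}:dv\in L\text{ for some integer }d\neq0\}$. For $\rho\in(\mathrm{Sat}\,L/L)^*=\mathrm{Hom}(\mathrm{Sat}\,L/L,\mathbb C^* )$ the ideal $\langle t^{v_+}-\rho(v)t^{v_-}:v\in\mathrm{Sat}\,L\rangle$ is a minimal prime of $I$; the corresponding irreducible components $S_\rho$ of $\mathrm{Def}^a_X$ are the main components, and $S=S_1$ ($\rho$ trivial) is a germ of a toric variety. Let $A$ be the matrix with columns $A_{p,\tau_k(p)}=\epsilon_k+e_p+e_{\tau_k(p)}-e_{-\tau_i(p)}-e_{-\tau_j(p)}\in\mathbb Z^3\oplus\mathbb Z^n$, where $\epsilon_1,\epsilon_2,\epsilon_3$ and $e_p$ ($p\in\mathrm{vert}\,T$) are the standard basis; then $\ker A=\mathrm{Sat}\,L$.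 Let $M=\operatorname{im}A$ and $\sigma^\vee\subset M_{\mathbb R}$ the cone generated by the columns. The normalization of $S$ is $\widetilde S$, the germ at the torus fixed point $0$ of $\mathrm{Spec}\,\mathbb C[M\cap\sigma^\vee]$, and $T_M=\mathrm{Hom}(M,\mathbb C^* )$ is its dense torus. A smoothing component is a component whose general fibre in the versal family is smooth. The discriminant of $\widetilde S$ is the set of points over which the fibre of the versal family (pulled back along $\widetilde S\to S\subset\mathrm{Def}^a_X$) is singular.
   Formalization: The claim that the discriminant is S~ minus T_M is stated for a suitable choice of the coordinates t allowed by the known theorem; it fails for arbitrary such coordinates, which may differ by automorphisms that are the identity modulo the square of the maximal ideal. *)

(* Defs.v *)
From HB Require Import structures.
From mathcomp Require Import all_boot all_order all_algebra.
From mathcomp Require Import mpoly complex reals.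

Set Implicit Arguments.
Unset Strict Implicit.
Unset Printing Implicit Defensive.

Import Order.TTheory GRing.Theory Num.Theory.
Local Open Scope ring_scope.

Section CommutativeAlgebra.

Definition gen_ideal (R : comNzRingType) (S : R -> Prop) : R -> Prop :=
  fun r => exists (k : nat) (a g : 'I_k -> R),
    (forall i, S (g i)) /\ r = \sum_i a i * g i.

Definition is_ideal (R : comNzRingType) (I : R -> Prop) : Prop :=
  [/\ I 0, forall x y, I x -> I y -> I (x + y) & forall a x, I x -> I (a * x)].

Definition ideal_sum (R : comNzRingType) (I J : R -> Prop) : R -> Prop :=
  fun r => exists x y, [/\ I x, J y & r = x + y].

Definition ideal_pow (R : comNzRingType) (I : R -> Prop) (k : nat) : R -> Prop :=
  gen_ideal (fun r => exists s : 'I_k -> R, (forall i, I (s i)) /\ r = \prod_i s i).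

Definition ext_ideal (P R : comNzRingType) (f : P -> R) (I : P -> Prop) : R -> Prop :=
  gen_ideal (fun r => exists2 p, I p & r = f p).

Definition prime_ideal (R : comNzRingType) (I : R -> Prop) : Prop :=
  [/\ is_ideal I, ~ I 1 & forall x y, I (x * y) -> I x \/ I y].

Definition minimal_prime (R : comNzRingType) (I : R -> Prop) : Prop :=
  prime_ideal I /\
  forall J, prime_ideal J -> (forall r, J r -> I r) -> forall r, I r -> J r.

Definition nonunit (R : comNzRingType) (r : R) : Prop := ~ exists s, r * s = 1.

(* The submodule mM, where m is the maximal ideal of the local ring R. *)
Definition max_mul (R : comNzRingType) (M : lmodType R) : M -> Prop :=
  fun x => exists (k : nat) (r : 'I_k -> R) (y : 'I_k -> M),
    (forall i, nonunit (r i)) /\ x = \sum_i r i *: y i.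

(* M/N is a flat R-module, by the equational criterion. *)
Definition flat_quotient (R : comNzRingType) (M : lmodType R) (N : M -> Prop) : Prop :=
  forall (k : nat) (r : 'I_k -> R) (y : 'I_k -> M),
    N (\sum_i r i *: y i) ->
    exists (l : nat) (a : 'I_k -> 'I_l -> R) (z : 'I_l -> M),
      (forall i, N (y i - \sum_j a i j *: z j)) /\
      (forall j, \sum_i r i * a i j = 0).

(* f : P -> R exhibits R as the completion of P/I in the ideal m, that is as
   lim_k P/(I + m^k). *)
Definition is_completion (P R : comNzRingType) (I m : P -> Prop) (f : P -> R) : Prop :=
  let mR k := ext_ideal f (ideal_pow m k) in
  [/\ forall k r, exists p, mR k (r - f p),
      forall k p, mR k (f p) <-> ideal_sum I (ideal_pow m k) p,
      forall r, (forall k, mR k r) -> r = 0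
    & forall u : nat -> R, (forall k, mR k (u k.+1 - u k)) ->
        exists r, forall k, mR k (r - u k)].

(* Over an algebraically closed field C: the local Artinian C-algebras (with
   residue field C). *)
Definition local_artinian (C : fieldType) (B : comAlgType C) : Prop :=
  (forall x y : B, nonunit x -> nonunit y -> nonunit (x + y)) /\
  exists (k : nat) (g : 'I_k -> B), forall b, exists c : 'I_k -> C, b = \sum_i c i *: g i.

Definition dual_numbers (C : fieldType) (B : comAlgType C) (e : B) : Prop :=
  [/\ e != 0, e * e = 0 & forall b : B, exists c d : C, b = c%:A + d *: e].

End CommutativeAlgebra.

(* The tessellated torus T = {3,6}/Gamma.  The triangular lattice is Z^2 with
   tau_1 = (1,0), tau_2 = (0,1), tau_3 = (-1,-1); Gamma is the kernel of a
   surjection q of Z^2 onto a finite abelian group G = vert T.  'I_3 carries its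
   cyclic addition, so that {i, j, k} = {k + 1, k - 1, k}.                     *)

Definition lattice_tau (k : 'I_3) : (int * int)%type :=
  if k == 0 then (1, 0) else if k == 1 then (0, 1) else (-1, -1).

Section Torus.

Context (G : finZmodType) (q : {additive (int * int)%type -> G}).

Definition tau (k : 'I_3) : G := q (lattice_tau k).

Definition edge : finType := (G * 'I_3)%type.

Definition edge_ends (e : edge) : {set G} := [set e.1; e.1 + tau e.2].

(* Every triangle of {3,6} has exactly one edge {p, p + tau_1}; (p, false) and
   (p, true) are the two triangles containing this edge. *)
Definition triangle : finType := (G * bool)%type.

Definition triangle_vertices (c : triangle) : {set G} :=
  let: (p, b) := c in
  [set p; p + tau 0; if b then p - tau 1 else p - tau 2].

Definition triangle_edges (c : triangle) : {set edge} :=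
  let: (p, b) := c in
  if b then [set (p, 0); (p - tau 1, 1); (p + tau 0, 2)]
  else [set (p, 0); (p + tau 0, 1); (p - tau 2, 2)].

(* Triangles and edges are counted as cells of the torus: two edges with the same
   end points may be different. *)
Definition polyhedral : Prop :=
  (forall c, #|triangle_vertices c| = 3%N) /\
  forall c d, c != d ->
    let common := triangle_vertices c :&: triangle_vertices d in
    (#|common| <= 1)%N \/
    exists2 e, e \in triangle_edges c :&: triangle_edges d & common = edge_ends e.

Definition face (f : {set G}) : bool :=
  [exists c : triangle, f \subset triangle_vertices c].

Definition nonempty_face : Type := {f : {set G} | (f != set0) && face f}.

Definition xvar (B : comNzRingType) (p : G) : {mpoly B[#|G|]} := 'X_(enum_rank p).

Definition xmon (B : comNzRingType) (m : {set G}) : {mpoly B[#|G|]} :=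
  \prod_(p in m) xvar B p.

Definition SR_ideal (B : comNzRingType) : {mpoly B[#|G|]} -> Prop :=
  gen_ideal (fun h => exists2 m, ~~ face m & h = xmon B m).

(* link of the edge e = {p, tau_k(p)} *)
Definition edge_link (e : edge) : {set G} :=
  let: (p, k) := e in [set p - tau (k + 1); p - tau (k - 1)].

Definition edge_hom (B : comNzRingType) (e : edge) (m : {set G}) : {mpoly B[#|G|]} :=
  if edge_link e \subset m
  then xmon B (m :\: edge_link e) * xvar B e.1 * xvar B (e.1 + tau e.2) else 0.

(* x_m |-> phi(x_m) corresponds to the ideal generated by the x_m + eps phi(x_m) *)
Definition first_order_ideal (B : comNzRingType) (eps : B) (e : edge) :
    {mpoly B[#|G|]} -> Prop :=
  gen_ideal (fun h => exists2 m, ~~ face m & h = xmon B m + eps *: edge_hom B e m).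

(* Deformations of the pair (X, O_X(1)).  X is covered by the affine open sets
   U_f = D_+(prod_(p in f) x_p), f a nonempty face; this cover is closed under
   intersection (U_f is empty if f is not a face).  A deformation (X', L) over B lives
   on the same topological space and is given by the graded B-algebras
   chart f = \bigoplus_(d in Z) Gamma(U_f, L^d) and the restriction maps.       *)

Section Deformations.

Context (C : fieldType).

(* evaluation of h, with coefficients pushed forward along phi *)
Definition ev (R : comNzRingType) (B : comNzRingType) (phi : R -> B) (E : comAlgType B)
    (xi : G -> E) (h : {mpoly R[#|G|]}) : E :=
  mmap (fun r => (phi r)%:A) (fun i => xi (enum_val i)) h.

Record pair_deformation (B : comAlgType C) := PairDeformation {
  chart : nonempty_face -> comAlgType B;
  res : forall f g : nonempty_face, sval f \subset sval g ->
    {lrmorphism chart f -> chart g};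
  hdeg : forall f : nonempty_face, int -> chart f -> Prop;
  (* The identification of the closed fibre with (X, O_X(1)) is recorded by
     elements coord f p whose classes modulo the maximal ideal are the sections
     x_p of O_X(1); only these classes are ever used. *)
  coord : forall f : nonempty_face, G -> chart f;
  res_id : forall (f : nonempty_face) (s : sval f \subset sval f) x, res s x = x;
  res_comp : forall (f g h : nonempty_face) (s : sval f \subset sval g)
    (t : sval g \subset sval h) (u : sval f \subset sval h) x, res t (res s x) = res u x;
  chart_flat : forall f : nonempty_face, flat_quotient (fun x : chart f => x = 0);
  hdeg_lin : forall (f : nonempty_face) d (b : B) (x y : chart f),
    hdeg d x -> hdeg d y -> hdeg d (b *: x + y);
  hdeg_0 : forall (f : nonempty_face) d, hdeg d (0 : chart f);
  hdeg_1 : forall f : nonempty_face, hdeg 0 (1 : chart f);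
  hdeg_mul : forall (f : nonempty_face) d d' (x y : chart f),
    hdeg d x -> hdeg d' y -> hdeg (d + d') (x * y);
  hdeg_span : forall (f : nonempty_face) (x : chart f),
    exists (s : seq int) (c : int -> chart f),
    [/\ uniq s, forall d, hdeg d (c d) & x = \sum_(d <- s) c d];
  hdeg_direct : forall (f : nonempty_face) (s : seq int) (c : int -> chart f),
    uniq s -> (forall d, hdeg d (c d)) -> \sum_(d <- s) c d = 0 ->
    forall d, d \in s -> c d = 0;
  hdeg_res : forall (f g : nonempty_face) (s : sval f \subset sval g) d x,
    hdeg d x -> hdeg d (res s x);
  coord_deg : forall (f : nonempty_face) p, hdeg 1 (coord f p);
  coord_res : forall (f g : nonempty_face) (s : sval f \subset sval g) p,
    max_mul (res s (coord f p) - coord g p);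
  (* chart f / m = (C[x]/I_T)[1/x_f] *)
  coord_unit : forall f : nonempty_face, exists y,
    max_mul (y * \prod_(p in sval f) coord f p - 1);
  coord_rel : forall (f : nonempty_face) (h : {mpoly B[#|G|]}),
    max_mul (ev idfun (coord f) h) <->
    exists N : nat,
      ideal_sum (SR_ideal (B := B)) (max_mul (M := {mpoly B[#|G|]}))
        (xmon B (sval f) ^+ N * h);
  coord_gen : forall (f : nonempty_face) (x : chart f),
    exists (N : nat) (h : {mpoly B[#|G|]}),
    max_mul (x * (\prod_(p in sval f) coord f p) ^+ N - ev idfun (coord f) h)
}.

Arguments res {B _ f g}.

(* eta' -> eta over pi : B' -> B.  By flatness such a map identifies eta with the
   base change of eta' along pi. *)
Record pair_morphism (B' B : comAlgType C) (pi : B' -> B)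
    (eta' : pair_deformation B') (eta : pair_deformation B)
    (u : forall f : nonempty_face, chart eta' f -> chart eta f) : Prop := PairMorphism {
  pm_add : forall (f : nonempty_face) (x y : chart eta' f), u f (x + y) = u f x + u f y;
  pm_mul : forall (f : nonempty_face) (x y : chart eta' f), u f (x * y) = u f x * u f y;
  pm_one : forall f : nonempty_face, u f 1 = 1;
  pm_scale : forall (f : nonempty_face) b (x : chart eta' f), u f (b *: x) = pi b *: u f x;
  pm_hdeg : forall (f : nonempty_face) d (x : chart eta' f), hdeg d x -> hdeg d (u f x);
  pm_res : forall (f g : nonempty_face) (s : sval f \subset sval g) x,
    u g (res s x) = res s (u f x);
  pm_coord : forall (f : nonempty_face) p, max_mul (u f (coord eta' f p) - coord eta f p)
}.

(* A family of closed subschemes Proj R[x]/J of P^(n-1) over the local ring R, flat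
   over R and with closed fibre X. *)
Definition embedded_family (R : comNzRingType) (J : {mpoly R[#|G|]} -> Prop) : Prop :=
  [/\ is_ideal J,
      forall h d, J h -> J (pihomog mdeg d h),
      flat_quotient (M := {mpoly R[#|G|]}) J
    & forall h, ideal_sum J (max_mul (M := {mpoly R[#|G|]})) h <->
                ideal_sum (SR_ideal (B := R)) (max_mul (M := {mpoly R[#|G|]})) h].

(* The base change of (Proj R[x]/J, O(1)) along phi : R -> B is isomorphic to eta:
   the isomorphism is given by the sections xi_p of L which are the images of x_p. *)
Definition induces (R : comNzRingType) (J : {mpoly R[#|G|]} -> Prop)
    (B : comAlgType C) (phi : R -> B) (eta : pair_deformation B) : Prop :=
  exists xi : forall f : nonempty_face, G -> chart eta f,
    [/\ forall (f : nonempty_face) p, hdeg 1 (xi f p),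
        forall (f g : nonempty_face) (s : sval f \subset sval g) p,
          res s (xi f p) = xi g p,
        forall (f : nonempty_face) p, max_mul (xi f p - coord eta f p)
      & forall (f : nonempty_face) h, J h -> ev phi (xi f) h = 0].

(* J is a miniversal family for the functor of isomorphism classes of
   deformations of (X, O_X(1)): the map from h_R is smooth, and injective (hence
   bijective) on tangent spaces.  Algebra maps from R to local Artinian algebras
   are automatically local. *)
Definition miniversal (R : comAlgType C) (J : {mpoly R[#|G|]} -> Prop) : Prop :=
  [/\ embedded_family J,
      forall (B' B : comAlgType C) (pi : {lrmorphism B' -> B})
          (eta' : pair_deformation B') (eta : pair_deformation B)
          (u : forall f : nonempty_face, chart eta' f -> chart eta f)
          (phi : {lrmorphism R -> B}),
        local_artinian B' -> local_artinian B -> (forall b, exists b', pi b' = b) ->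
        pair_morphism pi u -> induces J phi eta ->
        exists phi' : {lrmorphism R -> B'},
          (forall r, pi (phi' r) = phi r) /\ induces J phi' eta'
    & forall (B : comAlgType C) (eps : B) (eta : pair_deformation B)
          (phi1 phi2 : {lrmorphism R -> B}),
        dual_numbers eps -> induces J phi1 eta -> induces J phi2 eta ->
        forall r, phi1 r = phi2 r].

Definition tvar (e : edge) : {mpoly C[#|edge|]} := 'X_(enum_rank e).

(* t_(p, - tau_k(p)) = t_(p - tau_k, k) *)
Definition base_ideal : {mpoly C[#|edge|]} -> Prop :=
  gen_ideal (fun h => exists (p : G) (a b : 'I_3),
    h = tvar (p, a) * tvar (p - tau b, b) - tvar (p, b) * tvar (p - tau a, a)).

Definition t_ideal : {mpoly C[#|edge|]} -> Prop :=
  gen_ideal (fun h => exists e, h = tvar e).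

(* iota presents R as the complete local ring at 0 of the scheme defined by the
   minors, the coordinates t_e being dual to the given first order deformations.
   Such coordinates are not unique: they may be composed with any automorphism of
   R that is the identity modulo the square of the maximal ideal.  There are such
   automorphisms that preserve all the S_rho but not the toric boundary of the
   normalization of S. *)
Definition versal_coordinates (R : comAlgType C) (J : {mpoly R[#|G|]} -> Prop)
    (iota : {lrmorphism {mpoly C[#|edge|]} -> R}) : Prop :=
  is_completion base_ideal t_ideal iota /\
  forall (B : comAlgType C) (eps : B) (phi : {lrmorphism R -> B}) (e : edge),
    dual_numbers eps ->
    (forall e', phi (iota (tvar e')) = if e' == e then eps else 0) ->
    exists eta : pair_deformation B,
      induces J phi eta /\ induces (first_order_ideal eps e) idfun eta.

Definition minor_vector (p : G) (a b : 'I_3) : {ffun edge -> int} :=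
  let delta (e : edge) : {ffun edge -> int} := [ffun e' => (e' == e)%:R] in
  delta (p, a) + delta (p - tau b, b) - delta (p, b) - delta (p - tau a, a).

Definition binomial_lattice (v : {ffun edge -> int}) : Prop :=
  exists c : G -> 'I_3 -> 'I_3 -> int,
    v = \sum_p \sum_a \sum_b minor_vector p a b *~ c p a b.

Definition saturation (v : {ffun edge -> int}) : Prop :=
  exists2 d : int, d != 0 & binomial_lattice (v *~ d).

(* rho in Hom(Sat L / L, C^* ) *)
Definition sat_character (rho : {ffun edge -> int} -> C) : Prop :=
  [/\ forall v, saturation v -> rho v != 0,
      forall v w, saturation v -> saturation w -> rho (v + w) = rho v * rho w
    & forall v, binomial_lattice v -> rho v = 1].

Definition tmon_pos (v : {ffun edge -> int}) : {mpoly C[#|edge|]} :=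
  \prod_e tvar e ^+ `|Num.max (v e) 0|%N.

(* the ideal of the germ S_rho *)
Definition main_component (R : comAlgType C)
    (iota : {lrmorphism {mpoly C[#|edge|]} -> R}) (rho : {ffun edge -> int} -> C) :
    R -> Prop :=
  ext_ideal iota (fun h => exists2 v, saturation v &
    h = tmon_pos v - rho v *: tmon_pos (- v)).

End Deformations.

(* The K-points of a closed subscheme of P^(n-1)_K defined by a set of equations. *)
Definition proj_point (K : fieldType) (J : {mpoly K[#|G|]} -> Prop)
    (a : 'rV[K]_#|G|) : Prop :=
  a != 0 /\ forall h, J h -> h.@[a 0] = 0.

(* Jacobian criterion for surfaces: the kernel of the Jacobian matrix, which is the
   tangent space of the affine cone, has dimension 2 + 1.  All fibres of the
   families considered here have pure dimension 2. *)
Definition smooth_at (K : fieldType) (J : {mpoly K[#|G|]} -> Prop)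
    (a : 'rV[K]_#|G|) : Prop :=
  exists W : 'M[K]_(3, #|G|), row_free W /\
    forall v : 'rV[K]_#|G|,
      (v <= W)%MS <->
      forall h, J h -> \sum_i (mderiv i h).@[a 0] * v 0 i = 0.

(* The fibre over the point P of Spec R.  Smoothness is tested at all points of the
   fibre with values in a field. *)
Definition smooth_fibre (R : comNzRingType) (J : {mpoly R[#|G|]} -> Prop)
    (P : R -> Prop) : Prop :=
  forall (K : fieldType) (psi : {rmorphism R -> K}),
    (forall r, psi r = 0 <-> P r) ->
    let JK h := exists2 g, J g & h = map_mpoly psi g in
    forall a, proj_point JK a -> smooth_at JK a.

Definition smoothing_component (R : comNzRingType) (J : {mpoly R[#|G|]} -> Prop)
    (P : R -> Prop) : Prop :=
  minimal_prime P /\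
  exists2 f, ~ P f & forall Q, prime_ideal Q -> (forall r, P r -> Q r) -> ~ Q f ->
    smooth_fibre J Q.

Definition discriminant (R : comNzRingType) (J : {mpoly R[#|G|]} -> Prop)
    (P : R -> Prop) : Prop :=
  prime_ideal P /\ ~ smooth_fibre J P.

Definition char_lattice : zmodType := {ffun 'I_3 + G -> int}.

Definition basis_vector (i : 'I_3 + G) : char_lattice := [ffun i' => (i' == i)%:R].

Definition A_column (e : edge) : char_lattice :=
  let: (p, k) := e in
  basis_vector (inl k) + basis_vector (inr p) + basis_vector (inr (p + tau k))
  - basis_vector (inr (p - tau (k + 1))) - basis_vector (inr (p - tau (k - 1))).

(* M \cap sigma^vee *)
Definition toric_monoid (Rr : realType) (v : char_lattice) : Prop :=
  (exists c : edge -> int, v = \sum_e A_column e *~ c e) /\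
  exists c : edge -> Rr, (forall e, 0 <= c e) /\
    forall i, (v i)%:~R = \sum_e c e * (A_column e i)%:~R.

(* (P, chi) is the algebra C[Q] of the submonoid Q of a lattice V. *)
Definition monoid_algebra (C : fieldType) (V : zmodType) (Q : V -> Prop)
    (P : comAlgType C) (chi : V -> P) : Prop :=
  [/\ chi 0 = 1,
      forall v w, Q v -> Q w -> chi (v + w) = chi v * chi w,
      forall x, exists (k : nat) (c : 'I_k -> C) (v : 'I_k -> V),
        (forall i, Q (v i)) /\ x = \sum_i c i *: chi (v i)
    & forall (s : seq V) (c : V -> C), uniq s -> (forall v, v \in s -> Q v) ->
        \sum_(v <- s) c v *: chi v = 0 -> forall v, v \in s -> c v = 0].

(* Rt is the complete local ring of Spec C[M \cap sigma^vee] at the torus fixed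
   point (kappa is the completion map), and j : R -> Rt, t_e |-> chi^(A_e), is the
   normalization map to S followed by the inclusion in the versal base space. *)
Definition normalization_of_S (Rr : realType) (C : fieldType) (R : comAlgType C)
    (iota : {lrmorphism {mpoly C[#|edge|]} -> R})
    (P : comAlgType C) (chi : char_lattice -> P) (Rt : comAlgType C)
    (kappa : {lrmorphism P -> Rt}) (j : {lrmorphism R -> Rt}) : Prop :=
  [/\ monoid_algebra (toric_monoid Rr) chi,
      is_completion (fun x : P => x = 0)
        (gen_ideal (fun x => exists v, [/\ toric_monoid Rr v, v != 0 & x = chi v]))
        kappa
    & forall e, j (iota (tvar C e)) = kappa (chi (A_column e))].

(* the points of the germ that lie in T_M = Spec C[M] *)
Definition in_torus (Rr : realType) (C : fieldType)
    (P : comAlgType C) (chi : char_lattice -> P) (Rt : comAlgType C) (kappa : P -> Rt)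
    (Q : Rt -> Prop) : Prop :=
  forall v, toric_monoid Rr v -> ~ Q (kappa (chi v)).

Definition pullback_family (R R' : comNzRingType) (j : {rmorphism R -> R'})
    (J : {mpoly R[#|G|]} -> Prop) : {mpoly R'[#|G|]} -> Prop :=
  ext_ideal (map_mpoly j) J.

End Torus.

(* Main.v *)
(** Nonunits t_e of a local Artinian algebra that satisfy the minor relations define an
    explicit deformation of (X, O_X(1)), in the manner of Mumford: its charts are monoid
    algebras of Z x Z^2 twisted by monomials in the t_e whose exponents are the bends of a
    piecewise linear function on the fan of the hexagon around a vertex, and the minors
    are exactly the cocycle condition.  To first order this is the given deformation, so
    versality over the quotients of R by the powers of its maximal ideal yields an
    automorphism of R, the identity modulo the square of the maximal ideal, that carries
    iota to coordinates iota' for which J induces the explicit deformation over every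
    such quotient.

    Fibres can then be computed in the charts.  If some t_e lies in the prime P, the chart
    at e is, modulo P, the product of a two-dimensional torus and a node, which gives four
    independent derivations; if not, two independent directions and the Euler derivation
    span all of them near every vertex.  The charts live over Artinian quotients of R only;
    points with values in fields come from the product of the charts over all levels, because an
    ideal that is disjoint from a multiplicative set is killed by a map to a field that does
    not vanish on this set.  So the fibre over P is smooth exactly if no t_e lies in P.

    The primes with this property contain a lattice ideal twisted by a character rho,
    whose values are roots of unity.  Lattice ideals stay prime in R by comparison of
    initial forms; these also show that the answer is the same for iota and iota'. *)

Require Import Defs.
From HB Require Import structures.
From mathcomp Require Import all_boot all_order all_algebra.
From mathcomp Require Import boolp classical_sets.
From mathcomp Require monalg finmap.
From mathcomp Require Import mpoly complex reals generic_quotient ring_quotient fraction ring zify.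
Set Implicit Arguments.
Unset Strict Implicit.
Unset Printing Implicit Defensive.
Import Order.TTheory GRing.Theory Num.Theory.
Local Open Scope ring_scope.
Local Open Scope quotient_scope.

(** * Ideals *)

(** Two obstacles shape the proof. The multiplication in a chart has to be associative over rings in
    which the parameters are nilpotent and cannot be divided by. Modulo the minors at a vertex, a
    monomial in its six parameters depends on four numbers only; so bends are computed as quadruples
    of integers, where subtraction makes sense, and the parameters are substituted at the end.

    The other obstacle is that [miniversal] speaks of Artinian rings, while smoothness concerns
    arbitrary primes. A relation read off in the chart at p over level k holds after multiplication
    by a power of x_p, and this power depends on k. Krull's intersection theorem is therefore used
    with one multiplier for each k. Its conclusion is a contradiction only if the given point of the
    fibre specialises into the chart of p in the closed fibre. Some p has this property because
    projective space is proper; here this becomes a determinant argument with the monomials of one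
    large degree. *)

Section Ideals.
Variable A : comNzRingType.
Implicit Types (I J : A -> Prop) (s : seq A).

Lemma ideal0 I : is_ideal I -> I 0. Proof. by case. Qed.

Lemma idealD I x y : is_ideal I -> I x -> I y -> I (x + y).
Proof. by case=> _ h _; apply: h. Qed.

Lemma idealMl I a x : is_ideal I -> I x -> I (a * x).
Proof. by case=> _ _; apply. Qed.

Lemma idealMr I a x : is_ideal I -> I x -> I (x * a).
Proof. by move=> hI Ix; rewrite mulrC; apply: idealMl. Qed.

Lemma idealN I x : is_ideal I -> I x -> I (- x).
Proof. by move=> hI Ix; rewrite -mulN1r; apply: idealMl. Qed.

Lemma idealB I x y : is_ideal I -> I x -> I y -> I (x - y).
Proof. by move=> hI Ix Iy; apply: idealD => //; apply: idealN. Qed.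

Lemma ideal_bigsum I (T : Type) (r : seq T) (P : pred T) (F : T -> A) :
  is_ideal I -> (forall i, P i -> I (F i)) -> I (\sum_(i <- r | P i) F i).
Proof.
move=> hI h; elim/big_rec: _ => [|i x Pi Ix]; first exact: ideal0.
by apply: idealD => //; apply: h.
Qed.

Lemma gen_idealP (S : A -> Prop) : is_ideal (gen_ideal S).
Proof.
split.
- exists 0%N, (fun=> 0), (fun=> 0); split; first by case.
  by rewrite big_ord0.
- move=> x y [k [a [g [Sg ->]]]] [l [b [h [Sh ->]]]].
  exists (k + l)%N, (fun i => match split i with inl j => a j | inr j => b j end),
    (fun i => match split i with inl j => g j | inr j => h j end).
  split=> [i|]; first by case: (split i).
  rewrite big_split_ord /=; congr (_ + _); apply: eq_bigr => i _.
    by rewrite (unsplitK (inl i)).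
  by rewrite (unsplitK (inr i)).
- move=> c x [k [a [g [Sg ->]]]]; exists k, (fun i => c * a i), g; split=> //.
  by rewrite mulr_sumr; apply: eq_bigr => i _; rewrite mulrA.
Qed.

Lemma gen_ideal_sub (S : A -> Prop) x : S x -> gen_ideal S x.
Proof.
move=> Sx; exists 1%N, (fun=> 1), (fun=> x); split=> //.
by rewrite big_ord1 mul1r.
Qed.

Lemma gen_ideal_min (S : A -> Prop) I : is_ideal I -> (forall x, S x -> I x) ->
  forall x, gen_ideal S x -> I x.
Proof.
move=> hI SI x [k [a [g [Sg ->]]]]; apply: ideal_bigsum => // i _.
by apply: idealMl => //; apply: SI.
Qed.

Lemma ideal_sumP I J : is_ideal I -> is_ideal J -> is_ideal (ideal_sum I J).
Proof.
move=> hI hJ; split.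
- by exists 0, 0; split; rewrite ?addr0 //; apply: ideal0.
- move=> x y [a [b [Ia Jb ->]]] [c [d [Ic Jd ->]]]; exists (a + c), (b + d).
  by split; [apply: idealD| apply: idealD | rewrite addrACA].
- move=> a x [c [d [Ic Jd ->]]]; exists (a * c), (a * d).
  by split; [apply: idealMl| apply: idealMl | rewrite mulrDr].
Qed.

Lemma ideal_suml I J x : is_ideal J -> I x -> ideal_sum I J x.
Proof. by move=> hJ Ix; exists x, 0; split; rewrite ?addr0 //; apply: ideal0. Qed.

Lemma ideal_sumr I J x : is_ideal I -> J x -> ideal_sum I J x.
Proof. by move=> hI Jx; exists 0, x; split; rewrite ?add0r //; apply: ideal0. Qed.

Lemma prime_idealX I x k : prime_ideal I -> I (x ^+ k) -> I x.
Proof.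
case=> hI I1 hM; elim: k => [|k IH]; first by rewrite expr0 => /I1.
by rewrite exprS => /hM [].
Qed.

Lemma prime_ideal_prod I (T : Type) (r : seq T) (P : pred T) (F : T -> A) :
  prime_ideal I -> (forall i, P i -> ~ I (F i)) -> ~ I (\prod_(i <- r | P i) F i).
Proof.
move=> [hI I1 hM] h; elim/big_rec: _ => [|i x Pi Ix] //.
by case/hM => //; apply: h.
Qed.

(** * Noetherian rings and Krull's intersection theorem *)

Definition noetherian := forall I, is_ideal I ->
  exists s, (forall x, x \in s -> I x) /\ (forall x, I x -> gen_ideal (fun y => y \in s) x).

Lemma gen_ideal_mono (S T : A -> Prop) x :
  (forall y, S y -> T y) -> gen_ideal S x -> gen_ideal T x.
Proof.
by move=> ST [k [a [g [Sg ->]]]]; exists k, a, g; split=> // i; apply: ST.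
Qed.

(** The ascending chain condition in the form used by [krull], where the terms of the sequence are
    forms of growing degree. *)
Lemma noetherian_seq : noetherian -> forall u : nat -> A, forall k0, exists N,
  (k0 <= N)%N /\ gen_ideal (fun y => exists2 i, (k0 <= i < N)%N & y = u i) (u N).
Proof.
move=> hA u k0.
have [s [sI Is]] := hA _ (gen_idealP (fun y => exists2 i, (k0 <= i)%N & y = u i)).
have [N [hN hs]] : exists N, (k0 <= N)%N /\ forall x, x \in s ->
    gen_ideal (fun y => exists2 i, (k0 <= i < N)%N & y = u i) x.
  elim: s sI {Is} => [|x s IH] sI; first by exists k0.
  have [|N [kN hN]] := IH; first by move=> y ys; apply: sI; rewrite inE ys orbT.
  have [k [a [g [Sg ex]]]] := sI x (mem_head _ _).
  have /choice [f hf] : forall i, exists n, (k0 <= n)%N /\ g i = u n.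
    by move=> i; have [n h1 h2] := Sg i; exists n.
  pose N' := maxn N (\max_i f i).+1; exists N'; split; first by rewrite leq_max kN.
  move=> y; rewrite inE => /predU1P [->|/hN].
    exists k, a, g; split=> // i; have [h1 h2] := hf i; exists (f i) => //.
    by rewrite h1 /= leq_max ltnS (leq_bigmax i) orbT.
  apply: gen_ideal_mono => _ [i /andP [h1 h2] ->]; exists i => //.
  by rewrite h1 (leq_trans h2) // leq_max leqnn.
exists N; split=> //.
have uN : gen_ideal (fun y => exists2 i, (k0 <= i)%N & y = u i) (u N).
  by apply: gen_ideal_sub; exists N.
exact: (gen_ideal_min (gen_idealP _) hs (Is _ uN)).
Qed.

End Ideals.

Lemma noetherian_surj (A B : comNzRingType) (f : {rmorphism A -> B}) :
  (forall b, exists a, f a = b) -> noetherian A -> noetherian B.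
Proof.
move=> fs hA I hI.
have hJ : is_ideal (fun x => I (f x)).
  split; first by rewrite rmorph0; apply: ideal0.
    by move=> x y; rewrite rmorphD; apply: idealD.
  by move=> a x; rewrite rmorphM; apply: idealMl.
have [s [sI Is]] := hA _ hJ.
exists (map f s); split; first by move=> _ /mapP [x xs ->]; apply: sI.
move=> y; have [x <-] := fs y => /Is [k [a [g [gs ->]]]].
exists k, (f \o a), (f \o g); split; first by move=> i; apply: map_f.
by rewrite rmorph_sum; apply: eq_bigr => i _; rewrite rmorphM.
Qed.

Lemma field_noetherian (F : fieldType) : noetherian F.
Proof.
move=> I hI; case: (pselect (I 1)) => I1.
  exists [:: 1]; split; first by move=> x; rewrite inE => /eqP ->.
  move=> x _; rewrite -[x]mulr1; apply: idealMl; first exact: gen_idealP.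
  by apply: gen_ideal_sub; rewrite inE.
exists [::]; split=> // x Ix; case: (eqVneq x 0) => [->|x0].
  exact: ideal0 (gen_idealP _).
by case: I1; rewrite -(mulVf x0); apply: idealMl.
Qed.

(** The leading coefficients in degree n of elements of I form an increasing sequence of ideals
    [Lc n]. It is stationary from some N on, and lifts of generators of [Lc 0], ..., [Lc N] generate
    I, since a leading term of higher degree is cancelled by a shifted element of degree N. *)
Lemma hilbert_poly (A : comNzRingType) : noetherian A -> noetherian {poly A}.
Proof.
move=> hA I hI.
pose Lc n (c : A) := exists2 p, I p /\ (size p <= n.+1)%N & c = p`_n.
have Lci n : is_ideal (Lc n).
  split.
  - by exists 0; rewrite ?coef0 // size_poly0; split=> //; apply: ideal0.
  - move=> _ _ [p [Ip sp] ->] [p' [Ip' sp'] ->]; exists (p + p'); rewrite ?coefD //.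
    split; first exact: idealD.
    by apply: leq_trans (size_polyD _ _) _; rewrite geq_max sp.
  - move=> a _ [p [Ip sp] ->]; exists (a%:P * p); rewrite ?coefCM //.
    split; first exact: idealMl.
    by rewrite mul_polyC; apply: leq_trans (size_scale_leq _ _) _.
have LcS m n c : (m <= n)%N -> Lc m c -> Lc n c.
  move=> mn [p [Ip sp] ->]; exists ('X^(n - m) * p).
    split; first exact: idealMl.
    apply: leq_trans (size_polyMleq _ _) _; rewrite size_polyXn addSn /=.
    by apply: leq_trans (leq_add (leqnn _) sp) _; rewrite addnS subnK.
  by rewrite coefXnM ltnNge leq_subr /= subKn.
have hL : is_ideal (fun c => exists n, Lc n c).
  split.
  - by exists 0%N; apply: ideal0.
  - move=> x y [n hn] [m hm]; exists (maxn n m).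
    by apply: idealD => //; [apply: LcS hn | apply: LcS hm]; rewrite leq_max leqnn ?orbT.
  - by move=> a x [n hn]; exists n; apply: idealMl.
have [gl [glL Lgl]] := hA _ hL.
have [N hN] : exists N, forall c, (exists n, Lc n c) -> Lc N c.
  have [N hN] : exists N, forall c, c \in gl -> Lc N c.
    elim: gl glL {Lgl} => [|c gl IH] glL; first by exists 0%N.
    have [|N hN] := IH; first by move=> y ys; apply: glL; rewrite inE ys orbT.
    have [n hn] := glL c (mem_head _ _); exists (maxn n N) => y.
    rewrite inE => /predU1P [->|/hN hy]; first by apply: LcS hn; rewrite leq_max leqnn.
    by apply: LcS hy; rewrite leq_max leqnn orbT.
  by exists N => c /Lgl; apply: (gen_ideal_min (Lci N) hN).
have /choice [S hS] : forall n, exists s : seq {poly A},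
    (forall p, p \in s -> I p /\ (size p <= n.+1)%N) /\
    forall c, Lc n c -> gen_ideal (fun y => y \in [seq p`_n | p : {poly A} <- s]) c.
  move=> n; have [s [sL Ls]] := hA _ (Lci n).
  have /choice [pf hpf] : forall x, exists p : {poly A},
      Lc n x -> [/\ I p, (size p <= n.+1)%N & x = p`_n].
    move=> x; case: (pselect (Lc n x)) => [[p [h1 h2] h3]|h]; first by exists p.
    by exists 0 => /h.
  exists (map pf s); split; first by move=> _ /mapP [x /sL /hpf [h1 h2 _] ->].
  move=> c /Ls; apply: gen_ideal_mono => y ys; apply/mapP; exists (pf y).
    exact: map_f.
  by have [] := hpf y (sL y ys).
pose G := flatten [seq S n | n <- iota 0 N.+1].
have GI p : p \in G -> I p.
  by case/flatten_mapP => n _ /(proj1 (hS n)) [].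
exists G; split=> //.
have hG := gen_idealP (fun y : {poly A} => y \in G).
have SG n p : (n <= N)%N -> p \in S n -> p \in G.
  by move=> nN ps; apply/flatten_mapP; exists n; rewrite // mem_iota ltnS.
have lead n c : (n <= N)%N -> Lc n c ->
    exists p, [/\ gen_ideal (fun y => y \in G) p, (size p <= n.+1)%N & p`_n = c].
  move=> nN cL.
  apply: (gen_ideal_min (I := fun c => exists p, [/\ gen_ideal (fun y => y \in G) p,
    (size p <= n.+1)%N & p`_n = c]) _ _ (proj2 (hS n) c cL)).
    split.
    - exists 0; split; rewrite ?coef0 ?size_poly0 //; exact: ideal0.
    - move=> x y [p [hp sp <-]] [p' [hp' sp' <-]]; exists (p + p'); split.
      + exact: idealD.
      + by apply: leq_trans (size_polyD _ _) _; rewrite geq_max sp.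
      + by rewrite coefD.
    - move=> a x [p [hp sp <-]]; exists (a%:P * p); split.
      + exact: idealMl.
      + by rewrite mul_polyC; apply: leq_trans (size_scale_leq _ _) _.
      + by rewrite coefCM.
  move=> _ /mapP [p pS ->]; exists p; split=> //.
    by apply: gen_ideal_sub; apply: SG pS.
  by have [] := proj1 (hS n) _ pS.
have step m p : I p -> (size p <= m.+1)%N ->
    exists2 p', gen_ideal (fun y => y \in G) p' & (size (p - p')%R <= m)%N.
  move=> Ip sp; have cm : Lc m p`_m by exists p.
  have [q [hq sq cq]] : exists q, [/\ gen_ideal (fun y => y \in G) q,
      (size q <= m.+1)%N & q`_m = p`_m].
    case: (leqP m N) => mN; first exact: lead.
    have [q [hq sq cq]] := lead N _ (leqnn N) (hN _ (ex_intro _ m cm)).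
    exists ('X^(m - N) * q); split; first exact: idealMl.
      apply: leq_trans (size_polyMleq _ _) _; rewrite size_polyXn addSn /=.
      by apply: leq_trans (leq_add (leqnn _) sq) _; rewrite addnS subnK // ltnW.
    by rewrite coefXnM ltnNge leq_subr /= subKn // ltnW.
  exists q => //; apply/leq_sizeP => j; rewrite leq_eqVlt => /predU1P [<-|mj].
    by rewrite coefB cq subrr.
  have := leq_sizeP _ _ sp j mj; have := leq_sizeP _ _ sq j mj.
  by rewrite coefB => -> ->; rewrite subrr.
have main m p : I p -> (size p <= m)%N -> gen_ideal (fun y => y \in G) p.
  elim: m p => [|m IH] p Ip sp.
    by move: sp; rewrite leqn0 size_poly_eq0 => /eqP ->; apply: ideal0.
  have [q hq sq] := step m p Ip sp.
  rewrite -[p](subrK q); apply: idealD => //; apply: IH sq.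
  by apply: idealB => //; apply: (gen_ideal_min hI GI hq).
by move=> p Ip; apply: main Ip (leqnn _).
Qed.

Lemma hilbert_mpoly (A : comNzRingType) n : noetherian A -> noetherian {mpoly A[n]}.
Proof.
move=> hA; elim: n => [|n IH].
  apply: (@noetherian_surj A _ (@mpolyC 0 A)) hA => p; exists p@_0%MM.
  apply/mpolyP => m; rewrite mcoeffC; have -> : m = 0%MM by apply/mnmP; case.
  by rewrite eqxx mulr1.
have [f fE] : exists f : {rmorphism {poly {mpoly A[n]}} -> {mpoly A[n.+1]}},
    forall p, f p = (map_poly (@mwiden n A) p).['X_ord_max].
  by exists (horner_eval 'X_ord_max \o map_poly (@mwiden n A)).
apply: (@noetherian_surj _ _ f) (hilbert_poly IH).
pose im y := exists x, f x = y.
have imM x y : im x -> im y -> im (x * y).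
  by move=> [a <-] [b <-]; exists (a * b); rewrite rmorphM.
have im1 : im 1 by exists 1; rewrite rmorph1.
have imX i : im 'X_i.
  case: (unliftP ord_max i) => [j ->|->].
    exists ('X_j)%:P; rewrite fE map_polyC /= hornerC mwidenX mnmwiden1; congr 'X_[U_(_)].
    by apply/val_inj; rewrite /= /bump leqNgt ltn_ord.
  by exists 'X; rewrite fE map_polyX hornerX.
elim/mpolyind => [|c m p _ _ [x hx]]; first by exists 0; rewrite rmorph0.
suff [y hy] : im (c *: 'X_[m]) by exists (y + x); rewrite rmorphD hx hy.
rewrite -mul_mpolyC; apply: (imM _ _ _ _).
  by exists (c%:MP)%:P; rewrite fE map_polyC /= hornerC mwidenC.
rewrite mpolyXE_id; elim/big_rec: _ => [|i q _ hq] //; apply: (imM _ _ _ hq).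
by elim: (m i) => [|k IHk] //; rewrite exprS; apply: (imM _ _ _ IHk).
Qed.

Lemma pihomog_Mr n (A : comNzRingType) (p q : {mpoly A[n]}) d e :
  q \is e.-homog -> (e <= d)%N ->
  pihomog mdeg d (p * q) = pihomog mdeg (d - e) p * q.
Proof.
move=> hq ed; rewrite {1}(pihomog_partitionE (leqnn (mmeasure mdeg p))).
set k := mmeasure _ _; rewrite mulr_suml raddf_sum /=.
have h i : pihomog mdeg d (pihomog mdeg i p * q) =
    if i == (d - e)%N then pihomog mdeg (d - e) p * q else 0.
  have hi : pihomog mdeg i p * q \is (i + e).-homog.
    by apply: dhomogM => //; apply: pihomogP.
  case: eqP => [ie|ne]; first by rewrite -ie pihomog_dE // -(subnK ed) -ie.
  by apply: (pihomog_ne0 _ hi); apply/eqP => hd; apply: ne; rewrite -hd addnK.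
under eq_bigr do rewrite h.
case: (ltnP (d - e) k) => hk.
  rewrite (bigD1 (Ordinal hk)) //= eqxx big1 ?addr0 // => i.
  by rewrite -val_eqE /= => /negbTE ->.
rewrite big1 => [|i _]; last first.
  by case: eqP => // ie; move: (ltn_ord i); rewrite ie ltnNge hk.
rewrite (_ : pihomog mdeg (d - e) p = 0) ?mul0r //.
rewrite pihomogE big_seq_cond big1 // => m /andP [/msize_mdeg_lt hm /eqP dm].
by move: hm; rewrite dm ltnNge hk.
Qed.

Lemma meval_homog_ideal (A : comNzRingType) r (t : 'I_r -> A) d (p : {mpoly A[r]}) :
  (0 < d)%N -> p \is d.-homog -> gen_ideal (fun y => exists i, y = t i) p.@[t].
Proof.
move=> d0 /dhomogP hp; rewrite mevalE big_seq; apply: ideal_bigsum; first exact: gen_idealP.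
move=> m /hp dm; have {}dm : mdeg m = d by []. apply: idealMl; first exact: gen_idealP.
have [i mi] : exists i, (0 < m i)%N.
  apply/existsP; move: d0; rewrite -dm mdegE lt0n; apply: contraR => /existsPn h.
  by apply/eqP/big1 => i _; apply/eqP; have := h i; rewrite lt0n negbK.
rewrite (bigD1 i) //= -(prednK mi) exprS -mulrA; apply: idealMr (gen_idealP _) _.
by apply: gen_ideal_sub; exists i.
Qed.

(* Perdry's proof of Krull's intersection theorem, localised at the s_k. *)
Lemma krull (A : comNzRingType) (hA : noetherian A) r (t : 'I_r -> A) (I : A -> Prop)
    (hI : is_ideal I) (x : A) (s : nat -> A) (k0 : nat) :
  (forall k, (k0 <= k)%N ->
     exists2 p : {mpoly A[r]}, p \is k.-homog & I (p.@[t] - s k * x)) ->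
  exists N m (f : 'I_m -> nat) (c : 'I_m -> A), [/\ (k0 <= N)%N,
    forall j, (k0 <= f j)%N, forall j, gen_ideal (fun y => exists i, y = t i) (c j)
    & I ((s N - \sum_j c j * s (f j)) * x)].
Proof.
move=> h.
have /choice [P hP] : forall k, exists p : {mpoly A[r]},
    (k0 <= k)%N -> p \is k.-homog /\ I (p.@[t] - s k * x).
  move=> k; case: (leqP k0 k) => hk; last by exists 0.
  by have [p p1 p2] := h k hk; exists p.
have [N [kN [m [a [g [gP PN]]]]]] := noetherian_seq (hilbert_mpoly (n := r) hA) P k0.
have /choice [f hf] : forall j, exists i, (k0 <= i < N)%N /\ g j = P i.
  by move=> j; have [i h1 h2] := gP j; exists i.
pose q j := pihomog mdeg (N - f j) (a j).
exists N, m, f, (fun j => (q j).@[t]); split=> //.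
- by move=> j; have [/andP []] := hf j.
- move=> j; have [/andP [_ fN] _] := hf j.
  by apply: (@meval_homog_ideal _ _ _ (N - f j)); rewrite ?subn_gt0 ?pihomogP.
(* Only the part of degree N of the relation is kept. Its coefficients [q j] have positive degree N
   - f j, so their values lie in the ideal of the t i. *)
have eN : P N = \sum_j q j * P (f j).
  rewrite -(pihomog_dE (proj1 (hP N kN))) {1}PN raddf_sum; apply: eq_bigr => j _ /=.
  have [/andP [k0f fN] ->] := hf j.
  by rewrite (pihomog_Mr _ (proj1 (hP _ k0f))) // ltnW.
have -> : (s N - \sum_j (q j).@[t] * s (f j)) * x =
    - ((P N).@[t] - s N * x) + \sum_j (q j).@[t] * ((P (f j)).@[t] - s (f j) * x).
  have -> : (P N).@[t] = \sum_j (q j).@[t] * (P (f j)).@[t].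
    by rewrite eN rmorph_sum; apply: eq_bigr => j _; rewrite rmorphM.
  rewrite mulrBl mulr_suml.
  under [X in _ = _ + X]eq_bigr do rewrite mulrBr mulrA.
  rewrite sumrB; ring.
apply: idealD => //; first by apply: idealN => //; have [] := hP N kN.
apply: ideal_bigsum => // j _; apply: idealMl => //.
by have [/andP [k0f _] _] := hf j; have [] := hP _ k0f.
Qed.

Lemma asbool_idealr_closed (A : comNzRingType) (I : A -> Prop) :
  is_ideal I -> ~ I 1 -> idealr_closed ((fun x => `[< I x >]) : {pred A}).
Proof.
move=> hI I1; split; first by apply/asboolP; apply: ideal0.
  by apply/asboolP.
move=> a x y /asboolP Ix /asboolP Iy; apply/asboolP; apply: idealD => //.
exact: idealMl.
Qed.

(** * Quotient algebras, residue fields and primes avoiding a multiplicative set *)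

Module Quotients.
Section QuotientAlgebra.
Variables (C : comNzRingType) (A : comAlgType C) (I : A -> Prop).
Hypotheses (hI : is_ideal I) (I1 : ~ I 1).

Definition qpred : {pred A} := fun x => `[< I x >].

Lemma qpred_idealr : idealr_closed qpred.
Proof. exact: asbool_idealr_closed. Qed.

HB.instance Definition _ := isIdealr.Build A qpred qpred_idealr.

Definition qalg := {ideal_quot qpred}.
HB.instance Definition _ := GRing.ComNzRing.on qalg.

Definition qalg_scale (c : C) (x : qalg) : qalg := \pi_qalg (c%:A) * x.

Lemma qalg_scaleA a b v : qalg_scale a (qalg_scale b v) = qalg_scale (a * b) v.
Proof. by rewrite /qalg_scale mulrA -rmorphM /= -scalerAl mul1r scalerA. Qed.
Lemma qalg_scale1 : left_id 1 qalg_scale.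
Proof. by move=> v; rewrite /qalg_scale scale1r rmorph1 mul1r. Qed.
Lemma qalg_scaleDr : right_distributive qalg_scale +%R.
Proof. by move=> a u v; rewrite /qalg_scale mulrDr. Qed.
Lemma qalg_scaleDl v : {morph qalg_scale^~ v : a b / a + b}.
Proof. by move=> a b; rewrite /qalg_scale scalerDl rmorphD mulrDl. Qed.
HB.instance Definition _ := GRing.Zmodule_isLmodule.Build C qalg
  qalg_scaleA qalg_scale1 qalg_scaleDr qalg_scaleDl.
Lemma qalg_scaleAl (a : C) (u v : qalg) : a *: (u * v) = (a *: u) * v.
Proof. by rewrite /GRing.scale /= /qalg_scale mulrA. Qed.
HB.instance Definition _ := GRing.Lmodule_isLalgebra.Build C qalg qalg_scaleAl.
HB.instance Definition _ := GRing.Lalgebra_isComAlgebra.Build C qalg.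

Definition qproj (x : A) : qalg := \pi_qalg x.
HB.instance Definition _ := GRing.RMorphism.copy qproj (\pi_qalg : A -> qalg).
Lemma qproj_scale : scalable qproj.
Proof.
move=> a x; rewrite /GRing.scale /= /qalg_scale /qproj -rmorphM /=.
by rewrite -scalerAl mul1r.
Qed.
HB.instance Definition _ := GRing.isScalable.Build C A qalg _ qproj qproj_scale.

Lemma quotient_algebra : exists (B : comAlgType C) (f : {lrmorphism A -> B}),
  (forall b, exists a, f a = b) /\ (forall x, f x = 0 <-> I x).
Proof.
exists qalg, qproj; split=> [b|x].
  by exists (repr (b : qalg)); apply: (@reprK _ qalg).
rewrite /qproj -[X in _ = X](rmorph0 (\pi_qalg : {rmorphism A -> qalg})).
split=> [/eqP|Ix].
  by rewrite -Quotient.idealrBE subr0 => /asboolP.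
by apply/eqP; rewrite -Quotient.idealrBE subr0; apply/asboolP.
Qed.

End QuotientAlgebra.

Section PrimeField.
Variables (A : comNzRingType) (I : A -> Prop).
Hypothesis (hI : prime_ideal I).

Definition ppred : {pred A} := fun x => `[< I x >].

Lemma ppred_idealr : idealr_closed ppred.
Proof. by case: hI => i1 i2 _; apply: asbool_idealr_closed. Qed.
HB.instance Definition _ := isIdealr.Build A ppred ppred_idealr.
Lemma ppred_prime : prime_idealr_closed ppred.
Proof. 
case: hI => _ _ h u v /asboolP /h [] Iu; apply/orP; [left|right]; exact/asboolP.
Qed.
HB.instance Definition _ := isPrimeIdealrClosed.Build A ppred ppred_prime.

Definition pquot := {ideal_quot ppred}.
HB.instance Definition _ := GRing.ComNzRing.on pquot.

(** Fractions are formed over an integral domain equipped with inverses, so units and inverses of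
    the quotient are picked classically; off the units the inverse is the identity. *)
Definition pquot_unit : {pred pquot} := fun x => `[< exists y, y * x = 1 >].
Definition pquot_inv (x : pquot) : pquot :=
  if pselect (exists y, y * x = 1) is left h then sval (cid h) else x.
Lemma pquot_mulV : {in pquot_unit, left_inverse 1 pquot_inv *%R}.
Proof.
move=> x /asboolP hx; rewrite /pquot_inv; case: pselect => // h.
exact: (svalP (cid h)).
Qed.
Lemma pquot_unitP x y : y * x = 1 -> x \in pquot_unit.
Proof. by move=> h; apply/asboolP; exists y. Qed.
Lemma pquot_inv0 : {in [predC pquot_unit], pquot_inv =1 id}.
Proof.
move=> x; rewrite inE => /asboolP hx; rewrite /pquot_inv; case: pselect => // h.
Qed.
HB.instance Definition _ := GRing.ComNzRing_hasMulInverse.Build pquot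
  pquot_mulV pquot_unitP pquot_inv0.
HB.instance Definition _ := GRing.ComUnitRing_isIntegral.Build pquot
  (@Quotient.rquot_IdomainAxiom A ppred).

Definition pproj (x : A) : pquot := \pi_pquot x.
HB.instance Definition _ := GRing.RMorphism.copy pproj (\pi_pquot : A -> pquot).

Lemma prime_residue_field : exists (K : fieldType) (f : {rmorphism A -> K}),
  forall x, f x = 0 <-> I x.
Proof.
exists {fraction pquot}, (@tofrac pquot \o pproj) => x /=.
have pE : pproj x = 0 <-> I x.
  rewrite -[X in _ = X](rmorph0 pproj); split=> [/eqP|Ix].
    by rewrite /pproj -Quotient.idealrBE subr0 => /asboolP.
  by apply/eqP; rewrite /pproj -Quotient.idealrBE subr0; apply/asboolP.
rewrite -pE; split=> [/eqP|->]; last exact: tofrac0.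
by rewrite tofrac_eq0 => /eqP.
Qed.
End PrimeField.
End Quotients.
Import Quotients.

(** An ideal that is maximal among those containing I and missing S, as provided by Zorn's lemma, is
    prime: two elements outside it would each bring an element of S into the ideal enlarged by them,
    and the product of these two elements of S would lie in the ideal itself. *)
Lemma prime_avoiding (A : comNzRingType) (I S : A -> Prop) :
  is_ideal I -> S 1 -> (forall x y, S x -> S y -> S (x * y)) ->
  (forall x, S x -> ~ I x) ->
  exists J, [/\ prime_ideal J, forall x, I x -> J x & forall x, S x -> ~ J x].
Proof.
move=> hI S1 SM SI.
pose T := {J : A -> Prop | [/\ is_ideal J, forall x, I x -> J x & forall x, S x -> ~ J x]}.
have t0 : T by exists I.
pose R (J K : T) := `[< forall x, sval J x -> sval K x >].
have [|||J hJ] := @ZL_preorder T t0 R.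
- by move=> J; apply/asboolP.
- by move=> J K L /asboolP h1 /asboolP h2; apply/asboolP => x /h1 /h2.
- move=> F hF; case: (pselect (exists K, F K)) => [[K0 FK0]|nF]; last first.
    by exists t0 => K FK; case: nF; exists K.
  pose U x := exists2 K, F K & sval K x.
  have hU : [/\ is_ideal U, forall x, I x -> U x & forall x, S x -> ~ U x].
    split.
    + split.
      * by exists K0 => //; case: (svalP K0) => h _ _; apply: ideal0.
      * move=> x y [K FK Kx] [L FL Ly]; case: (hF K L FK FL) => /asboolP h.
          by exists L => //; case: (svalP L) => hL _ _; apply: idealD => //; apply: h.
        by exists K => //; case: (svalP K) => hL _ _; apply: idealD => //; apply: h.
      * move=> a x [K FK Kx]; exists K => //; case: (svalP K) => hK _ _.
        exact: idealMl.
    + by move=> x Ix; exists K0 => //; case: (svalP K0) => _ h _; apply: h.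
    + by move=> x Sx [K FK Kx]; case: (svalP K) => _ _ h; apply: h Kx.
  exists (exist _ U hU) => K FK; apply/asboolP => x Kx; by exists K.
case: (svalP J) => iJ IJ SJ; exists (sval J); split=> //; split=> //.
  exact: SJ.
have ext a : ~ sval J a -> exists b j, sval J j /\ S (j + b * a).
  move=> Ja; apply: contrapT => nE.
  pose L x := exists j b, sval J j /\ x = j + b * a.
  have hL : [/\ is_ideal L, forall x, I x -> L x & forall x, S x -> ~ L x].
    split.
    - split.
      + by exists 0, 0; split; [apply: ideal0 | rewrite mul0r addr0].
      + move=> x y [j [b [h1 ->]]] [k [c [h2 ->]]]; exists (j + k), (b + c).
        by split; [apply: idealD | rewrite mulrDl addrACA].
      + move=> c x [j [b [h1 ->]]]; exists (c * j), (c * b).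
        by split; [apply: idealMl | rewrite mulrDr mulrA].
    - by move=> x /IJ Jx; exists x, 0; rewrite mul0r addr0.
    - by move=> x Sx [j [b [h1 h2]]]; apply: nE; exists b, j; rewrite -h2.
  have h1 : R J (exist _ L hL).
    by apply/asboolP => x Jx; exists x, 0; rewrite mul0r addr0.
  have /asboolP h2 := hJ _ h1; apply: Ja; apply: h2 => /=.
  by exists 0, 1; split; [apply: ideal0 | rewrite mul1r add0r].
move=> x y Jxy; apply: contrapT => /not_orP [/ext [b [j [Jj h1]]] /ext [c [k [Jk h2]]]].
apply: (SJ _ (SM _ _ h1 h2)).
have -> : (j + b * x) * (k + c * y) = j * (k + c * y) + b * x * k + b * c * (x * y) by ring.
apply: idealD => //; last exact: idealMl.
by apply: idealD => //; [apply: idealMr | apply: idealMl].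
Qed.

Lemma field_avoiding (A : comNzRingType) (I S : A -> Prop) :
  is_ideal I -> S 1 -> (forall x y, S x -> S y -> S (x * y)) ->
  (forall x, S x -> ~ I x) ->
  exists (K : fieldType) (f : {rmorphism A -> K}),
    (forall x, I x -> f x = 0) /\ (forall x, S x -> f x != 0).
Proof.
move=> hI S1 SM SI; have [J [pJ IJ SJ]] := prime_avoiding hI S1 SM SI.
have [K [f fJ]] := prime_residue_field pJ.
exists K, f; split=> [x /IJ /fJ //|x /SJ nJ]; by apply/eqP => /fJ.
Qed.

(** * Ranks over rings and fields *)

(** Besides an invertible minor of maximal size, its rows are recorded as spanning the row space;
    Cramer's rule in [solve_denominator] rests on both. *)
Lemma rank_minor (K : fieldType) m n (M : 'M[K]_(m, n)) :
  exists (u : 'I_(\rank M) -> 'I_m) (v : 'I_(\rank M) -> 'I_n),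
    mxsub u v M \in unitmx /\ (M <= rowsub u M)%MS.
Proof.
pose u := maxrankfun M.
have ru : \rank (rowsub u M) = \rank M by rewrite (eq_maxrowsub M).
have rf : row_full (rowsub u M)^T by rewrite /row_full mxrank_tr ru.
exists u, (fullrankfun rf); split; last by rewrite (eq_maxrowsub M).
rewrite -unitmx_tr; have -> : (mxsub u (fullrankfun rf) M)^T =
    rowsub (fullrankfun rf) (rowsub u M)^T by apply/matrixP => i j; rewrite !mxE.
exact: fullrowsub_unit.
Qed.

Lemma minor_rank (K : fieldType) m n r (M : 'M[K]_(m, n)) (u : 'I_r -> 'I_m)
    (v : 'I_r -> 'I_n) : mxsub u v M \in unitmx -> (r <= \rank M)%N.
Proof.
move=> h; have -> : r = \rank (mxsub u v M) by rewrite mxrank_unit.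
have -> : mxsub u v M = rowsub u (colsub v M) by apply/matrixP => i j; rewrite !mxE.
rewrite rowsubE; apply: leq_trans (mxrankM_maxr _ _) _.
rewrite -mxrank_tr -[\rank M]mxrank_tr.
have -> : (colsub v M)^T = rowsub v M^T by apply/matrixP => i j; rewrite !mxE.
by rewrite rowsubE; apply: mxrankM_maxr.
Qed.

Lemma map_mxsub_unit (A : comNzRingType) (K : fieldType) (f : {rmorphism A -> K})
    m n r (M : 'M[A]_(m, n)) (u : 'I_r -> 'I_m) (v : 'I_r -> 'I_n) :
  (mxsub u v (map_mx f M) \in unitmx) = (f (\det (mxsub u v M)) != 0).
Proof.
rewrite unitmxE unitfE -det_map_mx; congr (\det _ != 0).
by apply/matrixP => i j; rewrite !mxE.
Qed.

(** The rank only depends on which minors vanish, hence on the kernel of the map and not on the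
    field that receives it. *)
Lemma rank_map_kernel (A : comNzRingType) (K L : fieldType)
    (f : {rmorphism A -> K}) (g : {rmorphism A -> L}) m n (M : 'M[A]_(m, n)) :
  (forall x, f x = 0 <-> g x = 0) -> \rank (map_mx f M) = \rank (map_mx g M).
Proof.
move=> fg; apply/eqP; rewrite eqn_leq; apply/andP; split.
  have [u [v [h _]]] := rank_minor (map_mx f M); apply: (@minor_rank _ _ _ _ _ u v).
  by move: h; rewrite !map_mxsub_unit; apply: contra_neq => /fg.
have [u [v [h _]]] := rank_minor (map_mx g M); apply: (@minor_rank _ _ _ _ _ u v).
by move: h; rewrite !map_mxsub_unit; apply: contra_neq => /fg.
Qed.

(* Cramer's rule: a linear system over A that is solvable over a field K has a
   solution over A up to a denominator. *)
Lemma solve_denominator (A : comNzRingType) (K : fieldType) (f : {rmorphism A -> K})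
    m n (M : 'M[A]_(m, n)) (b : 'rV[A]_n) :
  (map_mx f b <= map_mx f M)%MS ->
  exists (d : A) (y : 'rV[A]_m), f d != 0 /\ map_mx f (d *: b - y *m M) = 0.
Proof.
move=> bM; have [u [v [h Mu]]] := rank_minor (map_mx f M).
set r := \rank _ in u v h Mu.
pose N := mxsub u v M.
pose y := colsub v b *m \adj N.
exists (\det N), (y *m rowsub u 1%:M); split; first by rewrite -map_mxsub_unit.
rewrite -mulmxA -rowsubE; set w := _ - _.
have /submxP [z wz] : (map_mx f w <= rowsub u (map_mx f M))%MS.
  have -> : map_mx f w = f (\det N) *: map_mx f b - map_mx f y *m rowsub u (map_mx f M).
    rewrite /w map_mxB map_mxZ map_mxM; congr (_ - _ *m _).
    by apply/matrixP => i j; rewrite !mxE.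
  apply: addmx_sub; first by apply: scalemx_sub; apply: submx_trans bM Mu.
  by rewrite -mulNmx submxMl.
have wv : colsub v w = 0.
  rewrite /w /y; have -> : colsub v (\det N *: b - colsub v b *m \adj N *m rowsub u M) =
      \det N *: colsub v b - colsub v b *m \adj N *m N.
    apply/matrixP => i j; rewrite !mxE; congr (_ - _); apply: eq_bigr => k _.
    by rewrite !mxE.
  by rewrite -mulmxA mul_adj_mx mul_mx_scalar subrr.
have zv : z *m mxsub u v (map_mx f M) = 0.
  have := congr1 (colsub v) wz.
  have -> : colsub v (map_mx f w) = 0.
    transitivity (map_mx f (colsub v w)); last by rewrite wv map_mx0.
    by apply/matrixP => i j; rewrite !mxE.
  move=> ->; apply/matrixP => i j; rewrite !mxE; apply: eq_bigr => k _.
  by rewrite !mxE.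
have z0 : z = 0.
  have := congr1 (mulmx^~ (invmx (mxsub u v (map_mx f M)))) zv.
  by rewrite /= mul0mx mulmxK.
by rewrite wz z0 mul0mx.
Qed.

(** * Complete local rings *)

Section TPow.
Variables (A : comNzRingType) (N : nat) (t : 'I_N -> A).
Implicit Types (x y : A) (k l : nat).

(** The k-th power of the ideal generated by the t i, presented by values of forms of degree k, the
    shape in which [krull] takes its hypothesis. *)
Definition tpow k x := exists2 P : {mpoly A[N]}, P \is k.-homog & P.@[t] = x.

Lemma tpowP k : is_ideal (tpow k).
Proof.
split; first by exists 0; rewrite ?dhomog0 // rmorph0.
- move=> x y [P hP <-] [Q hQ <-]; exists (P + Q); rewrite ?rmorphD //.
  exact: dhomogD.
- move=> a x [P hP <-]; exists (a *: P); rewrite ?mevalZ //.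
  exact: dhomogZ.
Qed.

Lemma tpow0 x : tpow 0 x.
Proof. by exists x%:MP; rewrite ?mevalC // -[x%:MP]mulr1 mul_mpolyC dhomogZ ?dhomog1. Qed.

Lemma tpowM k l x y : tpow k x -> tpow l y -> tpow (k + l) (x * y).
Proof.
move=> [P hP <-] [Q hQ <-]; exists (P * Q); rewrite ?rmorphM //.
exact: dhomogM.
Qed.

Lemma tpow1 i : tpow 1 (t i).
Proof. by exists 'X_i; rewrite ?mevalXU // dhomogX /= mdeg1. Qed.

Lemma tpow_mon m : tpow (mdeg m) (\prod_i t i ^+ m i).
Proof.
exists 'X_[m]; first by rewrite dhomogX.
by rewrite mevalX.
Qed.

Lemma tpow_min k (J : A -> Prop) : is_ideal J ->
  (forall m : 'X_{1..N}, mdeg m = k -> J (\prod_i t i ^+ m i)) ->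
  forall x, tpow k x -> J x.
Proof.
move=> hJ h x [P /dhomogP hP <-]; rewrite mevalE big_seq.
by apply: ideal_bigsum => // m /hP /h Jm; apply: idealMl.
Qed.

Lemma mnm_split k (m : 'X_{1..N}) : mdeg m = k.+1 ->
  exists i m', mdeg m' = k /\ m = (U_(i) + m')%MM.
Proof.
move=> dm; have [i mi] : exists i, (0 < m i)%N.
  apply/existsP; move: (ltn0Sn k); rewrite -dm mdegE lt0n; apply: contraR => /existsPn h.
  by apply/eqP/big1 => i _; apply/eqP; have := h i; rewrite lt0n negbK.
have um : (U_(i) <= m)%MM by apply/mnm_lepP => j; rewrite mnm1E; case: eqP => [<-|] //.
exists i, (m - U_(i))%MM; split; last by rewrite addmC submK.
by apply/eqP; rewrite -eqSS -dm -{2}(submK um) mdegD mdeg1 addn1.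
Qed.

Lemma tmonD (m m' : 'X_{1..N}) : \prod_i t i ^+ (m + m')%MM i =
  (\prod_i t i ^+ m i) * \prod_i t i ^+ m' i.
Proof. by rewrite -big_split; apply: eq_bigr => i _; rewrite mnmDE exprD. Qed.

Lemma tmonU i : \prod_j t j ^+ (U_(i) : 'X_{1..N})%MM j = t i.
Proof.
rewrite (bigD1 i) //= mnm1E eqxx expr1 big1 ?mulr1 // => j ji.
by rewrite mnm1E eq_sym (negbTE ji) expr0.
Qed.

Lemma tpowS k x : tpow k.+1 x -> tpow k x.
Proof.
apply: tpow_min; first exact: tpowP.
move=> m /mnm_split [i [m' [dm ->]]]; rewrite tmonD; apply: idealMl (tpowP k) _.
by rewrite -dm; apply: tpow_mon.
Qed.

Lemma tpow_leq k l x : (k <= l)%N -> tpow l x -> tpow k x.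
Proof.
move=> /subnK <-; elim: (l - k)%N => [|n IH] //.
by rewrite addSn => /tpowS /IH.
Qed.

Lemma tpow_prod k (s : 'I_k -> A) : (forall i, tpow 1 (s i)) -> tpow k (\prod_i s i).
Proof.
elim: k s => [|k IH] s h; first by rewrite big_ord0; apply: tpow0.
rewrite big_ord_recl; apply: (@tpowM 1 k) => //; exact: IH.
Qed.

End TPow.

Lemma tpow_morph (A B : comNzRingType) (f : {rmorphism A -> B}) N (t : 'I_N -> A) k x :
  tpow t k x -> tpow (f \o t) k (f x).
Proof.
have [i0 iD iM] := tpowP (f \o t) k.
apply: (tpow_min (J := fun x => tpow (f \o t) k (f x))).
  split; first by rewrite rmorph0.
    by move=> x' y h1 h2; rewrite rmorphD; apply: iD.
  by move=> a y h; rewrite rmorphM; apply: iM.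
move=> m <-; rewrite rmorph_prod.
under eq_bigr do rewrite rmorphXn; exact: tpow_mon.
Qed.

Lemma mX_tpow (A : comNzRingType) N (p : {mpoly A[N]}) k :
  tpow (fun i => 'X_i : {mpoly A[N]}) k p <-> (forall m, m \in msupp p -> (k <= mdeg m)%N).
Proof.
split.
  move: p; apply: tpow_min.
    split=> [m|x y hx hy m|a x hx m]; first by rewrite msupp0.
      by move=> /msuppD_le; rewrite mem_cat => /orP [/hx|/hy].
    move=> /msuppM_le /allpairsP [[m1 m2] /= [_ /hx h ->]].
    by rewrite mdegD (leq_trans h) // leq_addl.
  move=> m <- m'; rewrite -mpolyXE_id msuppX inE => /eqP ->; exact: leqnn.
move=> h; rewrite [p]mpolyE big_seq; apply: ideal_bigsum; first exact: tpowP.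
move=> m /h km; rewrite -mul_mpolyC; apply: idealMl; first exact: tpowP.
by apply: tpow_leq km _; rewrite mpolyXE_id; apply: tpow_mon.
Qed.

Lemma pihomog_tpow (A : comNzRingType) N (p : {mpoly A[N]}) k d :
  (d < k)%N -> tpow (fun i => 'X_i : {mpoly A[N]}) k p -> pihomog mdeg d p = 0.
Proof.
move=> dk /mX_tpow h; rewrite pihomogE big_seq_cond big1 // => m /andP [/h km /eqP dm].
by move: km; rewrite dm leqNgt dk.
Qed.

Lemma ideal_powP (A : comNzRingType) (I : A -> Prop) k : is_ideal (ideal_pow I k).
Proof. exact: gen_idealP. Qed.

Lemma ideal_pow_mon (A : comNzRingType) N (t : 'I_N -> A) (I : A -> Prop) :
  (forall i, I (t i)) ->
  forall k (m : 'X_{1..N}), mdeg m = k -> ideal_pow I k (\prod_i t i ^+ m i).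
Proof.
move=> It k m dm; apply: gen_ideal_sub.
elim: k m dm => [|k IH] m dm.
  exists (fun=> 1); split; first by case.
  rewrite big_ord0; apply: big1 => i _; move/eqP: dm; rewrite mdeg_eq0 => /eqP ->.
  by rewrite mnm0E expr0.
have [i [m' [dm' ->]]] := mnm_split dm; have [s [sI es]] := IH m' dm'.
exists (fun j => if unlift ord0 j is Some l then s l else t i); split=> [j|].
  by case: (unliftP ord0 j).
rewrite big_ord_recl unlift_none tmonD tmonU es; congr (_ * _).
by apply: eq_bigr => j _; rewrite liftK.
Qed.

Lemma ideal_pow_tpow (A : comNzRingType) N (t : 'I_N -> A) k x :
  ideal_pow (gen_ideal (fun y => exists i, y = t i)) k x <-> tpow t k x.
Proof.
split.
  apply: gen_ideal_min; first exact: tpowP.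
  move=> _ [s [hs ->]]; apply: tpow_prod => i; move: (s i) (hs i).
  by apply: gen_ideal_min; [exact: tpowP | move=> _ [j ->]; apply: tpow1].
apply: tpow_min; first exact: ideal_powP.
by move=> m dm; apply: ideal_pow_mon dm => i; apply: gen_ideal_sub; exists i.
Qed.

Lemma ext_ideal_tpow (A B : comNzRingType) (f : {rmorphism A -> B}) N (t : 'I_N -> A) k x :
  ext_ideal f (tpow t k) x <-> tpow (f \o t) k x.
Proof.
split.
  apply: gen_ideal_min; first exact: tpowP.
  by move=> _ [p hp ->]; apply: tpow_morph.
apply: tpow_min; first exact: gen_idealP.
move=> m <-; apply: gen_ideal_sub; exists (\prod_i t i ^+ m i); first exact: tpow_mon.
by rewrite rmorph_prod; apply: eq_bigr => i _; rewrite rmorphXn.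
Qed.

Lemma noetherian_gen (A : comNzRingType) (S : A -> Prop) : noetherian A ->
  exists k (g : 'I_k -> A), (forall i, S (g i)) /\
    forall x, gen_ideal S x -> exists a : 'I_k -> A, x = \sum_i a i * g i.
Proof.
move=> hA; have [s [sS Ss]] := hA _ (gen_idealP S).
have [k [g [gS sg]]] : exists k (g : 'I_k -> A), (forall i, S (g i)) /\
    forall x, x \in s -> gen_ideal (fun y => exists i, y = g i) x.
  elim: s sS {Ss} => [|x s IH] sS.
    by exists 0%N, (fun=> 0); split=> [[]|] //.
  have [|k [g [gS sg]]] := IH; first by move=> y ys; apply: sS; rewrite inE ys orbT.
  have [l [a [h [hS ->]]]] := sS x (mem_head _ _).
  exists (k + l)%N, (fun i => match split i with inl i => g i | inr j => h j end).
  split=> [i|y]; first by case: (split i).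
  rewrite inE => /predU1P [->|/sg].
    apply: ideal_bigsum; first exact: gen_idealP.
    move=> i _; apply: idealMl; first exact: gen_idealP.
    by apply: gen_ideal_sub; exists (rshift k i); rewrite (unsplitK (inr i)).
  apply: gen_ideal_mono => _ [i ->]; exists (lshift l i).
  by rewrite (unsplitK (inl i)).
exists k, g; split=> // x /Ss xs.
have {xs} := gen_ideal_min (gen_idealP _) sg xs.
apply: (gen_ideal_min (I := fun x => exists a : 'I_k -> A, x = \sum_i a i * g i)); last first.
  move=> _ [i ->]; exists (fun j => (j == i)%:R).
  by rewrite (bigD1 i) //= eqxx mul1r big1 ?addr0 // => j /negbTE ->; rewrite mul0r.
split; first by exists (fun=> 0); rewrite big1 // => i _; rewrite mul0r.
- move=> _ _ [a ->] [b ->]; exists (fun i => a i + b i); rewrite -big_split.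
  by apply: eq_bigr => i _; rewrite mulrDl.
- move=> c _ [a ->]; exists (fun i => c * a i); rewrite mulr_sumr.
  by apply: eq_bigr => i _; rewrite mulrA.
Qed.

Section Completion.
Variables (C : fieldType) (N : nat) (R : comAlgType C).
Variables (I0 : {mpoly C[N]} -> Prop) (iota : {lrmorphism {mpoly C[N]} -> R}).
Local Notation X := (fun i : 'I_N => 'X_i : {mpoly C[N]}).
Hypothesis hI0 : is_ideal I0.
Hypothesis hc : is_completion I0 (gen_ideal (fun y => exists i, y = X i)) iota.
Local Notation mR := (tpow (fun i => iota 'X_i)).

Lemma ext_ideal_mR k r :
  ext_ideal iota (ideal_pow (gen_ideal (fun y => exists i, y = X i)) k) r <-> mR k r.
Proof.
rewrite -(ext_ideal_tpow iota X).
by split; apply: gen_ideal_mono => _ [p /ideal_pow_tpow hp ->]; exists p => //;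
  apply/ideal_pow_tpow.
Qed.

Lemma compl_approx k r : exists p, mR k (r - iota p).
Proof. by case: hc => h _ _ _; have [p /ext_ideal_mR] := h k r; exists p. Qed.

Lemma compl_kernel k p : mR k (iota p) <-> ideal_sum I0 (tpow X k) p.
Proof.
case: hc => _ h _ _; rewrite -ext_ideal_mR h.
by split=> -[a [b [Ia /ideal_pow_tpow hb ->]]]; exists a, b; split=> //;
  apply/ideal_pow_tpow.
Qed.

Lemma compl_sep r : (forall k, mR k r) -> r = 0.
Proof. by case: hc => _ _ h _ hr; apply: h => k; apply/ext_ideal_mR. Qed.

Lemma compl_lim (u : nat -> R) : (forall k, mR k (u k.+1 - u k)) ->
  exists r, forall k, mR k (r - u k).
Proof.
case: hc => _ _ _ h hu; have [k|r hr] := h u; first exact/ext_ideal_mR.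
by exists r => k; apply/ext_ideal_mR.
Qed.

Lemma iota_tpow k p : tpow X k p -> mR k (iota p).
Proof. exact: (tpow_morph iota). Qed.

Lemma iota_alg (c : C) : iota (c *: 1) = c *: 1.
Proof. by rewrite linearZ rmorph1. Qed.

Lemma residue r : exists c : C, mR 1 (r - c%:A).
Proof.
have [p hp] := compl_approx 1 r; exists p@_0%MM.
have -> : r - (p@_0)%:A = (r - iota p) + iota (p - (p@_0)%:MP).
  have -> : (p@_0)%:MP = p@_0 *: (1 : {mpoly C[N]}).
    by apply/mpolyP => m; rewrite mcoeffC mcoeffZ mcoeff1.
  rewrite rmorphB /= iota_alg; ring.
apply: idealD => //; first exact: tpowP.
apply/iota_tpow/mX_tpow => m; rewrite mcoeff_msupp mcoeffB mcoeffC lt0n mdeg_eq0.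
by apply: contraNneq => ->; rewrite eqxx mulr1 subrr.
Qed.

Lemma compl_lead k r : mR k r ->
  exists2 g : {mpoly C[N]}, g \is k.-homog & mR k.+1 (r - iota g).
Proof.
apply: (tpow_min (J := fun r => exists2 g : {mpoly C[N]}, g \is k.-homog & mR k.+1 (r - iota g))).
  split.
  - by exists 0; rewrite ?dhomog0 // rmorph0 subr0; apply: ideal0 (tpowP _ _).
  - move=> x y [g hg xg] [h hh yh]; exists (g + h); first exact: dhomogD.
    by rewrite rmorphD opprD addrACA; apply: idealD (tpowP _ _) _ _.
  - move=> a x [g hg xg]; have [c ac] := residue a; exists (c *: g); first exact: dhomogZ.
    have -> : a * x - iota (c *: g) = (a - c%:A) * iota g + a * (x - iota g).
      by rewrite linearZ /= mulrBl -scalerAl mul1r; ring.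
    apply: idealD (tpowP _ _) _ _; last exact: idealMl (tpowP _ _) _.
    rewrite -add1n; apply: tpowM => //; apply: iota_tpow; apply/mX_tpow => m.
    by move/dhomogP: hg => hg /hg /= ->.
move=> m dm; exists 'X_[m]; first by rewrite dhomogX /= dm.
rewrite mpolyXE_id rmorph_prod.
under [X in _ - X]eq_bigr do rewrite rmorphXn.
by rewrite subrr; apply: ideal0 (tpowP _ _).
Qed.

(** The leading forms of elements of I lie in a noetherian polynomial ring. If finitely many b i in
    I have leading forms that generate all of them, subtracting combinations of the b i raises the
    order of an element of I step by step, and the coefficients converge by completeness. *)
Lemma compl_noetherian : noetherian R.
Proof.
move=> I hI.
pose L (g : {mpoly C[N]}) := exists d b,
  [/\ g \is d.-homog, I b, mR d b & mR d.+1 (b - iota g)].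
have [n [g [/choice [d /choice [b gb]] Lg]]] :=
  noetherian_gen L (hilbert_mpoly (n := N) (@field_noetherian C)).
have step e (x : R) : exists c : 'I_n -> R, I x -> mR e x ->
    (forall i, mR (e - d i) (c i)) /\ mR e.+1 (x - \sum_i c i * b i).
  case: (pselect (I x /\ mR e x)) => [[Ix ex]|h]; last first.
    by exists (fun=> 0) => Ix ex; case: h.
  have [f hf xf] := compl_lead ex.
  have [a fE] : exists a : 'I_n -> {mpoly C[N]}, f = \sum_i a i * g i.
    by apply: Lg; apply: gen_ideal_sub; exists e, x.
  pose c i := if (d i <= e)%N then pihomog mdeg (e - d i) (a i) else 0.
  have fE' : f = \sum_i c i * g i.
    rewrite -(pihomog_dE hf) {1}fE raddf_sum; apply: eq_bigr => i _ /=.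
    have [gi _ _ _] := gb i; rewrite /c; case: leqP => de; first exact: pihomog_Mr.
    rewrite mul0r; apply: pihomog_tpow de _; apply: idealMl (tpowP _ _) _.
    by apply/mX_tpow => m; move/dhomogP: gi => gi /gi /= ->.
  exists (fun i => iota (c i)) => _ _; split=> [i|].
    apply: iota_tpow; apply/mX_tpow => m; rewrite /c; case: leqP => _; last by rewrite msupp0.
    by have /dhomogP h := pihomogP mdeg (e - d i) (a i) => /h /= ->.
  have -> : x - \sum_i iota (c i) * b i = (x - iota f) - \sum_i iota (c i) * (b i - iota (g i)).
    have -> : iota f = \sum_i iota (c i) * iota (g i).
      by rewrite fE' rmorph_sum; apply: eq_bigr => i _; rewrite rmorphM.
    under [X in _ = _ - X]eq_bigr do rewrite mulrBr.
    by rewrite sumrB; ring.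
  apply: idealB (tpowP _ _) _ _ => //; apply: ideal_bigsum => [|i _]; first exact: tpowP.
  have [_ _ _ h] := gb i; rewrite /c; case: leqP => de; last first.
    by rewrite rmorph0 mul0r; apply: ideal0 (tpowP _ _).
  rewrite -(subnK de) -addnS; apply: tpowM => //; apply: iota_tpow; apply/mX_tpow => m.
  by rewrite (subnK de); have /dhomogP h' := pihomogP mdeg (e - d i) (a i) => /h' /= ->.
exists [seq b i | i : 'I_n]; split.
  by move=> _ /mapP [i _ ->]; have [] := gb i.
move=> x Ix.
have /choice [cf hcf] : forall e, exists f : R -> 'I_n -> R, forall x, I x -> mR e x ->
    (forall i, mR (e - d i) (f x i)) /\ mR e.+1 (x - \sum_i f x i * b i).
  by move=> e; have /choice [f hf] := step e; exists f.
pose y := fix y e := if e is e'.+1 then y e' - \sum_i cf e' (y e') i * b i else x.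
have hy e : I (y e) /\ mR e (y e).
  elim: e => [|e [Iy ey]]; first by split=> //; apply: tpow0.
  have [_ h] := hcf e (y e) Iy ey; split=> //=; apply: idealB => //.
  by apply: ideal_bigsum => // i _; apply: idealMl => //; have [] := gb i.
(* The coefficient of [b i] added at stage e only has order e - d i; letting the partial sums run D
   stages ahead makes them Cauchy at the rate that [compl_lim] asks for. *)
pose D := \max_i d i.
pose u i e := \sum_(j < e + D) cf j (y j) i.
have /choice [r hr] : forall i, exists r, forall k, mR k (r - u i k).
  move=> i; apply: compl_lim => k; rewrite /u addSn [X in X - _]big_ord_recr /= addrAC subrr add0r.
  have [Iy my] := hy (k + D)%N; have [h _] := hcf _ _ Iy my.
  by apply: tpow_leq (h i); rewrite -addnBA ?leq_addr // leq_bigmax.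
suff -> : x = \sum_i r i * b i.
  by exists n, r, b; split=> // i; apply: map_f; rewrite mem_enum.
apply/eqP; rewrite -subr_eq0; apply/eqP; apply: compl_sep => k.
have yE e : y e = x - \sum_i (\sum_(j < e) cf j (y j) i) * b i.
  elim: e => [|e IH] /=.
    by rewrite big1 ?subr0 // => i _; rewrite big_ord0 mul0r.
  under [X in _ = _ - X]eq_bigr do rewrite big_ord_recr mulrDl.
  by rewrite big_split /= {1}IH opprD addrA.
have -> : x - \sum_i r i * b i = y (k + D)%N - \sum_i (r i - u i k) * b i.
  rewrite yE; under [X in _ = _ - X]eq_bigr do rewrite mulrBl.
  by rewrite sumrB; ring.
apply: idealB (tpowP _ _) _ _.
  by have [_] := hy (k + D)%N; apply: tpow_leq; rewrite leq_addr.
by apply: ideal_bigsum => [|i _]; [apply: tpowP | apply: idealMr (tpowP _ _) _].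
Qed.

(** The inverse is the geometric series. *)
Lemma unit_1B a : mR 1 a -> exists s, (1 - a) * s = 1.
Proof.
move=> ha.
have hp k : mR k (a ^+ k).
  elim: k => [|k IH]; first exact: tpow0.
  by rewrite exprS; apply: (@tpowM _ _ _ 1 k).
have [k|s hs] := @compl_lim (fun k => \sum_(i < k) a ^+ i).
  by rewrite [X in X - _]big_ord_recr /= addrAC subrr add0r.
exists s; apply/eqP; rewrite -subr_eq0; apply/eqP; apply: compl_sep => k.
have -> : (1 - a) * s - 1 = (1 - a) * (s - \sum_(i < k) a ^+ i) - a ^+ k.
  have e : (1 - a) * (\sum_(i < k) a ^+ i) = 1 - a ^+ k.
    by rewrite -[1 - a]opprB mulNr -subrX1 opprB.
  by rewrite mulrBr e; ring.
by apply: idealB (tpowP _ _) _ _ => //; apply: idealMl (tpowP _ _) _.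
Qed.

Lemma unit_notin r : ~ mR 1 r -> exists s, r * s = 1.
Proof.
move=> nr; have [c hc'] := residue r.
have c0 : c != 0 by apply/eqP => c0; move: hc'; rewrite c0 scale0r subr0.
have [|s hs] := @unit_1B (1 - c^-1 *: r).
  have -> : 1 - c^-1 *: r = (- c^-1)%:A * (r - c%:A).
    by rewrite mulr_algl scalerBr scalerA mulNr mulVf // scaleN1r opprK scaleNr addrC.
  exact: idealMl (tpowP _ _) _.
by exists (c^-1 *: s); move: hs; rewrite opprB addrC subrK -scalerAl -scalerAr.
Qed.

(** Krull's theorem with all multipliers equal to 1 yields c in the maximal ideal such that (1 - c)
    r lies in I, and 1 - c is a unit. *)
Lemma ideal_closed (I : R -> Prop) r : is_ideal I ->
  (forall k, exists2 y, mR k y & I (r - y)) -> I r.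
Proof.
move=> hI h.
have [k _|n [m [f [c [_ _ hcj Ir]]]]] :=
  @krull _ compl_noetherian N (fun i => iota 'X_i) I hI r (fun=> 1) 0.
  have [_ [P hP <-] hy] := h k; exists P => //.
  by rewrite mul1r -opprB; apply: idealN.
have [|s hs] := @unit_1B (\sum_j c j * 1).
  apply: ideal_bigsum => [|j _]; first exact: tpowP.
  rewrite mulr1; move: (hcj j); apply: gen_ideal_min; first exact: tpowP.
  by move=> _ [i ->]; apply: tpow1.
by rewrite -[r]mul1r -hs mulrAC mulrC; apply: idealMl.
Qed.

Hypothesis I02 : forall p, I0 p -> tpow X 2 p.

Lemma notin_mR1 : ~ mR 1 1.
Proof.
rewrite -(rmorph1 iota) => /compl_kernel [a [b [/I02 /tpowS ha hb e]]].
have /mX_tpow/(_ 0%MM) : tpow X 1 (1 : {mpoly C[N]}) by rewrite e; apply: idealD (tpowP _ _) _ _.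
by rewrite msupp1 inE eqxx mdeg0 => /(_ isT).
Qed.

Lemma nonunit_mR r : nonunit r <-> mR 1 r.
Proof.
split=> [nr|mr [s rs]]; first by apply: contrapT => /unit_notin.
by apply: notin_mR1; rewrite -rs; apply: idealMr (tpowP _ _) _.
Qed.

Lemma prime_sub_mR (Q : R -> Prop) r : prime_ideal Q -> Q r -> mR 1 r.
Proof.
move=> [hQ Q1 _] Qr; apply/nonunit_mR => -[s rs]; apply: Q1; rewrite -rs.
exact: idealMr.
Qed.

End Completion.

(** * Twisted monoid algebras *)

(** A symmetric 2-cocycle with values in the multiplicative monoid of B. Nilpotent values and zero
    are allowed, so that one construction covers tori, their degenerations and the deformations in
    between. *)
Record cocycle (B : comNzRingType) (W : zmodType) := Cocycle {
  coc :> W -> W -> B;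
  cocC : forall a b, coc a b = coc b a;
  cocA : forall a b c, coc a b * coc (a + b) c = coc b c * coc a (b + c);
  coc0 : forall a, coc 0 a = 1
}.

Definition ptwisted (B : comNzRingType) (W : zmodType) (c : cocycle B W) : Type := monalg.malg W B.

Section TwistedAlgebra.
Import monalg finmap.
Variables (B : comNzRingType) (W : zmodType) (c : cocycle B W).
Local Notation T := (ptwisted c).

HB.instance Definition _ := GRing.Lmodule.copy T (monalg.malg W B).

Definition ptcoef (w : W) (x : T) : B := monalg.mcoeff w x.
Definition ptbas (w : W) : T := monalg.mkmalgU w (1 : B).
Definition ptsupp (x : T) : seq W := enum_fset (monalg.msupp x).

Lemma ptsupp_uniq x : uniq (ptsupp x).
Proof. exact: finmap.fset_uniq. Qed.

Lemma ptwistedP (x y : T) : (forall w, ptcoef w x = ptcoef w y) -> x = y.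
Proof. by move=> h; apply/monalg.malgP. Qed.

Lemma ptcoef_supp w x : (ptcoef w x != 0) = (w \in ptsupp x).
Proof. exact: monalg.mcoeff_neq0. Qed.

Lemma ptcoef_linear w : linear (ptcoef w : T -> B^o).
Proof.
move=> a x y; rewrite /ptcoef; have -> := monalg.mcoeffD w (a *: x) y.
by congr (_ + _); apply: monalg.mcoeffZ.
Qed.
HB.instance Definition _ w := GRing.isLinear.Build B T B^o _ (ptcoef w) (ptcoef_linear w).

Lemma ptcoef_bas w v : ptcoef w (ptbas v) = (v == w)%:R.
Proof. exact: (monalg.mcoeffU v (1 : B) w). Qed.

Lemma ptcoefZ w a x : ptcoef w (a *: x) = a * ptcoef w x.
Proof. exact: monalg.mcoeffZ. Qed.

Lemma ptcoefD w x y : ptcoef w (x + y) = ptcoef w x + ptcoef w y.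
Proof. exact: raddfD. Qed.

Lemma ptsum (x : T) : x = \sum_(w <- ptsupp x) ptcoef w x *: ptbas w.
Proof.
apply: ptwistedP => w; rewrite raddf_sum /=.
under eq_bigr do rewrite ptcoefZ ptcoef_bas.
case: (boolP (w \in ptsupp x)) => wx.
  rewrite (bigD1_seq w) //= ?ptsupp_uniq // eqxx mulr1 big1 ?addr0 // => v vw.
  by rewrite (negbTE vw) mulr0.
rewrite big_seq big1 => [|v vx]; first by move: wx; rewrite -ptcoef_supp negbK => /eqP.
by case: eqP => [vw|]; [move: wx; rewrite -vw vx | rewrite mulr0].
Qed.

Lemma ptind (P : T -> Prop) : P 0 -> (forall x y, P x -> P y -> P (x + y)) ->
  (forall a w, P (a *: ptbas w)) -> forall x, P x.
Proof.
move=> P0 PD PU x; rewrite [x]ptsum; elim/big_rec: _ => // w y _ Py.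
exact: PD.
Qed.

Section Lift.
Variables (V : lmodType B) (F : W -> V).

Definition tlift (x : T) : V := \sum_(w <- ptsupp x) ptcoef w x *: F w.

(** Sums over supports are additive because the index set may be enlarged to one that serves all the
    summands. *)
Lemma tlift_sup (s : seq W) x : uniq s -> {subset ptsupp x <= s} ->
  tlift x = \sum_(w <- s) ptcoef w x *: F w.
Proof.
move=> us xs; rewrite (bigID (fun w => w \in ptsupp x)) /= [X in _ + X]big1 ?addr0.
  rewrite -big_filter; apply: perm_big; apply: uniq_perm.
  - exact: ptsupp_uniq.
  - exact: filter_uniq.
  - move=> w; rewrite mem_filter; case: (boolP (w \in ptsupp x)) => //= wx.
    exact/esym/xs.
by move=> w; rewrite -ptcoef_supp negbK => /eqP ->; rewrite scale0r.
Qed.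

Lemma tlift_linear : linear tlift.
Proof.
move=> a x y.
pose s := undup (ptsupp x ++ ptsupp y ++ ptsupp (a *: x + y)).
rewrite !(@tlift_sup s) ?undup_uniq //; first last.
- by move=> w; rewrite mem_undup !mem_cat => ->; rewrite !orbT.
- by move=> w; rewrite mem_undup !mem_cat => ->.
- by move=> w; rewrite mem_undup !mem_cat => ->; rewrite !orbT.
rewrite scaler_sumr -big_split; apply: eq_bigr => w _ /=.
by rewrite linearP /= scalerDl scalerA.
Qed.
HB.instance Definition _ := GRing.isLinear.Build B T V _ tlift tlift_linear.

Lemma tlift_bas w : tlift (ptbas w) = F w.
Proof.
rewrite (@tlift_sup [:: w]) // => [|v].
  by rewrite big_seq1 ptcoef_bas eqxx scale1r.
by rewrite -ptcoef_supp ptcoef_bas inE (eq_sym w v); case: (v == w); rewrite ?eqxx.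
Qed.
End Lift.

Definition tmul (x y : T) : T :=
  tlift (fun a => tlift (fun b => c a b *: ptbas (a + b)) y) x.

Lemma tmulDl x y z : tmul (x + y) z = tmul x z + tmul y z.
Proof. by rewrite /tmul linearD. Qed.
Lemma tmulZl a x y : tmul (a *: x) y = a *: tmul x y.
Proof. by rewrite /tmul linearZ. Qed.
Lemma tmulUU a b : tmul (ptbas a) (ptbas b) = c a b *: ptbas (a + b).
Proof. by rewrite /tmul !tlift_bas. Qed.
Lemma tmulDr x y z : tmul x (y + z) = tmul x y + tmul x z.
Proof.
rewrite /tmul /tlift -big_split; apply: eq_bigr => a _ /=.
by rewrite -scalerDr -/(tlift _ _) linearD.
Qed.
Lemma tmulZr a x y : tmul x (a *: y) = a *: tmul x y.
Proof.
rewrite /tmul {1 3}/tlift scaler_sumr; apply: eq_bigr => b _ /=.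
by rewrite linearZ /= !scalerA mulrC.
Qed.
Lemma tmul0l x : tmul 0 x = 0. Proof. by rewrite /tmul linear0. Qed.
Lemma tmul0r x : tmul x 0 = 0. Proof. by have := tmulZr 0 x 0; rewrite !scale0r. Qed.

Lemma tmulC : commutative tmul.
Proof.
elim/ptind => [|x y hx hy|a v] z; first by rewrite tmul0l tmul0r.
  by rewrite tmulDl tmulDr hx hy.
rewrite tmulZl tmulZr; congr (_ *: _); elim/ptind: z => [|x y hx hy|b w].
- by rewrite tmul0l tmul0r.
- by rewrite tmulDl tmulDr hx hy.
- by rewrite tmulZl tmulZr !tmulUU cocC addrC.
Qed.

Lemma tmulA : associative tmul.
Proof.
elim/ptind => [|x x' hx hx'|a u] y z; first by rewrite !tmul0l.
  by rewrite !tmulDl hx hx'.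
rewrite !tmulZl; congr (_ *: _); elim/ptind: y => [|x y hx hy|b v].
- by rewrite tmul0l tmul0r tmul0l.
- by rewrite !(tmulDl, tmulDr) hx hy.
rewrite !(tmulZl, tmulZr); congr (_ *: _); elim/ptind: z => [|x y hx hy|d w].
- by rewrite !tmul0r.
- by rewrite !tmulDr hx hy.
rewrite !(tmulZr, tmulUU); congr (_ *: _); rewrite !(tmulZl, tmulZr) !tmulUU !scalerA.
by rewrite -cocA addrA.
Qed.

Lemma tmul1l : left_id (ptbas 0) tmul.
Proof.
elim/ptind => [|x y hx hy|a v]; rewrite ?tmul0r // ?tmulDr ?hx ?hy //.
by rewrite tmulZr tmulUU coc0 scale1r add0r.
Qed.

Lemma ptbas_neq0 : ptbas 0 != 0.
Proof.
apply/eqP => h; have := congr1 (ptcoef 0) h; rewrite ptcoef_bas eqxx raddf0 => /eqP.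
by rewrite oner_eq0.
Qed.

HB.instance Definition _ := GRing.Zmodule_isComNzRing.Build T tmulA tmulC tmul1l
  tmulDl ptbas_neq0.

Lemma tscaleAl (a : B) (x y : T) : a *: (x * y) = (a *: x) * y.
Proof. by rewrite -[RHS]/(tmul _ _) tmulZl. Qed.
HB.instance Definition _ := GRing.Lmodule_isLalgebra.Build B T tscaleAl.
HB.instance Definition _ := GRing.Lalgebra_isComAlgebra.Build B T.

Lemma ptbasM a b : ptbas a * ptbas b = c a b *: ptbas (a + b).
Proof. exact: tmulUU. Qed.

Lemma ptbas0 : ptbas 0 = 1. Proof. by []. Qed.

(** The module is free on [ptbas]: the expansions of the y i over a common finite support are the
    witnesses of the equational criterion. *)
Lemma ptwisted_flat : flat_quotient (fun x : T => x = 0).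
Proof.
move=> k r y h.
pose s := undup (flatten [seq ptsupp (y i) | i <- enum 'I_k]).
exists (size s), (fun i j => ptcoef (nth 0 s j) (y i)), (fun j => ptbas (nth 0 s j)); split.
  move=> i; apply/eqP; rewrite subr_eq0; apply/eqP; rewrite [LHS]ptsum -/(tlift ptbas (y i)).
  rewrite (@tlift_sup _ _ s) ?undup_uniq //; first by rewrite (big_nth 0) big_mkord.
  move=> w wy; rewrite mem_undup; apply/flattenP; exists (ptsupp (y i)) => //.
  by apply: map_f; rewrite mem_enum.
move=> j; have := congr1 (ptcoef (nth 0 s j)) h; rewrite raddf0 raddf_sum => /= {2}<-.
by apply: eq_bigr => i _; rewrite ptcoefZ.
Qed.

End TwistedAlgebra.


(* Sealed, since the unifier otherwise unfolds the construction. *)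
Record twisted_model (B : comNzRingType) (W : zmodType) (c : cocycle B W) := TwistedModel {
  twm_alg : comAlgType B;
  twm_bas : W -> twm_alg;
  twm_coef : W -> twm_alg -> B;
  twm_supp : twm_alg -> seq W;
  twm_supp_uniq : forall x, uniq (twm_supp x);
  twm_ext : forall x y, (forall w, twm_coef w x = twm_coef w y) -> x = y;
  twm_coef_supp : forall w x, (twm_coef w x != 0) = (w \in twm_supp x);
  twm_coefD : forall w x y, twm_coef w (x + y) = twm_coef w x + twm_coef w y;
  twm_coefZ : forall w a x, twm_coef w (a *: x) = a * twm_coef w x;
  twm_coef_bas : forall w v, twm_coef w (twm_bas v) = (v == w)%:R;
  twm_sum : forall x, x = \sum_(w <- twm_supp x) twm_coef w x *: twm_bas w;
  twm_bas0 : twm_bas 0 = 1;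
  twm_basM : forall a b, twm_bas a * twm_bas b = c a b *: twm_bas (a + b);
  twm_flat : flat_quotient (fun x : twm_alg => x = 0)
}.

Definition twisted_construction (B : comNzRingType) (W : zmodType) (c : cocycle B W) :
  twisted_model c.
Proof.
exact: (@TwistedModel B W c (ptwisted c) (@ptbas B W c) (@ptcoef B W c) (@ptsupp B W c)
  (@ptsupp_uniq B W c) (@ptwistedP B W c) (@ptcoef_supp B W c) (@ptcoefD B W c)
  (@ptcoefZ B W c) (@ptcoef_bas B W c) (@ptsum B W c) (@ptbas0 B W c) (@ptbasM B W c)
  (@ptwisted_flat B W c)).
Qed.

Section Twisted.
Variables (B : comNzRingType) (W : zmodType) (c : cocycle B W).
Definition twisted : comAlgType B := twm_alg (twisted_construction c).
Definition tbas w : twisted := twm_bas (twisted_construction c) w.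
Definition tcoef w (x : twisted) : B := twm_coef w x.
Definition tsupp (x : twisted) : seq W := twm_supp x.
Lemma tsupp_uniq x : uniq (tsupp x). Proof. exact: twm_supp_uniq. Qed.
Lemma twistedP x y : (forall w, tcoef w x = tcoef w y) -> x = y. Proof. exact: twm_ext. Qed.
Lemma tcoef_supp w x : (tcoef w x != 0) = (w \in tsupp x). Proof. exact: twm_coef_supp. Qed.
Lemma tcoefD w x y : tcoef w (x + y) = tcoef w x + tcoef w y. Proof. exact: twm_coefD. Qed.
Lemma tcoefZ w a x : tcoef w (a *: x) = a * tcoef w x. Proof. exact: twm_coefZ. Qed.
Lemma tcoef_bas w v : tcoef w (tbas v) = (v == w)%:R. Proof. exact: twm_coef_bas. Qed.
Lemma tsum x : x = \sum_(w <- tsupp x) tcoef w x *: tbas w. Proof. exact: twm_sum. Qed.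
Lemma tbas0 : tbas 0 = 1. Proof. exact: twm_bas0. Qed.
Lemma tbasM a b : tbas a * tbas b = c a b *: tbas (a + b). Proof. exact: twm_basM. Qed.
Lemma twisted_flat : flat_quotient (fun x : twisted => x = 0). Proof. exact: twm_flat. Qed.

Lemma tcoef0 w : tcoef w 0 = 0.
Proof. by have := tcoefZ w 0 0; rewrite scale0r mul0r. Qed.

Lemma tcoef_sum w (I : Type) (s : seq I) (P : pred I) (F : I -> twisted) :
  tcoef w (\sum_(i <- s | P i) F i) = \sum_(i <- s | P i) tcoef w (F i).
Proof. by elim/big_rec2: _ => [|i a x _ <-]; rewrite ?tcoef0 ?tcoefD. Qed.

Lemma tind (P : twisted -> Prop) : P 0 -> (forall x y, P x -> P y -> P (x + y)) ->
  (forall a w, P (a *: tbas w)) -> forall x, P x.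
Proof.
move=> P0 PD PU x; rewrite [x]tsum; elim/big_rec: _ => // w y _ Py.
exact: PD.
Qed.
End Twisted.

Section TwistedMorphism.
Variables (B B' : comNzRingType) (W W' : zmodType) (c : cocycle B W) (c' : cocycle B' W').
Variables (f : {rmorphism B -> B'}) (th : {additive W -> W'}) (ps : W -> B').
Hypotheses (ps0 : ps 0 = 1)
  (psM : forall a b, f (c a b) * ps (a + b) = ps a * ps b * c' (th a) (th b)).

(** Weights are moved by [th] and basis elements rescaled by [ps]. The hypothesis [psM] says that
    the two cocycles differ by the coboundary of [ps], written without division. *)
Definition tmap (x : twisted c) : twisted c' :=
  \sum_(w <- tsupp x) (f (tcoef w x) * ps w) *: tbas c' (th w).

Lemma tmap_sup (s : seq W) x : uniq s -> {subset tsupp x <= s} ->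
  tmap x = \sum_(w <- s) (f (tcoef w x) * ps w) *: tbas c' (th w).
Proof.
move=> us xs; rewrite (bigID (fun w => w \in tsupp x)) /= [X in _ + X]big1 ?addr0.
  rewrite -big_filter; apply: perm_big; apply: uniq_perm.
  - exact: tsupp_uniq.
  - exact: filter_uniq.
  - move=> w; rewrite mem_filter; case: (boolP (w \in tsupp x)) => //= wx.
    exact/esym/xs.
by move=> w; rewrite -tcoef_supp negbK => /eqP ->; rewrite rmorph0 mul0r scale0r.
Qed.

Lemma tmapP a x y : tmap (a *: x + y) = f a *: tmap x + tmap y.
Proof.
pose s := undup (tsupp x ++ tsupp y ++ tsupp (a *: x + y)).
rewrite !(@tmap_sup s) ?undup_uniq //; first last.
- by move=> w; rewrite mem_undup !mem_cat => ->; rewrite !orbT.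
- by move=> w; rewrite mem_undup !mem_cat => ->.
- by move=> w; rewrite mem_undup !mem_cat => ->; rewrite !orbT.
rewrite scaler_sumr -big_split; apply: eq_bigr => w _ /=.
by rewrite tcoefD tcoefZ rmorphD rmorphM mulrDl scalerDl scalerA mulrA.
Qed.

Lemma tmapD x y : tmap (x + y) = tmap x + tmap y.
Proof. by have := tmapP 1 x y; rewrite rmorph1 !scale1r. Qed.

Lemma tmap0 : tmap 0 = 0.
Proof. by apply: (addrI (tmap 0)); rewrite -tmapD !addr0. Qed.

Lemma tmapZ a x : tmap (a *: x) = f a *: tmap x.
Proof. by have := tmapP a x 0; rewrite tmap0 !addr0. Qed.

Lemma tmapB x y : tmap (x - y) = tmap x - tmap y.
Proof. by rewrite tmapD -[in LHS]scaleN1r tmapZ rmorphN1 scaleN1r. Qed.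

Lemma tmap_bas w : tmap (tbas c w) = ps w *: tbas c' (th w).
Proof.
rewrite (@tmap_sup [:: w]) // => [|v].
  by rewrite big_seq1 tcoef_bas eqxx rmorph1 mul1r.
by rewrite -tcoef_supp tcoef_bas inE (eq_sym w v); case: (v == w); rewrite ?eqxx.
Qed.

Lemma tmap1 : tmap 1 = 1.
Proof. by rewrite -tbas0 tmap_bas ps0 scale1r raddf0 tbas0. Qed.

Lemma tmapM x y : tmap (x * y) = tmap x * tmap y.
Proof.
elim/tind: x y => [|x x' hx hx'|a u] y; first by rewrite mul0r tmap0 mul0r.
  by rewrite mulrDl !tmapD mulrDl hx hx'.
rewrite -scalerAl !tmapZ -scalerAl; congr (_ *: _); elim/tind: y => [|x y hx hy|b v].
- by rewrite mulr0 tmap0 mulr0.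
- by rewrite mulrDr !tmapD mulrDr hx hy.
rewrite -scalerAr !tmapZ -scalerAr; congr (_ *: _).
rewrite tbasM tmapZ !tmap_bas -scalerAl -scalerAr tbasM !scalerA raddfD.
by rewrite -psM.
Qed.

End TwistedMorphism.

(** * The fan of the hexagon *)

Inductive ray := R0 | R1 | R2 | R3 | R4 | R5.

Definition ray_nat (r : ray) : nat :=
  match r with R0 => 0 | R1 => 1 | R2 => 2 | R3 => 3 | R4 => 4 | R5 => 5 end.
Lemma ray_nat_inj : injective ray_nat. Proof. by case; case. Qed.
HB.instance Definition _ := Equality.copy ray (inj_type ray_nat_inj).

Definition rays : seq ray := [:: R0; R1; R2; R3; R4; R5].
Lemma mem_rays r : r \in rays. Proof. by case: r. Qed.

Definition rvec (r : ray) : (int * int)%type :=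
  match r with R0 => (1, 0) | R1 => (1, 1) | R2 => (0, 1)
  | R3 => (-1, 0) | R4 => (-1, -1) | R5 => (0, -1) end.
Definition rnext (r : ray) : ray :=
  match r with R0 => R1 | R1 => R2 | R2 => R3 | R3 => R4 | R4 => R5 | R5 => R0 end.
Definition rprev (r : ray) : ray :=
  match r with R0 => R5 | R1 => R0 | R2 => R1 | R3 => R2 | R4 => R3 | R5 => R4 end.
Definition ropp (r : ray) : ray :=
  match r with R0 => R3 | R1 => R4 | R2 => R5 | R3 => R0 | R4 => R1 | R5 => R2 end.

(* The linear form det(r, .), positive on the side of the next ray. *)
Definition rdet (r : ray) (u : (int * int)%type) : int := (rvec r).1 * u.2 - (rvec r).2 * u.1.

(* The cones of the fan of the hexagon: the vertex, the rays, and the cones spanned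
   by a ray and its successor. *)
Inductive cell := CV | CE of ray | CT of ray.

Definition cell_nat (c : cell) : nat :=
  match c with CV => 0 | CE r => (ray_nat r).*2.+1 | CT r => (ray_nat r).*2.+2 end.
Lemma cell_nat_inj : injective cell_nat. Proof. by case=> [|[]|[]] [|[]|[]]. Qed.
HB.instance Definition _ := Equality.copy cell (inj_type cell_nat_inj).

Definition cells : seq cell := CV :: map CE rays ++ map CT rays.
Lemma mem_cells c : c \in cells. Proof. by case: c => [|[]|[]]. Qed.

Definition crays (c : cell) : seq ray :=
  match c with CV => [::] | CE r => [:: r] | CT r => [:: r; rnext r] end.
Definition subcell (c d : cell) := all (fun r => r \in crays d) (crays c).

Definition ipos (z : int) : int := Num.max z 0.
Definition hpos (x y : int) : int := Num.max 0 (Num.max (- x) (- y)).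

(** The quadruple (i, (y_0, (y_1, y_2))) stands for a monomial in the six parameters at a vertex:
    y_k is its degree in the two parameters along tau_k and - tau_k, and i its degree in the three
    parameters along the tau_k. Modulo the minors nothing else about the monomial matters, and
    [expo_valid] says that such a monomial exists. *)
Definition expo := (int * (int * (int * int)))%type.

Definition expo_valid (e : expo) : bool :=
  [&& 0 <= e.1, 0 <= e.2.1, 0 <= e.2.2.1, 0 <= e.2.2.2 &
      e.1 <= e.2.1 + (e.2.2.1 + e.2.2.2)].

(* The piecewise linear function whose bend at the ray tau_k is a + y_k and at the
   ray - tau_k is b + y_k, where b is eliminated by a + b = y_0 + y_1 + y_2; for the
   other cells, its linear part along the cell. *)
Definition phi (c : cell) (u : (int * int)%type) : expo :=
  let: (x, y) := u in
  match c with
  | CV => (hpos x y, (ipos y, (ipos (- x), ipos (x - y))))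
  | CE R0 => (ipos (- y), (ipos y, (0, x - y)))
  | CE R1 => (0, (y, (0, ipos (x - y))))
  | CE R2 => (ipos (- x), (y, (ipos (- x), 0)))
  | CE R3 => (- x, (ipos y, (- x, 0)))
  | CE R4 => (Num.max (- x) (- y), (0, (- x, ipos (x - y))))
  | CE R5 => (- y, (0, (ipos (- x), x - y)))
  | CT R0 => (0, (y, (0, x - y)))
  | CT R1 => (0, (y, (0, 0)))
  | CT R2 => (- x, (y, (- x, 0)))
  | CT R3 => (- x, (0, (- x, 0)))
  | CT R4 => (- y, (0, (- x, x - y)))
  | CT R5 => (- y, (0, (0, x - y)))
  end.

Lemma phi0 c : phi c 0 = 0.
Proof. by case: c => [|[]|[]]. Qed.

(** The convex function with bends along the three rays tau_k and its reflection, with bends along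
    the - tau_k, add up to the sum of the functions that bend along the three full lines. This is
    how the eliminated quantity b is recovered. *)
Lemma hpos_opp (x y : int) :
  hpos x y = ipos y + (ipos (- x) + ipos (x - y)) - hpos (- x) (- y).
Proof. by rewrite /hpos /ipos; lia. Qed.

Lemma hpos_convex (x y z w : int) : 0 <= hpos x y + hpos z w - hpos (x + z) (y + w).
Proof. by rewrite /hpos; lia. Qed.

(** For the vertex cell, four of the inequalities are convexity of the entries of [phi]. The last
    one is convexity of the function that bends along the - tau_k, brought in by [hpos_opp]. *)
Lemma phi_convex c u v : expo_valid (phi c u + phi c v - phi c (u + v)).
Proof.
case: u v => [x y] [z w]; rewrite /expo_valid.
case: c => [|r|r]; last by case: r; apply/and5P; split; rewrite /=; lia.
  2: by case: r; apply/and5P; split; rewrite /= /ipos; lia.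
apply/and5P; split; rewrite /=.
1: exact: hpos_convex.
1-3: by rewrite /ipos; lia.
have := hpos_convex (- x) (- y) (- z) (- w); rewrite -!opprD => h.
rewrite [hpos x y]hpos_opp [hpos z w]hpos_opp [hpos (x + z) _]hpos_opp.
by rewrite -subr_ge0; apply: le_trans h _; rewrite le_eqVlt; apply/orP; left; apply/eqP; ring.
Qed.

(** The function of a larger cell is the germ along this cell, extended so as to be linear along it;
    it supports the convex function of the smaller cell from below. *)
Lemma phi_mono c d u : subcell c d -> expo_valid (phi c u - phi d u).
Proof.
case: u => [x y]; rewrite /expo_valid.
by case: c => [|[]|[]]; case: d => [|[]|[]] // _; apply/and5P; split;
  rewrite /= /hpos /ipos; lia.
Qed.

Section HexagonMonomials.
Variables (B : comNzRingType) (w : ray -> B).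

Definition hexagon_minors := [/\ w R0 * w R5 = w R2 * w R3, w R0 * w R1 = w R4 * w R3
  & w R2 * w R1 = w R4 * w R5].
Hypothesis wm : hexagon_minors.

Definition hmon (p0 q0 p1 q1 p2 q2 : nat) : B :=
  w R0 ^+ p0 * w R3 ^+ q0 * (w R2 ^+ p1 * w R5 ^+ q1) * (w R4 ^+ p2 * w R1 ^+ q2).

(** The normal form of a monomial modulo the minors: the degree i on the side of the tau_k is spent
    greedily, on the first line up to its degree x, then on the second and the third. *)
Definition hexp (i x y z : nat) : B :=
  let i0 := minn i x in let i1 := minn (i - i0) y in let i2 := minn (i - i0 - i1) z in
  hmon i0 (x - i0) i1 (y - i1) i2 (z - i2).

Lemma swap_powers (a d a' d' : B) m n m' n' k : a * d' = a' * d -> (k <= n)%N -> (k <= m')%N ->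
  a ^+ m * d ^+ n * (a' ^+ m' * d' ^+ n') =
  a ^+ (m + k) * d ^+ (n - k) * (a' ^+ (m' - k) * d' ^+ (n' + k)).
Proof.
move=> h kn km; have e : d ^+ k * a' ^+ k = a ^+ k * d' ^+ k.
  by rewrite -!exprMn mulrC h mulrC.
rewrite -{1}(subnK kn) -{1}(subnK km) !exprD.
transitivity (a ^+ m * d ^+ (n - k) * a' ^+ (m' - k) * d' ^+ n' * (d ^+ k * a' ^+ k)).
  by ring.
by rewrite e; ring.
Qed.

Lemma hmonE p0 q0 p1 q1 p2 q2 :
  hmon p0 q0 p1 q1 p2 q2 = hexp (p0 + p1 + p2) (p0 + q0) (p1 + q1) (p2 + q2).
Proof.
case: wm => h01 h02 h12; rewrite /hexp /hmon.
(* The numbers k, l and m count the exchanges by the three minors that fill the first line from the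
   second, the first from the third, and the second from the third. *)
set k := minn q0 p1.
rewrite (@swap_powers (w R0) (w R3) (w R2) (w R5) p0 q0 p1 q1 k) ?geq_minl ?geq_minr //.
set l := minn (q0 - k) p2.
rewrite mulrAC.
rewrite (@swap_powers (w R0) (w R3) (w R4) (w R1) (p0 + k) (q0 - k) p2 q2 l)
  ?geq_minl ?geq_minr //.
set m := minn (q1 + k) (p2 - l).
rewrite mulrAC -[LHS]mulrA.
rewrite (@swap_powers (w R2) (w R5) (w R4) (w R1) (p1 - k) (q1 + k) (p2 - l) (q2 + l) m)
  ?geq_minl ?geq_minr // [LHS]mulrA.
have hk1 : (k <= q0)%N by apply: geq_minl.
have hk2 : (k <= p1)%N by apply: geq_minr.
have hl1 : (l <= q0 - k)%N by apply: geq_minl.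
have hl2 : (l <= p2)%N by apply: geq_minr.
have hm1 : (m <= q1 + k)%N by apply: geq_minl.
have hm2 : (m <= p2 - l)%N by apply: geq_minr.
have -> : minn (p0 + p1 + p2) (p0 + q0) = (p0 + k + l)%N by move: (erefl k) (erefl l); rewrite {2}/k {2}/l; lia.
have -> : minn (p0 + p1 + p2 - (p0 + k + l)) (p1 + q1) = (p1 - k + m)%N by move: (erefl m); rewrite {2}/m; lia.
have -> : minn (p0 + p1 + p2 - (p0 + k + l) - (p1 - k + m)) (p2 + q2) = (p2 - l - m)%N by lia.
by congr (_ ^+ _ * _ ^+ _ * (_ ^+ _ * _ ^+ _) * (_ ^+ _ * _ ^+ _)); lia.
Qed.

Lemma hmonM p0 q0 p1 q1 p2 q2 p0' q0' p1' q1' p2' q2' :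
  hmon p0 q0 p1 q1 p2 q2 * hmon p0' q0' p1' q1' p2' q2' =
  hmon (p0 + p0') (q0 + q0') (p1 + p1') (q1 + q1') (p2 + p2') (q2 + q2').
Proof. by rewrite /hmon !exprD; ring. Qed.

Definition tm (e : expo) : B := hexp `|e.1|%N `|e.2.1|%N `|e.2.2.1|%N `|e.2.2.2|%N.

Lemma tm0 : tm 0 = 1.
Proof. by rewrite /tm /hexp /hmon /= !min0n !subn0 !expr0 !mulr1. Qed.

Lemma minn3 i x y z : (i <= x + (y + z))%N ->
  (minn i x + minn (i - minn i x) y + minn (i - minn i x - minn (i - minn i x) y) z = i)%N.
Proof.
move=> h; case: (leqP i x) => ix; first by rewrite subnn min0n sub0n min0n !addn0.
case: (leqP (i - x) y) => iy; first by rewrite subnn min0n; lia.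
by rewrite (minn_idPl _); lia.
Qed.

(** Validity makes the greedy filling of either factor exhaust its first entry ([minn3]). The
    product of the two normal forms therefore has the sum of the quadruples, and [hmonE] brings it
    to normal form. *)
Lemma tmD e f : expo_valid e -> expo_valid f -> tm (e + f) = tm e * tm f.
Proof.
case: e f => [i [x [y z]]] [j [x' [y' z']]] /and5P /= [h1 h2 h3 h4 h5] /and5P /= [g1 g2 g3 g4 g5].
have aD (a b : int) : 0 <= a -> 0 <= b -> `|(a + b)%R|%N = (`|a| + `|b|)%N by lia.
rewrite /tm /= !aD // {2 3}/hexp hmonM hmonE.
have {}h5 : (`|i| <= `|x| + (`|y| + `|z|))%N by lia.
have {}g5 : (`|j| <= `|x'| + (`|y'| + `|z'|))%N by lia.
have e1 := minn3 h5; have e2 := minn3 g5; move: e1 e2.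
have {h5 g5} := (geq_minr `|i| `|x|, geq_minr (`|i| - minn `|i| `|x|) `|y|,
  geq_minr (`|i| - minn `|i| `|x| - minn (`|i| - minn `|i| `|x|) `|y|) `|z|,
  geq_minr `|j| `|x'|, geq_minr (`|j| - minn `|j| `|x'|) `|y'|,
  geq_minr (`|j| - minn `|j| `|x'| - minn (`|j| - minn `|j| `|x'|) `|y'|) `|z'|).
move: (minn _ `|z|%N) (minn _ `|z'|%N) => a3 b3.
move: (minn _ `|y|%N) (minn _ `|y'|%N) => a2 b2.
move: (minn _ `|x|%N) (minn _ `|x'|%N) => a1 b1.
move: `|i|%N `|j|%N `|x|%N `|y|%N `|z|%N `|x'|%N `|y'|%N `|z'|%N => ni nj nx ny nz nx' ny' nz'.
case=> -[[[[l1 l2] l3] l4] l5] l6 e1 e2; congr hexp.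
- by rewrite -e1 -e2; lia.
- by lia.
- by lia.
- by lia.
Qed.

(* The parameter at a ray occurs with the exponents of the pure bends. *)
Lemma tm_ray r n : tm (match r with
    R0 => (n%:Z, (n%:Z, (0, 0))) | R3 => (0, (n%:Z, (0, 0)))
  | R2 => (n%:Z, (0, (n%:Z, 0))) | R5 => (0, (0, (n%:Z, 0)))
  | R4 => (n%:Z, (0, (0, n%:Z))) | R1 => (0, (0, (0, n%:Z))) end) = w r ^+ n.
Proof.
by case: r; rewrite /tm /hexp /hmon /= ?(min0n, minn0, minnn, subnn, subn0, sub0n, expr0, mulr1, mul1r).
Qed.

End HexagonMonomials.

(** * Cells of the torus *)

(** Identities between the [tau k] are proved in Z^2, before [q] is applied. *)
Ltac zq := rewrite /Defs.tau -?raddfN -?addrA -?raddfD //.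

Section TorusCells.
Variables (G : finZmodType) (q : {additive (int * int)%type -> G}).
Hypothesis poly : polyhedral q.
Local Notation tau := (tau q).

Definition nb (p : G) (r : ray) : G := p + q (rvec r).

Lemma q_rvec r : q (rvec r) = match r with R0 => tau 0 | R1 => - tau 2 | R2 => tau 1
  | R3 => - tau 0 | R4 => tau 2 | R5 => - tau 1 end.
Proof. by case: r => //; rewrite -raddfN. Qed.

Lemma tau2E : tau 2 = - tau 0 - tau 1.
Proof. by rewrite -!raddfN -raddfD. Qed.

(** The triangle at p in the sector between r and [rnext r], named through its edge parallel to
    [tau 0]. *)
Definition tri (p : G) (r : ray) : triangle G :=
  match r with R0 => (p, false) | R1 => (p + tau 1, true) | R2 => (p - tau 0, false)
  | R3 => (p - tau 0, true) | R4 => (p + tau 2, false) | R5 => (p, true) end.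

Definition eray (p : G) (r : ray) : edge G :=
  match r with R0 => (p, 0) | R1 => (p - tau 2, 2) | R2 => (p, 1) | R3 => (p - tau 0, 0)
  | R4 => (p, 2) | R5 => (p - tau 1, 1) end.

Lemma edge_ends_eray p r : edge_ends q (eray p r) = [set p; nb p r].
Proof.
rewrite /nb q_rvec; apply/setP => x; rewrite /edge_ends.
by case: r; rewrite /= !inE ?subrK // orbC.
Qed.

Lemma tri_vertices p r :
  triangle_vertices q (tri p r) = [set p; nb p r; nb p (rnext r)].
Proof.
rewrite /nb !q_rvec; apply/setP => x; case: r; rewrite /= !inE.
- by [].
- have -> : p + tau 1 + tau 0 = p - tau 2 by zq.
  by rewrite addrK; case: (x == p); case: (_ == p - _); case: (_ == p + _).
- have -> : p - tau 0 - tau 2 = p + tau 1 by zq.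
  by rewrite subrK; case: (x == p); case: (_ == p - _); case: (_ == p + _).
- have -> : p - tau 0 - tau 1 = p + tau 2 by zq.
  by rewrite subrK; case: (x == p); case: (_ == p - _); case: (_ == p + _).
- have -> : p + tau 2 + tau 0 = p - tau 1 by zq.
  by rewrite addrK; case: (x == p); case: (_ == p - _); case: (_ == p + _).
- by case: (x == p); case: (_ == p - _); case: (_ == p + _).
Qed.

Lemma tri_edges p r : triangle_edges q (tri p r) =
  [set eray p r; eray p (rnext r); eray (nb p r) (rnext (rnext r))].
Proof.
rewrite /nb !q_rvec; apply/setP => x; case: r; rewrite /= !inE.
- by case: (x == (p, 0)); case: (x == (p - tau 2, 2)); rewrite ?orbT ?orbF.
- rewrite addrK; have -> : p + tau 1 + tau 0 = p - tau 2 by zq.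
  have -> : p - tau 2 - tau 0 = p + tau 1 by zq.
  by case: (x == (p, 1)); case: (x == (p - tau 2, 2)); rewrite ?orbT ?orbF.
- rewrite subrK; have -> : p - tau 0 - tau 2 = p + tau 1 by zq.
  by case: (x == (p, 1)); case: (x == (p - tau 0, 0)); rewrite ?orbT ?orbF.
- rewrite subrK.
  by case: (x == (p, 2)); case: (x == (p - tau 0, 0)); rewrite ?orbT ?orbF.
- rewrite addrK; have -> : p + tau 2 + tau 0 = p - tau 1 by zq.
  by case: (x == (p, 2)); case: (x == (p - tau 1, 1)); rewrite ?orbT ?orbF.
- have -> : p - tau 1 - tau 2 = p + tau 0 by zq.
  by case: (x == (p, 0)); case: (x == (p - tau 1, 1)); rewrite ?orbT ?orbF.
Qed.

Lemma tri_ex (c : triangle G) p : p \in triangle_vertices q c -> exists r, c = tri p r.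
Proof.
case: c => p0 []; rewrite /= !inE -orbA => /or3P [] /eqP ->.
- by exists R5.
- by exists R3; rewrite /= addrK.
- by exists R1; rewrite /= subrK.
- by exists R0.
- by exists R2; rewrite /= addrK.
- by exists R4; rewrite /= subrK.
Qed.

Lemma tri_distinct p r : [/\ p != nb p r, nb p r != nb p (rnext r) & p != nb p (rnext r)].
Proof.
have := (proj1 poly) (tri p r); rewrite tri_vertices => h.
have {}h : [&& p != nb p r, nb p r != nb p (rnext r) & p != nb p (rnext r)].
  apply/negPn/negP; rewrite !negb_and !negbK => hh.
  have : (#|[set p; nb p r; nb p (rnext r)]| <= 2)%N; last by rewrite h.
  case/or3P: hh => /eqP <-.
  - by rewrite finset.setUid cards2; case: (_ != _).
  - by rewrite -finset.setUA finset.setUid cards2; case: (_ != _).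
  - by rewrite finset.setUAC finset.setUid cards2; case: (_ != _).
by case/and3P: h.
Qed.

Lemma nb_neq p r : nb p r != p.
Proof. by have [h _ _] := tri_distinct p r; rewrite eq_sym. Qed.

Lemma q_rvec_neq0 r : q (rvec r) != 0.
Proof. by have := nb_neq 0 r; rewrite /nb add0r. Qed.

Lemma q_shift p (u v : int * int) r : u - v = rvec r -> p + q u <> p + q v.
Proof.
move=> e /addrI /eqP; rewrite -subr_eq0 -raddfB e => /eqP h.
by have := q_rvec_neq0 r; rewrite h eqxx.
Qed.

(** Two edges at p of the same type start at points that differ by the image of a ray, and [q] kills
    no ray because every triangle has three vertices. *)
Lemma eray_inj p : injective (eray p).
Proof.
pose ev r : int * int :=
  match r with R0 | R2 | R4 => 0 | R1 => (1, 1) | R3 => (-1, 0) | R5 => (0, -1) end.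
have evE r : (eray p r).1 = p + q (ev r).
  by case: r; rewrite /= ?raddf0 ?addr0 //; zq.
move=> r s e; have h t := @q_shift p (ev r) (ev s) t.
have {e} [e1 e2] : (eray p r).1 = (eray p s).1 /\ (eray p r).2 = (eray p s).2 by rewrite e.
move: e1; rewrite !evE => e1.
by case: r h e1 e2; case: s => // h e1 _; exfalso;
  solve [exact: (h R0 _ e1) | exact: (h R1 _ e1) | exact: (h R2 _ e1)
  | exact: (h R3 _ e1) | exact: (h R4 _ e1) | exact: (h R5 _ e1)].
Qed.

Lemma tri_inj p : injective (tri p).
Proof.
pose ev r : int * int := match r with R0 | R5 => 0 | R1 => (0, 1) | R2 | R3 => (-1, 0)
  | R4 => (-1, -1) end.
have evE r : (tri p r).1 = p + q (ev r).
  by case: r; rewrite /= ?raddf0 ?addr0 //; zq.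
move=> r s e; have h t := @q_shift p (ev r) (ev s) t.
have {e} [e1 e2] : (tri p r).1 = (tri p s).1 /\ (tri p r).2 = (tri p s).2 by rewrite e.
move: e1; rewrite !evE => e1.
by case: r h e1 e2; case: s => // h e1 _; exfalso;
  solve [exact: (h R0 _ e1) | exact: (h R1 _ e1) | exact: (h R2 _ e1)
  | exact: (h R3 _ e1) | exact: (h R4 _ e1) | exact: (h R5 _ e1)].
Qed.

(** If two rays led to the same vertex, the triangles in their sectors would share two vertices,
    hence an edge, by polyhedrality. In either triangle the only edge with these ends is the one
    along the ray in question, and [eray] is injective. *)
Lemma nb_inj p : injective (nb p).
Proof.
move=> r s e; apply: contrapT => rs.
have [||[f]] := (proj2 poly) (tri p r) (tri p s); first by apply/eqP => /tri_inj.
  rewrite leqNgt => /negP []; apply: (@leq_trans #|[set p; nb p r]|).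
    by rewrite cards2 eq_sym nb_neq.
  apply: subset_leq_card; apply/fintype.subsetP => x.
  by rewrite !tri_vertices !inE => /orP [] /eqP ->; rewrite ?e ?eqxx ?orbT.
rewrite finset.inE => /andP [fr fs] fe.
have pf : p \in edge_ends q f by rewrite -fe !tri_vertices !inE eqxx.
have nf : nb p r \in edge_ends q f by rewrite -fe !tri_vertices !inE e eqxx !orbT.
have key t : nb p t \in edge_ends q f -> f \in triangle_edges q (tri p t) -> f = eray p t.
  have [d1 d2 d3] := tri_distinct p t.
  move=> nt; rewrite tri_edges !inE => /orP [/orP [] /eqP fE|/eqP fE] //; exfalso.
    by move: nt; rewrite fE edge_ends_eray !inE (negbTE (nb_neq _ _)) (negbTE d2).
  move: pf; rewrite fE edge_ends_eray !inE (negbTE d1) /=.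
  have -> : nb (nb p t) (rnext (rnext t)) = nb p (rnext t) by rewrite /nb; case: (t); zq.
  by rewrite (negbTE d3).
apply: rs; apply: (@eray_inj p); rewrite -(key r) // -(key s) //; by rewrite -e.
Qed.

End TorusCells.

(** The cell of a face as seen from its vertex in direction r; from there the old base vertex lies
    in direction [ropp r]. *)
Definition rebase (r : ray) (c : cell) : cell :=
  match c with
  | CV => CV
  | CE _ => CE (ropp r)
  | CT s => if s == r then CT (rnext (rnext r)) else CT (ropp r)
  end.

Definition compat (c : cell) (r : ray) := has (fun d => subcell c d && (r \in crays d)) cells.

Section Cells.
Variables (G : finZmodType) (q : {additive (int * int)%type -> G}).
Hypothesis poly : polyhedral q.
Local Notation nb := (nb q).

Definition cset (p : G) (c : cell) : {set G} :=
  [set x | (x == p) || has (fun r => x == nb p r) (crays c)].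

Lemma mem_cset_base p c : p \in cset p c.
Proof. by rewrite inE eqxx. Qed.

Lemma mem_cset_nb p c r : (nb p r \in cset p c) = (r \in crays c).
Proof.
rewrite inE (negbTE (nb_neq poly _ _)) /=; apply/hasP/idP => [[s sc /eqP /(nb_inj poly) ->]|rc] //.
by exists r.
Qed.

Lemma mem_cset p c x : x \in cset p c -> x = p \/ exists2 r, r \in crays c & x = nb p r.
Proof. by rewrite inE => /predU1P [|/hasP [r rc /eqP ->]]; [left | right; exists r]. Qed.

Lemma cset_CT p r : cset p (CT r) = triangle_vertices q (tri q p r).
Proof. by rewrite tri_vertices; apply/setP => x; rewrite !inE /= orbF orbA. Qed.

Lemma subcellP (c d : cell) :
  reflect {subset crays c <= crays d} (subcell c d).
Proof. exact: allP. Qed.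

Lemma cset_sub p c d : (cset p c \subset cset p d) = subcell c d.
Proof.
apply/fintype.subsetP/subcellP => h.
  by move=> r rc; rewrite -(mem_cset_nb p) h // mem_cset_nb.
move=> x /mem_cset [->|[r rc ->]]; first exact: mem_cset_base.
by rewrite mem_cset_nb h.
Qed.

Lemma subcell_anti c d : subcell c d -> subcell d c -> c = d.
Proof. by case: c => [|[]|[]]; case: d => [|[]|[]]. Qed.

Lemma cset_inj p : injective (cset p).
Proof. by move=> c d e; apply: subcell_anti; rewrite -(cset_sub p) e. Qed.

Lemma cset_face p c : face q (cset p c).
Proof.
have [r rc] : exists r, subcell c (CT r) by case: c => [|r|r]; [exists R0 | exists r; case: r | exists r; case: r].
by apply/existsP; exists (tri q p r); rewrite -cset_CT cset_sub.
Qed.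

Lemma face_cset (f : {set G}) p : face q f -> p \in f -> exists c, f = cset p c.
Proof.
move=> /existsP [t ft] pf.
have [r rE] := tri_ex (fintype.subsetP ft p pf); move: ft; rewrite rE -cset_CT => fr.
have rr : r != rnext r by case: (r).
exists (if nb p r \in f then if nb p (rnext r) \in f then CT r else CE r
  else if nb p (rnext r) \in f then CE (rnext r) else CV).
apply/setP => x; case: (boolP (x \in cset p (CT r))) => [/mem_cset [->|[s sr ->]]|xr].
- rewrite pf; symmetry; case: ifP => _; case: ifP => _; exact: mem_cset_base.
- have /orP [] : (s == r) || (s == rnext r) by move: sr; rewrite /= !inE.
    move=> /eqP ->; case: ifP => _; case: ifP => _; rewrite mem_cset_nb /= ?inE ?eqxx //.
    by rewrite (negbTE rr).
  move=> /eqP ->; case: ifP => _; case: ifP => _; rewrite mem_cset_nb /= ?inE ?eqxx ?orbT //.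
  by rewrite eq_sym (negbTE rr).
- transitivity false; first by apply: contraNF xr; apply: (fintype.subsetP fr).
  symmetry; apply: contraNF xr; apply: fintype.subsetP; rewrite cset_sub.
  by case: ifP => _; case: ifP => _; case: (r).
Qed.

(** The key seals two searches. The values of [cellof] are meaningful at a vertex of a face, those
    of [dir] for two vertices of a common face; elsewhere they are defaults. *)
Fact face_key : unit. Proof. by []. Qed.
Definition cellof : {set G} -> G -> cell := locked_with face_key
  (fun f p => nth CV cells (find (fun c => f == cset p c) cells)).

Lemma cellofP (f : {set G}) p : face q f -> p \in f -> cset p (cellof f p) = f.
Proof.
move=> ff pf; have [c cE] := face_cset ff pf.
have h : has (fun c => f == cset p c) cells by apply/hasP; exists c; rewrite ?mem_cells ?cE.
by have /eqP := nth_find CV h; rewrite /cellof unlock.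
Qed.

Lemma cellof_cset p c : cellof (cset p c) p = c.
Proof. by apply: (@cset_inj p); apply: cellofP (cset_face p c) (mem_cset_base p c). Qed.

Lemma cellof_sub (f g : {set G}) p : face q f -> face q g -> p \in f -> f \subset g ->
  subcell (cellof f p) (cellof g p).
Proof.
move=> ff fg pf sfg; have pg := fintype.subsetP sfg p pf.
have key c d : cset p c = f -> cset p d = g -> subcell c d.
  by move=> cf dg; rewrite -(cset_sub p) cf dg.
exact: key (cellofP ff pf) (cellofP fg pg).
Qed.

Definition dir : G -> G -> int * int := locked_with face_key
  (fun p x => if x == p then 0 else rvec (nth R0 rays (find (fun r => x == nb p r) rays))).

Lemma dir0 p : dir p p = 0.
Proof. by rewrite /dir unlock eqxx. Qed.

Lemma dir_nb p r : dir p (nb p r) = rvec r.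
Proof.
rewrite /dir unlock (negbTE (nb_neq poly _ _)); congr rvec; apply/esym/(@nb_inj _ _ poly p).
have h : has (fun s => nb p r == nb p s) rays by apply/hasP; exists r; rewrite ?mem_rays.
by have /eqP := nth_find R0 h.
Qed.

Lemma cset_rebase p c r : r \in crays c -> cset p c = cset (nb p r) (rebase r c).
Proof.
have e s t : rvec s + rvec t = 0 -> nb (nb p s) t = p.
  by move=> h; rewrite /nb -addrA -raddfD h raddf0 addr0.
have e' s t u : rvec s + rvec t = rvec u -> nb (nb p s) t = nb p u.
  by move=> h; rewrite /nb -addrA -raddfD h.
case: c => [|s|s] //; rewrite /= !inE.
  move=> /eqP ->; apply/setP => x; rewrite !inE /= !orbF.
  by rewrite orbC e //; case: (s).
case: eqVneq => [->|rs] /=.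
  move=> _; apply/setP => x; rewrite !inE /= !orbF.
  rewrite [nb (nb p s) (rnext (rnext s))](e' _ _ (rnext s)); last by case: (s).
  rewrite [nb (nb p s) _](e _ (rnext (rnext (rnext s)))); last by case: (s).
  by case: (x == p); case: (x == nb p s); case: (x == _).
move=> /eqP rE; rewrite rE.
apply/setP => x; rewrite !inE /= !orbF.
rewrite [nb (nb p (rnext s)) (ropp _)]e; last by case: (s).
rewrite [nb (nb p (rnext s)) (rnext _)](e' _ _ s); last by case: (s).
by case: (x == p); case: (x == nb p s); case: (x == _).
Qed.

Lemma cellof_rebase f p r : face q f -> p \in f -> r \in crays (cellof f p) ->
  cellof f (nb p r) = rebase r (cellof f p).
Proof.
move=> ff pf rc; rewrite -{1}(cellofP ff pf) (cset_rebase _ rc).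
exact: cellof_cset.
Qed.

Lemma mem_face_nb f p x : face q f -> p \in f -> x \in f ->
  x = p \/ exists2 r, r \in crays (cellof f p) & x = nb p r.
Proof. by move=> ff pf; rewrite -{1}(cellofP ff pf); apply: mem_cset. Qed.

(** Inside one triangle the difference of two directions is again a ray, so the vertices of a face
    lift consistently to Z^2. *)
Lemma dir_add f p x y : face q f -> p \in f -> x \in f -> y \in f ->
  dir p x + dir x y = dir p y.
Proof.
move=> ff pf xf yf; have [->|[r rc xE]] := mem_face_nb ff pf xf.
  by rewrite dir0 add0r.
have e s t u : rvec s + rvec t = rvec u -> nb (nb p s) t = nb p u.
  by move=> h; rewrite /nb -addrA -raddfD h.
have e0 s : nb (nb p s) (ropp s) = p.
  by rewrite /nb -addrA -raddfD; case: (s); rewrite raddf0 addr0.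
have [->|[s sc yE]] := mem_face_nb ff pf yf.
  by rewrite dir0 xE dir_nb -[X in dir _ X](e0 r) dir_nb; case: (r).
case: (eqVneq r s) => [rs|rs]; first by rewrite xE yE rs dir0 addr0.
rewrite xE yE dir_nb.
suff [t tE] : exists t, rvec r + rvec t = rvec s by rewrite -(e _ _ _ tE) !dir_nb // tE (e _ _ _ tE) dir_nb.
move: rc sc rs; case: (cellof f p) => [|c|c] //=; rewrite !inE.
  by move=> /eqP -> /eqP ->; rewrite eqxx.
move=> /orP [] /eqP -> /orP [] /eqP ->; rewrite ?eqxx // => _.
  by exists (rnext (rnext c)); case: (c).
by exists (rprev c); case: (c).
Qed.

Lemma star_nb f p x : face q f -> p \in f ->
  face q (x |: f) <-> x = p \/ exists2 r, compat (cellof f p) r & x = nb p r.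
Proof.
move=> ff pf; split=> [fx|[->|[r /hasP [d _ /andP [cd rd]] ->]]].
- have px : p \in x |: f by rewrite !inE pf orbT.
  have [->|[r rc xE]] := mem_face_nb fx px (setU11 _ _); [by left|right].
  exists r => //; apply/hasP; exists (cellof (x |: f) p); first exact: mem_cells.
  by rewrite rc andbT; apply: cellof_sub => //; apply: finset.subsetUr.
- by have -> : p |: f = f by apply/finset.setUidPr; rewrite finset.sub1set.
- have /existsP [t ht] := cset_face p d; apply/existsP; exists t.
  apply: fintype.subset_trans ht; rewrite finset.subUset finset.sub1set mem_cset_nb rd /=.
  by rewrite -(cellofP ff pf) cset_sub.
Qed.

End Cells.

(** * The cocycle at a vertex *)

(** The quadruple of the n-th power of the single parameter at r, see [tm_kink]. *)
Definition kink (r : ray) (n : int) : expo :=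
  match r with
  | R0 | R3 => (if r == R0 then n else 0, (n, (0, 0)))
  | R2 | R5 => (if r == R2 then n else 0, (0, (n, 0)))
  | R4 | R1 => (if r == R4 then n else 0, (0, (0, n)))
  end.

Lemma tm_kink (B : comNzRingType) (w : ray -> B) r n : 0 <= n -> tm w (kink r n) = w r ^+ `|n|%N.
Proof. by case: n => // n _; rewrite -tm_ray; case: r. Qed.

Lemma phi_CE_delta r u v : phi (CE r) u + phi (CE r) v - phi (CE r) (u + v) =
  kink r (ipos (rdet r u) + ipos (rdet r v) - ipos (rdet r (u + v))).
Proof.
case: u v => [x y] [z w].
case: r; rewrite /rdet /= /ipos; repeat congr pair; rewrite /=; lia.
Qed.

Lemma phi_CT_delta r u v : phi (CT r) u + phi (CT r) v - phi (CT r) (u + v) = 0.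
Proof.
case: u v => [x y] [z w].
by case: r; rewrite /=; repeat congr pair; rewrite /=; lia.
Qed.

Lemma phi_CE_CT r u : phi (CE r) u - phi (CT r) u = kink r (ipos (- rdet r u)).
Proof. by case: u => [x y]; case: r; rewrite /rdet /= /ipos; repeat congr pair; rewrite /=; lia. Qed.

Lemma phi_CE_CTp r u : phi (CE r) u - phi (CT (rprev r)) u = kink r (ipos (rdet r u)).
Proof. by case: u => [x y]; case: r; rewrite /rdet /= /ipos; repeat congr pair; rewrite /=; lia. Qed.

Lemma pair_mulrz (v : int * int) (k : int) : v *~ k = (v.1 * k, v.2 * k).
Proof. by rewrite [LHS]surjective_pairing (raddfMz fst) (raddfMz snd) /= !mulrzz. Qed.

Lemma rdet_opp r u (n : int) : rdet (ropp r) (u - rvec r *~ n) = - rdet r u.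
Proof.
case: u => [x y]; rewrite pair_mulrz; case: r; rewrite /rdet /=; lia.
Qed.

Lemma rdetD r u v : rdet r (u + v) = rdet r u + rdet r v.
Proof. by case: u v => [x y] [z w]; case: r; rewrite /rdet /=; lia. Qed.

Lemma cocycle_cancel (V : zmodType) (a b d x y z : V) :
  (a + b - x) + (x + d - z) = (b + d - y) + (a + y - z).
Proof.
have e (u v w : V) : (u - w) + (w + v) = u + v by rewrite addrA subrK.
rewrite -(addrA x) e [a + y]addrC -(addrA y) e.
by rewrite [a + b]addrC addrACA.
Qed.

Lemma expo_validD e f : expo_valid e -> expo_valid f -> expo_valid (e + f).
Proof.
case: e f => [i [x [y z]]] [j [x' [y' z']]] /and5P /= [h1 h2 h3 h4 h5] /and5P /= [g1 g2 g3 g4 g5].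
by apply/and5P; split; rewrite /=; lia.
Qed.

Section VertexCocycle.
Variables (G : finZmodType) (q : {additive (int * int)%type -> G}).
Hypothesis poly : polyhedral q.
Variables (B : comNzRingType) (t : edge G -> B).
Local Notation tau := (tau q).
Local Notation nb := (nb q).
Local Notation W := (int * (int * int))%type.

Definition minor_relations := forall (p : G) (a b : 'I_3),
  t (p, a) * t (p - tau b, b) = t (p, b) * t (p - tau a, a).
Hypothesis tmin : minor_relations.

Definition wt (p : G) (r : ray) : B := t (eray q p r).

Lemma wt_minors p : hexagon_minors (wt p).
Proof. by split; apply: tmin. Qed.

(** [cst] is the formal coboundary of the piecewise linear function [phi c] with the parameters at p
    substituted, and [psi] is the substituted difference of two such functions. The cocycle
    identities are thus identities between quadruples, transported by [tmD]. *)
Fact cst_key : unit. Proof. by []. Qed.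
Definition cst : G -> cell -> W -> W -> B := locked_with cst_key
  (fun p c a b => tm (wt p) (phi c a.2 + phi c b.2 - phi c (a.2 + b.2))).
Definition psi : G -> cell -> cell -> W -> B := locked_with cst_key
  (fun p c d a => tm (wt p) (phi c a.2 - phi d a.2)).

Lemma cstE p c a b : cst p c a b = tm (wt p) (phi c a.2 + phi c b.2 - phi c (a.2 + b.2)).
Proof. by rewrite /cst unlock. Qed.

Lemma psiE p c d a : psi p c d a = tm (wt p) (phi c a.2 - phi d a.2).
Proof. by rewrite /psi unlock. Qed.

Lemma cstC p c a b : cst p c a b = cst p c b a.
Proof. by rewrite !cstE [phi c _ + phi c _]addrC [a.2 + _]addrC. Qed.

Lemma cst0 p c a : cst p c 0 a = 1.
Proof. by rewrite !cstE phi0 !add0r subrr tm0. Qed.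

Lemma cstA p c a b d : cst p c a b * cst p c (a + b) d = cst p c b d * cst p c a (b + d).
Proof.
have wm := wt_minors p; rewrite !cstE -!(tmD wm) ?phi_convex //; congr tm.
have -> : a.2 + (b + d).2 = (a + b).2 + d.2 by rewrite /= addrA.
exact: cocycle_cancel.
Qed.

Definition vcoc p c := Cocycle (cstC p c) (cstA p c) (cst0 p c).

Lemma psi0 p c d : psi p c d 0 = 1.
Proof. by rewrite !psiE !phi0 subrr tm0. Qed.

Lemma psi_id p c a : psi p c c a = 1.
Proof. by rewrite !psiE subrr tm0. Qed.

Lemma psi_comp p c d e a : subcell c d -> subcell d e ->
  psi p c d a * psi p d e a = psi p c e a.
Proof.
move=> cd de; have wm := wt_minors p.
by rewrite !psiE -(tmD wm) ?phi_mono // addrA subrK.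
Qed.

Lemma psi_cst p c d a b : subcell c d ->
  cst p c a b * psi p c d (a + b) = psi p c d a * psi p c d b * cst p d a b.
Proof.
move=> cd; have wm := wt_minors p.
have va u := phi_mono u cd.
rewrite !psiE !cstE -(tmD wm (va a.2) (va b.2)) -(tmD wm (phi_convex _ _ _) (va _)).
rewrite -(tmD wm (expo_validD (va _) (va _)) (phi_convex _ _ _)); congr tm.
by rewrite addrA subrK [X in _ = X + _]addrACA -opprD addrA subrK.
Qed.

Lemma wt_opp p r : wt (nb p r) (ropp r) = wt p r.
Proof.
congr t; rewrite /nb q_rvec.
by case: r; rewrite /= ?subrK ?addrK ?opprK.
Qed.

(** A weight (d, u) at a base vertex b means x_b^d times the character u. Written with the vertex in
    direction m in place of b it becomes (d, u - d m). *)
Definition shift (m : int * int) (a : W) : W := (a.1, a.2 - m *~ a.1).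

Lemma shift_additive m : zmod_morphism (shift m).
Proof.
move=> a b; rewrite /shift /= mulrzBr; congr pair => /=.
by rewrite opprB [in RHS]opprB [X in _ + X = _]addrC addrACA [X in _ + X = _]addrC.
Qed.
HB.instance Definition _ m := GRing.isZmodMorphism.Build W W (shift m) (shift_additive m).

Lemma shift0 a : shift 0 a = a.
Proof. by case: a => d u; rewrite /shift /= mul0rz subr0. Qed.

Lemma shift_comp m n a : shift n (shift m a) = shift (m + n) a.
Proof. by rewrite /shift /= mulrzDl opprD addrA. Qed.

Lemma rebase_CT r s : r \in crays (CT s) -> rebase r (CT s) =
  if s == r then CT (rprev (ropp r)) else CT (ropp r).
Proof. by case: r; case: s. Qed.

(** Along an edge only the bend at this edge is left, and ipos z + ipos w - ipos (z + w) is
    invariant under a common change of sign; along a triangle there is no bend. Both ends of an edge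
    see the same parameter by [wt_opp]. *)
Lemma cst_rebase p c r a b : r \in crays c ->
  cst p c a b = cst (nb p r) (rebase r c) (shift (rvec r) a) (shift (rvec r) b).
Proof.
case: c => [|s|s] //; last first.
  move=> rs; rewrite rebase_CT // !cstE phi_CT_delta tm0.
  by case: ifP => _; rewrite phi_CT_delta tm0.
rewrite inE => /eqP ->; rewrite [rebase _ _]/= !cstE !phi_CE_delta.
have rs x : rdet (ropp s) (shift (rvec s) x).2 = - rdet s x.2 by rewrite rdet_opp.
have pos (z w : int) : 0 <= ipos z + ipos w - ipos (z + w) by rewrite /ipos; lia.
rewrite [rdet s (_ + _)]rdetD [rdet (ropp s) (_ + _)]rdetD !tm_kink // wt_opp !rs; congr (_ ^+ `|_|%N).
move: (rdet s a.2) (rdet s b.2) => z w; rewrite /ipos; lia.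
Qed.

Lemma psi_rebase p c d r a : r \in crays c -> subcell c d ->
  psi p c d a = psi (nb p r) (rebase r c) (rebase r d) (shift (rvec r) a).
Proof.
case: (eqVneq c d) => [->|cd]; first by rewrite !psi_id.
case: c cd => [|s|s] // cd; last first.
  by case: d cd => [|u|u] //; case: s => //; case: u.
rewrite inE => /eqP ->; case: d cd => [|u|u] // cd; first by move: cd; case: s; case: u.
move=> su; have rs : rdet (ropp s) (shift (rvec s) a).2 = - rdet s a.2 by rewrite rdet_opp.
have pos (z : int) : 0 <= ipos z by rewrite /ipos; lia.
have [->|us] : u = s \/ u = rprev s by case: (s) su; case: (u) => //; auto.
  rewrite /= eqxx; have -> : CT (rnext (rnext s)) = CT (rprev (ropp s)) by case: (s).
  by rewrite !psiE phi_CE_CT phi_CE_CTp rs !tm_kink // wt_opp.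
rewrite /= (_ : (u == s) = false); last by rewrite us; case: (s).
by rewrite us !psiE phi_CE_CT phi_CE_CTp rs opprK !tm_kink // wt_opp.
Qed.

Variables (f g : {set G}).
Hypotheses (ff : face q f) (fg : face q g).

Lemma cst_dir p x a b : p \in g -> x \in g ->
  cst p (cellof q g p) a b =
  cst x (cellof q g x) (shift (dir q p x) a) (shift (dir q p x) b).
Proof.
move=> pg xg; have [->|[r rc ->]] := mem_face_nb poly fg pg xg.
  by rewrite dir0 !shift0.
rewrite (dir_nb poly) (cellof_rebase poly fg pg rc); exact: cst_rebase.
Qed.

Lemma psi_dir p x a : f \subset g -> p \in f -> x \in f ->
  psi p (cellof q f p) (cellof q g p) a =
  psi x (cellof q f x) (cellof q g x) (shift (dir q p x) a).
Proof.
move=> sfg pf xf; have pg := fintype.subsetP sfg p pf.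
have cfg := cellof_sub poly ff fg pf sfg.
have [->|[r rc ->]] := mem_face_nb poly ff pf xf; first by rewrite dir0 shift0.
have rg : r \in crays (cellof q g p) by move/subcellP: cfg; apply.
rewrite (dir_nb poly) (cellof_rebase poly ff pf rc) (cellof_rebase poly fg pg rg).
exact: psi_rebase.
Qed.

End VertexCocycle.

(** * Maximal cones and the flag property of the fan *)

Definition cone (r : ray) (u : int * int) : bool := (0 <= rdet r u) && (rdet (rnext r) u <= 0).

Lemma coneD r u v : cone r u -> cone r v -> cone r (u + v).
Proof. by move=> /andP [h1 h2] /andP [h3 h4]; rewrite /cone !rdetD; lia. Qed.

Lemma cone0 r : cone r 0. Proof. by case: r. Qed.

Lemma cone_ray r s : s \in crays (CT r) -> cone r (rvec s).
Proof. by case: r; case: s. Qed.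

Lemma phi_cone c r u : subcell c (CT r) -> cone r u -> phi c u = phi (CT r) u.
Proof.
case: u => [x y] sc; rewrite /cone => /andP [].
by case: c sc => [|[]|[]]; case: r => // _; rewrite /rdet /= /hpos /ipos => h1 h2;
  repeat congr pair; lia.
Qed.

Lemma phi_compat c d r : compat d r -> subcell c d -> phi c (rvec r) = phi d (rvec r).
Proof. by case: c => [|[]|[]]; case: d => [|[]|[]]; case: r. Qed.

Lemma phi_incompat c d r : compat c r -> subcell c d -> ~~ compat d r ->
  phi c (rvec r) - phi d (rvec r) != 0.
Proof. by case: c => [|[]|[]]; case: d => [|[]|[]]; case: r. Qed.

Definition common (c : cell) (r s : ray) :=
  has (fun d => [&& subcell c d, r \in crays d & s \in crays d]) cells.

Lemma phi_uncommon c r s : compat c r -> compat c s -> ~~ common c r s ->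
  phi c (rvec r) + phi c (rvec s) - phi c (rvec r + rvec s) != 0.
Proof. by case: c => [|[]|[]]; case: r; case: s. Qed.

Lemma phi_along c r u : r \in crays c -> phi c u + phi c (rvec r) - phi c (u + rvec r) = 0.
Proof.
case: u => [x y]; case: c => [|[]|[]]; case: r => // _; rewrite /= /hpos /ipos;
  repeat congr pair; rewrite /=; lia.
Qed.

(** A finite check that links are flag complexes. It reduces a monomial that is not supported on a
    face to two variables without a common cell. *)
Lemma common_flag c (D : ray -> bool) : (forall r, D r -> compat c r) ->
  (forall r s, D r -> D s -> common c r s) ->
  exists d, subcell c (CT d) /\ forall r, D r -> r \in crays (CT d).
Proof.
move=> h1 h2.
have : has (fun d => subcell c (CT d) && all (fun r => D r ==> (r \in crays (CT d))) rays) rays.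
  have k1 : all (fun r => D r ==> compat c r) rays by apply/allP => r _; apply/implyP/h1.
  have k2 : all (fun r => all (fun s => D r ==> D s ==> common c r s) rays) rays.
    by apply/allP => r _; apply/allP => s _; apply/implyP => Dr; apply/implyP; apply: h2.
  move: k1 k2; rewrite /=.
  case: (D R0); case: (D R1); case: (D R2); case: (D R3); case: (D R4); case: (D R5);
    by case: c {h1 h2} => [|[]|[]].
move=> /hasP [d _ /andP [cd /allP h]]; exists d; split=> // r Dr.
by have /implyP := h r (mem_rays r); apply.
Qed.

(** The Courant function of r: piecewise linear on the fan, 1 at [rvec r] and 0 at the other rays.
    It recovers the exponents of a monomial from its weight. *)
Definition rcoef (r : ray) (u : int * int) : int :=
  Num.max 0 (Num.min (rdet (rprev r) u) (- rdet (rnext r) u)).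

Lemma rcoef_cone d r (i j : int) : 0 <= i -> 0 <= j ->
  rcoef r (rvec d *~ i + rvec (rnext d) *~ j) =
  if r == d then i else if r == rnext d then j else 0.
Proof.
by move=> i0 j0; rewrite !pair_mulrz; case: d; case: r; rewrite /rcoef /rdet /=; lia.
Qed.

Lemma cone_decomp r u : cone r u ->
  u = rvec r *~ (- rdet (rnext r) u) + rvec (rnext r) *~ (rdet r u).
Proof.
by case: u => [x y] _; rewrite !pair_mulrz; case: r; rewrite /rdet /=; congr pair; rewrite /=; lia.
Qed.

Lemma cone_cover u : exists r, cone r u.
Proof.
case: u => [x y]; have : [|| cone R0 (x, y), cone R1 (x, y), cone R2 (x, y),
    cone R3 (x, y), cone R4 (x, y) | cone R5 (x, y)].
  by rewrite /cone /rdet /=; lia.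
by case/or4P => [||| /or3P []]; [exists R0|exists R1|exists R2|exists R3|exists R4|exists R5].
Qed.

Lemma rdet_pair r s u (n : nat) :
  rdet r (u + rvec s *+ n) = rdet r u + rdet r (rvec s) * n%:Z.
Proof. by rewrite pmulrn pair_mulrz; case: u => [x y]; rewrite /rdet /=; ring. Qed.

(** The shift corresponds to multiplying by the invertible coordinates of the face; it reduces the
    weights of a chart to those of monomials. *)
Lemma cone_shift c u : exists (r : ray) (N : nat), subcell c (CT r) /\
  forall n, (N <= n)%N -> cone r (u + (\sum_(s <- crays c) rvec s) *+ n).
Proof.
case: c => [|s|s].
- have [r hr] := cone_cover u; exists r, 0%N; split=> // n _.
  by rewrite big_nil mul0rn addr0.
- case: (lerP 0 (rdet s u)) => h.
    exists s, `|rdet (rnext s) u|%N; split=> [|n hn]; first by case: (s).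
    rewrite big_seq1 /cone !rdet_pair; move: h hn; move: (rdet s u) (rdet (rnext s) u).
    by case: s => a b; rewrite /rdet /=; lia.
  exists (rprev s), `|rdet (rprev s) u|%N; split=> [|n hn]; first by case: (s).
  rewrite big_seq1 /cone !rdet_pair; have -> : rnext (rprev s) = s by case: (s).
  move: h hn; move: (rdet s u) (rdet (rprev s) u).
  by case: s => a b; rewrite /rdet /=; lia.
- exists s, (`|rdet s u| + `|rdet (rnext s) u|)%N; split=> [|n hn]; first by case: (s).
  rewrite big_cons big_seq1 mulrnDl addrA /cone !rdet_pair; move: hn.
  by move: (rdet s u) (rdet (rnext s) u); case: s => a b; rewrite /rdet /=; lia.
Qed.

(** * Calculus modulo the maximal ideal and evaluation of polynomials *)

Section MaxMul.
Variables (R : comNzRingType) (M : lmodType R).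
Implicit Types (x y : M).

Lemma max_mul0 : max_mul (0 : M).
Proof. by exists 0%N, (fun=> 0), (fun=> 0); split=> [[]|] //; rewrite big_ord0. Qed.

Lemma max_mulD x y : max_mul x -> max_mul y -> max_mul (x + y).
Proof.
move=> [k [a [g [Sg ->]]]] [l [b [h [Sh ->]]]].
exists (k + l)%N, (fun i => match split i with inl j => a j | inr j => b j end),
  (fun i => match split i with inl j => g j | inr j => h j end).
split=> [i|]; first by case: (split i).
rewrite big_split_ord /=; congr (_ + _); apply: eq_bigr => i _.
  by rewrite (unsplitK (inl i)).
by rewrite (unsplitK (inr i)).
Qed.

Lemma max_mulZ (b : R) x : max_mul x -> max_mul (b *: x).
Proof.
move=> [k [a [g [Sg ->]]]]; exists k, a, (fun i => b *: g i); split=> //.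
by rewrite scaler_sumr; apply: eq_bigr => i _; rewrite !scalerA mulrC.
Qed.

Lemma max_mulN x : max_mul x -> max_mul (- x).
Proof. by move=> h; rewrite -scaleN1r; apply: max_mulZ. Qed.

Lemma max_mulB x y : max_mul x -> max_mul y -> max_mul (x - y).
Proof. by move=> hx hy; apply: max_mulD => //; apply: max_mulN. Qed.

Lemma max_mul_nonunit (r : R) x : nonunit r -> max_mul (r *: x).
Proof. by move=> h; exists 1%N, (fun=> r), (fun=> x); rewrite big_ord1. Qed.

Lemma max_mul_sum (I : Type) (s : seq I) (P : pred I) (F : I -> M) :
  (forall i, P i -> max_mul (F i)) -> max_mul (\sum_(i <- s | P i) F i).
Proof.
move=> h; elim/big_rec: _ => [|i x Pi hx]; first exact: max_mul0.
by apply: max_mulD => //; apply: h.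
Qed.
End MaxMul.

Lemma max_mul_map (R R' : comNzRingType) (M : lmodType R) (M' : lmodType R')
    (f : M -> M') (g : R -> R') :
  (forall x y, f (x + y) = f x + f y) -> (forall r x, f (r *: x) = g r *: f x) ->
  (forall r, nonunit r -> nonunit (g r)) ->
  forall x, max_mul x -> max_mul (f x).
Proof.
move=> fD fZ gn x [k [a [y [an ->]]]].
have f0 : f 0 = 0 by apply: (addrI (f 0)); rewrite -fD !addr0.
have -> : f (\sum_i a i *: y i) = \sum_i f (a i *: y i).
  by elim/big_ind2: _ => // u v u' v' <- <-; rewrite fD.
by apply: max_mul_sum => i _; rewrite fZ; apply: max_mul_nonunit; apply: gn.
Qed.

Lemma max_mul_mul (R : comNzRingType) (E : comAlgType R) (x y : E) :
  max_mul x -> max_mul (x * y).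
Proof.
by apply: (max_mul_map (f := fun z => z * y) (g := id)) => // [u v|r u];
  rewrite ?mulrDl ?scalerAl.
Qed.

Lemma max_mul_mulr (R : comNzRingType) (E : comAlgType R) (x y : E) :
  max_mul y -> max_mul (x * y).
Proof. by rewrite mulrC; apply: max_mul_mul. Qed.

Lemma nonunitM (R : comNzRingType) (r s : R) : nonunit r -> nonunit (r * s).
Proof. by move=> h [u hu]; apply: h; exists (s * u); rewrite mulrA. Qed.

Lemma nonunit0 (R : comNzRingType) : nonunit (0 : R).
Proof. by case=> s /eqP; rewrite mul0r eq_sym oner_eq0. Qed.

Section Ev.
Variables (G : finZmodType) (R B : comNzRingType) (phi : {rmorphism R -> B}).
Variables (E : comAlgType B) (xi : G -> E).
Local Notation ev := (ev phi xi).
Implicit Types (g h : {mpoly R[#|G|]}).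

Definition evm : {rmorphism {mpoly R[#|G|]} -> E} :=
  mmap (in_alg E \o phi) (fun i => xi (enum_val i)).

Lemma evD g h : ev (g + h) = ev g + ev h. Proof. exact: (rmorphD evm). Qed.
Lemma evB g h : ev (g - h) = ev g - ev h. Proof. exact: (rmorphB evm). Qed.
Lemma evM g h : ev (g * h) = ev g * ev h. Proof. exact: (rmorphM evm). Qed.
Lemma ev0 : ev 0 = 0. Proof. exact: (rmorph0 evm). Qed.
Lemma ev1 : ev 1 = 1. Proof. exact: (rmorph1 evm). Qed.
Lemma evXn h n : ev (h ^+ n) = ev h ^+ n. Proof. exact: (rmorphXn evm). Qed.
Lemma ev_sum (I : Type) (s : seq I) (P : pred I) (F : I -> {mpoly R[#|G|]}) :
  ev (\sum_(i <- s | P i) F i) = \sum_(i <- s | P i) ev (F i).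
Proof. exact: (rmorph_sum evm). Qed.
Lemma ev_prod (I : Type) (s : seq I) (P : pred I) (F : I -> {mpoly R[#|G|]}) :
  ev (\prod_(i <- s | P i) F i) = \prod_(i <- s | P i) ev (F i).
Proof. exact: (rmorph_prod evm). Qed.

Lemma evC c : ev c%:MP = (phi c)%:A.
Proof. exact: (mmapC _ (in_alg E \o phi)). Qed.

Lemma evZ c h : ev (c *: h) = phi c *: ev h.
Proof. by rewrite -mul_mpolyC evM evC mulr_algl. Qed.

Lemma ev_X m : ev 'X_[m] = mmap1 (fun i => xi (enum_val i)) m.
Proof. exact: (mmapX _ (in_alg E \o phi)). Qed.

Lemma ev_xvar p : ev (xvar R p) = xi p.
Proof. by rewrite ev_X mmap1U enum_rankK. Qed.

Lemma ev_xmon (m : {set G}) : ev (xmon R m) = \prod_(p in m) xi p.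
Proof. by rewrite ev_prod; apply: eq_bigr => p _; rewrite ev_xvar. Qed.

Lemma ev_mon (m : 'X_{1..#|G|}) : ev 'X_[m] = \prod_p xi p ^+ m (enum_rank p).
Proof.
rewrite ev_X /mmap1 (reindex_onto enum_rank enum_val) /=; last first.
  by move=> i _; rewrite enum_valK.
by apply: eq_big => [p|p _]; rewrite enum_rankK ?eqxx.
Qed.

Lemma evE h : ev h = \sum_(m <- msupp h) phi h@_m *: \prod_p xi p ^+ m (enum_rank p).
Proof.
rewrite {1}[h]mpolyE ev_sum; apply: eq_bigr => m _.
by rewrite evZ ev_mon.
Qed.

End Ev.

Lemma ev_comp (G : finZmodType) (R B : comNzRingType) (phi : {rmorphism R -> B})
    (E : comAlgType B) (xi : G -> E) (h : {mpoly R[#|G|]}) :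
  ev idfun xi (map_mpoly phi h) = ev phi xi h.
Proof.
rewrite [h in RHS]mpolyE [h in LHS]mpolyE raddf_sum.
rewrite (ev_sum (idfun : {rmorphism B -> B})) (ev_sum phi); apply: eq_bigr => m _ /=.
rewrite evZ -[_ *: _]mul_mpolyC rmorphM /= map_mpolyC mul_mpolyC map_mpolyX.
by rewrite (evZ (idfun : {rmorphism B -> B})) !ev_mon.
Qed.

Lemma ev_push (G : finZmodType) (R B B' : comNzRingType) (phi : {rmorphism R -> B})
    (pi : B -> B') (E : comAlgType B) (E' : comAlgType B') (u : E -> E') (xi : G -> E)
    (h : {mpoly R[#|G|]}) :
  (forall x y, u (x + y) = u x + u y) -> (forall x y, u (x * y) = u x * u y) ->
  u 1 = 1 -> (forall b x, u (b *: x) = pi b *: u x) ->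
  u (ev phi xi h) = ev (fun r => pi (phi r)) (fun p => u (xi p)) h.
Proof.
move=> uD uM u1 uZ.
have u0 : u 0 = 0 by apply: (addrI (u 0)); rewrite -uD !addr0.
rewrite /ev /mmap; elim/big_rec2: _ => // m x y _ <-; rewrite uD; congr (_ + _).
rewrite uM uZ u1; congr (_ * _); rewrite /mmap1.
elim/big_rec2: _ => // i a b _ <-; rewrite uM; congr (_ * _).
by elim: (m i) => [|k IH]; rewrite ?expr0 // !exprS uM IH.
Qed.

(** * Toric deformations *)

(** A nonzero valid quadruple has a positive exponent at some ray. Absorbing sets cover both
    applications, to the nonunits and to zero. *)
Lemma tm_absorb (B : comNzRingType) (w : ray -> B) e (I : B -> Prop) :
  (forall a b, I a -> I (a * b)) -> (forall r, I (w r)) -> expo_valid e -> e != 0 -> I (tm w e).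
Proof.
case: e => [i [x [y z]]] hI hw /and5P /= [h1 h2 h3 h4 h5] e0.
have hX r n : (0 < n)%N -> I (w r ^+ n).
  by case: n => // n _; rewrite exprS; apply: (hI _ _ (hw r)).
have hMl (a b : B) : I a -> I (a * b) by apply: hI.
have hMr (a b : B) : I b -> I (a * b) by rewrite mulrC; apply: hI.
rewrite /tm /hexp /hmon /=.
set i0 := minn `|i|%N `|x|%N; set i1 := minn _ `|y|%N; set i2 := minn _ `|z|%N.
have : [|| (0 < i0)%N, (0 < `|x| - i0)%N, (0 < i1)%N, (0 < `|y| - i1)%N,
   (0 < i2)%N | (0 < `|z| - i2)%N].
  apply/negPn/negP; rewrite !negb_or -!eqn0Ngt => /and5P [a1 a2 a3 a4 /andP [a5 a6]].
  have xyz : [/\ x = 0, y = 0 & z = 0] by split; lia.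
  by case: xyz h5 e0 => -> -> -> h5; have -> : i = 0 by lia.
case/or4P => [h|h|h|/or3P [h|h|h]].
- by apply/hMl/hMl/hMl/hX.
- by apply/hMl/hMl/hMr/hX.
- by apply/hMl/hMr/hMl/hX.
- by apply/hMl/hMr/hMr/hX.
- by apply/hMr/hMl/hX.
- by apply/hMr/hMr/hX.
Qed.

Lemma tm_nonunit (B : comNzRingType) (w : ray -> B) e : (forall r, nonunit (w r)) ->
  expo_valid e -> e != 0 -> nonunit (tm w e).
Proof. by apply: tm_absorb => a b; apply: nonunitM. Qed.

(** A chart is written from one vertex of its face, chosen once and sealed; [tth] and [tps] account
    for the choices. *)
Fact bpt_key : unit. Proof. by []. Qed.
Definition bpt (G : finZmodType) : {set G} -> G := locked_with bpt_key
  (fun f => odflt 0 [pick p in f]).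

Section NonemptyFace.
Variables (G : finZmodType) (q : {additive (int * int)%type -> G}) (f : nonempty_face q).

Lemma nf_face : face q (sval f).
Proof. by case/andP: (svalP f). Qed.

Lemma nf_in : bpt (sval f) \in sval f.
Proof.
have [/set0Pn [x xf] _] := andP (svalP f); rewrite /bpt unlock; case: pickP => //= /(_ x).
by rewrite xf.
Qed.

Definition nf_cell : cell := cellof q (sval f) (bpt (sval f)).
End NonemptyFace.

Section Toric.
Variables (G : finZmodType) (q : {additive (int * int)%type -> G}).
Hypothesis poly : polyhedral q.
Variables (C : fieldType) (B : comAlgType C) (t : edge G -> B).
Hypothesis tmin : minor_relations q t.
Hypothesis Bloc : forall x y : B, nonunit x -> nonunit y -> nonunit (x + y).
Hypothesis tn : forall e, nonunit (t e).
Local Notation W := (int * (int * int))%type.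
Local Notation face := (nonempty_face q).
Implicit Types (f g h : face).

Definition tcoc f : cocycle B W := vcoc tmin (bpt (sval f)) (nf_cell f).
Definition tchart f : comAlgType B := twisted (tcoc f).

(** Restriction has two stages: [tps] passes from the cell of f to that of g with the base vertex of
    f kept, and [tth] then moves the base vertex inside g. *)
Definition tth f g : {additive W -> W} := shift (dir q (bpt (sval f)) (bpt (sval g))).
Definition tps f g (a : W) : B :=
  psi q t (bpt (sval f)) (nf_cell f) (cellof q (sval g) (bpt (sval f))) a.

Lemma sub_cells f g : sval f \subset sval g ->
  subcell (nf_cell f) (cellof q (sval g) (bpt (sval f))).
Proof. exact: cellof_sub (nf_face f) (nf_face g) (nf_in f). Qed.

Lemma tps0 f g : tps f g 0 = 1.
Proof. exact: psi0. Qed.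

Lemma tpsM f g : sval f \subset sval g -> forall a b,
  (idfun : {rmorphism B -> B}) (tcoc f a b) * tps f g (a + b) =
  tps f g a * tps f g b * tcoc g (tth f g a) (tth f g b).
Proof.
move=> s a b; have bg := fintype.subsetP s _ (nf_in f).
apply: (etrans (psi_cst tmin _ a b (sub_cells s))); congr (_ * _).
exact: (cst_dir poly t (nf_face g) a b bg (nf_in g)).
Qed.

Definition tres f g (s : sval f \subset sval g) : tchart f -> tchart g :=
  @tmap B B W W (tcoc f) (tcoc g) idfun (tth f g) (tps f g).

Section Res.
Variables (f g : face) (s : sval f \subset sval g).
Lemma tres_zmod : zmod_morphism (tres s).
Proof. by move=> x y; apply: tmapB. Qed.
HB.instance Definition _ := GRing.isZmodMorphism.Build _ _ (tres s) tres_zmod.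
Lemma tres_monoid : monoid_morphism (tres s).
Proof.
split; first exact: tmap1 (tps0 f g).
exact: tmapM (tpsM s).
Qed.
HB.instance Definition _ := GRing.isMonoidMorphism.Build _ _ (tres s) tres_monoid.
Lemma tres_scale : scalable (tres s).
Proof. by move=> a x; apply: tmapZ. Qed.
HB.instance Definition _ := GRing.isScalable.Build _ _ _ _ (tres s) tres_scale.
Definition trmorph : {lrmorphism tchart f -> tchart g} := tres s.

Lemma tresD x y : tres s (x + y) = tres s x + tres s y.
Proof. exact: tmapD. Qed.
Lemma tresZ a x : tres s (a *: x) = a *: tres s x.
Proof. exact: tmapZ. Qed.
Lemma tres0 : tres s 0 = 0.
Proof. exact: tmap0. Qed.
Lemma tres_tb w : tres s (tbas (tcoc f) w) = tps f g w *: tbas (tcoc g) (tth f g w).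
Proof. exact: tmap_bas. Qed.
End Res.

Lemma tth_id f w : tth f f w = w.
Proof. by rewrite /tth dir0; apply: shift0. Qed.

Lemma tps_id f w : tps f f w = 1.
Proof. exact: psi_id. Qed.

Lemma tres_id f (s : sval f \subset sval f) x : tres s x = x.
Proof.
elim/tind: x => [|x y hx hy|a w]; first exact: tres0.
  by rewrite tresD hx hy.
by rewrite tresZ tres_tb tth_id tps_id scale1r.
Qed.

Lemma dir_nf f g h : sval f \subset sval g -> sval g \subset sval h ->
  dir q (bpt (sval f)) (bpt (sval g)) + dir q (bpt (sval g)) (bpt (sval h)) =
  dir q (bpt (sval f)) (bpt (sval h)).
Proof.
move=> s u; apply: (dir_add poly (nf_face h)); last exact: nf_in.
  exact: (fintype.subsetP u _ (fintype.subsetP s _ (nf_in f))).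
exact: (fintype.subsetP u _ (nf_in g)).
Qed.

Lemma tth_comp f g h w : sval f \subset sval g -> sval g \subset sval h ->
  tth g h (tth f g w) = tth f h w.
Proof.
move=> s u.
have := shift_comp (dir q (bpt (sval f)) (bpt (sval g))) (dir q (bpt (sval g)) (bpt (sval h))) w.
by rewrite (dir_nf s u).
Qed.

Lemma tps_comp f g h w : sval f \subset sval g -> sval g \subset sval h ->
  tps f g w * tps g h (tth f g w) = tps f h w.
Proof.
move=> s u; have bg := fintype.subsetP s _ (nf_in f).
have e := psi_dir poly t (nf_face g) (nf_face h) w u bg (nf_in g).
have sc := cellof_sub poly (nf_face g) (nf_face h) bg u.
have c := psi_comp tmin (bpt (sval f)) w (sub_cells s) sc; exact: etrans (congr1 (fun z => tps f g w * z) (esym e)) c.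
Qed.

Lemma tres_comp_tb f g h (s : sval f \subset sval g) (u : sval g \subset sval h)
  (v : sval f \subset sval h) w : tres u (tres s (tbas (tcoc f) w)) = tres v (tbas (tcoc f) w).
Proof.
rewrite !tres_tb tresZ tres_tb (tth_comp w s u) -(tps_comp w s u).
exact: scalerA.
Qed.

Lemma tres_comp f g h (s : sval f \subset sval g) (u : sval g \subset sval h)
  (v : sval f \subset sval h) x : tres u (tres s x) = tres v x.
Proof.
elim/tind: x => [|x y hx hy|a w].
- by rewrite !tres0.
- by rewrite !tresD hx hy.
- by rewrite !tresZ (tres_comp_tb s u v).
Qed.

End Toric.

Lemma face_sub (G : finZmodType) (q : {additive (int * int)%type -> G}) (f g : {set G}) :
  f \subset g -> face q g -> face q f.
Proof. by move=> fg /existsP [c gc]; apply/existsP; exists c; apply: fintype.subset_trans gc. Qed.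

Lemma big_cset (G : finZmodType) (q : {additive (int * int)%type -> G}) (poly : polyhedral q)
    (A : Type) (idx : A) (op : Monoid.com_law idx) (p : G) (c : cell) (F : G -> A) :
  \big[op/idx]_(x in cset q p c) F x = op (F p) (\big[op/idx]_(r <- crays c) F (nb q p r)).
Proof.
rewrite -(big_map (nb q p) xpredT F) -(big_cons _ _ p _ xpredT F) big_uniq /=.
  apply: eq_bigl => x; rewrite !inE; congr orb.
  by apply/hasP/mapP => -[r rc h]; exists r => //; apply/eqP.
rewrite map_inj_uniq; last exact: nb_inj.
apply/andP; split; last by case: c => [|r|r] //=; rewrite inE andbT; case: r.
by apply/mapP => -[r _ /eqP]; rewrite eq_sym (negbTE (nb_neq poly _ _)).
Qed.

Section Toric.
Variables (G : finZmodType) (q : {additive (int * int)%type -> G}).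
Hypothesis poly : polyhedral q.
Variables (C : fieldType) (B : comAlgType C) (t : edge G -> B).
Hypothesis tmin : minor_relations q t.
Hypothesis Bloc : forall x y : B, nonunit x -> nonunit y -> nonunit (x + y).
Hypothesis tn : forall e, nonunit (t e).
Local Notation W := (int * (int * int))%type.
Local Notation face := (nonempty_face q).
Local Notation tcoc := (tcoc tmin).
Local Notation tchart := (tchart tmin).
Local Notation tb f w := (tbas (tcoc f) w).
Local Notation base f := (bpt (sval f)).
Implicit Types (f g h : face).

Definition tdeg f (d : int) (x : tchart f) := forall w, tcoef w x != 0 -> w.1 = d.

Lemma tdeg_tb f w : tdeg w.1 (tb f w).
Proof. by move=> v; rewrite tcoef_bas; case: (w =P v) => [->|]; rewrite ?eqxx. Qed.

Lemma tdeg_lin f d b (x y : tchart f) : tdeg d x -> tdeg d y -> tdeg d (b *: x + y).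
Proof.
move=> hx hy w; rewrite tcoefD tcoefZ; case: (eqVneq (tcoef w y) 0) => [->|/hy //].
by rewrite addr0; case: (eqVneq (tcoef w x) 0) => [->|/hx //]; rewrite mulr0 eqxx.
Qed.

Lemma tdeg_0 f d : tdeg d (0 : tchart f).
Proof. by move=> w; rewrite tcoef0 eqxx. Qed.

Lemma tdeg_1 f : tdeg 0 (1 : tchart f).
Proof. by rewrite -(tbas0 (tcoc f)); apply: (@tdeg_tb f 0). Qed.

Lemma tdeg_sum f d (I : Type) (s : seq I) (P : pred I) (F : I -> tchart f) :
  (forall i, P i -> tdeg d (F i)) -> tdeg d (\sum_(i <- s | P i) F i).
Proof.
move=> h; elim/big_rec: _ => [|i x Pi hx]; first exact: tdeg_0.
by rewrite -[F i]scale1r; apply: tdeg_lin => //; apply: h.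
Qed.

Lemma tdegZ f d b (x : tchart f) : tdeg d x -> tdeg d (b *: x).
Proof. by move=> hx; rewrite -[_ *: _]addr0; apply: tdeg_lin => //; apply: tdeg_0. Qed.

Lemma tdeg_mul f d d' (x y : tchart f) : tdeg d x -> tdeg d' y -> tdeg (d + d') (x * y).
Proof.
move=> hx hy; rewrite (tsum x) mulr_suml big_seq; apply: tdeg_sum => v.
rewrite -tcoef_supp => /hx <-; rewrite -scalerAl; apply: tdegZ.
rewrite (tsum y) mulr_sumr big_seq; apply: tdeg_sum => w.
rewrite -tcoef_supp => /hy <-; rewrite -scalerAr; apply: tdegZ.
by rewrite tbasM; apply: tdegZ; apply: (@tdeg_tb f (v + w)).
Qed.

Lemma tdeg_span f (x : tchart f) : exists (s : seq int) (c : int -> tchart f),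
  [/\ uniq s, forall d, tdeg d (c d) & x = \sum_(d <- s) c d].
Proof.
pose s := undup [seq w.1 | w <- tsupp x].
pose c d : tchart f := \sum_(w <- tsupp x | w.1 == d) tcoef w x *: tb f w.
exists s, c; split; first exact: undup_uniq.
  by move=> d; apply: tdeg_sum => w /eqP <-; apply: tdegZ; apply: tdeg_tb.
rewrite {1}(tsum x) /c (exchange_big_dep xpredT) //=.
rewrite big_seq [RHS]big_seq; apply: eq_bigr => w wx.
rewrite big_mkcond (bigD1_seq w.1) ?undup_uniq ?mem_undup ?map_f //= eqxx big1 ?addr0 // => d.
by rewrite eq_sym => /negbTE ->.
Qed.

Lemma tdeg_direct f (s : seq int) (c : int -> tchart f) : uniq s ->
  (forall d, tdeg d (c d)) -> \sum_(d <- s) c d = 0 -> forall d, d \in s -> c d = 0.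
Proof.
move=> us hc h d ds; apply: twistedP => w; rewrite tcoef0.
case: (eqVneq (tcoef w (c d)) 0) => // nz; have wd := hc d w nz.
have := congr1 (tcoef w) h; rewrite tcoef0 tcoef_sum (bigD1_seq d) //= big1 ?addr0 // => e ed.
apply/eqP; case: eqVneq => // /hc; rewrite wd => de; by rewrite de eqxx in ed.
Qed.

Lemma tdeg_res f g (s : sval f \subset sval g) d x : tdeg d x -> tdeg d (tres s x).
Proof.
move=> hx; have e : tres s x = \sum_(w <- tsupp x) tcoef w x *: tres s (tb f w).
  rewrite {1}(tsum x); elim/big_rec2: _ => [|w y z _ <-]; first exact: tres0.
  by rewrite tresD tresZ.
rewrite e big_seq; apply: tdeg_sum => w; rewrite -tcoef_supp => /hx <-; apply: tdegZ.
by rewrite tres_tb; apply: tdegZ; apply: (@tdeg_tb g (tth f g w)).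
Qed.

(** Off the star of f a global section lifting x_p takes values in the maximal ideal times the
    chart. Zero represents their class, and [coord] records only classes. *)
Definition tcoord f (p : G) : tchart f :=
  if Defs.face q (p |: sval f) then tb f (1, dir q (base f) p) else 0.

Lemma tcoord_deg f p : tdeg 1 (tcoord f p).
Proof. by rewrite /tcoord; case: ifP => _; [apply: tdeg_tb | apply: tdeg_0]. Qed.

Lemma star_cell f p : Defs.face q (p |: sval f) ->
  p = base f \/ exists2 r, compat (nf_cell f) r & p = nb q (base f) r.
Proof. by move/(star_nb poly p (nf_face f) (nf_in f)). Qed.

Lemma wt_nonunit p r : nonunit (wt q t p r).
Proof. exact: tn. Qed.

Lemma star_sub f g p : sval f \subset sval g -> Defs.face q (p |: sval g) ->
  Defs.face q (p |: sval f).
Proof. by move=> s; apply: face_sub; apply: finset.setUS. Qed.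

Lemma tth_coord f g p : sval f \subset sval g -> Defs.face q (p |: sval g) ->
  tth f g (1, dir q (base f) p) = (1, dir q (base g) p).
Proof.
move=> s pg; rewrite /= /shift /= mulr1z; congr pair.
have bf : base f \in p |: sval g by rewrite !inE (fintype.subsetP s _ (nf_in f)) orbT.
have bg : base g \in p |: sval g by rewrite !inE (nf_in g) orbT.
have pp : p \in p |: sval g by exact: setU11.
have e := dir_add poly pg bf bg pp.
by rewrite -e addrAC subrr add0r.
Qed.

Lemma tres_coord_star f g (s : sval f \subset sval g) p : Defs.face q (p |: sval g) ->
  tres s (tcoord f p) = tcoord g p.
Proof.
move=> pg; have bg := fintype.subsetP s _ (nf_in f); have sc := sub_cells poly s.
rewrite /tcoord pg (star_sub s pg) tres_tb (tth_coord s pg).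
have -> : tps t f g (1, dir q (base f) p) = 1.
  rewrite /tps psiE /=; have [->|[r rc ->]] := (star_nb poly p (nf_face g) bg).1 pg.
    by rewrite dir0 !phi0 subrr tm0.
  by rewrite (dir_nb poly) (phi_compat rc sc) subrr tm0.
by rewrite scale1r.
Qed.

Lemma tcoord_res f g (s : sval f \subset sval g) p :
  max_mul (tres s (tcoord f p) - tcoord g p).
Proof.
have bg := fintype.subsetP s _ (nf_in f); have sc := sub_cells poly s.
case: (boolP (Defs.face q (p |: sval g))) => pg.
  by rewrite tres_coord_star // subrr; apply: max_mul0.
rewrite {2}/tcoord (negbTE pg) subr0 /tcoord.
case: (boolP (Defs.face q (p |: sval f))) => pf; last by rewrite tres0; apply: max_mul0.
rewrite tres_tb; apply: max_mul_nonunit.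
have [pE|[r rc pE]] := star_cell pf.
  by move/negP: pg => []; apply/(star_nb poly _ (nf_face g) bg); left.
rewrite /tps psiE /= pE (dir_nb poly); apply: tm_nonunit => //; first exact: wt_nonunit.
  exact: phi_mono.
apply: phi_incompat => //; apply/negP => rg; move/negP: pg => [].
by apply/(star_nb poly _ (nf_face g) bg); right; exists r.
Qed.

Lemma tb_along f w p : p \in sval f ->
  tb f w * tb f (1, dir q (base f) p) = tb f (w + (1, dir q (base f) p)).
Proof.
move=> pf; rewrite tbasM; have -> : tcoc f w (1, dir q (base f) p) = 1.
  apply: etrans (cstE _ _ _ _ _ _) _.
  rewrite [(_, dir _ _ _).2]/=.
  have [->|[r rc ->]] := mem_face_nb poly (nf_face f) (nf_in f) pf.
    by rewrite dir0 phi0 !addr0 subrr tm0.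
  by rewrite (dir_nb poly) phi_along // tm0.
by rewrite scale1r.
Qed.

Lemma tcoord_in f p : p \in sval f -> tcoord f p = tb f (1, dir q (base f) p).
Proof.
move=> pf; rewrite /tcoord; have -> : p |: sval f = sval f.
  by apply/finset.setUidPr; rewrite finset.sub1set.
by rewrite (nf_face f).
Qed.

Lemma tb_cone f r v w : subcell (nf_cell f) (CT r) -> cone r v.2 -> cone r w.2 ->
  tb f v * tb f w = tb f (v + w).
Proof.
move=> sc cv cw; rewrite tbasM; have -> : tcoc f v w = 1.
  apply: etrans (cstE _ _ _ _ _ _) _.
  by rewrite !(phi_cone sc) ?coneD // phi_CT_delta tm0.
by rewrite scale1r.
Qed.

Lemma coneM r u n : cone r u -> cone r (u *+ n).
Proof.
by move=> h; elim: n => [|n IH]; [rewrite mulr0n; apply: cone0 | rewrite mulrS; apply: coneD].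
Qed.

Lemma tb_coneX f r v n : subcell (nf_cell f) (CT r) -> cone r v.2 -> tb f v ^+ n = tb f (v *+ n).
Proof.
move=> sc cv; elim: n => [|n IH]; first by rewrite mulr0n tbas0.
rewrite exprS IH mulrS (tb_cone sc) // (raddfMn snd); exact: coneM.
Qed.

Lemma cset_dir f r p : p \in cset q (base f) (CT r) -> cone r (dir q (base f) p).
Proof.
move/mem_cset => [->|[s sr ->]]; first by rewrite dir0; apply: cone0.
by rewrite (dir_nb poly); apply: cone_ray.
Qed.

Lemma cset_star f r p : subcell (nf_cell f) (CT r) -> p \in cset q (base f) (CT r) ->
  Defs.face q (p |: sval f).
Proof.
move=> sc pr; apply: face_sub (cset_face poly (base f) (CT r)).
rewrite finset.subUset finset.sub1set pr /= -{1}(cellofP poly (nf_face f) (nf_in f)).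
by rewrite (cset_sub poly).
Qed.

Definition mon_value f (m : 'X_{1..#|G|}) : tchart f :=
  \prod_p tcoord f p ^+ m (enum_rank p).
Definition mon_weight f (m : 'X_{1..#|G|}) : W :=
  \sum_p (1, dir q (base f) p) *+ m (enum_rank p).
Definition mon_good f (m : 'X_{1..#|G|}) := exists r, subcell (nf_cell f) (CT r) /\
  forall p, m (enum_rank p) != 0%N -> p \in cset q (base f) (CT r).

Lemma mon_value_good f m : mon_good f m -> mon_value f m = tb f (mon_weight f m).
Proof.
move=> [r [sc hm]].
suff : mon_value f m = tb f (mon_weight f m) /\ cone r (mon_weight f m).2 by case.
rewrite /mon_value /mon_weight; elim/big_rec2: _ => [|p x y _ [-> cx]].
  by rewrite tbas0; split=> //; apply: cone0.
case: (eqVneq (m (enum_rank p)) 0%N) => [->|mp]; first by rewrite expr0 mul1r mulr0n add0r.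
have pr := hm p mp; have cp : cone r (1 : int, dir q (base f) p).2 by apply: cset_dir.
have cpn : cone r (((1 : int, dir q (base f) p) : W) *+ m (enum_rank p)).2.
  by rewrite (raddfMn snd); apply: coneM.
rewrite /tcoord (cset_star sc pr) (tb_coneX _ sc cp) (tb_cone sc cpn cx); split=> //.
exact: coneD.
Qed.

(** Either some variable lies off the star, or the flag property provides two variables whose rays
    lie in no common cell with f. The product of these two crosses a bend, which contributes a
    nonunit. *)
Lemma mon_value_bad f m : ~ mon_good f m -> max_mul (mon_value f m).
Proof.
move=> bad; case: (pselect (exists2 p, m (enum_rank p) != 0%N & ~~ Defs.face q (p |: sval f))).
  move=> [p mp pf]; rewrite /mon_value (bigD1 p) //= /tcoord (negbTE pf).
  by rewrite expr0n (negbTE mp) mul0r; apply: max_mul0.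
move=> allstar; have {}allstar p : m (enum_rank p) != 0%N -> Defs.face q (p |: sval f).
  by move=> mp; apply: contrapT => /negP h; apply: allstar; exact: (ex_intro2 _ _ p mp h).
pose D r := m (enum_rank (nb q (base f) r)) != 0%N.
have Dc r : D r -> compat (nf_cell f) r.
  move=> /allstar /star_cell [/eqP|[s sc /(nb_inj poly) -> //]].
  by rewrite (negbTE (nb_neq poly _ _)).
have [r [s [Dr Ds rs]]] : exists r s, [/\ D r, D s & ~~ common (nf_cell f) r s].
  apply: contrapT => h; apply: bad.
  have [|d [sd hd]] := common_flag Dc.
    by move=> r s Dr Ds; apply/negPn/negP => nc; apply: h; exists r, s.
  exists d; split=> // p mp; have [pE|[r _ pE]] := star_cell (allstar p mp); rewrite pE.
    exact: mem_cset_base.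
  by rewrite (mem_cset_nb poly); apply: hd; rewrite /D -pE.
have rs' : r != s.
  apply: contraNneq rs => ->; have /hasP [d dc /andP [h1 h2]] := Dc s Ds.
  by apply/hasP; exists d; rewrite ?h1 ?h2.
have nrs : nb q (base f) s != nb q (base f) r by rewrite (inj_eq (@nb_inj _ _ poly _)) eq_sym.
rewrite /mon_value (bigD1 (nb q (base f) r)) //= (bigD1 (nb q (base f) s)) //=.
rewrite -(prednK (n := m (enum_rank (nb q (base f) r)))) ?lt0n // exprS.
rewrite -(prednK (n := m (enum_rank (nb q (base f) s)))) ?lt0n // exprS.
rewrite -[X in _ * X]mulrA mulrACA.
apply: max_mul_mul; rewrite /tcoord !allstar // !(dir_nb poly) tbasM.
apply: max_mul_nonunit; apply: (eq_ind _ (fun u => nonunit u) _ _ (esym (cstE _ _ _ _ _ _))).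
apply: tm_nonunit; [exact: wt_nonunit | exact: phi_convex | ].
by apply: phi_uncommon => //; apply: Dc.
Qed.

End Toric.

Lemma rdetMn r (u v : int * int) (n : nat) : rdet r (u + v *+ n) = rdet r u + rdet r v * n%:Z.
Proof. by rewrite pmulrn pair_mulrz; case: u v => [x y] [z w]; rewrite /rdet /=; ring. Qed.

(** Multiplying by all coordinates of the face raises the degree by size + 1 and the sum of the
    exponents at the two rays by size, so the exponent left for the base vertex grows by one each
    time. *)
Lemma shift_pos c r (a : int) (u : int * int) (n : nat) : subcell c (CT r) ->
  (`|(a + rdet (rnext r) u - rdet r u)%R| <= n)%N ->
  0 <= a + (size (crays c)).+1%:Z *+ n + rdet (rnext r) (u + (\sum_(s <- crays c) rvec s) *+ n)
    - rdet r (u + (\sum_(s <- crays c) rvec s) *+ n).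
Proof.
move=> sc; rewrite !rdetMn; set S := \sum_(s <- _) _.
have -> : rdet (rnext r) S = rdet r S - (size (crays c))%:Z.
  by rewrite /S; case: c sc {S} => [|s|s]; rewrite ?big_cons ?big_nil; case: r => //; case: s.
rewrite -mulr_natr natz; move: (size _) (rdet r S) (rdet r u) (rdet (rnext r) u) => k x y z h.
suff -> : a + k.+1%:Z * n%:Z + (z + (x - k%:Z) * n%:Z) - (y + x * n%:Z) = (a + z - y) + n%:Z by lia.
by rewrite -addn1 PoszD; ring.
Qed.

(** The two determinants give, up to sign, the exponents at the rays of the triangle, and the base
    vertex takes the rest of the degree. *)
Lemma cone_weight r (v : int * (int * int)) : cone r v.2 ->
  0 <= v.1 + rdet (rnext r) v.2 - rdet r v.2 ->
  v = (1, 0) *+ `|(v.1 + rdet (rnext r) v.2 - rdet r v.2)%R|%N +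
    ((1, rvec r) *+ `|rdet (rnext r) v.2|%N + (1, rvec (rnext r)) *+ `|rdet r v.2|%N).
Proof.
have pm (k : nat) (x : int * (int * int)) :
    x *+ k = (x.1 * k%:Z, (x.2.1 * k%:Z, x.2.2 * k%:Z)).
  apply: injective_projections; last apply: injective_projections; rewrite /=.
  - by rewrite (raddfMn fst) -mulr_natr natz.
  - by rewrite (raddfMn snd) (raddfMn fst) -mulr_natr natz.
  - by rewrite !(raddfMn snd) -mulr_natr natz.
case: v => a [x y]; rewrite !pm /cone /=; case: r; rewrite /rdet /= => /andP [h1 h2] pos;
  (apply: injective_projections; last apply: injective_projections); rewrite /=; lia.
Qed.

Lemma xmonE (G : finZmodType) (B : comNzRingType) (S : {set G}) :
  xmon B S = 'X_[[multinom (enum_val i \in S : nat) | i < #|G|]].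
Proof.
rewrite /xmon big_mkcond mpolyXE_id (reindex_onto enum_rank enum_val) /=; last first.
  by move=> i _; rewrite enum_valK.
apply: eq_big => [p|p _]; first by rewrite enum_rankK eqxx.
by rewrite mnmE enum_rankK; case: (p \in S); rewrite ?expr1 ?expr0.
Qed.

Section ToricCoordinates.
Variables (G : finZmodType) (q : {additive (int * int)%type -> G}).
Hypothesis poly : polyhedral q.
Variables (C : fieldType) (B : comAlgType C) (t : edge G -> B).
Hypothesis tmin : minor_relations q t.
Hypothesis Bloc : forall x y : B, nonunit x -> nonunit y -> nonunit (x + y).
Hypothesis tn : forall e, nonunit (t e).
Local Notation W := (int * (int * int))%type.
Local Notation face := (nonempty_face q).
Local Notation tcoc := (tcoc tmin).
Local Notation tchart := (tchart tmin).
Local Notation tb f w := (tbas (tcoc f) w).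
Local Notation base f := (bpt (sval f)).
Local Notation tcoord := (tcoord tmin).
Local Notation idB := (idfun : {rmorphism B -> B}).
Implicit Types (f g : face) (m : 'X_{1..#|G|}).

Lemma tmax_mulP f (x : tchart f) : max_mul x <-> forall w, nonunit (tcoef w x).
Proof.
split=> [[k [r [y [rn ->]]]] w|hn].
  rewrite tcoef_sum; elim/big_rec: _ => [|i z _ hz]; first exact: nonunit0.
  by apply: Bloc => //; rewrite tcoefZ; apply: nonunitM.
by rewrite (tsum x); apply: max_mul_sum => w _; apply: max_mul_nonunit.
Qed.

Definition face_weight f : W := \sum_(p in sval f) (1, dir q (base f) p).

Lemma tb_prod f w : tb f w * \prod_(p in sval f) tcoord f p = tb f (w + face_weight f).
Proof.
rewrite /face_weight; elim/big_rec2: _ => [|p x y pf e]; first by rewrite mulr1 addr0.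
rewrite (tcoord_in tmin pf) mulrCA e mulrC (tb_along poly _ _ pf).
by rewrite -addrA [x + _]addrC.
Qed.

Lemma tb_prodX f w N : tb f w * (\prod_(p in sval f) tcoord f p) ^+ N =
  tb f (w + face_weight f *+ N).
Proof.
elim: N w => [|N IH] w; first by rewrite expr0 mulr1 mulr0n addr0.
by rewrite exprS mulrA tb_prod IH mulrS addrA.
Qed.

Lemma tcoord_unit f : exists y : tchart f,
  max_mul (y * \prod_(p in sval f) tcoord f p - 1).
Proof.
exists (tb f (- face_weight f)); rewrite tb_prod addNr tbas0 subrr.
exact: max_mul0.
Qed.

Lemma ev_mon_value f m : ev idfun (tcoord f) 'X_[m] = mon_value tmin f m.
Proof. exact: (ev_mon idB). Qed.

Lemma mon_weight_good f m r : (forall p, m (enum_rank p) != 0%N -> p \in cset q (base f) (CT r)) ->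
  mon_weight f m = (1, 0) *+ m (enum_rank (base f)) +
    ((1, rvec r) *+ m (enum_rank (nb q (base f) r)) +
     (1, rvec (rnext r)) *+ m (enum_rank (nb q (base f) (rnext r)))).
Proof.
move=> hm; rewrite /mon_weight (bigID (mem (cset q (base f) (CT r)))) /= addrC big1; last first.
  by move=> p /negP pr; case: eqVneq (hm p) => [-> _|_ /(_ isT)] //; rewrite mulr0n.
rewrite add0r (big_cset poly) dir0; congr (_ + _).
by rewrite big_cons big_seq1 !(dir_nb poly).
Qed.

Lemma mon_weight1 f m : (mon_weight f m).1 = \sum_p (m (enum_rank p))%:Z.
Proof.
rewrite /mon_weight (raddf_sum fst); apply: eq_bigr => p _.
by rewrite (raddfMn fst) /= -natz.
Qed.

Lemma mon_weight_rcoef f m s : mon_good f m ->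
  rcoef s (mon_weight f m).2 = m (enum_rank (nb q (base f) s)).
Proof.
move=> [r [_ hm]]; rewrite (mon_weight_good hm) !(raddfD snd) !(raddfMn snd) /= mul0rn add0r.
rewrite !pmulrn rcoef_cone //; case: (eqVneq s r) => [->|sr] //.
case: (eqVneq s (rnext r)) => [->|srn] //.
apply/eqP; rewrite eq_sym eqz_nat; apply: contraT => /hm.
by rewrite (mem_cset_nb poly) /= !inE (negbTE sr) (negbTE srn).
Qed.

(** Courant functions recover the exponents at the neighbours, and the total degree then recovers
    the one at the base vertex. *)
Lemma mon_weight_inj f m m' : mon_good f m -> mon_good f m' ->
  mon_weight f m = mon_weight f m' -> m = m'.
Proof.
move=> gm gm' e.
have nbE s : m (enum_rank (nb q (base f) s)) = m' (enum_rank (nb q (base f) s)).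
  by apply/eqP; rewrite -eqz_nat -(mon_weight_rcoef s gm) e (mon_weight_rcoef s gm').
have offE p : p != base f -> m (enum_rank p) = m' (enum_rank p).
  move=> pb; case: (pselect (exists s, p = nb q (base f) s)) => [[s ->] //|np].
  have z mm : mon_good f mm -> mm (enum_rank p) = 0%N.
    move=> [r [_ h]]; apply/eqP; apply: contraT => /h /mem_cset [pE|[s _ pE]].
      by rewrite pE eqxx in pb.
    by case: np; exists s.
  by rewrite !z.
have bE : m (enum_rank (base f)) = m' (enum_rank (base f)).
  have := congr1 fst e; rewrite !mon_weight1 (bigD1 (base f)) //= [RHS](bigD1 (base f)) //=.
  rewrite [X in _ + X](eq_bigr (fun p => (m' (enum_rank p))%:Z)); last by move=> p /offE ->.
  by move=> /addIr /eqP; rewrite eqz_nat => /eqP.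
apply/mnmP => i; rewrite -(enum_valK i); case: (eqVneq (enum_val i) (base f)) => [->//|].
exact: offE.
Qed.

Lemma mon_goodP f m :
  Defs.face q (sval f :|: [set p | m (enum_rank p) != 0%N]) -> mon_good f m.
Proof.
set F := _ :|: _ => Ff; have bF : base f \in F by rewrite !inE (nf_in f).
have [r hr] : exists r, subcell (cellof q F (base f)) (CT r).
  case: (cellof _ _ _) => [|r|r]; first by exists R0.
    by exists r; case: r.
  by exists r; case: r.
exists r; split=> [|p mp].
  rewrite -(cset_sub poly (base f)); apply: (@fintype.subset_trans _ _ F).
    by rewrite (cellofP poly (nf_face f) (nf_in f)) finset.subsetUl.
  by rewrite -{1}(cellofP poly Ff bF) (cset_sub poly).
have pF : p \in F by rewrite !inE mp orbT.
move: hr; rewrite -(cset_sub poly (base f)) (cellofP poly Ff bF) => /fintype.subsetP; exact.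
Qed.

Lemma bad_SR f m : ~ mon_good f m -> SR_ideal q (B := B) (xmon B (sval f) * 'X_[m]).
Proof.
move=> bad; set F := sval f :|: [set p | m (enum_rank p) != 0%N].
have Fn : ~~ Defs.face q F by apply/negP => /mon_goodP.
have -> : xmon B (sval f) * 'X_[m] = 'X_[[multinom (((enum_val i \in sval f) + m i)
    - (enum_val i \in F))%N | i < #|G|]] * xmon B F.
  rewrite !xmonE -!mpolyXD; congr 'X_[_]; apply/mnmP => i; rewrite !mnmE subnK //.
  rewrite !inE enum_valK; case: (enum_val i \in sval f) => //=.
  by case: (m i).
apply: idealMl; first exact: gen_idealP.
by apply: gen_ideal_sub; exists F.
Qed.

Lemma SR_max_mul f (h : {mpoly B[#|G|]}) :
  SR_ideal q h -> max_mul (ev idfun (tcoord f) h : tchart f).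
Proof.
apply: (gen_ideal_min (I := fun h => max_mul (ev idfun (tcoord f) h : tchart f))).
  split; first by rewrite (ev0 idB); apply: max_mul0.
    by move=> x y hx hy; rewrite (evD idB); apply: max_mulD.
  by move=> a x hx; rewrite (evM idB); apply: max_mul_mulr.
move=> _ [S Sn ->]; rewrite xmonE ev_mon_value; apply: (mon_value_bad poly) => // -[r [_ hr]].
move/negP: Sn; apply; apply: (face_sub _ (cset_face poly (base f) (CT r))).
by apply/fintype.subsetP => p pS; apply: hr; rewrite mnmE enum_rankK pS.
Qed.

Lemma ev_max_mul f (h : {mpoly B[#|G|]}) :
  max_mul h -> max_mul (ev idfun (tcoord f) h : tchart f).
Proof.
apply: (max_mul_map (g := id)) => // [x y|r x]; first exact: (evD idB).
exact: (evZ idB).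
Qed.

(** The coefficient of a good monomial is visible at its weight: other good monomials have other
    weights, and bad ones contribute nonunits there. *)
Lemma good_nonunit f (h : {mpoly B[#|G|]}) m :
  max_mul (ev idfun (tcoord f) h : tchart f) -> mon_good f m -> nonunit h@_m.
Proof.
move=> hev gm; have := (tmax_mulP _).1 hev (mon_weight f m).
rewrite (evE idB) => hc.
case: (boolP (m \in msupp h)) => mh; last first.
  by rewrite (memN_msupp_eq0 mh); apply: nonunit0.
have -> : h@_m = (h@_m + \sum_(m' <- msupp h | m' != m)
    h@_m' * tcoef (mon_weight f m) (mon_value tmin f m'))
   - \sum_(m' <- msupp h | m' != m) h@_m' * tcoef (mon_weight f m) (mon_value tmin f m').
  by rewrite addrK.
have nN (b : B) : nonunit b -> nonunit (- b) by rewrite -mulrN1; apply: nonunitM.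
apply: Bloc.
  move: hc; rewrite tcoef_sum (bigD1_seq m) ?msupp_uniq //=.
  rewrite tcoefZ [X in h@_m * X](_ : _ = 1) ?mulr1; last first.
    by rewrite -[\prod_p _]/(mon_value tmin f m) (mon_value_good poly) // tcoef_bas eqxx.
  by under eq_bigr do rewrite tcoefZ.
apply: nN; elim/big_rec: _ => [|m' x m'm hx]; first exact: nonunit0.
apply: (Bloc _ hx); rewrite mulrC; apply: nonunitM.
case: (pselect (mon_good f m')) => [gm'|bm'].
  rewrite (mon_value_good poly) // tcoef_bas; case: eqP => [/mon_weight_inj e|_].
    by rewrite (e gm' gm) eqxx in m'm.
  exact: nonunit0.
exact: ((tmax_mulP _).1 (mon_value_bad poly tmin tn bm') _).
Qed.

Lemma tcoord_rel f (h : {mpoly B[#|G|]}) :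
  max_mul (ev idfun (tcoord f) h : tchart f) <->
  exists N : nat, ideal_sum (SR_ideal q (B := B)) (max_mul (M := {mpoly B[#|G|]}))
        (xmon B (sval f) ^+ N * h).
Proof.
split=> [hev|[N [g [k [hg hk e]]]]].
  (* One factor x_f already makes every bad monomial a multiple of a nonface monomial, by
     [bad_SR]. *)
  exists 1%N; rewrite expr1 [h]mpolyE mulr_sumr.
  have SRi : is_ideal (SR_ideal q (B := B)) by exact: gen_idealP.
  have MMi : is_ideal (max_mul (M := {mpoly B[#|G|]})).
    split; [exact: max_mul0|by move=> *; exact: max_mulD|by move=> *; exact: max_mul_mulr].
  apply: ideal_bigsum (ideal_sumP SRi MMi) _ => m _; rewrite -scalerAr.
  case: (pselect (mon_good f m)) => [gm|bm].
    by apply: (ideal_sumr SRi); apply: max_mul_nonunit; apply: (good_nonunit hev).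
  apply: (ideal_suml MMi); rewrite -mul_mpolyC; apply: idealMl => //; exact: bad_SR.
have eh : ev idfun (tcoord f) h =
    tb f (- (face_weight f *+ N)) * (ev idfun (tcoord f) (xmon B (sval f) ^+ N * h)).
  rewrite (evM idB) (evXn idB) (ev_xmon idB) mulrA tb_prodX addNr tbas0.
  by rewrite mul1r.
rewrite eh e (evD idB); apply: max_mul_mulr; apply: max_mulD.
  exact: SR_max_mul.
exact: ev_max_mul.
Qed.

Lemma face_weight1 f : (face_weight f).1 = (size (crays (nf_cell f))).+1.
Proof.
rewrite /face_weight -{1}(cellofP poly (nf_face f) (nf_in f)) (big_cset poly) (raddfD fst).
rewrite (raddf_sum fst) -/(nf_cell f) /=.
by case: (nf_cell f) => [|s|s]; rewrite ?big_nil ?big_cons ?big_nil.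
Qed.

Lemma face_weight2 f : (face_weight f).2 = \sum_(s <- crays (nf_cell f)) rvec s.
Proof.
rewrite /face_weight -{1}(cellofP poly (nf_face f) (nf_in f)) (big_cset poly) (raddfD snd).
rewrite (raddf_sum snd) -/(nf_cell f) /= dir0 add0r.
by apply: eq_bigr => s _ /=; rewrite (dir_nb poly).
Qed.

Lemma tb_mon f w : exists N m, tb f w * (\prod_(p in sval f) tcoord f p) ^+ N =
  ev idfun (tcoord f) ('X_[m] : {mpoly B[#|G|]}).
Proof.
have [r [N [sc hN]]] := cone_shift (nf_cell f) w.2.
(* N moves the weight into a maximal cone; the second summand makes the exponent of the base vertex
   nonnegative. *)
pose n := (N + `|(w.1 + rdet (rnext r) w.2 - rdet r w.2)%R|)%N.
pose v := w + face_weight f *+ n.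
have v2 : v.2 = w.2 + (\sum_(s <- crays (nf_cell f)) rvec s) *+ n.
  by rewrite -face_weight2 (raddfD snd) (raddfMn snd).
have cv : cone r v.2 by rewrite v2; apply: hN; apply: leq_addr.
have pos : 0 <= v.1 + rdet (rnext r) v.2 - rdet r v.2.
  have v1 : v.1 = w.1 + (size (crays (nf_cell f))).+1%:Z *+ n.
    by rewrite -face_weight1 (raddfD fst) (raddfMn fst).
  by rewrite v2 v1; apply: (shift_pos sc); apply: leq_addl.
exists n; pose F p := if p == base f then `|(v.1 + rdet (rnext r) v.2 - rdet r v.2)%R|%N
  else if p == nb q (base f) r then `|rdet (rnext r) v.2|%N
  else if p == nb q (base f) (rnext r) then `|rdet r v.2|%N else 0%N.
pose m := [multinom F (enum_val i) | i < #|G|].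
have mE p : m (enum_rank p) = F p by rewrite mnmE enum_rankK.
exists m; rewrite tb_prodX ev_mon_value -/v.
have hm p : m (enum_rank p) != 0%N -> p \in cset q (base f) (CT r).
  rewrite mE /F; case: (p =P base f) => [->|_]; first by rewrite mem_cset_base.
  case: (p =P nb q (base f) r) => [->|_]; first by rewrite (mem_cset_nb poly) inE eqxx.
  by case: (p =P nb q (base f) (rnext r)) => [->|//]; rewrite (mem_cset_nb poly) !inE eqxx orbT.
rewrite (mon_value_good poly); last by exists r.
congr tbas; rewrite (mon_weight_good hm) !mE /F eqxx !(negbTE (nb_neq poly _ _)).
have rr : (rnext r == r) = false by case: (r).
by rewrite !(inj_eq (@nb_inj _ _ poly (base f))) rr !eqxx; exact: cone_weight.
Qed.

Lemma tcoord_gen f (x : tchart f) : exists (N : nat) (h : {mpoly B[#|G|]}),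
  max_mul (x * (\prod_(p in sval f) tcoord f p) ^+ N - ev idfun (tcoord f) h).
Proof.
suff [N [h e]] : exists (N : nat) (h : {mpoly B[#|G|]}),
    x * (\prod_(p in sval f) tcoord f p) ^+ N = ev idfun (tcoord f) h.
  by exists N, h; rewrite e subrr; apply: max_mul0.
have eX : \prod_(p in sval f) tcoord f p = ev idfun (tcoord f) (xmon B (sval f)).
  by rewrite (ev_xmon idB).
elim/tind: x => [|x y [N [h hx]] [N' [h' hy]]|a w].
- by exists 0%N, 0; rewrite mul0r (ev0 idB).
- exists (N + N')%N, (h * xmon B (sval f) ^+ N' + h' * xmon B (sval f) ^+ N).
  rewrite (evD idB) !(evM idB) !(evXn idB) -eX -hx -hy mulrDl exprD !mulrA; congr (_ + _).
  by rewrite mulrAC.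
- have [N [m e]] := tb_mon f w; exists N, (a *: 'X_[m]).
  by rewrite (evZ idB) -e scalerAl.
Qed.

Definition toric_deformation : pair_deformation q B := PairDeformation
  (chart := tchart) (res := fun f g s => trmorph poly tmin s) (hdeg := @tdeg G q C B t tmin)
  (coord := tcoord)
  (fun f s x => tres_id s x)
  (fun f g h s u v x => tres_comp poly s u v x)
  (fun f => @twisted_flat _ _ (tcoc f))
  (fun f d b x y hx hy => tdeg_lin hx hy)
  (fun f d => @tdeg_0 _ _ _ _ _ tmin f d)
  (fun f => @tdeg_1 _ _ _ _ _ tmin f)
  (fun f d d' x y hx hy => tdeg_mul hx hy)
  (fun f x => tdeg_span x)
  (fun f s c us hc h => tdeg_direct us hc h)
  (fun f g s d x hx => tdeg_res hx)
  (fun f p => @tcoord_deg _ _ _ _ _ tmin f p)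
  (fun f g s p => tcoord_res poly tmin tn s p)
  tcoord_unit tcoord_rel tcoord_gen.

End ToricCoordinates.

(** * Morphisms of deformations *)

Lemma tm_rmorph (B B' : comNzRingType) (g : {rmorphism B -> B'}) (w : ray -> B) (w' : ray -> B') e :
  (forall r, w' r = g (w r)) -> g (tm w e) = tm w' e.
Proof. by move=> h; rewrite /tm /hexp /hmon !h !rmorphM !rmorphXn. Qed.

Section ToricMorphism.
Variables (G : finZmodType) (q : {additive (int * int)%type -> G}).
Hypothesis poly : polyhedral q.
Variables (C : fieldType) (B' B : comAlgType C) (pi : {lrmorphism B' -> B}).
Variables (t' : edge G -> B') (t : edge G -> B).
Hypothesis tE : forall e, t e = pi (t' e).
Hypotheses (tmin' : minor_relations q t') (tmin : minor_relations q t).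
Hypothesis Bloc' : forall x y : B', nonunit x -> nonunit y -> nonunit (x + y).
Hypothesis tn' : forall e, nonunit (t' e).
Hypothesis Bloc : forall x y : B, nonunit x -> nonunit y -> nonunit (x + y).
Hypothesis tn : forall e, nonunit (t e).
Local Notation W := (int * (int * int))%type.

Definition tpush (f : nonempty_face q) : tchart tmin' f -> tchart tmin f :=
  @tmap B' B W W (tcoc tmin' f) (tcoc tmin f) pi idfun (fun=> 1).

Lemma tcoc_push (f : nonempty_face q) a b : pi (tcoc tmin' f a b) = tcoc tmin f a b.
Proof.
apply: (etrans (congr1 pi (cstE _ _ _ _ _ _))); apply: etrans (esym (cstE _ _ _ _ _ _)).
by apply: tm_rmorph => r; apply: tE.
Qed.

Lemma tps_push (f g : nonempty_face q) a : pi (tps t' f g a) = tps t f g a.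
Proof. by rewrite /tps !psiE; apply: tm_rmorph => r; apply: tE. Qed.

Lemma tpush_tb f w : tpush (tbas (tcoc tmin' f) w) = tbas (tcoc tmin f) w.
Proof. by rewrite /tpush tmap_bas scale1r. Qed.

Lemma tpushZ f b (x : tchart tmin' f) : tpush (b *: x) = pi b *: tpush x.
Proof. exact: tmapZ. Qed.

Lemma tpushD f (x y : tchart tmin' f) : tpush (x + y) = tpush x + tpush y.
Proof. exact: tmapD. Qed.

Lemma tpush0 f : tpush (0 : tchart tmin' f) = 0.
Proof. exact: tmap0. Qed.

Lemma tpush_deg f d (x : tchart tmin' f) : tdeg d x -> tdeg d (tpush x).
Proof.
move=> hx; have -> : tpush x = \sum_(w <- tsupp x) pi (tcoef w x) *: tbas (tcoc tmin f) w.
  rewrite {1}(tsum x); elim/big_rec2: _ => [|w y z _ <-]; first exact: tpush0.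
  by rewrite tpushD tpushZ tpush_tb.
rewrite big_seq; apply: tdeg_sum => w; rewrite -tcoef_supp => /hx <-; apply: tdegZ.
exact: tdeg_tb.
Qed.

Lemma tpush_res (f g : nonempty_face q) (s : sval f \subset sval g) x : tpush (tres s x) = tres s (tpush x).
Proof.
elim/tind: x => [|x y hx hy|a w].
- by rewrite tpush0 !tres0 tpush0.
- by rewrite tresD tpushD hx hy tpushD tresD.
- rewrite tresZ !tpushZ tresZ tpush_tb !tres_tb tpushZ tpush_tb.
  by rewrite tps_push.
Qed.

Lemma tpush_coord f p : tpush (tcoord tmin' f p) = tcoord tmin f p.
Proof. by rewrite /tcoord; case: ifP => _; [apply: tpush_tb | apply: tpush0]. Qed.

Lemma toric_morphism : pair_morphism (eta' := toric_deformation poly tmin' Bloc' tn')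
  (eta := toric_deformation poly tmin Bloc tn) pi (fun f => @tpush f).
Proof.
split.
- exact: tpushD.
- by move=> f x y; apply: tmapM => a b; rewrite !mulr1 mul1r; apply: tcoc_push.
- by move=> f; apply: tmap1.
- exact: tpushZ.
- exact: tpush_deg.
- by move=> f g s x; apply: tpush_res.
- by move=> f p; rewrite /= tpush_coord subrr; apply: max_mul0.
Qed.

End ToricMorphism.

Lemma induces_push (G : finZmodType) (q : {additive (int * int)%type -> G}) (C : fieldType)
    (R : comNzRingType) (J : {mpoly R[#|G|]} -> Prop) (B' B : comAlgType C) (pi : B' -> B)
    (phi : {rmorphism R -> B'}) (eta' : pair_deformation q B') (eta : pair_deformation q B)
    (u : forall f : nonempty_face q, chart eta' f -> chart eta f) :
  (forall b, nonunit b -> nonunit (pi b)) -> pair_morphism pi u -> induces J phi eta' ->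
  induces J (fun r => pi (phi r)) eta.
Proof.
move=> pn [uD uM u1 uZ ud ur uc] [xi [xd xr xc xJ]].
exists (fun f p => u f (xi f p)); split=> [f p|f g s p|f p|f h Jh].
- exact: ud.
- by rewrite -ur xr.
- have -> : u f (xi f p) - Defs.coord eta f p =
      u f (xi f p - Defs.coord eta' f p) + (u f (Defs.coord eta' f p) - Defs.coord eta f p).
    by rewrite addrA -uD subrK.
  apply: max_mulD (uc f p); exact: max_mul_map (uD f) (uZ f) pn _ (xc f p).
- rewrite -(ev_push phi _ _ (uD f) (uM f) (u1 f) (uZ f)) xJ //.
  by apply: (addrI (u f 0)); rewrite -uD !addr0.
Qed.

(** Nilpotence of the maximal ideal is stated through products of sequences, the form in which the
    inductions of [nil_nakayama] and [section_rel] consume it. *)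
Definition nil_local (B : comNzRingType) (n : nat) :=
  (forall x y : B, nonunit x -> nonunit y -> nonunit (x + y)) /\
  forall s : seq B, (n <= size s)%N -> (forall b, b \in s -> nonunit b) -> \prod_(b <- s) b = 0.

(** Induction on the number of nonunits that s still lacks: approximating y by an element of D
    appends one nonunit to s, and a product of n nonunits vanishes. *)
Lemma nil_nakayama (B : comNzRingType) n (M : lmodType B) (D : M -> Prop) : nil_local B n ->
  D 0 -> (forall x y, D x -> D y -> D (x + y)) -> (forall b x, D x -> D (b *: x)) ->
  (forall x, exists2 d, D d & max_mul (x - d)) -> forall x, D x.
Proof.
move=> [_ nil] D0 DD DZ hD x.
suff key k (s : seq B) y : (n <= size s + k)%N -> (forall b, b \in s -> nonunit b) ->
    D ((\prod_(b <- s) b) *: y).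
  by have := key n [::] x (leqnn n); rewrite big_nil scale1r; apply.
elim: k s y => [|k IH] s y ns sn.
  by rewrite nil ?scale0r //; rewrite addn0 in ns.
have [d Dd [l [r [z [rn e]]]]] := hD y.
rewrite -(subrK d y) e scalerDr; apply: (DD _ _ _ (DZ _ _ Dd)).
rewrite scaler_sumr; apply: (big_rec D) => // i v _ Dv; apply: (DD _ _ _ Dv).
rewrite scalerA mulrC -[r i * _](big_cons _ _ (r i) s xpredT id); apply: IH.
  by rewrite /= addSnnS.
by move=> b; rewrite inE => /predU1P [->|/sn].
Qed.

Lemma max_mul_unit (B : comNzRingType) n (E : comAlgType B) (z : E) : nil_local B n ->
  max_mul z -> exists w, w * (1 + z) = 1.
Proof.
move=> hB hz; suff [w e] : exists w, 1 = w * (1 + z) by exists w.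
apply: (nil_nakayama (D := fun x => exists w, x = w * (1 + z)) hB) => [|_ _ [v ->] [w ->]|b _ [w ->]|x].
- by exists 0; rewrite mul0r.
- by exists (v + w); rewrite mulrDl.
- by exists (b *: w); rewrite scalerAl.
- exists (x * (1 + z)); first by exists x.
  by rewrite mulrDr mulr1 opprD addrA subrr sub0r; apply: max_mulN; apply: max_mul_mulr.
Qed.

Lemma max_mul_prod (B : comNzRingType) (E : comAlgType B) (I : Type) (s : seq I) (P : pred I)
    (F F' : I -> E) : (forall i, max_mul (F i - F' i)) ->
  max_mul (\prod_(i <- s | P i) F i - \prod_(i <- s | P i) F' i).
Proof.
move=> h; elim/big_rec2: _ => [|i x y _ hxy]; first by rewrite subrr; apply: max_mul0.
have -> : F i * y - F' i * x = (F i - F' i) * y + F' i * (y - x) by ring.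
by apply: max_mulD; [apply: max_mul_mul | apply: max_mul_mulr].
Qed.

Lemma max_mulX (B : comNzRingType) (E : comAlgType B) (x y : E) n :
  max_mul (x - y) -> max_mul (x ^+ n - y ^+ n).
Proof.
move=> h; have := @max_mul_prod B E _ (nseq n tt) xpredT (fun=> x) (fun=> y) (fun=> h).
by rewrite !big_const_seq !count_predT !size_nseq !iter_mulr_1.
Qed.

Lemma ev_congr (G : finZmodType) (R B : comNzRingType) (phi : {rmorphism R -> B})
    (E : comAlgType B) (xi xi' : G -> E) (h : {mpoly R[#|G|]}) :
  (forall p, max_mul (xi p - xi' p)) -> max_mul (ev phi xi h - ev phi xi' h).
Proof.
move=> hx; rewrite !evE -sumrB; apply: max_mul_sum => m _; rewrite -scalerBr.
by apply: max_mulZ; apply: max_mul_prod => p; apply: max_mulX.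
Qed.

(** * Charts as localised quotients of the polynomial ring *)

Section Universal.
Variables (G : finZmodType) (q : {additive (int * int)%type -> G}).
Variables (C : fieldType) (B : comAlgType C) (n : nat).
Hypothesis hB : nil_local B n.
Variables (eta : pair_deformation q B) (f : nonempty_face q) (J : {mpoly B[#|G|]} -> Prop).
Hypothesis hJ : is_ideal J.
Hypothesis hSR : forall h, SR_ideal q h -> ideal_sum J (max_mul (M := {mpoly B[#|G|]})) h.
Variable xi : G -> chart eta f.
Hypothesis xi_coord : forall p, max_mul (xi p - Defs.coord eta f p).
Hypothesis xiJ : forall h, J h -> ev idfun xi h = 0.
Local Notation P := (\prod_(p in sval f) xi p).
Local Notation idB := (idfun : {rmorphism B -> B}).
Local Notation xf := (xmon B (sval f)).

Lemma ev_xf : ev idfun xi xf = P. Proof. exact: (ev_xmon idB). Qed.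

Lemma section_unit : exists v, v * P = 1.
Proof.
have [y hy] := coord_unit eta f.
have hz : max_mul (y * P - 1).
  have -> : y * P - 1 = y * (P - \prod_(p in sval f) Defs.coord eta f p) +
      (y * \prod_(p in sval f) Defs.coord eta f p - 1) by ring.
  by apply: max_mulD hy; apply: max_mul_mulr; apply: max_mul_prod.
have [w] := max_mul_unit hB hz; rewrite addrC subrK mulrA => e.
by exists (w * y).
Qed.

Lemma section_gen z : exists N h, z * P ^+ N = ev idfun xi h.
Proof.
apply: (nil_nakayama (D := fun z => exists N h, z * P ^+ N = ev idfun xi h) hB)
    => [|x y [N [h hx]] [N' [h' hy]]|b x [N [h hx]]|{}z].
- by exists 0%N, 0; rewrite mul0r (ev0 idB).
- exists (N + N')%N, (h * xf ^+ N' + h' * xf ^+ N).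
  rewrite (evD idB) !(evM idB) !(evXn idB) ev_xf -hx -hy mulrDl exprD !mulrA; congr (_ + _).
  by rewrite mulrAC.
- by exists N, (b *: h); rewrite (evZ idB) -hx scalerAl.
have [N [h hz]] := coord_gen z; have [v hv] := section_unit.
have vN : v ^+ N * P ^+ N = 1 by rewrite -exprMn hv expr1n.
exists (v ^+ N * ev idfun xi h).
  by exists N, h; rewrite mulrAC vN mul1r.
have -> : z - v ^+ N * ev idfun xi h = v ^+ N * (z * P ^+ N - ev idfun xi h).
  by rewrite mulrBr mulrCA vN mulr1.
apply: max_mul_mulr.
have -> : z * P ^+ N - ev idfun xi h =
    z * (P ^+ N - (\prod_(p in sval f) Defs.coord eta f p) ^+ N) +
    (z * (\prod_(p in sval f) Defs.coord eta f p) ^+ N - ev idfun (Defs.coord eta f) h)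
    - (ev idfun xi h - ev idfun (Defs.coord eta f) h) by ring.
apply: max_mulB; last exact: (ev_congr idB).
by apply: max_mulD hz; apply: max_mul_mulr; apply: max_mulX; apply: max_mul_prod.
Qed.

(** Modulo the maximal ideal the relation is known, so a power of x_f times g lies in J up to a
    combination of some y i with nonunit coefficients. Flatness trivialises the relation that the
    values of the y i satisfy, so the y i can be changed into polynomials that evaluate to 0 again.
    Each round gains a nonunit, and nilpotence ends the induction. *)
Lemma section_rel h : ev idfun xi h = 0 -> exists N, J (xf ^+ N * h).
Proof.
have [_ nil] := hB.
have xfJ N M h' : J (xf ^+ N * h') -> J (xf ^+ (M + N) * h').
  by rewrite exprD -mulrA => /(idealMl (xf ^+ M) hJ).
suff key k (s : seq B) g : (n <= size s + k)%N -> (forall b, b \in s -> nonunit b) ->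
    ev idfun xi g = 0 -> exists N, J (xf ^+ N * ((\prod_(b <- s) b) *: g)).
  move=> eh; have := key n [::] h (leqnn n); rewrite big_nil scale1r; exact.
elim: k s g => [|k IH] s g ns sn eg.
  by exists 0%N; rewrite nil ?scale0r ?mulr0 //; [case: hJ | rewrite addn0 in ns].
have : max_mul (ev idfun (Defs.coord eta f) g).
  rewrite -[ev _ _ _]opprK -[- ev _ _ _]add0r -{1}eg; apply: max_mulN.
  exact: (ev_congr idB).
move/(coord_rel eta f g).1 => [N [g1 [g2 [/hSR [a [b [Ja mb ->]]] mg2 e]]]].
have {b mb g1 g2 mg2 e} [l [r [y [rn e]]]] : exists l (r : 'I_l -> B) y,
    (forall i, nonunit (r i)) /\ xf ^+ N * g = a + \sum_i r i *: y i.
  have [l [r [y [rn e']]]] := max_mulD mb mg2; exists l, r, y; split=> //.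
  by rewrite e -addrA e'.
have : \sum_i r i *: ev idfun xi (y i) = 0.
  have := congr1 (ev idfun xi) e; rewrite (evM idB) eg mulr0 (evD idB) xiJ // add0r (ev_sum idB).
  by move=> e0; rewrite [RHS]e0; apply: eq_bigr => i _; rewrite (evZ idB).
move/(chart_flat (f := f)) => [m [c [z [yE rc]]]].
have [M [h' hz]] : exists M (h' : 'I_m -> _), forall j, z j * P ^+ M = ev idfun xi (h' j).
  have /choice [Nh hNh] : forall j, exists Nh : nat * {mpoly B[#|G|]},
      z j * P ^+ Nh.1 = ev idfun xi Nh.2.
    by move=> j; have [N' [h' e']] := section_gen (z j); exists (N', h').
  exists (\sum_j (Nh j).1)%N, (fun j => (Nh j).2 * xf ^+ (\sum_(i | i != j) (Nh i).1)) => j.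
  by rewrite (evM idB) (evXn idB) ev_xf -hNh (bigD1 j) //= exprD mulrA.
pose y' i := xf ^+ M * y i - \sum_j c i j *: h' j.
have ey' i : ev idfun xi (y' i) = 0.
  rewrite (evB idB) (evM idB) (evXn idB) ev_xf (ev_sum idB).
  have /eqP := yE i; rewrite subr_eq0 => /eqP ->; rewrite mulr_sumr.
  apply/eqP; rewrite subr_eq0; apply/eqP; apply: eq_bigr => j _.
  by rewrite (evZ idB) -hz -scalerAr mulrC.
have e2 : xf ^+ (M + N) * g = xf ^+ M * a + \sum_i r i *: y' i.
  rewrite exprD -mulrA e mulrDr; congr (_ + _); rewrite mulr_sumr.
  under [RHS]eq_bigr do rewrite scalerBr.
  rewrite sumrB; under [LHS]eq_bigr do rewrite -scalerAr.
  rewrite [X in _ - X](_ : _ = 0) ?subr0 //.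
  under eq_bigr do rewrite scaler_sumr.
  rewrite exchange_big big1 // => j _; under eq_bigr do rewrite scalerA.
  by rewrite -scaler_suml rc scale0r.
have /choice [K hK] : forall i, exists K, J (xf ^+ K * ((\prod_(b <- r i :: s) b) *: y' i)).
  move=> i; apply: IH => //; first by rewrite /= addSnnS.
  by move=> b; rewrite inE => /predU1P [->|/sn].
exists ((\sum_i K i) + (M + N))%N; rewrite exprD -mulrA -scalerAr e2 scalerDr mulrDr.
apply: idealD => //.
  by rewrite -mul_mpolyC; do 3 apply: idealMl => //.
rewrite scaler_sumr mulr_sumr; apply: ideal_bigsum => // i _.
have := hK i; rewrite big_cons (bigD1 i) //= addnC => /xfJ; rewrite scalerA mulrC.
by rewrite mulrC [r i * _]mulrC; apply.
Qed.

Section Map.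
Variables (T : comNzRingType) (s : {rmorphism B -> T}) (y : G -> T).
Local Notation mv := (mmap s (fun i => y (enum_val i))).
Hypothesis yJ : forall h, J h -> mv h = 0.
Hypothesis y_unit : exists v, v * \prod_(p in sval f) y p = 1.

Lemma mv_xf : mv xf = \prod_(p in sval f) y p.
Proof.
rewrite rmorph_prod; apply: eq_bigr => p _.
by rewrite /= mmapX mmap1U enum_rankK.
Qed.

(** By [section_gen] and [section_rel] the chart is the localisation of B[x]/J at x_f. The map is
    obtained from its graph [gr], and its properties are listed one by one because it is linear only
    along s. *)
Lemma universal_map : exists u : chart eta f -> T,
  [/\ forall x z, u (x + z) = u x + u z, forall x z, u (x * z) = u x * u z, u 1 = 1,
      forall b x, u (b *: x) = s b * u x & forall h, u (ev idfun xi h) = mv h].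
Proof.
have [v hv] := y_unit; have vN N : v ^+ N * mv xf ^+ N = 1 by rewrite -exprMn mv_xf hv expr1n.
pose gr z a := exists N h, z * P ^+ N = ev idfun xi h /\ a * mv xf ^+ N = mv h.
have gr_fun z a b : gr z a -> gr z b -> a = b.
  move=> [N [h [e1 e2]]] [M [g [e3 e4]]].
  have : ev idfun xi (h * xf ^+ M - g * xf ^+ N) = 0.
    rewrite (evB idB) !(evM idB) !(evXn idB) ev_xf -e1 -e3.
    by rewrite -!mulrA -!exprD addnC subrr.
  move/section_rel => [K /yJ]; rewrite rmorphM rmorphB !rmorphM !rmorphXn /= -e2 -e4.
  move=> e; have {}e : v ^+ (K + (N + M)) * (mv xf ^+ K * (a * mv xf ^+ N * mv xf ^+ M -
      b * mv xf ^+ M * mv xf ^+ N)) = 0 by rewrite e mulr0.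
  apply/eqP; rewrite -subr_eq0; apply/eqP; rewrite -e.
  rewrite -[a - b]mul1r -(vN (K + (N + M))%N) !exprD; ring.
have gr_ex z : exists a, gr z a.
  have [N [h e]] := section_gen z; exists (v ^+ N * mv h), N, h; split=> //.
  by rewrite mulrAC vN mul1r.
have /choice [u hu] := gr_ex.
have uE z a : gr z a -> u z = a by apply: gr_fun.
exists u; split.
- move=> x z; apply: uE; have [N [h [e1 e2]]] := hu x; have [M [g [e3 e4]]] := hu z.
  exists (N + M)%N, (h * xf ^+ M + g * xf ^+ N); split.
    by rewrite (evD idB) !(evM idB) !(evXn idB) ev_xf -e1 -e3 exprD; ring.
  by rewrite rmorphD !rmorphM !rmorphXn /= -e2 -e4 exprD; ring.
- move=> x z; apply: uE; have [N [h [e1 e2]]] := hu x; have [M [g [e3 e4]]] := hu z.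
  exists (N + M)%N, (h * g); split.
    by rewrite !(evM idB) -e1 -e3 exprD; ring.
  by rewrite rmorphM /= -e2 -e4 exprD; ring.
- by apply: uE; exists 0%N, 1; rewrite !expr0 !mul1r (ev1 idB) rmorph1.
- move=> b x; apply: uE; have [N [h [e1 e2]]] := hu x; exists N, (b *: h); split.
    by rewrite (evZ idB) -e1 scalerAl.
  by rewrite -mul_mpolyC rmorphM /= mmapC -e2 mulrA.
- by move=> h; apply: uE; exists 0%N, h; rewrite !expr0 !mulr1.
Qed.

End Map.
End Universal.

(** * Homogeneous elements of the charts *)

Section Grading.
Variables (G : finZmodType) (q : {additive (int * int)%type -> G}).
Variables (C : fieldType) (B : comAlgType C) (eta : pair_deformation q B) (f : nonempty_face q).
Implicit Types (x y z : chart eta f) (d : int).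

Lemma hdegD d x y : hdeg d x -> hdeg d y -> hdeg d (x + y).
Proof. by move=> hx hy; rewrite -[x]scale1r; apply: hdeg_lin. Qed.

Lemma hdegZ d b x : hdeg d x -> hdeg d (b *: x).
Proof. by move=> hx; rewrite -[_ *: _]addr0; apply: hdeg_lin (hdeg_0 _ _ _). Qed.

Lemma hdegN d x : hdeg d x -> hdeg d (- x).
Proof. by move=> hx; rewrite -scaleN1r; apply: hdegZ. Qed.

Lemma hdeg_sum d (I : Type) (s : seq I) (P : pred I) (F : I -> chart eta f) :
  (forall i, P i -> hdeg d (F i)) -> hdeg d (\sum_(i <- s | P i) F i).
Proof.
move=> h; apply: (big_ind (fun x => hdeg d x)) => //; first exact: hdeg_0.
by move=> x y; apply: hdegD.
Qed.

Lemma hdegX d x n : hdeg d x -> hdeg (d *+ n) (x ^+ n).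
Proof.
move=> hx; elim: n => [|n IH]; first by rewrite mulr0n expr0; apply: hdeg_1.
by rewrite mulrS exprS; apply: hdeg_mul.
Qed.

Lemma hdeg_prod (I : Type) (s : seq I) (P : pred I) (F : I -> chart eta f) (D : I -> int) :
  (forall i, P i -> hdeg (D i) (F i)) ->
  hdeg (\sum_(i <- s | P i) D i) (\prod_(i <- s | P i) F i).
Proof.
by move=> h; elim/big_rec2: _ => [|i x y Pi]; [apply: hdeg_1 | apply/hdeg_mul/h].
Qed.

Lemma hdeg_component (s : seq int) (c : int -> chart eta f) d : uniq s ->
  (forall e, hdeg e (c e)) -> hdeg d (\sum_(e <- s) c e) ->
  \sum_(e <- s) c e = if d \in s then c d else 0.
Proof.
move=> us hc; set z := \sum_(e <- s) c e => hz; case: ifP => ds.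
  apply/eqP; rewrite eq_sym -subr_eq0; apply/eqP.
  have := @hdeg_direct _ _ _ _ eta f s (fun e => if e == d then c d - z else c e) us _ _ d ds.
  rewrite eqxx; apply => [e|].
    by case: (e =P d) => [->|_] //; apply: hdegD (hc d) (hdegN hz).
  rewrite (bigD1_seq d) //= eqxx (eq_bigr c); last by move=> e /negbTE ->.
  by rewrite addrAC -(bigD1_seq (F := c) d ds us) subrr.
have := @hdeg_direct _ _ _ _ eta f (d :: s) (fun e => if e == d then - z else c e) _ _ _ d.
rewrite eqxx => h; rewrite -[z]opprK h ?oppr0 ?mem_head //=; first by rewrite ds.
  by move=> e; case: (e =P d) => [->|_] //; apply: hdegN.
rewrite big_cons eqxx big_seq (eq_bigr c) -?big_seq ?addNr // => e es.
by case: eqP => // ed; rewrite -ed es in ds.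
Qed.

(** Comparing components of degree 0 in y x = 1 shows that the component of y of degree - d is
    already an inverse of x. *)
Lemma hdeg_inv d x y : hdeg d x -> y * x = 1 -> hdeg (- d) y.
Proof.
move=> hx yx; have [s [c [us hc yE]]] := hdeg_span y.
have e : \sum_(e <- [seq e + d | e <- s]) c (e - d) * x = 1.
  by rewrite big_map -yx {1}yE mulr_suml; apply: eq_bigr => e _; rewrite addrK.
have := @hdeg_component [seq e + d | e <- s] (fun e => c (e - d) * x) 0.
rewrite map_inj_uniq => [/(_ us)|]; last exact: addIr.
rewrite e => /(_ (fun k => _) (hdeg_1 _ _)); case: ifP => _ /(_ _) h.
  have {}h : c (- d) * x = 1.
    by rewrite h ?sub0r // => k; rewrite -{1}(subrK d k); apply: hdeg_mul.
  have -> : y = c (- d) by rewrite -[LHS]mulr1 -h mulrCA yx mulr1.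
  exact: hc.
have : 1 = 0 :> chart eta f.
  by apply: h => k; rewrite -{1}(subrK d k); apply: hdeg_mul.
by move/eqP; rewrite oner_eq0.
Qed.

Lemma ev_homog (R : comNzRingType) (phi : {rmorphism R -> B}) (xi : G -> chart eta f)
    (h : {mpoly R[#|G|]}) k : (forall p, hdeg 1 (xi p)) -> h \is k.-homog ->
  hdeg k%:Z (ev phi xi h).
Proof.
move=> hxi /dhomogP hh; rewrite evE big_seq; apply: hdeg_sum => m /hh mk; apply: hdegZ.
have -> : k%:Z = \sum_p 1 *+ m (enum_rank p).
  have {}mk : mdeg m = k := mk.
  have -> : k = (\sum_i m i)%N by rewrite -mk mdegE.
  rewrite (reindex_onto enum_rank enum_val) /=; last by move=> i _; rewrite enum_valK.
  rewrite (big_morph Posz PoszD (erefl _)); apply: eq_big => [p|p _]; first by rewrite enum_rankK eqxx.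
  by rewrite natz.
by apply: hdeg_prod => p _; apply: hdegX.
Qed.

Lemma ev_component (R : comNzRingType) (phi : {rmorphism R -> B}) (xi : G -> chart eta f)
    (h : {mpoly R[#|G|]}) d : (forall p, hdeg 1 (xi p)) -> hdeg d (ev phi xi h) ->
  exists g : {mpoly R[#|G|]}, [/\ ev phi xi h = ev phi xi g &
    g = 0 \/ exists2 k, d = k%:Z & g \is k.-homog].
Proof.
move=> hxi hd; pose n := msize h.
pose c (e : int) := if e is Posz k then ev phi xi (pihomog mdeg k h) else 0.
have hE : ev phi xi h = \sum_(e <- [seq Posz k | k <- index_iota 0 n]) c e.
  rewrite big_map big_mkord {1}(pihomog_partitionE (leqnn n)).
  by rewrite ev_sum.
have us : uniq [seq Posz k | k <- index_iota 0 n] by rewrite map_inj_uniq ?iota_uniq // => i j [].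
have hc e : hdeg e (c e).
  by case: e => k; [apply: ev_homog => //; apply: pihomogP | apply: hdeg_0].
move: hd; rewrite hE => /(hdeg_component us hc) ->.
case: ifP => [/mapP [k _ ->]|_]; last by exists 0; rewrite ev0; split=> //; left.
by exists (pihomog mdeg k h); split=> //; right; exists k => //; apply: pihomogP.
Qed.

End Grading.

Lemma res_ev (G : finZmodType) (q : {additive (int * int)%type -> G}) (C : fieldType)
    (R : comNzRingType) (B : comAlgType C) (phi : {rmorphism R -> B})
    (eta : pair_deformation q B) (xi : forall f : nonempty_face q, G -> chart eta f)
    (hr : forall (f g : nonempty_face q) (s : sval f \subset sval g) p,
      res eta s (xi f p) = xi g p)
    (f g : nonempty_face q) (s : sval f \subset sval g) h :
  res eta s (ev phi (xi f) h) = ev phi (xi g) h.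
Proof.
rewrite (ev_push phi (pi := idfun) (u := res eta s)) //=.
- by rewrite (_ : (fun p => res eta s (xi f p)) = xi g) //; apply: funext => p.
- exact: rmorphD.
- exact: rmorphM.
- exact: rmorph1.
- by move=> b y; rewrite linearZ.
Qed.

(** The sections of the first deformation present its charts, so sending them to those of the second
    one defines the maps. This compares the given first order deformation with the toric one. *)
Lemma induced_morphism (G : finZmodType) (q : {additive (int * int)%type -> G})
    (C : fieldType) (B : comAlgType C) n (J : {mpoly B[#|G|]} -> Prop)
    (eta1 eta2 : pair_deformation q B) : nil_local B n -> is_ideal J ->
  (forall h, SR_ideal q h -> ideal_sum J (max_mul (M := {mpoly B[#|G|]})) h) ->
  induces J idfun eta1 -> induces J idfun eta2 ->
  exists u : forall f : nonempty_face q, chart eta1 f -> chart eta2 f,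
    pair_morphism (idfun : B -> B) u.
Proof.
move=> hB hJ hSR [xi1 [d1 r1 c1 J1]] [xi2 [d2 r2 c2 J2]].
have unit1 f := section_unit hB (c1 f); have unit2 f := section_unit hB (c2 f).
have gen1 f := section_gen hB (c1 f).
pose spec f (u : chart eta1 f -> chart eta2 f) :=
    [/\ forall x z, u (x + z) = u x + u z, forall x z, u (x * z) = u x * u z, u 1 = 1,
      forall b x, u (b *: x) = (in_alg (chart eta2 f) b) * u x &
      forall h, u (ev idfun (xi1 f) h) = ev idfun (xi2 f) h].
have H f : exists u, spec f u.
  exact: (universal_map hB hJ hSR (c1 f) (J1 f) (s := in_alg (chart eta2 f)) (J2 f) (unit2 f)).
pose u f := sval (cid (H f)).
have hu f : spec f (u f) := svalP (cid (H f)).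
have uD f x z : u f (x + z) = u f x + u f z by case: (hu f).
have uM f x z : u f (x * z) = u f x * u f z by case: (hu f).
have u1 f : u f 1 = 1 by case: (hu f).
have uZ f b x : u f (b *: x) = b *: u f x.
  by case: (hu f) => _ _ _ h _; rewrite h /= mulr_algl.
have uev f h : u f (ev idfun (xi1 f) h) = ev idfun (xi2 f) h by case: (hu f).
have uX f x k : u f (x ^+ k) = u f x ^+ k.
  by elim: k => [|k IH]; rewrite ?expr0 ?u1 // !exprS uM IH.
have uxi f p : u f (xi1 f p) = xi2 f p.
  by have := uev f (xvar B p); rewrite !(ev_xvar (idfun : {rmorphism B -> B})).
have uprod f (F : {set G}) : u f (\prod_(p in F) xi1 f p) = \prod_(p in F) xi2 f p.
  by rewrite -!(ev_xmon (idfun : {rmorphism B -> B})) uev.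
exists u; split=> //.
- move=> f d x hx; have [N [h e]] := gen1 f x.
  have [v hv] := unit2 f; pose k := \sum_(p in sval f) 1 : int.
  have hP1 : hdeg k (\prod_(p in sval f) xi1 f p) by apply: hdeg_prod => p _; apply: d1.
  have hP2 : hdeg k (\prod_(p in sval f) xi2 f p) by apply: hdeg_prod => p _; apply: d2.
  have : hdeg (d + k *+ N) (ev idfun (xi1 f) h).
    by rewrite -e; apply: hdeg_mul => //; apply: hdegX.
  move/(ev_component (phi := (idfun : {rmorphism B -> B})) (d1 f)) => [g [eg hg]].
  have {}hg : hdeg (d + k *+ N) (ev idfun (xi2 f) g).
    case: hg => [->|[l -> hl]]; first by rewrite (ev0 (idfun : {rmorphism B -> B})); apply: hdeg_0.
    by apply: (ev_homog (idfun : {rmorphism B -> B})).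
  have e2 : u f x * (\prod_(p in sval f) xi2 f p) ^+ N = ev idfun (xi2 f) g.
    by rewrite -uprod -uX -uM e eg uev.
  have -> : u f x = v ^+ N * ev idfun (xi2 f) g.
    by rewrite -e2 mulrCA -exprMn hv expr1n mulr1.
  have -> : d = (- k) *+ N + (d + k *+ N) by rewrite mulNrn addrCA addNr addr0.
  by apply: hdeg_mul => //; apply: hdegX; apply: hdeg_inv hP2 hv.
- move=> f g s x; have [N [h e]] := gen1 f x; have [v hv] := unit2 f.
  have resP (eta : pair_deformation q B) (xi : forall f : nonempty_face q, G -> chart eta f)
      (hr : forall (f g : nonempty_face q) (s : sval f \subset sval g) p,
        res eta s (xi f p) = xi g p) :
      res eta s (\prod_(p in sval f) xi f p) = \prod_(p in sval f) xi g p.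
    by rewrite -!(ev_xmon (idfun : {rmorphism B -> B})) (res_ev _ hr).
  have rE (eta : pair_deformation q B) (xi : forall f : nonempty_face q, G -> chart eta f)
      (hr : forall (f g : nonempty_face q) (s : sval f \subset sval g) p,
        res eta s (xi f p) = xi g p) y :
      y * (\prod_(p in sval f) xi f p) ^+ N = ev idfun (xi f) h ->
      res eta s y * (\prod_(p in sval f) xi g p) ^+ N = ev idfun (xi g) h.
    move=> ey; rewrite -(res_ev (idfun : {rmorphism B -> B}) hr s) -ey rmorphM rmorphXn /=.
    by rewrite resP.
  have e1 : u g (res eta1 s x) * (\prod_(p in sval f) xi2 g p) ^+ N = ev idfun (xi2 g) h.
    by rewrite -uprod -uX -uM (rE _ _ r1 _ e) uev.
  have e2 : res eta2 s (u f x) * (\prod_(p in sval f) xi2 g p) ^+ N = ev idfun (xi2 g) h.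
    by apply: (rE _ _ r2); rewrite -uprod -uX -uM e uev.
  have vN : (\prod_(p in sval f) xi2 g p) ^+ N * res eta2 s v ^+ N = 1.
    rewrite -exprMn mulrC -(resP eta2 xi2 r2).
    have -> : res eta2 s v * res eta2 s (\prod_(p in sval f) xi2 f p) = 1.
      by have := congr1 (res eta2 s) hv; rewrite rmorphM rmorph1.
    by rewrite expr1n.
  by rewrite -[LHS]mulr1 -vN mulrA e1 -e2 -mulrA vN mulr1.
- move=> f p; have -> : u f (Defs.coord eta1 f p) - Defs.coord eta2 f p =
      u f (- (xi1 f p - Defs.coord eta1 f p)) + (xi2 f p - Defs.coord eta2 f p).
    have uN y : u f (- y) = - u f y by rewrite -scaleN1r uZ scaleN1r.
    by rewrite opprB uD uN uxi addrA subrK.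
  apply: max_mulD (c2 f p).
  by apply: (max_mul_map (g := id) (uD f) (uZ f)) => //; apply: max_mulN.
Qed.

(** * First order deformations *)

Lemma edge_link_eray (G : finZmodType) (q : {additive (int * int)%type -> G}) b s :
  edge_link q (eray q b s) = [set nb q b (rnext s); nb q b (rprev s)].
Proof.
have [i3a i3b i3c] : [/\ (0 + 1 = 1 :> 'I_3) /\ (0 - 1 = 2 :> 'I_3), (1 + 1 = 2 :> 'I_3) /\ (1 - 1 = 0 :> 'I_3)
    & (2 + 1 = 0 :> 'I_3) /\ (2 - 1 = 1 :> 'I_3)].
  by do !split; apply: val_inj.
have t0 : tau q 0 + tau q 1 + tau q 2 = 0 by rewrite tau2E -opprD subrr.
have e3 (x y z : G) : x + y + z = 0 -> b - x - y = b + z.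
  by move=> h; rewrite -addrA; congr (_ + _); apply/eqP; rewrite -opprD eq_sym -subr_eq0 opprK addrC h.
have [t1 t2 t3] : [/\ tau q 2 + tau q 0 + tau q 1 = 0, tau q 1 + tau q 2 + tau q 0 = 0 &
  tau q 1 + tau q 0 + tau q 2 = 0].
  by split; rewrite -t0; [rewrite -addrA addrC | rewrite addrC addrA | rewrite [tau q 1 + _]addrC].
have [t4 t5] : tau q 2 + tau q 1 + tau q 0 = 0 /\ tau q 0 + tau q 2 + tau q 1 = 0.
  by split; [rewrite -t2 [tau q 2 + _]addrC | rewrite -t1 [tau q 0 + _]addrC].
case: i3a i3b i3c => [a1 a2] [b1 b2] [c1 c2].
rewrite /nb !q_rvec; apply/setP => x; case: s => /=; rewrite ?(a1, a2, b1, b2, c1, c2) !inE.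
- by rewrite orbC.
- by rewrite (e3 _ _ _ t1) (e3 _ _ _ t4).
- by rewrite orbC.
- by rewrite (e3 _ _ _ t0) (e3 _ _ _ t5).
- by rewrite orbC.
- by rewrite (e3 _ _ _ t2) (e3 _ _ _ t3).
Qed.

Lemma flag_ex (G : finZmodType) (q : {additive (int * int)%type -> G}) (e : edge G) b :
  b \in edge_ends q e -> exists s, eray q b s = e.
Proof.
case: e => p k; rewrite /edge_ends !inE /=.
have [->|[->|->]] : k = 0 \/ (k = 1 \/ k = 2).
  by case: k => [[|[|[|//]]] i]; [left|right; left|right; right]; apply: val_inj.
- by move=> /orP [] /eqP ->; [exists R0 | exists R3]; rewrite /= ?addrK.
- by move=> /orP [] /eqP ->; [exists R2 | exists R5]; rewrite /= ?addrK.
- by move=> /orP [] /eqP ->; [exists R4 | exists R1]; rewrite /= ?addrK.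
Qed.

Definition ray_expo (e : expo) (r : ray) : nat :=
  let i := `|e.1|%N in let x := `|e.2.1|%N in let y := `|e.2.2.1|%N in let z := `|e.2.2.2|%N in
  let i0 := minn i x in let i1 := minn (i - i0) y in let i2 := minn (i - i0 - i1) z in
  match r with R0 => i0 | R3 => x - i0 | R2 => i1 | R5 => y - i1 | R4 => i2 | R1 => z - i2 end.

Lemma tmE (B : comNzRingType) (w : ray -> B) e : tm w e = \prod_(r <- rays) w r ^+ ray_expo e r.
Proof.
rewrite /tm /hexp /hmon /ray_expo /rays !big_cons big_nil mulr1.
set a := _ ^+ _; set b := _ ^+ _; set c := _ ^+ _; set d := _ ^+ _; set x := _ ^+ _; set y := _ ^+ _.
by ring.
Qed.

(** Ray s points to the third vertex of the triangle that adjoins the triangle of r along the edge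
    s0. *)
Definition across (s0 r s : ray) : bool :=
  (s0 == r) && (s == rprev r) || (s0 == rnext r) && (s == rnext (rnext r)).

(** A finite check by computation. Crossing just the edge s0 costs its parameter once; any other
    passage costs a square or the parameter of another edge, and so vanishes to first order. *)
Lemma ray_expo_across c r s s0 : subcell c (CT r) -> compat c s -> s \notin crays (CT r) ->
  forall n, n = ray_expo (phi c (rvec s) - phi (CT r) (rvec s)) ->
  if across s0 r s then all (fun r' => n r' == (r' == s0)) rays
  else has (fun r' => (1 < n r') || (0 < n r') && (r' != s0))%N rays.
Proof.
suff: all (fun c => all (fun r => all (fun s => all (fun s0 =>
    [==> subcell c (CT r), compat c s, s \notin crays (CT r) =>
    let n := ray_expo (phi c (rvec s) - phi (CT r) (rvec s)) in
    if across s0 r s then all (fun r' => n r' == (r' == s0)) rays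
    else has (fun r' => (1 < n r') || (0 < n r') && (r' != s0))%N rays]) rays) rays) rays) cells.
  move=> /allP /(_ c (mem_cells c)) /allP /(_ r (mem_rays r)) /allP /(_ s (mem_rays s)).
  by move=> /allP /(_ s0 (mem_rays s0)) /implyP h /h /implyP {}h /h /implyP {}h /h {}h n ->.
by vm_compute.
Qed.

Lemma tm_across (B : comNzRingType) (w : ray -> B) (z : B) c r s s0 : z * z = 0 ->
  (forall r', w r' = if r' == s0 then z else 0) ->
  subcell c (CT r) -> compat c s -> s \notin crays (CT r) ->
  tm w (phi c (rvec s) - phi (CT r) (rvec s)) = if across s0 r s then z else 0.
Proof.
move=> z2 hw h1 h2 h3; rewrite tmE.
have := ray_expo_across s0 h1 h2 h3 erefl; set n := ray_expo _; clearbody n; case: ifP => _.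
  move=> /allP h; rewrite (bigD1_seq s0) ?mem_rays //= hw eqxx.
  have /eqP -> := h s0 (mem_rays s0); rewrite eqxx expr1 big_seq_cond big1 ?mulr1 // => r'.
  by move=> /andP [/h /eqP -> /negbTE ->]; rewrite expr0.
move=> /hasP [r' _ h]; rewrite (bigD1_seq r') ?mem_rays //= [_ ^+ n r'](_ : _ = 0) ?mul0r //.
rewrite hw; case/orP: h => [h|/andP [h /negbTE ->]]; last by case: (n r') h => // k _; rewrite expr0n.
case: ifP => _; last by case: (n r') h => // k _; rewrite expr0n.
by rewrite -(subnK h) exprD expr2 z2 mulr0.
Qed.

Lemma phi_triangle c u : exists2 r, subcell c (CT r) & phi c u = phi (CT r) u.
Proof.
case: c => [|s|s]; last by exists s; case: (s).
  by have [r hr] := cone_cover u; exists r => //; apply: phi_cone hr.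
case: (lerP 0 (rdet s u)) => h.
  exists s; first by case: (s).
  apply/eqP; rewrite -subr_eq0 phi_CE_CT /ipos (_ : Num.max _ _ = 0); last by lia.
  by case: (s).
exists (rprev s); first by case: (s).
apply/eqP; rewrite -subr_eq0 phi_CE_CTp /ipos (_ : Num.max _ _ = 0); last by lia.
by case: (s).
Qed.

Lemma dual_nonunit (C : fieldType) (B : comAlgType C) (eps : B) (b : B) : dual_numbers eps ->
  nonunit b <-> exists d : C, b = d *: eps.
Proof.
move=> [_ ee span]; split=> [nb|[d -> [s /(congr1 (fun x => x * x))]]].
  have [c [d bE]] := span b; exists d; case: (eqVneq c 0) bE => [->|c0] bE.
    by rewrite bE scale0r add0r.
  case: nb; exists (c^-1%:A - (d / c ^+ 2) *: eps); rewrite bE mulrDl !mulrBr.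
  rewrite -!scalerAl -!scalerAr !mul1r mulr1 ee !scaler0 subr0 !scalerA divff // scale1r.
  rewrite addrAC -addrA -scalerBl [_ - _](_ : _ = 0) ?scale0r ?addr0 //.
  by field.
have -> : d *: eps * s * (d *: eps * s) = d *: (d *: (eps * eps * (s * s))).
  by rewrite -!scalerAl -scalerAr; congr (_ *: (_ *: _)); ring.
by rewrite ee mul0r !scaler0 mulr1 => /eqP; rewrite eq_sym oner_eq0.
Qed.

Lemma dual_nil_local (C : fieldType) (B : comAlgType C) (eps : B) : dual_numbers eps ->
  nil_local B 2.
Proof.
move=> he; have nP b := dual_nonunit b he; have [_ ee _] := he; split=> [x y|s].
  move=> /nP [c ->] /nP [d ->]; apply/nP; exists (c + d); exact: esym (scalerDl _ _ _).
case: s => [|x [|y s]] // _ h; rewrite !big_cons.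
have /nP [c ->] := h x (mem_head _ _).
have /nP [d ->] : nonunit y by apply: h; rewrite !inE eqxx orbT.
by rewrite mulrA -scalerAl -scalerAr ee !scaler0 mul0r.
Qed.

Section FirstOrder.
Variables (G : finZmodType) (q : {additive (int * int)%type -> G}).
Hypothesis poly : polyhedral q.
Variables (C : fieldType) (B : comAlgType C) (eps : B) (e0 : edge G) (t : edge G -> B).
Hypothesis heps : dual_numbers eps.
Hypothesis tE : forall e, t e = if e == e0 then - eps else 0.
Hypothesis tmin : minor_relations q t.
Local Notation W := (int * (int * int))%type.
Local Notation face := (nonempty_face q).
Local Notation tcoc := (tcoc tmin).
Local Notation tchart := (tchart tmin).
Local Notation tb f w := (tbas (tcoc f) w).
Local Notation base f := (bpt (sval f)).
Local Notation tcoord := (tcoord tmin).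
Local Notation idB := (idfun : {rmorphism B -> B}).
Implicit Types (f g : face) (b u v w p : G).

Lemma first_nonunit : nonunit (- eps).
Proof. by apply/(dual_nonunit _ heps); exists (- 1); rewrite scaleN1r. Qed.

Lemma eps_max f (x : tchart f) : max_mul x -> eps *: x = 0.
Proof.
move=> [k [r [y [rn ->]]]]; rewrite scaler_sumr big1 // => i _.
have /(dual_nonunit _ heps) [d ->] := rn i; rewrite scalerA.
by case: heps => _ ee _; rewrite -scalerAr ee scaler0 scale0r.
Qed.

Lemma eps_congr f (x y : tchart f) : max_mul (x - y) -> eps *: x = eps *: y.
Proof. by move/eps_max/eqP; rewrite scalerBr subr_eq0 => /eqP. Qed.

Lemma tn0 e : nonunit (t e).
Proof. by rewrite tE; case: ifP => _; [apply: first_nonunit | apply: nonunit0]. Qed.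

Definition opp v w := [&& v \in edge_link q e0, w \in edge_link q e0 & v != w].

Lemma flag_ends b s : eray q b s = e0 -> edge_ends q e0 = [set b; nb q b s].
Proof. by move=> <-; apply: edge_ends_eray. Qed.

Lemma flag_link b s : eray q b s = e0 ->
  edge_link q e0 = [set nb q b (rnext s); nb q b (rprev s)].
Proof. by move=> <-; apply: edge_link_eray. Qed.

Lemma wt_flag b s r : eray q b s = e0 -> wt q t b r = if r == s then - eps else 0.
Proof. by move=> e; rewrite /wt tE -e (inj_eq (@eray_inj _ _ poly b)). Qed.

Lemma wt_noflag b r : b \notin edge_ends q e0 -> wt q t b r = 0.
Proof.
move=> be; rewrite /wt tE; case: eqP => // e.
by rewrite -e edge_ends_eray !inE eqxx in be.
Qed.

Lemma opp_face v w b (F : {set G}) : opp v w -> Defs.face q F -> v \in F -> w \in F ->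
  b \in edge_ends q e0 -> b \notin F.
Proof.
move=> /and3P [vl wl vw] FF vF wF /flag_ex [s es]; apply/negP => bF.
move: vl wl vF wF; rewrite (flag_link es) !inE -(cellofP poly FF bF).
have key : (rnext s \in crays (cellof q F b)) && (rprev s \in crays (cellof q F b)) = false.
  by case: (cellof q F b) => [|[]|[]]; case: (s).
move=> /orP [] /eqP vE /orP [] /eqP wE; move: vw; rewrite vE wE ?eqxx // => _;
  by rewrite !(mem_cset_nb poly) => h1 h2; rewrite h1 h2 in key.
Qed.

Lemma opp_third v w (F : {set G}) : opp v w -> Defs.face q F -> w \in F ->
  edge_ends q e0 \subset F -> F = w |: edge_ends q e0.
Proof.
move=> /and3P [_ wl _] FF wF eF; have [s es] : exists s, eray q e0.1 s = e0.
  by apply: flag_ex; rewrite !inE eqxx.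
move: eF wl; rewrite (flag_ends es) (flag_link es) finset.subUset !finset.sub1set => /andP [bF sF].
have e := cellofP poly FF bF.
have sc : s \in crays (cellof q F e0.1) by rewrite -(mem_cset_nb poly e0.1) e.
rewrite !inE => /orP [] /eqP wE; move: wF; rewrite -{1}e wE (mem_cset_nb poly) => wc.
  have cE : cellof q F e0.1 = CT s by move: sc wc; case: (cellof q F e0.1) => [|[]|[]]; case: (s).
  by rewrite -{1}e cE; apply/setP => x; rewrite !inE /= orbF orbA orbC.
have cE : cellof q F e0.1 = CT (rprev s).
  by move: sc wc; case: (cellof q F e0.1) => [|[]|[]]; case: (s).
rewrite -{1}e cE; apply/setP => x; rewrite !inE /= orbF.
by rewrite (_ : rnext (rprev s) = s) 1?orbCA //; case: (s).
Qed.

Lemma opp_ends_face v w : opp v w -> Defs.face q (v |: edge_ends q e0).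
Proof.
move=> /and3P [vl _ _]; have [s es] : exists s, eray q e0.1 s = e0.
  by apply: flag_ex; rewrite !inE eqxx.
rewrite (flag_ends es); move: vl; rewrite (flag_link es) !inE => /orP [] /eqP ->.
  apply: face_sub (cset_face poly e0.1 (CT s)); rewrite !finset.subUset !finset.sub1set.
  by rewrite !(mem_cset_nb poly) mem_cset_base /= !inE !eqxx orbT.
apply: face_sub (cset_face poly e0.1 (CT (rprev s))); rewrite !finset.subUset !finset.sub1set.
rewrite !(mem_cset_nb poly) mem_cset_base /= !inE !eqxx /=.
by rewrite (_ : rnext (rprev s) = s) ?eqxx ?orbT //; case: (s).
Qed.

(** The section x_p x_q / x_w, where p and q are the ends of e0. *)
Definition kelt f w : tchart f :=
  (\prod_(p in edge_ends q e0) tcoord f p) * tb f (- (1, dir q (base f) w)).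

(** Toric coordinates agree under restriction only modulo eps. The correction - eps x_p x_q / x_w
    for the vertex w of f opposite to v makes them compatible, and gives x_v x_w + eps x_p x_q = 0,
    the equation of the first order deformation. *)
Definition fcoord f v : tchart f :=
  tcoord f v + \sum_(w in sval f | opp v w) (- eps) *: kelt f w.

Lemma tb_inv f w : w \in sval f -> tb f (- (1, dir q (base f) w)) * tcoord f w = 1.
Proof. by move=> wf; rewrite (tcoord_in tmin wf) (tb_along poly _ _ wf) addNr tbas0. Qed.

(** For each weight w some triangle containing f has a linear function that agrees at w with the one
    of f ([phi_triangle]). Restriction to it keeps the coefficient at w and moves weights
    injectively. Hence equations can be checked on triangles, where there are no bends. *)
Lemma triangle_inj f (x : tchart f) :
  (forall g (s : sval f \subset sval g) r, sval g = cset q (base f) (CT r) -> tres s x = 0) ->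
  x = 0.
Proof.
move=> h; apply: twistedP => w; rewrite tcoef0.
have [r sc e] := phi_triangle (nf_cell f) w.2.
have ff : (cset q (base f) (CT r) != finset.set0) && Defs.face q (cset q (base f) (CT r)).
  by rewrite (cset_face poly) andbT; apply/set0Pn; exists (base f); apply: mem_cset_base.
pose g : face := exist (fun f : {set G} => (f != finset.set0) && Defs.face q f) _ ff.
have s : sval f \subset sval g.
  by rewrite -(cellofP poly (nf_face f) (nf_in f)) (cset_sub poly).
have inj : injective (tth f g).
  move=> [a a'] [c c'] h'; have h1 := congr1 fst h'; have := congr1 snd h'.
  by move: h1 => /= -> /addIr ->.
have := congr1 (tcoef (tth f g w)) (h g s r erefl); rewrite tcoef0 => <-.
have -> : tres s x = \sum_(v <- tsupp x) (tcoef v x * tps t f g v) *: tb g (tth f g v).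
  rewrite {1}(tsum x); elim/big_rec2: _ => [|v y z _ <-]; first exact: tres0.
  by rewrite tresD tresZ tres_tb scalerA.
rewrite tcoef_sum; case: (boolP (w \in tsupp x)) => wx; last first.
  rewrite big_seq big1 => [|v vx]; first by apply/eqP; rewrite -[_ == _]negbK tcoef_supp.
  rewrite tcoefZ tcoef_bas (inj_eq inj); case: eqP => [vw|_]; last by rewrite mulr0.
  by rewrite -vw vx in wx.
rewrite (bigD1_seq w) ?tsupp_uniq //= big1 => [|v vw]; last first.
  by rewrite tcoefZ tcoef_bas (inj_eq inj) (negbTE vw) mulr0.
rewrite tcoefZ tcoef_bas eqxx addr0 mulr1 /tps psiE.
have -> : cellof q (sval g) (base f) = CT r by exact: cellof_cset.
by rewrite -/(nf_cell f) e subrr tm0 mulr1.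
Qed.

Section Triangle.
Variables (g : face) (b0 : G) (r0 : ray).
Hypothesis gE : sval g = cset q b0 (CT r0).

Lemma triangle_cell b : b \in sval g -> exists r, cellof q (sval g) b = CT r.
Proof.
move=> bg; have := cellofP poly (nf_face g) bg; rewrite gE => e.
have [->|[s sc bE]] : b = b0 \/ exists2 s, s \in crays (CT r0) & b = nb q b0 s.
  by apply: mem_cset; rewrite -gE.
  by exists r0; apply: cellof_cset.
have b0g : b0 \in sval g by rewrite gE mem_cset_base.
have c0 : cellof q (sval g) b0 = CT r0 by rewrite gE; apply: cellof_cset.
rewrite bE -gE (cellof_rebase poly (nf_face g) b0g) c0 //=; case: ifP => _.
  by exists (rnext (rnext s)).
by exists (ropp s).
Qed.

Lemma triangle_star v : Defs.face q (v |: sval g) = (v \in sval g).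
Proof.
apply/idP/idP => [|vg]; last first.
  by rewrite (finset.setUidPr _) ?finset.sub1set ?(nf_face g).
move/(star_nb poly v (nf_face g) (nf_in g)) => [->|[s]]; first exact: nf_in.
have [r cE] := triangle_cell (nf_in g); rewrite cE => sr ->.
have := cellofP poly (nf_face g) (nf_in g); rewrite cE => e.
suff : nb q (base g) s \in cset q (base g) (CT r) by rewrite e.
by rewrite (mem_cset_nb poly); move: sr; case: (r); case: (s).
Qed.

Lemma triangle_coord0 v : v \notin sval g -> tcoord g v = 0.
Proof. by move=> vg; rewrite /tcoord triangle_star (negbTE vg). Qed.

Lemma triangle_mul (v w : W) : tb g v * tb g w = tb g (v + w).
Proof.
have [r cE] := triangle_cell (nf_in g).
rewrite tbasM; have -> : tcoc g v w = 1; last by rewrite scale1r.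
by apply: etrans (cstE _ _ _ _ _ _) _; rewrite /nf_cell cE phi_CT_delta tm0.
Qed.

Lemma triangle_kelt0 w : ~~ (edge_ends q e0 \subset sval g) -> kelt g w = 0.
Proof.
move=> /subsetPn [p pe pg]; rewrite /kelt (bigD1 p) //= triangle_coord0 //.
by rewrite !mul0r.
Qed.

Lemma fcoord_in v : v \in sval g -> fcoord g v = tcoord g v.
Proof.
move=> vg; rewrite /fcoord big1 ?addr0 // => w /andP [wg ow].
rewrite triangle_kelt0 ?scaler0 //; apply/subsetPn; exists e0.1; rewrite ?inE ?eqxx //.
by apply: (opp_face ow (nf_face g) vg wg); rewrite !inE eqxx.
Qed.

Lemma fcoord_out v : v \notin sval g ->
  fcoord g v = \sum_(w in sval g | opp v w) (- eps) *: kelt g w.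
Proof. by move=> vg; rewrite /fcoord triangle_coord0 ?add0r. Qed.

Lemma opp_uniq v w w' : opp v w -> opp v w' -> w = w'.
Proof.
have [s es] : exists s, eray q e0.1 s = e0 by apply: flag_ex; rewrite !inE eqxx.
rewrite /opp (flag_link es) !inE => /and3P [/orP [] /eqP -> /orP [] /eqP -> h1]
  /and3P [_ /orP [] /eqP -> h2] //; by rewrite eqxx in h1 h2.
Qed.

Lemma fcoord_opp v w : v \notin sval g -> w \in sval g -> opp v w ->
  fcoord g v = (- eps) *: kelt g w.
Proof.
move=> vg wg ow; rewrite fcoord_out // (bigD1 w) /=; last by rewrite wg.
rewrite big1 ?addr0 // => w' /andP [/andP [_ ow'] ww].
by rewrite (opp_uniq ow ow') eqxx in ww.
Qed.

Lemma triangle_third : edge_ends q e0 \subset sval g ->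
  exists v w, [/\ opp v w, w \in sval g & edge_link q e0 = [set v; w]].
Proof.
move=> eg; have [s es] : exists s, eray q e0.1 s = e0 by apply: flag_ex; rewrite !inE eqxx.
have bg : e0.1 \in sval g by apply: (fintype.subsetP eg); rewrite !inE eqxx.
have [r cE] := triangle_cell bg; have gC := cellofP poly (nf_face g) bg; rewrite cE in gC.
have memg r' : (nb q e0.1 r' \in sval g) = (r' \in crays (CT r)).
  by rewrite -gC (mem_cset_nb poly).
have sr : s \in crays (CT r).
  by rewrite -memg; apply: (fintype.subsetP eg); rewrite (flag_ends es) !inE eqxx orbT.
case: (eqVneq s r) => [sE|sE].
  exists (nb q e0.1 (rprev s)), (nb q e0.1 (rnext s)); rewrite /opp (flag_link es) memg.
  rewrite !inE !eqxx !(inj_eq (@nb_inj _ _ poly _)) finset.setUC sE; split=> //.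
    by case: (r).
  by rewrite eqxx orbT.
have {}sE : s = rnext r by move: sr; rewrite !inE (negbTE sE) => /eqP.
exists (nb q e0.1 (rnext s)), (nb q e0.1 (rprev s)); rewrite /opp (flag_link es) memg.
rewrite !inE !eqxx !(inj_eq (@nb_inj _ _ poly _)) sE; split=> //; by case: (r).
Qed.

(** Both terms vanish if the triangle does not contain e0, and also if m has a vertex outside the
    triangle other than the vertex v0 beyond e0. Otherwise m, not being a face, contains both
    vertices of the link of e0, and the two terms cancel. *)
Lemma relation_triangle (m : {set G}) : ~~ Defs.face q m ->
  ev idfun (fcoord g) (xmon B m + eps *: edge_hom q B e0 m) = 0.
Proof.
move=> mn.
have eF (S : {set G}) : eps *: \prod_(p in S) fcoord g p = eps *: \prod_(p in S) tcoord g p.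
  apply: eps_congr; apply: max_mul_prod => p; rewrite /fcoord addrAC subrr add0r.
  by apply: max_mul_sum => w _; apply: max_mul_nonunit; apply: first_nonunit.
have mg : ~~ (m \subset sval g) by apply: contra mn => /face_sub; apply; apply: nf_face.
rewrite (evD idB) (evZ idB) (ev_xmon idB).
have homE : eps *: ev idfun (fcoord g) (edge_hom q B e0 m) =
    if edge_link q e0 \subset m then eps *: (\prod_(p in m :\: edge_link q e0) tcoord g p *
      \prod_(p in edge_ends q e0) tcoord g p) else 0.
  rewrite /edge_hom; case: ifP => _; last by rewrite (ev0 idB) scaler0.
  rewrite -mulrA !(evM idB) (ev_xmon idB) !(ev_xvar idB).
  have -> : fcoord g e0.1 * fcoord g (e0.1 + tau q e0.2) = \prod_(p in edge_ends q e0) fcoord g p.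
    rewrite /edge_ends big_setU1 ?big_set1 //= inE.
    have [s es] : exists s, eray q e0.1 s = e0 by apply: flag_ex; rewrite !inE eqxx.
    have := edge_ends_eray q e0.1 s; rewrite es => /setP /(_ (e0.1 + tau q e0.2)).
    rewrite !inE eqxx orbT => /esym /orP [/eqP h|/eqP ->]; last by rewrite eq_sym (nb_neq poly).
    have := edge_ends_eray q e0.1 s; rewrite es /edge_ends h => /setP /(_ (nb q e0.1 s)).
    by rewrite !inE eqxx orbT (negbTE (nb_neq poly _ _)).
  rewrite scalerAl eF -scalerAl scalerAr eF -scalerAr.
  by [].
rewrite homE; case: (boolP (edge_ends q e0 \subset sval g)) => eg; last first.
  have [v vm vg] := subsetPn mg; rewrite (bigD1 v) //= fcoord_out // [X in X * _]big1 ?mul0r.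
    case: ifP => _; rewrite ?addr0 // add0r.
    have [p pe pg] := subsetPn eg; rewrite [X in _ * X](bigD1 p) //= triangle_coord0 // mul0r mulr0.
    by rewrite scaler0.
  by move=> w _; rewrite triangle_kelt0 ?scaler0.
have [v0 [w [ovw wg lE]]] := triangle_third eg.
have v0g : v0 \notin sval g.
  have e1 : e0.1 \in edge_ends q e0 by rewrite !inE eqxx.
  apply/negP => vg; have := opp_face ovw (nf_face g) vg wg e1.
  by rewrite (fintype.subsetP eg _ e1).
case: (boolP [exists x in m, (x \notin sval g) && (x != v0)]) => [/existsP [x /and3P [xm xg xv]]|].
  rewrite (bigD1 x) //= fcoord_out // big1 ?mul0r => [|w' /andP [w'g /and3P [xl _ _]]]; last first.
    by move: xl; rewrite lE !inE (negbTE xv) /= => /eqP xw; rewrite xw wg in xg.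
  case: ifP => _; rewrite ?addr0 // add0r (bigD1 x) /= ?triangle_coord0 ?mul0r ?scaler0 //.
  by rewrite inE xm lE !inE (negbTE xv) /= andbT; apply: contraNneq xg => ->.
rewrite negb_exists => /forallP hm.
have {}hm x : x \in m -> (x \in sval g) || (x == v0).
  by move=> xm; have := hm x; rewrite xm /= negb_and !negbK.
have v0m : v0 \in m.
  apply: contraR mg => v0m; apply/fintype.subsetP => x xm.
  by case/orP: (hm x xm) => // /eqP xv; rewrite -xv xm in v0m.
have gE' := opp_third ovw (nf_face g) wg eg.
have wm : w \in m.
  apply: contraR mn => wm; apply: face_sub (opp_ends_face ovw).
  apply/fintype.subsetP => x xm; rewrite in_setU1; case/orP: (hm x xm) => [|->//].
  rewrite gE' in_setU1 => /orP [/eqP xw|->]; last by rewrite orbT.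
  by rewrite xw (negbTE wm) in xm.
have [_ _ vw] := and3P ovw.
have lm : edge_link q e0 \subset m by rewrite lE finset.subUset !finset.sub1set v0m wm.
rewrite lm (bigD1 v0) //= (bigD1 w) /=; last by rewrite wm eq_sym.
rewrite (eq_bigl (fun x => x \in m :\: edge_link q e0)) => [|x]; last first.
  by rewrite finset.in_setD lE finset.in_set2; case: (x == v0); case: (x == w); case: (x \in m).
rewrite (fcoord_opp v0g wg ovw) (fcoord_in wg).
have kw : kelt g w * tcoord g w = \prod_(p in edge_ends q e0) tcoord g p.
  by rewrite /kelt -mulrA tb_inv // mulr1.
rewrite mulrA -scalerAl kw -scalerAl scaleNr [X in - (eps *: X)]mulrC scalerAl eF -scalerAl.
by rewrite addNr.
Qed.

Lemma res_inv f (s : sval f \subset sval g) w : w \in sval f ->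
  tres s (tb f (- (1, dir q (base f) w))) = tb g (- (1, dir q (base g) w)).
Proof.
move=> wf; have wg := fintype.subsetP s w wf.
have e : tres s (tb f (- (1, dir q (base f) w))) * tcoord g w = 1.
  rewrite -(tres_coord_star poly tmin s) ?triangle_star //.
  by rewrite -(rmorphM (trmorph poly tmin s)) tb_inv // rmorph1.
by rewrite -[LHS]mulr1 -(tb_inv wg) mulrCA e mulr1.
Qed.

Lemma res_kelt f (s : sval f \subset sval g) w : w \in sval f ->
  eps *: tres s (kelt f w) = eps *: kelt g w.
Proof.
move=> wf; have -> : tres s (kelt f w) =
    (\prod_(p in edge_ends q e0) tres s (tcoord f p)) * tb g (- (1, dir q (base g) w)).
  rewrite -(res_inv s wf) -(rmorph_prod (trmorph poly tmin s)).
  exact: (rmorphM (trmorph poly tmin s)).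
rewrite /kelt !scalerAl; congr (_ * _); apply: eps_congr.
by apply: max_mul_prod => p; apply: (tcoord_res poly tmin tn0).
Qed.

(** Restricting x_v across e0 picks up the parameter - eps of this edge, and the linear relation
    between the rays to v, to w and along e0 turns what remains into x_p x_q / x_w. *)
Lemma res_across f (s : sval f \subset sval g) v w : v \notin sval g -> w \in sval g ->
  w \notin sval f -> opp v w -> edge_ends q e0 \subset sval g ->
  tres s (tcoord f v) = (- eps) *: kelt g w.
Proof.
move=> vg wg wf ovw eg; have gE' := opp_third ovw (nf_face g) wg eg.
have be : base f \in edge_ends q e0.
  have := fintype.subsetP s _ (nf_in f); rewrite {1}gE' in_setU1 => /orP [/eqP h|] //.
  by move: wf; rewrite -h (nf_in f).
have [s0 es] := flag_ex be.
have vf : Defs.face q (v |: sval f).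
  apply: face_sub (opp_ends_face ovw); apply: finset.setUS; apply/fintype.subsetP => x xf.
  have := fintype.subsetP s x xf; rewrite {1}gE' in_setU1 => /orP [/eqP h|] //.
  by move: wf; rewrite -h xf.
have bg := fintype.subsetP s _ (nf_in f).
have [r cE] := triangle_cell bg.
have gC := cellofP poly (nf_face g) bg; rewrite cE in gC.
have memg r' : (nb q (base f) r' \in sval g) = (r' \in crays (CT r)).
  by rewrite -{1}gC (mem_cset_nb poly).
have s0r : s0 \in crays (CT r).
  by rewrite -memg; apply: (fintype.subsetP eg); rewrite (flag_ends es) !inE eqxx orbT.
have [s1 [s2 [vE wE ac rE]]] : exists s1 s2, [/\ v = nb q (base f) s1, w = nb q (base f) s2,
    across s0 r s1 & rvec s1 = rvec s0 - rvec s2].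
  case/and3P: ovw; rewrite (flag_link es) !inE => /orP [] /eqP vE /orP [] /eqP wE vw.
  - by rewrite vE wE eqxx in vw.
  - exists (rnext s0), (rprev s0); split=> //; last by case: (s0).
    by move: s0r wg; rewrite wE memg /across; case: (s0); case: (r).
  - exists (rprev s0), (rnext s0); split=> //; last by case: (s0).
    by move: s0r wg; rewrite wE memg /across; case: (s0); case: (r).
  - by rewrite vE wE eqxx in vw.
have s1r : s1 \notin crays (CT r) by rewrite -memg -vE.
have s1c : compat (nf_cell f) s1.
  have [h|[s' hs' /eqP]] := (star_nb poly v (nf_face f) (nf_in f)).1 vf.
    by rewrite h bg in vg.
  by rewrite vE (inj_eq (@nb_inj _ _ poly _)) => /eqP ->.
rewrite /tcoord vf tres_tb /tps psiE cE vE /= (dir_nb poly).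
have sc : subcell (nf_cell f) (CT r) by have := sub_cells poly s; rewrite cE.
have ee : - eps * - eps = 0 by rewrite mulrNN; case: heps.
rewrite (tm_across ee (fun r' => wt_flag r' es) sc s1c s1r) ac; congr (_ *: _).
have th x : x \in sval g -> (1, dir q (base g) x) = tth f g (1, dir q (base f) x) :> W.
  by move=> xg; rewrite (tth_coord poly s) // triangle_star.
have sg : nb q (base f) s0 \in sval g by rewrite memg.
rewrite /kelt (flag_ends es) big_setU1 ?big_set1 ?inE 1?eq_sym ?(nb_neq poly) //=.
rewrite !(tcoord_in tmin) // !triangle_mul !th // -raddfN -!raddfD; congr (tb g (tth f g _)).
rewrite dir0 wE !(dir_nb poly) rE; apply: injective_projections => //=.
by rewrite add0r.
Qed.

(** If v lies in g, all corrections vanish. If v is opposite to a vertex of g outside f and g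
    contains e0, the correction arises from restricting x_v. In the remaining case x_v restricts to
    0, and the nonzero corrections on the two sides are the same. *)
Lemma res_fcoord f (s : sval f \subset sval g) v : tres s (fcoord f v) = fcoord g v.
Proof.
have bg := fintype.subsetP s _ (nf_in f).
have -> : tres s (fcoord f v) = tres s (tcoord f v) +
    \sum_(w in sval f | opp v w) (- eps) *: kelt g w.
  rewrite /fcoord tresD; congr (_ + _).
  apply: etrans (linear_sum (trmorph poly tmin s) _ _ _) _.
  apply: eq_bigr => w /andP [wf _]; apply: (etrans (tresZ s _ _)).
  by rewrite !scaleNr (res_kelt s wf).
have e1 : e0.1 \in edge_ends q e0 by rewrite !inE eqxx.
case: (boolP (v \in sval g)) => vg.
  rewrite (tres_coord_star poly tmin s) ?triangle_star // fcoord_in // big1 ?addr0 //.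
  move=> w /andP [/(fintype.subsetP s) wg ow]; rewrite triangle_kelt0 ?scaler0 //.
  by apply/subsetPn; exists e0.1 => //; apply: (opp_face ow (nf_face g) vg wg).
case: (pselect (exists w, [/\ w \in sval g, w \notin sval f, opp v w
    & edge_ends q e0 \subset sval g])) => [[w [wg wf ow eg]]|nA].
  rewrite (res_across s vg wg wf ow eg) (fcoord_opp vg wg ow) big1 ?addr0 //.
  by move=> w' /andP [w'f ow']; rewrite (opp_uniq ow' ow) (negbTE wf) in w'f.
have -> : tres s (tcoord f v) = 0.
  rewrite /tcoord; case: ifP => [vf|_]; last exact: tres0.
  have [h|[s1 s1c vE]] := (star_nb poly v (nf_face f) (nf_in f)).1 vf.
    by rewrite h bg in vg.
  have [r cE] := triangle_cell bg.
  have gC := cellofP poly (nf_face g) bg; rewrite cE in gC.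
  have memg r' : (nb q (base f) r' \in sval g) = (r' \in crays (CT r)).
    by rewrite -{1}gC (mem_cset_nb poly).
  have s1r : s1 \notin crays (CT r) by rewrite -memg -vE.
  have sc : subcell (nf_cell f) (CT r) by have := sub_cells poly s; rewrite cE.
  rewrite tres_tb /tps psiE cE vE /= (dir_nb poly).
  case: (boolP (base f \in edge_ends q e0)) => [/flag_ex [s0 es]|bn]; last first.
    rewrite (tm_absorb (I := fun a => a = 0)) ?scale0r //.
    - by move=> a b ->; rewrite mul0r.
    - by move=> r'; apply: wt_noflag.
    - exact: phi_mono.
    - by apply: phi_incompat => //; move: s1r; case: (r); case: (s1).
  have ee : - eps * - eps = 0 by rewrite mulrNN; case: heps.
  rewrite (tm_across ee (fun r' => wt_flag r' es) sc s1c s1r).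
  case: ifP => [ac|_]; last by rewrite scale0r.
  case: nA; have [s2 [s2r ow]] : exists s2, s2 \in crays (CT r) /\ opp v (nb q (base f) s2).
    rewrite /opp (flag_link es) vE !inE !(inj_eq (@nb_inj _ _ poly _)).
    case/orP: ac => /andP [/eqP -> /eqP ->].
      by exists (rnext r); rewrite !inE !(inj_eq (@nb_inj _ _ poly _)); split; case: (r).
    by exists r; rewrite !inE !(inj_eq (@nb_inj _ _ poly _)); split; case: (r).
  have wg : nb q (base f) s2 \in sval g by rewrite memg.
  exists (nb q (base f) s2); split=> //.
    apply/negP => wf; have bE : base f \in edge_ends q e0 by rewrite (flag_ends es) !inE eqxx.
    have := opp_face ow vf (setU11 _ _) (setU1r _ wf) bE.
    by rewrite in_setU1 (nf_in f) orbT.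
  rewrite (flag_ends es) finset.subUset !finset.sub1set bg memg.
  by case/orP: ac => /andP [/eqP -> _]; case: (r).
rewrite add0r fcoord_out // [RHS](bigID (fun w => w \in sval f)) /= [X in _ = _ + X]big1 ?addr0.
  apply: eq_bigl => w; case: (boolP (w \in sval f)) => wf; rewrite ?andbF ?andbT //.
  by rewrite (fintype.subsetP s _ wf).
move=> w /andP [/andP [wg ow] wf]; rewrite triangle_kelt0 ?scaler0 //.
by apply/negP => eg; apply: nA; exists w.
Qed.

End Triangle.

Lemma first_order_toric Bloc tn :
  induces (first_order_ideal q eps e0) idfun (@toric_deformation G q poly C B t tmin Bloc tn).
Proof.
have rc f g (s : sval f \subset sval g) v : tres s (fcoord f v) = fcoord g v.
  apply/eqP; rewrite -subr_eq0; apply/eqP; apply: triangle_inj => h u r hE.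
  rewrite (raddfB (trmorph poly tmin u)) /= (tres_comp poly s u (fintype.subset_trans s u)).
  by rewrite !(res_fcoord hE) subrr.
have fdeg f v : tdeg 1 (fcoord f v).
  rewrite -[fcoord f v]scale1r -[1 *: _]addr0; apply: tdeg_lin; last exact: tdeg_0.
  rewrite /fcoord -[tcoord f v]scale1r; apply: tdeg_lin; first exact: tcoord_deg.
  apply: tdeg_sum => w _; apply: tdegZ.
  have e : (1 : int) = \sum_(p in edge_ends q e0) 1 + (- 1).
    have [s es] : exists s, eray q e0.1 s = e0 by apply: flag_ex; rewrite !inE eqxx.
    by rewrite (flag_ends es) big_setU1 ?big_set1 //= inE eq_sym (nb_neq poly).
  rewrite {1}e; apply: tdeg_mul; last exact: (@tdeg_tb _ _ _ _ _ tmin f (- (1, _))).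
  apply: (@hdeg_prod _ _ _ _ (@toric_deformation G q poly C B t tmin Bloc tn) f) => p _.
  exact: tcoord_deg.
exists fcoord; split=> //.
- move=> f p; rewrite /= /fcoord addrAC subrr add0r.
  by apply: max_mul_sum => w _; apply: max_mul_nonunit; apply: first_nonunit.
- move=> f h hh; apply: triangle_inj => g s r gE.
  have -> : tres s (ev idfun (fcoord f) h) = ev idfun (fcoord g) h.
    have rc' : forall (f g : face) (s : sval f \subset sval g) p, res
      (@toric_deformation G q poly C B t tmin Bloc tn) s (fcoord f p) = fcoord g p := rc.
    exact: (res_ev idB rc').
  move: h hh; apply: (gen_ideal_min (I := fun h => ev idfun (fcoord g) h = 0)).
    split; first exact: (ev0 idB).
      by move=> x y hx hy; rewrite (evD idB) hx hy addr0.
    by move=> a x hx; rewrite (evM idB) hx mulr0.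
  by move=> _ [m mn ->]; apply: (relation_triangle gE).
Qed.

End FirstOrder.

(** * Toric coordinates on the versal base *)

Lemma tpow_gen_mono (A : comNzRingType) N M (s : 'I_N -> A) (t : 'I_M -> A) k x :
  (forall i, tpow t 1 (s i)) -> tpow s k x -> tpow t k x.
Proof.
move=> st; apply: tpow_min; first exact: tpowP.
elim: k => [|k IH] m dm; first exact: tpow0.
have [i [m' [dm' ->]]] := mnm_split dm; rewrite tmonD tmonU.
by apply: (@tpowM _ _ _ 1 k) => //; apply: IH.
Qed.

Section BuildMorphism.
Variables (C : fieldType) (A B : comAlgType C) (u : A -> B).
Hypotheses (uD : forall x y, u (x + y) = u x + u y) (uM : forall x y, u (x * y) = u x * u y)
  (u1 : u 1 = 1) (uZ : forall c x, u (c *: x) = c *: u x).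

(** The dummy argument makes [u' tt] an application to which the morphism structures can be
    attached. *)
Let u' (_ : unit) := u.
Lemma build_zmod : zmod_morphism (u' tt).
Proof. by move=> x y; rewrite /u' -[- y]scaleN1r uD uZ scaleN1r. Qed.
HB.instance Definition _ := GRing.isZmodMorphism.Build A B (u' tt) build_zmod.
Lemma build_monoid : monoid_morphism (u' tt). Proof. by split. Qed.
HB.instance Definition _ := GRing.isMonoidMorphism.Build A B (u' tt) build_monoid.
Lemma build_scale : scalable (u' tt). Proof. exact: uZ. Qed.
HB.instance Definition _ := GRing.isScalable.Build C A B _ (u' tt) build_scale.

Lemma build_lrmorphism : exists v : {lrmorphism A -> B}, v =1 u.
Proof. by exists (u' tt). Qed.
End BuildMorphism.

Lemma factor_lrmorphism (C : fieldType) (A B B' : comAlgType C) (f : {lrmorphism A -> B})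
    (g : {lrmorphism A -> B'}) : (forall b, exists a, f a = b) -> (forall a, f a = 0 -> g a = 0) ->
  exists h : {lrmorphism B -> B'}, forall a, h (f a) = g a.
Proof.
move=> /choice [r rK] fg.
have gE a a' : f a = f a' -> g a = g a'.
  move=> e; have /fg : f (a - a') = 0 by rewrite rmorphB /= e subrr.
  by rewrite rmorphB /= => /eqP; rewrite subr_eq0 => /eqP.
have [||||h hE] := @build_lrmorphism C B B' (fun b => g (r b)).
- by move=> x y; rewrite -rmorphD; apply: gE; rewrite rmorphD /= !rK.
- by move=> x y; rewrite -rmorphM; apply: gE; rewrite rmorphM /= !rK.
- by rewrite -(rmorph1 g); apply: gE; rewrite rK rmorph1.
- by move=> c x; rewrite -linearZ; apply: gE; rewrite linearZ /= !rK.
by exists h => a; rewrite hE; apply: gE; rewrite rK.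
Qed.

Lemma joint_lrmorphism (C : fieldType) (A A' : comAlgType C) (B : nat -> comAlgType C)
    (f : forall k, {lrmorphism A' -> B k}) (g : forall k, {lrmorphism A -> B k}) (u : A -> A') :
  (forall x, (forall k, f k x = 0) -> x = 0) -> (forall k a, f k (u a) = g k a) ->
  exists v : {lrmorphism A -> A'}, forall k a, f k (v a) = g k a.
Proof.
move=> inj uE; have injE x y : (forall k, f k x = f k y) -> x = y.
  by move=> e; apply/eqP; rewrite -subr_eq0; apply/eqP/inj => k; rewrite rmorphB /= e subrr.
have [||||v vE] := @build_lrmorphism C A A' u.
- by move=> x y; apply: injE => k; rewrite rmorphD /= !uE rmorphD.
- by move=> x y; apply: injE => k; rewrite rmorphM /= !uE rmorphM.
- by apply: injE => k; rewrite uE !rmorph1.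
- by move=> c x; apply: injE => k; rewrite linearZ /= !uE linearZ.
by exists v => k a; rewrite vE.
Qed.

Section LocalCompletion.
Variables (C : fieldType) (N : nat) (R : comAlgType C).
Variables (I0 : {mpoly C[N]} -> Prop) (iota : {lrmorphism {mpoly C[N]} -> R}).
Local Notation X := (fun i : 'I_N => 'X_i : {mpoly C[N]}).
Hypothesis hI0 : is_ideal I0.
Hypothesis hc : is_completion I0 (gen_ideal (fun y => exists i, y = X i)) iota.
Hypothesis I02 : forall p, I0 p -> tpow X 2 p.
Local Notation x := (fun i => iota 'X_i).
Local Notation mR := (tpow x).

Section Quotients.
Variables (B : comAlgType C) (f : {lrmorphism R -> B}).
Hypothesis fs : forall b, exists a, f a = b.

Lemma surj_nonunit r : nonunit (f r) <-> mR 1 r.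
Proof.
split=> [nf|mr [b]].
  apply: contrapT => /(unit_notin hc) [s rs]; apply: nf; exists (f s).
  by rewrite -rmorphM rs rmorph1.
have [s <-] := fs b; rewrite -rmorphM => e.
have [|v hv] := unit_1B hc (a := r * s); first exact: idealMr (tpowP _ _) _.
have /eqP := congr1 f hv; rewrite rmorphM rmorphB /= e !rmorph1 subrr mul0r.
by rewrite eq_sym oner_eq0.
Qed.

Lemma surj_local (b c : B) : nonunit b -> nonunit c -> nonunit (b + c).
Proof.
have [r <-] := fs b; have [s <-] := fs c; rewrite -rmorphD => /surj_nonunit hr /surj_nonunit hs.
by apply/surj_nonunit; apply: idealD (tpowP _ _) _ _.
Qed.

Lemma surj_nil_local k : (forall r, mR k r -> f r = 0) -> nil_local B k.
Proof.
move=> fk; split=> [|s ks sn]; first exact: surj_local.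
suff [r mr ->] : exists2 r, mR (size s) r & \prod_(b <- s) b = f r.
  by apply: fk; apply: tpow_leq mr.
elim: s sn {ks} => [|b s IH] sn; first by exists 1; rewrite ?big_nil ?rmorph1 //; apply: tpow0.
have [|r mr e] := IH; first by move=> c cs; apply: sn; rewrite inE cs orbT.
have [a ae] := fs b; have ma : mR 1 a by apply/surj_nonunit; rewrite ae; apply: sn; apply: mem_head.
exists (a * r); first exact: (@tpowM _ _ _ 1 (size s)).
by rewrite big_cons e rmorphM /= ae.
Qed.

Lemma surj_artinian k : (forall r, mR k r -> f r = 0) -> local_artinian B.
Proof.
move=> fk; split; first exact: surj_local.
exists #|{: 'X_{1..N < k}}|, (fun i => f (iota 'X_[enum_val i : 'X_{1..N < k}])) => b; have [r <-] := fs b.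
have [p hp] := compl_approx hc k r.
exists (fun i => p@_(enum_val i : 'X_{1..N < k})).
have -> : f r = f (iota (\sum_(m : 'X_{1..N < k}) p@_m *: 'X_[m])).
  apply/eqP; rewrite -subr_eq0 -rmorphB; apply/eqP/fk.
  have -> : r - iota (\sum_(m : 'X_{1..N < k}) p@_m *: 'X_[m]) =
      (r - iota p) + iota (p - \sum_(m : 'X_{1..N < k}) p@_m *: 'X_[m]) by rewrite rmorphB /=; ring.
  apply: idealD (tpowP _ _) hp _; apply: (iota_tpow _ (k := k)); apply/mX_tpow => m.
  rewrite mcoeff_msupp; apply: contraR; rewrite -ltnNge => mk.
  rewrite mcoeffB raddf_sum /= (bigD1 (BMultinom mk)) //= mcoeffZ mcoeffX eqxx mulr1.
  rewrite big1 ?addr0 ?subrr // => m' mm'; rewrite mcoeffZ mcoeffX.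
  by case: eqP => [e|]; rewrite ?mulr0 //; case/eqP: mm'; apply: val_inj.
rewrite !rmorph_sum (reindex_onto enum_rank enum_val) /=; last by move=> i _; rewrite enum_valK.
by apply: eq_big => [m|m _]; rewrite enum_rankK ?eqxx // !linearZ.
Qed.
End Quotients.

(** Level k is the quotient by the power k + 1 of the maximal ideal, so that level 0 is the residue
    field and not the zero ring. *)
Lemma level_exists k : exists (B : comAlgType C) (f : {lrmorphism R -> B}),
  (forall b, exists a, f a = b) /\ (forall r, f r = 0 <-> mR k.+1 r).
Proof.
apply: quotient_algebra; first exact: tpowP.
by move=> h; apply: (notin_mR1 hc I02); apply: tpow_leq h.
Qed.

Lemma mR1_linear r : mR 1 r -> exists c : 'I_N -> C, mR 2 (r - \sum_i c i *: x i).
Proof.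
apply: (tpow_min (J := fun r => exists c : 'I_N -> C, mR 2 (r - \sum_i c i *: x i))).
  split.
  - exists (fun=> 0); rewrite big1 ?subr0; first by case: (tpowP x 2).
    by move=> i _; rewrite scale0r.
  - move=> a b [c hc1] [d hd]; exists (fun i => c i + d i).
    under eq_bigr do rewrite scalerDl.
    by rewrite big_split opprD addrACA; apply: idealD (tpowP _ _) _ _.
  - move=> a b [c hb]; have [e he] := residue hc a; exists (fun i => e * c i).
    have -> : a * b - \sum_i (e * c i) *: x i =
        a * (b - \sum_i c i *: x i) + (a - e%:A) * \sum_i c i *: x i.
      under eq_bigr do rewrite -scalerA.
      by rewrite -scaler_sumr mulrBr mulrBl mulr_algl addrA subrK.
    apply: idealD (tpowP _ _) _ _; first exact: idealMl (tpowP _ _) _.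
    apply: (@tpowM _ _ _ 1 1) he _; apply: ideal_bigsum (tpowP _ _) _ => i _.
    by rewrite -mulr_algl; apply: idealMl (tpowP _ _) _; apply: (tpow1 x).
move=> m /(@mnm_split _ 0) [i [m' [/eqP]]]; rewrite mdeg_eq0 => /eqP -> ->.
exists (fun j => (j == i)%:R); rewrite tmonD tmonU big1; last by move=> j _; rewrite mnm0E.
rewrite mulr1 (bigD1 i) //= eqxx scale1r big1 => [|j /negbTE ->]; last by rewrite scale0r.
by rewrite addr0 subrr; case: (tpowP x 2).
Qed.

(** By [I02] the relations start in degree 2, so they impose nothing on the cotangent space. *)
Lemma mR2_linear (c : 'I_N -> C) : mR 2 (\sum_i c i *: x i) -> forall i, c i = 0.
Proof.
have -> : \sum_i c i *: x i = iota (\sum_i c i *: 'X_i).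
  by rewrite rmorph_sum; apply: eq_bigr => i _; rewrite /= linearZ.
move=> /(compl_kernel hc) [a [b [/I02 ha hb e]]] i.
have /mX_tpow h : tpow X 2 (\sum_i c i *: 'X_i) by rewrite e; apply: idealD (tpowP _ _) _ _.
have ci : (\sum_i c i *: 'X_i : {mpoly C[N]})@_(U_(i)) = c i.
  rewrite raddf_sum (bigD1 i) //= mcoeffZ mcoeffX eqxx mulr1 big1 ?addr0 // => j ji.
  by rewrite mcoeffZ mcoeffX; case: eqP => [/mnmP /(_ j)|_]; rewrite ?mulr0 // !mnm1E eqxx eq_sym (negbTE ji).
apply/eqP; apply: contraT => ci0.
by have := h U_(i)%MM; rewrite mcoeff_msupp ci ci0 mdeg1 => /(_ isT).
Qed.

Section Automorphism.
Variable phi : {lrmorphism R -> R}.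
Hypothesis phix : forall i, mR 2 (phi (x i) - x i).

Lemma auto_mR k r : mR k r -> mR k (phi r).
Proof.
move/(tpow_morph phi); apply: tpow_gen_mono => i /=.
rewrite -(subrK (x i) (phi _)); apply: idealD (tpowP _ _) _ (tpow1 x i).
exact: tpowS (phix i).
Qed.

(** An endomorphism that is the identity on the cotangent space moves an element by something of
    higher order, by induction through phi (u v) - u v = phi u (phi v - v) + (phi u - u) v. *)
Lemma auto_res k r : mR k r -> mR k.+1 (phi r - r).
Proof.
have base a : mR 1 (phi a - a).
  have [c hcc] := residue hc a.
  have -> : phi a - a = phi (a - c%:A) - (a - c%:A).
    by rewrite rmorphB /= linearZ /= rmorph1; ring.
  exact: idealB (tpowP _ _) (auto_mR hcc) hcc.
elim: k r => [|k IH] r; first by move=> _; apply: base.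
suff h : mR k.+1 r -> mR k.+1 r /\ mR k.+2 (phi r - r) by move/h => [].
apply: (tpow_min (J := fun r => mR k.+1 r /\ mR k.+2 (phi r - r))).
  split.
  - by rewrite rmorph0 subrr; split; apply: (ideal0 (tpowP _ _)).
  - move=> u v [u1 u2] [v1 v2]; split; first exact: idealD (tpowP _ _) _ _.
    by rewrite rmorphD /= opprD addrACA; apply: idealD (tpowP _ _) _ _.
  - move=> u v [v1 v2]; split; first exact: idealMl (tpowP _ _) _.
    have -> : phi (u * v) - u * v = phi u * (phi v - v) + (phi u - u) * v.
      by rewrite rmorphM /=; ring.
    apply: idealD (tpowP _ _) _ _; first exact: idealMl (tpowP _ _) _.
    exact: (@tpowM _ _ _ 1 k.+1).
move=> m dm; split; first by rewrite -dm; apply: (tpow_mon x).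
have [i [m' [dm' ->]]] := mnm_split dm; rewrite tmonD tmonU rmorphM /=.
set w := \prod_i _; have mw : mR k w by rewrite -dm'; apply: (tpow_mon x).
have -> : phi (x i) * phi w - x i * w = (phi (x i) - x i) * phi w + x i * (phi w - w) by ring.
apply: idealD (tpowP _ _) _ _.
  by apply: (@tpowM _ _ _ 2 k) (phix i) _; apply: auto_mR.
by apply: (@tpowM _ _ _ 1 k.+1); [apply: (tpow1 x) | apply: IH].
Qed.

Lemma auto_reflect k r : mR k (phi r) -> mR k r.
Proof.
elim: k => [|k IH] h; first exact: tpow0.
have hr := IH (tpowS h); rewrite -[r](subKr (phi r)).
by apply: idealB (tpowP _ _) h _; apply: auto_res.
Qed.

(** Orders are preserved, hence phi is injective. A preimage of s is the limit of the iteration of r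
    + (s - phi r), whose error gains one order in each step. *)
Lemma auto_inverse : exists psi : {lrmorphism R -> R},
  [/\ cancel phi psi, cancel psi phi, forall k r, mR k (psi r) <-> mR k r
    & forall i, mR 2 (psi (x i) - x i)].
Proof.
have inj r : phi r = 0 -> r = 0.
  move=> e; apply: (compl_sep hc) => k; apply: auto_reflect; rewrite e.
  exact: (ideal0 (tpowP _ _)).
have surj s : exists r, phi r = s.
  pose step r := r + (s - phi r).
  have hs k : mR k (s - phi (iter k step 0)).
    elim: k => [|k IH]; first exact: tpow0.
    have -> : s - phi (iter k.+1 step 0) =
        - (phi (s - phi (iter k step 0)) - (s - phi (iter k step 0))).
      by rewrite iterS /step rmorphD; ring.
    by apply: idealN (tpowP _ _) _; apply: auto_res.
  have [k|r hr] := compl_lim hc (u := fun k => iter k step 0).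
    by rewrite iterS /step addrAC subrr add0r.
  exists r; apply/eqP; rewrite -subr_eq0; apply/eqP; apply: (compl_sep hc) => k.
  have -> : phi r - s = phi (r - iter k step 0) - (s - phi (iter k step 0)).
    by rewrite rmorphB /=; ring.
  by apply: idealB (tpowP _ _) _ (hs k); apply: auto_mR.
have [psi hpsi] := factor_lrmorphism (g := idfun) surj inj.
have K2 : cancel psi phi by move=> s; have [r <-] := surj s; rewrite hpsi.
exists psi; split=> // [k r|i].
  by split=> [h|h]; [rewrite -(K2 r); apply: auto_mR | apply: auto_reflect; rewrite K2].
apply: auto_reflect; rewrite rmorphB /= K2 -opprB.
exact: idealN (tpowP _ _) (phix i).
Qed.

Lemma auto_completion (psi : {lrmorphism R -> R}) : cancel phi psi -> cancel psi phi ->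
  (forall k r, mR k (psi r) <-> mR k r) ->
  is_completion I0 (gen_ideal (fun y => exists i, y = X i)) (psi \o iota) /\
  forall k r, tpow (fun i => psi (x i)) k r <-> mR k r.
Proof.
move=> K1 K2 hpsi; have mRE k r : tpow (fun i => psi (x i)) k r <-> mR k r.
  split=> h.
    have {}h : tpow x k (phi r).
      move/(tpow_morph phi): h; apply: tpow_gen_mono => i /=; rewrite K2; exact: (tpow1 x).
    by have := (hpsi k (phi r)).2 h; rewrite K1.
  have /(tpow_morph psi) : mR k (phi r) by apply/hpsi; rewrite K1.
  by rewrite /= K1.
have eE k r : ext_ideal (psi \o iota) (ideal_pow (gen_ideal (fun y => exists i, y = X i)) k) r <->
    mR k r.
  by rewrite -mRE; apply: (ext_ideal_mR (psi \o iota)).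
split=> //; split.
- move=> k r; have [p hp] := compl_approx hc k (phi r); exists p; apply/eE.
  by rewrite -[r]K1 -rmorphB; apply/hpsi.
- move=> k p; rewrite eE /= hpsi -(ext_ideal_mR iota); case: hc => _ h _ _; exact: h.
- by move=> r h; apply: (compl_sep hc) => k; apply/eE.
- move=> u hu; have [k|r hr] := compl_lim hc (u := u); first by apply/eE.
  by exists r => k; apply/eE.
Qed.
End Automorphism.
End LocalCompletion.

Section Versal.
Variables (G : finZmodType) (q : {additive (int * int)%type -> G}).
Hypothesis poly : polyhedral q.
Variables (C : fieldType) (R : comAlgType C) (J : {mpoly R[#|G|]} -> Prop).
Hypothesis J_versal : miniversal q J.
Local Notation N := #|edge G|.
Local Notation X := (fun i : 'I_N => 'X_i : {mpoly C[N]}).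
Local Notation I0 := (@base_ideal G q C).

Lemma t_idealE : @t_ideal G C = gen_ideal (fun y => exists i, y = X i).
Proof.
congr gen_ideal; apply: funext => h; apply: propext.
by split=> [[e ->]|[i ->]]; [exists (enum_rank e) | exists (enum_val i); rewrite /tvar enum_valK].
Qed.

Lemma base_ideal2 p : I0 p -> tpow X 2 p.
Proof.
apply: gen_ideal_min; first exact: tpowP.
move=> _ [p' [a [b ->]]].
by apply: idealB (tpowP _ _) _ _; apply: (@tpowM _ _ _ 1 1); apply: (tpow1 X).
Qed.

Section Coordinates.
Variable iota : {lrmorphism {mpoly C[N]} -> R}.
Hypothesis hc : is_completion I0 (gen_ideal (fun y => exists i, y = X i)) iota.
Local Notation x := (fun i => iota 'X_i).
Local Notation te e := (iota (tvar C e)).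
Local Notation mR := (tpow x).

Lemma base_ideal_kernel p : I0 p -> iota p = 0.
Proof.
move=> Ip; apply: (compl_sep hc) => k; apply/(compl_kernel hc); exists p, 0.
by rewrite addr0; split=> //; apply: (ideal0 (tpowP _ _)).
Qed.

Lemma te_minors : minor_relations q (fun e => te e).
Proof.
move=> p a b; apply/eqP; rewrite -subr_eq0 -!rmorphM -rmorphB; apply/eqP.
by apply: base_ideal_kernel; apply: gen_ideal_sub; exists p, a, b.
Qed.

Lemma te_mR e : mR 1 (te e).
Proof. exact: (tpow1 x). Qed.

Section Toric.
Variables (B : comAlgType C) (f : {lrmorphism R -> B}).
Hypothesis fs : forall b, exists a, f a = b.

(* The first order deformation gives the equation x_u x_v + eps x_p x_q = 0 on the chart at
   an edge, where the toric deformation has x_u x_v = t x_p x_q. *)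
Definition tpar e := f (- te e).
Lemma tpar_minors : minor_relations q tpar.
Proof. by move=> p a b; rewrite /tpar -!rmorphM !mulrNN te_minors. Qed.
Lemma tpar_nonunit e : nonunit (tpar e).
Proof. by apply/(surj_nonunit hc fs); apply: idealN (tpowP _ _) (te_mR e). Qed.
Definition toric_level : pair_deformation q B :=
  toric_deformation poly tpar_minors (surj_local hc fs) tpar_nonunit.
End Toric.

Lemma toric_level_push (B' B : comAlgType C) (f' : {lrmorphism R -> B'}) (f : {lrmorphism R -> B})
    (fs' : forall b, exists a, f' a = b) (fs : forall b, exists a, f a = b)
    (pi : {lrmorphism B' -> B}) : (forall e, pi (f' (te e)) = f (te e)) ->
  exists u : forall g : nonempty_face q, chart (toric_level fs') g -> chart (toric_level fs) g,
    pair_morphism pi u.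
Proof.
move=> h; exists (fun g => @tpush _ _ _ _ _ pi _ _ (tpar_minors f') (tpar_minors f) g).
by apply: toric_morphism => e; rewrite /tpar !rmorphN /= h.
Qed.

Lemma lrmorph_nonunit (B' B : comAlgType C) (f' : {lrmorphism R -> B'}) (f : {lrmorphism R -> B})
    (fs' : forall b, exists a, f' a = b) (fs : forall b, exists a, f a = b)
    (pi : {lrmorphism B' -> B}) : (forall e, pi (f' (te e)) = f (te e)) ->
  forall b, nonunit b -> nonunit (pi b).
Proof.
move=> h b; have [r <-] := fs' b; move/(surj_nonunit hc fs').
apply: (tpow_min (J := fun r => nonunit (pi (f' r)))).
  split; first by rewrite !rmorph0; apply: nonunit0.
    by move=> r1 r2 h1 h2; rewrite !rmorphD; apply: (surj_local hc fs).
  by move=> a r1 h1; rewrite !rmorphM mulrC; apply: nonunitM.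
move=> m /(@mnm_split _ 0) [i [m' [_ ->]]]; rewrite tmonD tmonU !rmorphM /=.
apply: nonunitM; have := h (enum_val i); rewrite /tvar enum_valK => ->.
by apply/(surj_nonunit hc fs); apply: (tpow1 x).
Qed.

Lemma SR_map (S B : comNzRingType) (f : {rmorphism S -> B}) h :
  SR_ideal q h -> SR_ideal q (map_mpoly f h).
Proof.
apply: (gen_ideal_min (I := fun h => SR_ideal q (map_mpoly f h))).
  split; first by rewrite rmorph0; apply: (ideal0 (gen_idealP _)).
    by move=> a b ha hb; rewrite rmorphD; apply: idealD (gen_idealP _) ha hb.
  by move=> a b hb; rewrite rmorphM; apply: idealMl (gen_idealP _) hb.
move=> _ [m mn ->]; apply: gen_ideal_sub; exists m => //.
by rewrite rmorph_prod; apply: eq_bigr => p _; rewrite /= map_mpolyX.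
Qed.

Lemma max_mul_map_mpoly (S B : comNzRingType) (f : {rmorphism S -> B}) (h : {mpoly S[#|G|]}) :
  (forall r, nonunit r -> nonunit (f r)) -> max_mul h -> max_mul (map_mpoly f h).
Proof.
move=> fn; apply: (max_mul_map (g := f)) fn _ => [a b|r a]; first exact: rmorphD.
by rewrite -mul_mpolyC rmorphM /= map_mpolyC mul_mpolyC.
Qed.

(** Over the residue field nonunits vanish and both sides are X; this starts the lifting in
    [versal_limit]. *)
Lemma closed_fibre_induced (B : comAlgType C) (f : {lrmorphism R -> B})
    (fs : forall b, exists a, f a = b) : (forall r, mR 1 r -> f r = 0) ->
  induces J f (toric_level fs).
Proof.
move=> f1; have nB (b : B) : nonunit b -> b = 0.
  by have [r <-] := fs b; move/(surj_nonunit hc fs)/f1.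
have m0 (M : lmodType B) (y : M) : max_mul y -> y = 0.
  by move=> [k [r [z [rn ->]]]]; rewrite big1 // => i _; rewrite (nB _ (rn i)) scale0r.
have fn r : nonunit r -> nonunit (f r).
  by move/(nonunit_mR hc base_ideal2)/f1 ->; apply: nonunit0.
exists (fun g p => Defs.coord (toric_level fs) g p); split=> //.
- by move=> g p; apply: coord_deg.
- by move=> g g' s p; apply/eqP; rewrite -subr_eq0; apply/eqP/m0; apply: coord_res.
- by move=> g p; rewrite subrr; apply: max_mul0.
move=> g h Jh; rewrite -ev_comp; apply: m0.
apply/(coord_rel (toric_level fs) g); exists 0%N; rewrite expr0 mul1r.
case: J_versal => -[_ _ _ cf] _ _.
have [|a [b [Sa mb ->]]] := (cf h).1.
  exists h, 0; rewrite addr0; split=> //; exact: max_mul0.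
exists (map_mpoly f a), (map_mpoly f b); rewrite rmorphD; split=> //.
  exact: SR_map.
exact: max_mul_map_mpoly.
Qed.

(* The toric deformations over the truncations of R are induced by the versal family
   through a compatible system of maps, which defines an endomorphism of R. *)
Lemma versal_limit : exists phi : {lrmorphism R -> R},
  forall k (B : comAlgType C) (f : {lrmorphism R -> B}) (fs : forall b, exists a, f a = b),
    (forall r, mR k.+1 r -> f r = 0) -> induces J (f \o phi) (toric_level fs).
Proof.
have H k := cid (level_exists hc base_ideal2 k).
pose Bk k := sval (H k); have H' k := cid (svalP (H k)).
pose fk k : {lrmorphism R -> Bk k} := sval (H' k).
have fks k : forall b, exists a, fk k a = b by have [] := svalP (H' k).
have fk0 k r : fk k r = 0 <-> mR k.+1 r by have [_] := svalP (H' k).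
have P k := cid (factor_lrmorphism (g := fk k) (fks k.+1)
  (fun r h => (fk0 k r).2 (tpowS ((fk0 k.+1 r).1 h)))).
pose pk k : {lrmorphism Bk k.+1 -> Bk k} := sval (P k).
have pkE k r : pk k (fk k.+1 r) = fk k r by apply: (svalP (P k)).
pose S k := {g : {lrmorphism R -> Bk k} | induces J g (toric_level (fks k))}.
have s0 : S 0%N by exists (fk 0%N); apply: closed_fibre_induced => r /fk0.
(* Smoothness of the versal family lifts the map of level k along the morphism between toric
   deformations; the lift is chosen as data in order to feed a dependent recursion. *)
have step k (s : S k) : {s' : S k.+1 | forall r, pk k (sval s' r) = sval s r}.
  apply: cid; have [u hu] := toric_level_push (fks k.+1) (fks k) (fun e => pkE k (te e)).
  case: J_versal => _ lift _; have [|||g [h1 h2]] := lift _ _ (pk k) _ _ u (sval s) _ _ _ hu (svalP s).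
  - by apply: (surj_artinian hc (fks k.+1) (k := k.+2)) => r /fk0.
  - by apply: (surj_artinian hc (fks k) (k := k.+1)) => r /fk0.
  - by move=> b; have [r <-] := fks k b; exists (fk k.+1 r).
  by exists (exist _ g h2).
pose s := nat_rect S s0 (fun k sk => sval (step k sk)).
have sE k r : pk k (sval (s k.+1) r) = sval (s k) r by apply: (svalP (step k (s k))).
have lim r : exists r', forall k, fk k r' = sval (s k) r.
  have /choice [u hu] : forall k, exists a, fk k a = sval (s k) r by move=> k; apply: fks.
  have du k : mR k.+1 (u k.+1 - u k).
    by apply/fk0; rewrite rmorphB /= hu -sE -hu pkE subrr.
  have [k|r' hr] := compl_lim hc (u := u); first exact: tpowS.
  exists r' => k; rewrite -hu; apply/eqP; rewrite -subr_eq0 -rmorphB; apply/eqP/fk0.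
  rewrite -(subrK (u k.+1) r') -addrA; apply: idealD (tpowP _ _) (hr k.+1) (du k).
have /choice [u hu] := lim.
have [|phi hphi] := joint_lrmorphism (f := fk) (g := fun k => sval (s k)) _ (fun k a => hu a k).
  by move=> r hr; apply: (compl_sep hc) => k; apply: tpowS; apply/fk0.
exists phi => k B f fs fk1.
have [th thE] := factor_lrmorphism (g := f) (fks k) (fun r h => fk1 r ((fk0 k r).1 h)).
have [v hv] := toric_level_push (fks k) fs (fun e => thE (te e)).
have := induces_push (lrmorph_nonunit (fks k) fs (fun e => thE (te e))) hv (svalP (s k)).
congr (induces J _ _); apply: funext => r /=.
by rewrite -hphi thE.
Qed.

(** The quotient of R by the square of the maximal ideal and all coordinates except that of e, which
    survives because the coordinates are independent modulo the square. *)
Lemma first_order_quotient (e : edge G) : exists (B : comAlgType C) (f : {lrmorphism R -> B}),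
  [/\ forall b, exists a, f a = b, forall r, mR 2 r -> f r = 0, dual_numbers (f (te e))
    & forall e', f (te e') = if e' == e then f (te e) else 0].
Proof.
pose K := gen_ideal (fun y => exists2 e', e' != e & y = te e').
pose I := ideal_sum (mR 2) K.
have hK : is_ideal K by exact: gen_idealP.
have hI : is_ideal I by apply: ideal_sumP => //; apply: tpowP.
have KE r : K r -> exists c : 'I_N -> C, c (enum_rank e) = 0 /\ mR 2 (r - \sum_i c i *: x i).
  apply: (gen_ideal_min (I := fun r => exists c : 'I_N -> C,
      c (enum_rank e) = 0 /\ mR 2 (r - \sum_i c i *: x i))).
    split.
    - exists (fun=> 0); split=> //; rewrite big1 ?subr0; first exact: (ideal0 (tpowP _ _)).
      by move=> i _; rewrite scale0r.
    - move=> a b [c [c0 hc1]] [d [d0 hd]]; exists (fun i => c i + d i); rewrite c0 d0 addr0.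
      split=> //; under eq_bigr do rewrite scalerDl.
      by rewrite big_split opprD addrACA; apply: idealD (tpowP _ _) _ _.
    - move=> a b [c [c0 hb]]; have [d hd] := residue hc a.
      exists (fun i => d * c i); rewrite c0 mulr0; split=> //.
      have -> : a * b - \sum_i (d * c i) *: x i =
          a * (b - \sum_i c i *: x i) + (a - d%:A) * \sum_i c i *: x i.
        under eq_bigr do rewrite -scalerA.
        by rewrite -scaler_sumr mulrBr mulrBl mulr_algl addrA subrK.
      apply: idealD (tpowP _ _) _ _; first exact: idealMl (tpowP _ _) _.
      apply: (@tpowM _ _ _ 1 1) hd _; apply: ideal_bigsum (tpowP _ _) _ => i _.
      by rewrite -mulr_algl; apply: idealMl (tpowP _ _) _; apply: (tpow1 x).
  move=> _ [e' ee ->]; exists (fun j => (j == enum_rank e')%:R).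
  rewrite (inj_eq enum_rank_inj) eq_sym (negbTE ee); split=> //.
  rewrite (bigD1 (enum_rank e')) //= eqxx scale1r big1 => [|j /negbTE ->]; last by rewrite scale0r.
  by rewrite addr0 subrr; apply: (ideal0 (tpowP _ _)).
have IE r : I r -> exists c : 'I_N -> C, c (enum_rank e) = 0 /\ mR 2 (r - \sum_i c i *: x i).
  move=> [a [b [ha /KE [c [c0 hb]] ->]]]; exists c; split=> //.
  by rewrite -addrA; apply: idealD (tpowP _ _) _ _.
have nte : ~ I (te e).
  move=> /IE [c [c0 h]].
  have h1 : mR 2 (\sum_i ((i == enum_rank e)%:R - c i) *: x i).
    under eq_bigr do rewrite scalerBl.
    rewrite sumrB (bigD1 (enum_rank e)) //= eqxx scale1r big1 ?addr0 // => i /negbTE ->.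
    by rewrite scale0r.
  have := mR2_linear hc base_ideal2 h1 (enum_rank e); rewrite eqxx c0 subr0.
  by move/eqP; rewrite oner_eq0.
have hI1 : ~ I 1 by move=> h; apply: nte; rewrite -[te e]mulr1; apply: idealMl.
have [B [f [fs f0]]] := quotient_algebra hI hI1.
have f2 r : mR 2 r -> f r = 0 by move=> h; apply/f0; apply: ideal_suml.
have fe e' : f (te e') = if e' == e then f (te e) else 0.
  case: eqP => [->|/eqP ee] //; apply/f0; apply: ideal_sumr; first exact: tpowP.
  by apply: gen_ideal_sub; exists e'.
exists B, f; split=> //; split.
- by apply/eqP => /f0.
- by rewrite -rmorphM; apply: f2; apply: (@tpowM _ _ _ 1 1); apply: te_mR.
move=> b; have [r <-] := fs b; have [c hcr] := residue hc r.
have [d hd] := mR1_linear hc hcr; exists c, (d (enum_rank e)).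
have -> : f r = f (c%:A + \sum_i d i *: x i).
  apply/eqP; rewrite -subr_eq0 -rmorphB opprD addrA; apply/eqP; exact: f2.
rewrite rmorphD /= linearZ /= rmorph1; congr (_ + _); rewrite rmorph_sum (bigD1 (enum_rank e)) //=.
rewrite linearZ /= big1 ?addr0; first by rewrite /tvar.
move=> i ie; rewrite linearZ /=.
have := fe (enum_val i); rewrite /tvar enum_valK => ->.
by rewrite -(inj_eq enum_rank_inj) enum_valK (negbTE ie) scaler0.
Qed.
End Coordinates.

(** Over the dual numbers of an edge, J induces the toric deformation along f phi by construction of
    phi. It also does so along f, because there the given first order deformation and the toric one
    are induced by the same ideal. Uniqueness on tangent spaces gives f phi = f for every edge, so
    phi is the identity to first order, and iota' is iota followed by the inverse of phi. *)
Lemma toric_coordinates (iota : {lrmorphism {mpoly C[N]} -> R}) : versal_coordinates q J iota ->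
  exists (iota' : {lrmorphism {mpoly C[N]} -> R})
    (hc : is_completion I0 (gen_ideal (fun y => exists i, y = X i)) iota'),
    [/\ versal_coordinates q J iota',
        forall i, tpow (fun i => iota 'X_i) 2 (iota' 'X_i - iota 'X_i)
      & forall k (B : comAlgType C) (f : {lrmorphism R -> B}) (fs : forall b, exists a, f a = b),
        (forall r, tpow (fun i => iota' 'X_i) k.+1 r -> f r = 0) ->
        induces J f (toric_level hc fs)].
Proof.
rewrite /versal_coordinates t_idealE => -[hc hcoord].
have [phi hphi] := versal_limit hc.
have phix i : tpow (fun i => iota 'X_i) 2 (phi (iota 'X_i) - iota 'X_i).
  have key e : exists (B : comAlgType C) (f : {lrmorphism R -> B}),
      [/\ forall r, f (phi r) = f r, forall r, tpow (fun i => iota 'X_i) 2 r -> f r = 0,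
       f (iota (tvar C e)) != 0 & forall e', e' != e -> f (iota (tvar C e')) = 0].
    have [B [f [fs f2 dual fe]]] := first_order_quotient hc e.
    exists B, f; split=> //; [|by case: dual|by move=> e' /negbTE ee; rewrite fe ee].
    have [eta [Jeta foeta]] := hcoord B (f (iota (tvar C e))) f e dual fe.
    have tE e' : tpar iota f e' = if e' == e then - f (iota (tvar C e)) else 0.
      by rewrite /tpar rmorphN /= fe; case: ifP => _ //; rewrite oppr0.
    have fot : induces (first_order_ideal q (f (iota (tvar C e))) e) idfun (toric_level hc fs).
      exact: first_order_toric dual tE _ _ _.
    have [||u hu] := induced_morphism (dual_nil_local dual) _ _ foeta fot.
    - exact: gen_idealP.
    - apply: gen_ideal_min.
        apply: ideal_sumP; first exact: gen_idealP.
        by split; [apply: max_mul0 | move=> *; apply: max_mulD | move=> *; apply: max_mul_mulr].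
      move=> _ [m mn ->]; exists (xmon B m + f (iota (tvar C e)) *: edge_hom q B e m).
      exists (- (f (iota (tvar C e)) *: edge_hom q B e m)); split.
      + by apply: gen_ideal_sub; exists m.
      + by apply/max_mulN/max_mul_nonunit/(surj_nonunit hc fs); apply: te_mR.
      + by rewrite addrK.
    have Jt : induces J (fun r => idfun (f r)) (toric_level hc fs).
      by apply: induces_push hu Jeta.
    case: J_versal => _ _ uniq.
    exact: (uniq _ _ _ (f \o phi) f dual (hphi 1%N _ _ fs f2) Jt).
  set d := phi _ - _; have fd (B : comAlgType C) (f : {lrmorphism R -> B}) : (forall r, f (phi r) = f r) -> f d = 0.
    by move=> h; rewrite rmorphB /= h subrr.
  have md : tpow (fun i => iota 'X_i) 1 d.
    have [B [f [fphi f2 _ _]]] := key (enum_val i).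
    apply: contrapT => /(unit_notin hc) [s /(congr1 f)]; rewrite rmorphM /= fd // mul0r rmorph1.
    by move/eqP; rewrite eq_sym oner_eq0.
  have [c hcd] := mR1_linear hc md.
  have c0 j : c j = 0.
    have [B [f [fphi f2 fe fe']]] := key (enum_val j).
    have : f (\sum_k c k *: iota 'X_k) = 0.
      by rewrite -[\sum_k _](subKr d) rmorphB /= (f2 _ hcd) (fd _ f fphi) subrr.
    rewrite rmorph_sum (bigD1 j) //= linearZ /= big1 ?addr0 => [|k kj].
      case: (eqVneq (c j) 0) => // cj /(congr1 (fun z => (c j)^-1 *: z)).
      by rewrite scalerA mulVf // scale1r scaler0 => e; move: fe; rewrite /tvar enum_valK e eqxx.
    have := fe' (enum_val k); rewrite /tvar enum_valK (inj_eq enum_val_inj) => h.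
    by rewrite linearZ /= h // scaler0.
  have e0 : \sum_k c k *: iota 'X_k = 0 by rewrite big1 // => k _; rewrite c0 scale0r.
  by move: hcd; rewrite e0 subr0.
have [psi [K1 K2 hpsi psix]] := auto_inverse hc phix.
have [hc' mRE] := auto_completion hc K1 K2 hpsi.
exists (psi \o iota), hc'; split=> //.
  split=> // B eps chi e dual hchi; apply: (hcoord B eps chi e dual) => e'.
  rewrite -(hchi e') /=; apply/esym/eqP; rewrite -subr_eq0 -rmorphB; apply/eqP.
  have chi2 r : tpow (fun i => psi (iota 'X_i)) 2 r -> chi r = 0.
    apply: (tpow_min (J := fun r => chi r = 0)).
      split; first exact: rmorph0.
        by move=> a b ha hb; rewrite rmorphD /= ha hb addr0.
      by move=> a b hb; rewrite rmorphM /= hb mulr0.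
    move=> m /mnm_split [i [m' [/(@mnm_split _ 0) [j [m'' [_ ->]]] ->]]].
    rewrite !tmonD !tmonU !rmorphM /= mulrA.
    have := hchi (enum_val i); have := hchi (enum_val j); rewrite /= /tvar !enum_valK => -> ->.
    have [_ ee _] := dual.
    by case: ifP => _; case: ifP => _; rewrite ?mulr0 ?mul0r // ee mul0r.
  by apply/chi2/mRE; rewrite /tvar; apply: psix.
move=> k B f fs fk.
have fs' b : exists a, (f \o psi) a = b.
  by have [a <-] := fs b; exists (phi a); rewrite /= K1.
have ind : induces J ((f \o psi) \o phi) (toric_level hc fs').
  by apply: (hphi k) => r hr; apply: fk; apply/mRE/hpsi.
have tE e : tpar (psi \o iota) f e = idfun (tpar iota (f \o psi) e).
  by rewrite /tpar /= !rmorphN.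
have fE : (f : R -> B) = (fun r => idfun (((f \o psi) \o phi) r)).
  by apply: funext => r /=; rewrite K1.
rewrite fE; apply: (induces_push (fun b nb => nb) _ ind).
exact: (toric_morphism poly (pi := idfun) tE (tpar_minors hc (f \o psi)) (tpar_minors hc' f)
  (surj_local hc fs') (tpar_nonunit hc fs') (surj_local hc' fs) (tpar_nonunit hc' fs)).
Qed.

End Versal.

(** * Derivations of the charts *)

Module DependentProducts.
Section DependentProduct.
Variable E : nat -> comNzRingType.
Definition dprod := forall k, E k.
HB.instance Definition _ := gen_eqMixin dprod.
HB.instance Definition _ := gen_choiceMixin dprod.
Implicit Types (x y z : dprod).

Definition dprod_zero : dprod := fun k => 0.
Definition dprod_opp x : dprod := fun k => - x k.
Definition dprod_add x y : dprod := fun k => x k + y k.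
Definition dprod_one : dprod := fun k => 1.
Definition dprod_mul x y : dprod := fun k => x k * y k.

Lemma dprodP x y : (forall k, x k = y k) -> x = y.
Proof. exact: functional_extensionality_dep. Qed.

Lemma dprod_addA : associative dprod_add. Proof. by move=> x y z; apply: dprodP => k; apply: addrA. Qed.
Lemma dprod_addC : commutative dprod_add. Proof. by move=> x y; apply: dprodP => k; apply: addrC. Qed.
Lemma dprod_add0 : left_id dprod_zero dprod_add. Proof. by move=> x; apply: dprodP => k; apply: add0r. Qed.
Lemma dprod_addN : left_inverse dprod_zero dprod_opp dprod_add.
Proof. by move=> x; apply: dprodP => k; apply: addNr. Qed.
HB.instance Definition _ := GRing.isZmodule.Build dprod dprod_addA dprod_addC dprod_add0 dprod_addN.

Lemma dprod_mulA : associative dprod_mul. Proof. by move=> x y z; apply: dprodP => k; apply: mulrA. Qed.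
Lemma dprod_mulC : commutative dprod_mul. Proof. by move=> x y; apply: dprodP => k; apply: mulrC. Qed.
Lemma dprod_mul1 : left_id dprod_one dprod_mul. Proof. by move=> x; apply: dprodP => k; apply: mul1r. Qed.
Lemma dprod_mulD : left_distributive dprod_mul dprod_add.
Proof. by move=> x y z; apply: dprodP => k; apply: mulrDl. Qed.
Lemma dprod_1neq0 : dprod_one != 0.
Proof. by apply/eqP => /(congr1 (fun x : dprod => x 0%N)) /eqP; rewrite oner_eq0. Qed.
HB.instance Definition _ := GRing.Zmodule_isComNzRing.Build dprod
  dprod_mulA dprod_mulC dprod_mul1 dprod_mulD dprod_1neq0.

Definition dproj k (x : dprod) : E k := x k.
Lemma dproj_zmod k : zmod_morphism (dproj k). Proof. by []. Qed.
HB.instance Definition _ k := GRing.isZmodMorphism.Build dprod (E k) (dproj k) (dproj_zmod k).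
Lemma dproj_monoid k : monoid_morphism (dproj k). Proof. by []. Qed.
HB.instance Definition _ k := GRing.isMonoidMorphism.Build dprod (E k) (dproj k) (dproj_monoid k).

Variables (S : comNzRingType) (f : forall k, {rmorphism S -> E k}).
Definition dlift (s : S) : dprod := fun k => f k s.
Lemma dlift_zmod : zmod_morphism dlift.
Proof. by move=> x y; apply: dprodP => k; apply: rmorphB. Qed.
HB.instance Definition _ := GRing.isZmodMorphism.Build S dprod dlift dlift_zmod.
Lemma dlift_monoid : monoid_morphism dlift.
Proof. by split=> [|x y]; apply: dprodP => k; [apply: rmorph1 | apply: rmorphM]. Qed.
HB.instance Definition _ := GRing.isMonoidMorphism.Build S dprod dlift dlift_monoid.

Lemma dprod_mxP m n (M M' : 'M[dprod]_(m, n)) :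
  (forall k, map_mx (dproj k) M = map_mx (dproj k) M') -> M = M'.
Proof.
move=> h; apply/matrixP => i j; apply: dprodP => k.
by have /matrixP /(_ i j) := h k; rewrite !mxE.
Qed.
End DependentProduct.
End DependentProducts.
Import DependentProducts.

Lemma mpoly_ring_ind (A : comNzRingType) n (P : {mpoly A[n]} -> Prop) :
  (forall c, P c%:MP) -> (forall i, P 'X_i) -> (forall g h, P g -> P h -> P (g + h)) ->
  (forall g h, P g -> P h -> P (g * h)) -> forall h, P h.
Proof.
move=> PC PX PD PM h; rewrite [h]mpolyE; apply: (big_ind P); [by rewrite -mpolyC0| by []|].
move=> m _; rewrite -mul_mpolyC; apply: (PM _ _ (PC _)); rewrite mpolyXE_id.
apply: (big_ind P); [by rewrite -mpolyC1 | by [] | move=> i _].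
by elim: (m i) => [|k IH]; [rewrite expr0 -mpolyC1 | rewrite exprS; apply: PM].
Qed.

Definition derivation (B : comNzRingType) (E : comAlgType B) (T : comNzRingType)
    (i : {rmorphism E -> T}) (d : E -> T) : Prop :=
  [/\ forall x y, d (x + y) = d x + d y, forall x y, d (x * y) = i x * d y + d x * i y
    & forall b : B, d b%:A = 0].

Section Derivation.
Variables (B : comNzRingType) (E : comAlgType B) (T : comNzRingType).
Variables (i : {rmorphism E -> T}) (d : E -> T).
Hypothesis hd : derivation i d.

Lemma derivation0 : d 0 = 0.
Proof. by case: hd => _ _ h; rewrite -(h 0) scale0r. Qed.

Lemma derivation1 : d 1 = 0.
Proof. by case: hd => _ _ h; rewrite -(h 1) scale1r. Qed.

Lemma derivationZ b x : d (b *: x) = i b%:A * d x.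
Proof. by case: hd => _ hM h; rewrite -(mulr_algl b x) hM h mul0r addr0. Qed.

Lemma derivation_chain (G : finZmodType) (xi : G -> E) (h : {mpoly B[#|G|]}) :
  d (ev idfun xi h) =
  \sum_(j < #|G|) i (ev idfun xi (mderiv j h)) * d (xi (enum_val j)).
Proof.
pose idB := (idfun : {rmorphism B -> B}); case: (hd) => hD hM hC.
elim/mpoly_ring_ind: h => [c|k|g h Hg Hh|g h Hg Hh].
- rewrite (evC idB) hC big1 // => j _; rewrite mderivC (ev0 idB) rmorph0 mul0r.
  by [].
- rewrite (bigD1 k) //= big1 => [|j jk].
    rewrite mderivX mnm1E eqxx (_ : (U_(k) - U_(k) = 0)%MM) ?mpolyX0 ?scale1r; last first.
      by apply/mnmP => l; rewrite mnmBE subnn mnm0E.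
    by rewrite (ev1 idB) rmorph1 mul1r addr0 -[k in LHS]enum_valK (ev_xvar idB).
  by rewrite mderivX mnm1E eq_sym (negbTE jk) scale0r (ev0 idB) rmorph0 mul0r.
- rewrite (evD idB) hD Hg Hh -big_split; apply: eq_bigr => j _ /=.
  by rewrite mderivD (evD idB) rmorphD mulrDl.
- rewrite (evM idB) hM Hg Hh mulr_sumr mulr_suml -big_split; apply: eq_bigr => j _ /=.
  rewrite mderivM (evD idB) !(evM idB) rmorphD !rmorphM /=; ring.
Qed.
End Derivation.

(** * Differentials of a chart *)

Section Cotangent.
Variables (G : finZmodType) (q : {additive (int * int)%type -> G}).
Variables (C : fieldType) (B : comAlgType C) (n : nat).
Hypothesis hB : nil_local B n.
Variables (eta : pair_deformation q B) (f : nonempty_face q).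
Variable xi : G -> chart eta f.
Hypothesis xi_coord : forall p, max_mul (xi p - Defs.coord eta f p).
Local Notation E := (chart eta f).
Local Notation xj j := (xi (enum_val j)).
Local Notation idB := (idfun : {rmorphism B -> B}).
Local Notation P := (\prod_(p in sval f) xi p).

(** The quotient rule for z P^N = h(xi). The coefficients are independent of the derivation, so they
    serve for the logarithmic derivations and for the one of [cotangent] alike. *)
Lemma gradient (z : E) : exists F : 'I_#|G| -> E,
  forall (T : comNzRingType) (i : {rmorphism E -> T}) (d : E -> T), derivation i d ->
    d z = \sum_j i (F j) * d (xj j).
Proof.
have [N [h e]] := section_gen hB xi_coord z.
have [v hv] := section_unit hB xi_coord.
pose g := xmon B (sval f) ^+ N.
have eg : ev idfun xi g = P ^+ N by rewrite (evXn idB) (ev_xmon idB).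
exists (fun j => v ^+ N * (ev idfun xi (mderiv j h) - z * ev idfun xi (mderiv j g))).
move=> T i d hd; case: (hd) => hD hM hC.
have vN : i (v ^+ N) * i (P ^+ N) = 1 by rewrite -rmorphM -exprMn hv expr1n rmorph1.
have := hM z (P ^+ N); rewrite e -eg !(derivation_chain hd) eg => e2.
rewrite -[d z]mul1r -vN -mulrA [i (P ^+ N) * d z]mulrC.
have -> : d z * i (P ^+ N) = \sum_j (i (ev idfun xi (mderiv j h)) * d (xj j) -
    i z * (i (ev idfun xi (mderiv j g)) * d (xj j))).
  by rewrite sumrB e2 mulr_sumr addrAC subrr add0r.
rewrite mulr_sumr; apply: eq_bigr => j _; rewrite rmorphM rmorphB rmorphM /=; ring.
Qed.

Variable J : {mpoly B[#|G|]} -> Prop.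
Hypothesis hJ : is_ideal J.
Hypothesis hSR : forall h, SR_ideal q h -> ideal_sum J (max_mul (M := {mpoly B[#|G|]})) h.
Hypothesis xiJ : forall h, J h -> ev idfun xi h = 0.
Variables (r : nat) (hg : 'I_r -> {mpoly B[#|G|]}).
Hypothesis J_gen : forall h, J h -> exists a : 'I_r -> _, h = \sum_l a l * hg l.
Hypothesis hgJ : forall l, J (hg l).

(** An explicit form of the module of differentials modulo the columns of F. T is a square-zero
    extension of E by the cokernel of F and the Jacobian; the universal property of the chart
    extends x_j |-> x_j + Y_j to a ring map u, and d is u - i. *)
Lemma cotangent s (F : 'M[E]_(#|G|, s)) :
  exists (T : comNzRingType) (i : {rmorphism E -> T}) (d : E -> T),
  [/\ derivation i d, forall l, \sum_j i (F j l) * d (xj j) = 0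
    & forall w : 'cV[E]_#|G|, \sum_j i (w j 0) * d (xj j) = 0 ->
      exists (b : 'cV[E]_s) (c : 'cV[E]_r),
        w = F *m b + (\matrix_(j, l) ev idfun xi (mderiv j (hg l))) *m c].
Proof.
set A : 'M[E]_(#|G|, r) := \matrix_(j, l) _.
pose v0 (h : {mpoly E[#|G|]}) := h.@[fun=> 0].
pose lin (h : {mpoly E[#|G|]}) : 'cV[E]_#|G| := \col_j v0 (mderiv j h).
pose sp (w : 'cV[E]_#|G|) := exists b c, w = F *m b + A *m c.
have spD w w' : sp w -> sp w' -> sp (w + w').
  move=> [b [c ->]] [b' [c' ->]]; exists (b + b'), (c + c').
  by rewrite !mulmxDr addrACA.
have spZ (a : E) w : sp w -> sp (a *: w).
  move=> [b [c ->]]; exists (a *: b), (a *: c).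
  by rewrite scalerDr !scalemxAr.
pose I h := v0 h = 0 /\ sp (lin h).
have lin0 : lin 0 = 0 by apply/matrixP => j k; rewrite !mxE /v0 !raddf0.
have linD g h : lin (g + h) = lin g + lin h.
  by apply/matrixP => j k; rewrite !mxE /v0 mderivD rmorphD.
have linM g h : lin (g * h) = v0 g *: lin h + v0 h *: lin g.
  apply/matrixP => j k; rewrite !mxE /v0 mderivM rmorphD !rmorphM /=; ring.
have hI : is_ideal I.
  split.
  - by split; [apply: rmorph0 | rewrite lin0; exists 0, 0; rewrite !mulmx0 addr0].
  - move=> g h [g0 gs] [h0 hs]; split; last by rewrite linD; apply: spD.
    by rewrite /v0 rmorphD /= -/(v0 g) -/(v0 h) g0 h0 addr0.
  - move=> g h [h0 hs]; split; first by rewrite /v0 rmorphM /= -/(v0 h) h0 mulr0.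
    by rewrite linM h0 scale0r addr0; apply: spZ.
have hI1 : ~ I 1 by case=> /eqP; rewrite /v0 rmorph1 oner_eq0.
have [T [pr [prs pr0]]] := quotient_algebra hI hI1.
have [i iE] : exists i : {rmorphism E -> T}, forall a, i a = pr a%:MP.
  by exists (pr \o @mpolyC #|G| E).
pose Y j := pr 'X_j.
have v0X j : v0 'X_j = 0 by rewrite /v0 mevalXU.
have linX j : lin 'X_j = delta_mx j 0.
  apply/matrixP => k l; rewrite !mxE ord1 andbT /v0 mderivX mnm1E eq_sym.
  case: eqP => [->|_]; last by rewrite scale0r rmorph0.
  rewrite (_ : (U_(j) - U_(j) = 0)%MM) ?mpolyX0 ?scale1r ?rmorph1 //.
  by apply/mnmP => l'; rewrite mnmBE subnn mnm0E.
have YY j k : Y j * Y k = 0.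
  rewrite -rmorphM; apply/pr0; split; first by rewrite /v0 rmorphM /= -/(v0 'X_j) v0X mul0r.
  by rewrite linM !v0X !scale0r addr0; exists 0, 0; rewrite !mulmx0 addr0.
have spY (w : 'cV[E]_#|G|) : \sum_j i (w j 0) * Y j = 0 <-> sp w.
  have -> : \sum_j i (w j 0) * Y j = pr (\sum_j (w j 0)%:MP * 'X_j).
    by rewrite rmorph_sum; apply: eq_bigr => j _; rewrite rmorphM iE.
  have linw : lin (\sum_j (w j 0)%:MP * 'X_j) = w.
    rewrite (big_morph lin linD lin0) [RHS]matrix_sum_delta.
    apply: eq_bigr => j _; rewrite big_ord1 linM v0X scale0r addr0 linX.
    by rewrite /v0 mevalC.
  rewrite pr0 /I linw; split=> [[]|] //; split=> //.
  by rewrite /v0 rmorph_sum big1 // => j _; rewrite rmorphM /= mevalXU mulr0.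
have [s0 s0E] : exists s0 : {rmorphism B -> T}, forall b, s0 b = i b%:A.
  by exists (i \o in_alg E).
pose y p := i (xi p) + Y (enum_rank p).
pose K t := exists w : 'I_#|G| -> T, t = \sum_j w j * Y j.
have KK t t' : K t -> K t' -> t * t' = 0.
  move=> [w ->] [w' ->]; rewrite mulr_suml big1 // => j _; rewrite mulr_sumr big1 // => k _.
  by rewrite mulrACA YY mulr0.
have KD t t' : K t -> K t' -> K (t + t').
  move=> [w ->] [w' ->]; exists (fun j => w j + w' j).
  by rewrite -big_split; apply: eq_bigr => j _; rewrite mulrDl.
have KM t t' : K t' -> K (t * t').
  by move=> [w ->]; exists (fun j => t * w j); rewrite mulr_sumr; apply: eq_bigr => j _; rewrite mulrA.
have taylor h : mmap s0 (fun j => y (enum_val j)) h =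
    i (ev idfun xi h) + \sum_j i (ev idfun xi (mderiv j h)) * Y j.
  elim/mpoly_ring_ind: h => [c|k|g h Hg Hh|g h Hg Hh].
  - rewrite mmapC (evC idB) /= s0E big1 ?addr0 // => j _.
    by rewrite mderivC (ev0 idB) rmorph0 mul0r.
  - rewrite mmapX mmap1U -{2}[k]enum_valK (ev_xvar idB) /y enum_valK; congr (_ + _).
    rewrite (bigD1 k) //= big1 ?addr0 => [|j jk].
      rewrite mderivX mnm1E eqxx (_ : (U_(k) - U_(k) = 0)%MM) ?mpolyX0 ?scale1r; last first.
        by apply/mnmP => l; rewrite mnmBE subnn mnm0E.
      by rewrite (ev1 idB) rmorph1 mul1r.
    by rewrite mderivX mnm1E eq_sym (negbTE jk) scale0r (ev0 idB) rmorph0 mul0r.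
  - rewrite rmorphD /= Hg Hh (evD idB) rmorphD addrACA -big_split; congr (_ + _).
    by apply: eq_bigr => j _; rewrite mderivD (evD idB) rmorphD mulrDl.
  - set U := \sum_j i (ev idfun xi (mderiv j g)) * Y j in Hg.
    set V := \sum_j i (ev idfun xi (mderiv j h)) * Y j in Hh.
    have UV : U * V = 0 by apply: KK; [exists (fun j => i (ev idfun xi (mderiv j g)))
      | exists (fun j => i (ev idfun xi (mderiv j h)))].
    have -> : \sum_j i (ev idfun xi (mderiv j (g * h))) * Y j =
        i (ev idfun xi g) * V + i (ev idfun xi h) * U.
      rewrite !mulr_sumr -big_split; apply: eq_bigr => j _.
      rewrite mderivM (evD idB) !(evM idB) rmorphD !rmorphM /=; ring.
    by rewrite rmorphM /= Hg Hh (evM idB) rmorphM /= mulrDl !mulrDr UV addr0 addrA [U * _]mulrC.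
have mK h : K (mmap s0 (fun j => y (enum_val j)) h - i (ev idfun xi h)).
  by rewrite taylor addrAC subrr add0r; exists (fun j => i (ev idfun xi (mderiv j h))).
have [u [uD uM u1 uZ uE]] : exists u : E -> T,
  [/\ forall x z, u (x + z) = u x + u z, forall x z, u (x * z) = u x * u z, u 1 = 1,
      forall b x, u (b *: x) = s0 b * u x & forall h, u (ev idfun xi h) =
        mmap s0 (fun j => y (enum_val j)) h].
  apply: (universal_map hB hJ hSR xi_coord xiJ (s := s0) (y := y)).
    move=> h Jh; rewrite taylor (xiJ Jh) rmorph0 add0r.
    have [a e] := J_gen Jh.
    have -> : \sum_j i (ev idfun xi (mderiv j h)) * Y j =
        \sum_j i ((\col_j ev idfun xi (mderiv j h)) j 0) * Y j.
      by apply: eq_bigr => j _; rewrite mxE.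
    apply/spY; exists 0, (\col_l ev idfun xi (a l)); rewrite mulmx0 add0r.
    apply/matrixP => j k; rewrite !mxE e raddf_sum (ev_sum idB); apply: eq_bigr => l _ /=.
    by rewrite !mxE mderivM (evD idB) !(evM idB) (xiJ (hgJ l)) mulr0 add0r mulrC.
  have [v hv] := section_unit hB xi_coord.
  pose t := \prod_(p in sval f) y p - i P.
  have Kt : K t.
    have := mK (xmon B (sval f)); rewrite (ev_xmon idB) /t; congr (K (_ - _)).
    by rewrite rmorph_prod; apply: eq_bigr => p _; rewrite /= mmapX mmap1U enum_rankK.
  have iv : i v * i P = 1 by rewrite -rmorphM hv rmorph1.
  (* The inverse of i P + t for t of square zero. *)
  exists (i v - i v * (i v * t)); rewrite -(subrK (i P) (\prod_(p in _) _)) -/t.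
  have -> : (i v - i v * (i v * t)) * (t + i P) =
      i v * i P + i v * t * (1 - i v * i P) - i v * i v * (t * t) by ring.
  by rewrite iv subrr mulr0 addr0 (KK t t) // mulr0 subr0.
have uP N : u (P ^+ N) = mmap s0 (fun j => y (enum_val j)) (xmon B (sval f) ^+ N).
  by rewrite -uE (evXn idB) (ev_xmon idB).
have [v hv] := section_unit hB xi_coord.
have Kd x : K (u x - i x).
  have [N [h e]] := section_gen hB xi_coord x.
  have vN : u (v ^+ N) * u (P ^+ N) = 1 by rewrite -uM -exprMn hv expr1n u1.
  rewrite -[u x - i x]mul1r -vN -mulrA; apply: (KM _ _).
  have -> : u (P ^+ N) * (u x - i x) = (u (x * P ^+ N) - i (x * P ^+ N)) +
      - i x * (u (P ^+ N) - i (P ^+ N)) by rewrite uM rmorphM /=; ring.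
  apply: (KD _ _); first by rewrite e uE; apply: mK.
  by apply: (KM _ _); rewrite uP -(ev_xmon idB) -(evXn idB); apply: mK.
have dx j : u (xj j) - i (xj j) = Y j.
  rewrite -(ev_xvar idB xi (enum_val j)) uE mmapX mmap1U (ev_xvar idB) enum_rankK /y enum_valK.
  by rewrite addrAC subrr add0r.
exists T, i, (fun x => u x - i x); split.
- split=> [x z|x z|b].
  + by rewrite uD rmorphD /=; ring.
  + rewrite uM rmorphM /=; have := KK _ _ (Kd x) (Kd z) => e.
    by rewrite -[LHS]subr0 -e; ring.
  + by rewrite uZ u1 mulr1 s0E subrr.
- move=> l; under eq_bigr do rewrite dx.
  have -> : \sum_j i (F j l) * Y j = \sum_j i ((col l F) j 0) * Y j.
    by apply: eq_bigr => j _; rewrite mxE.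
  by apply/spY; exists (delta_mx l 0), 0; rewrite mulmx0 addr0 colE.
- by move=> w; under eq_bigr do rewrite dx; move/spY.
Qed.
End Cotangent.

(** * Logarithmic derivations and the chart at a vertex *)

Section LogDerivation.
Variables (B : comNzRingType) (W : zmodType) (c : cocycle B W) (l : {additive W -> int}).

(** The infinitesimal action of a one-parameter subgroup of the torus of weights; it is compatible
    with any twist. *)
Definition dlog (x : twisted c) : twisted c :=
  \sum_(w <- tsupp x) ((l w)%:~R * tcoef w x) *: tbas c w.

Lemma tcoef_dlog w x : tcoef w (dlog x) = (l w)%:~R * tcoef w x.
Proof.
rewrite /dlog tcoef_sum; case: (boolP (w \in tsupp x)) => wx.
  rewrite (bigD1_seq w) ?tsupp_uniq //= tcoefZ tcoef_bas eqxx mulr1 big1 ?addr0 // => v vw.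
  by rewrite tcoefZ tcoef_bas (negbTE vw) mulr0.
have -> : tcoef w x = 0 by apply/eqP; rewrite -[_ == _]negbK tcoef_supp.
rewrite mulr0 big_seq big1 // => v vx; rewrite tcoefZ tcoef_bas.
by case: eqP => [vw|]; rewrite ?mulr0 //; rewrite -vw vx in wx.
Qed.

Lemma dlog_bas w : dlog (tbas c w) = (l w)%:~R *: tbas c w.
Proof.
apply: twistedP => v; rewrite tcoef_dlog tcoefZ tcoef_bas.
by case: eqP => [->|]; rewrite ?mulr0.
Qed.

Lemma dlog_derivation : derivation (idfun : {rmorphism twisted c -> twisted c}) dlog.
Proof.
have dD x y : dlog (x + y) = dlog x + dlog y.
  by apply: twistedP => w; rewrite !(tcoefD, tcoef_dlog) mulrDr.
have dZ a x : dlog (a *: x) = a *: dlog x.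
  by apply: twistedP => w; rewrite !(tcoefZ, tcoef_dlog) mulrCA.
have d0 : dlog 0 = 0 by apply: twistedP => w; rewrite tcoef_dlog tcoef0 mulr0.
split=> // [x y|b] /=; last by rewrite dZ -tbas0 dlog_bas raddf0 scale0r scaler0.
elim/tind: x => [|x x' hx hx'|a u]; first by rewrite mul0r d0 !mul0r addr0.
  by rewrite [in LHS]mulrDl [in LHS]dD hx hx' dD !mulrDl addrACA.
rewrite -scalerAl !dZ -!scalerAl -scalerDr; congr (_ *: _).
elim/tind: y => [|y y' hy hy'|b v]; first by rewrite mulr0 d0 !mulr0 addr0.
  by rewrite [in LHS]mulrDr [in LHS]dD hy hy' dD !mulrDr addrACA.
rewrite -scalerAr !dZ -!scalerAr -scalerDr; congr (_ *: _).
rewrite tbasM dZ !dlog_bas -scalerAl -scalerAr tbasM -scalerDl raddfD /=.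
by rewrite rmorphD /= !scalerA mulrC [in RHS]addrC.
Qed.
End LogDerivation.

Definition bend (B : comNzRingType) (w : ray -> B) (r s : ray) : B :=
  tm w (phi CV (rvec r) + phi CV (rvec s) - phi CV (rvec r + rvec s)).
(** The four bends through which the weights at R0 and R2 control the others: R3 and R5 as their
    opposites, R1 as the sum of R0 and R2, and R4 as the sum of R3 and R5. *)
Definition bends (B : comNzRingType) (w : ray -> B) : B :=
  bend w R0 R3 * bend w R2 R5 * bend w R0 R2 * bend w R3 R5.

Section VertexChart.
Variables (G : finZmodType) (q : {additive (int * int)%type -> G}).
Hypothesis poly : polyhedral q.
Variables (C : fieldType) (B : comAlgType C) (t : edge G -> B).
Hypothesis tmin : minor_relations q t.
Local Notation W := (int * (int * int))%type.
Variables (f : nonempty_face q) (p : G).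
Hypothesis fp : sval f = [set p].
Local Notation tb w := (tbas (tcoc tmin f) w).
Local Notation E := (tchart tmin f).

Lemma vertex_base : bpt (sval f) = p.
Proof. by have := nf_in f; rewrite {2}fp inE => /eqP. Qed.

Lemma vertex_cell : nf_cell f = CV.
Proof.
rewrite /nf_cell vertex_base fp; have -> : [set p] = cset q p CV.
  by apply/setP => x; rewrite !inE /= orbF.
exact: (cellof_cset poly).
Qed.

Lemma vertex_mul v w : tb v * tb w =
  tm (wt q t p) (phi CV v.2 + phi CV w.2 - phi CV (v.2 + w.2)) *: tb (v + w).
Proof.
rewrite tbasM; congr (_ *: _); apply: etrans (cstE _ _ _ _ _ _) _.
by rewrite vertex_cell vertex_base.
Qed.

Lemma vertex_ray r s : tb (0, rvec r) * tb (0, rvec s) =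
  bend (wt q t p) r s *: tb (0, rvec r + rvec s).
Proof. by rewrite vertex_mul /bend; congr (_ *: tb (_, _)). Qed.

Lemma vertex_unit : tb (1, 0) * tb (- 1, 0) = 1.
Proof. by rewrite vertex_mul !phi0 add0r subrr tm0 scale1r -tbas0. Qed.

Section Derivation.
Variables (T : comNzRingType) (i : {rmorphism E -> T}) (d : E -> T).
Hypothesis hd : derivation i d.
Hypotheses (d1 : d (tb (1, 0)) = 0) (dx : d (tb (0, rvec R0)) = 0)
  (dy : d (tb (0, rvec R2)) = 0).

(** The generator at each other ray occurs in a product with known differential, whose bend
    therefore kills its differential too. Within a maximal cone basis elements multiply without
    bends, so the six rays and the degree generate everything. *)
Lemma vertex_kappa x : i (bends (wt q t p))%:A * d x = 0.
Proof.
set w := wt q t p; case: (hd) => hD hM hC.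
have iZ b z : i (b *: z) = i b%:A * i z by rewrite -(mulr_algl b z) rmorphM.
have dZ b z := derivationZ hd b z.
have bM b c : i (b * c)%:A = i b%:A * i c%:A.
  by rewrite -rmorphM /= -scalerAl mul1r scalerA.
have rel r s u : rvec r + rvec s = rvec u ->
    i (bend w r s)%:A * d (tb (0, rvec u)) =
    i (tb (0, rvec r)) * d (tb (0, rvec s)) + d (tb (0, rvec r)) * i (tb (0, rvec s)).
  by move=> e; rewrite -dZ -e -vertex_ray hM.
have rel0 r s : rvec r + rvec s = 0 -> d (tb (0, rvec r)) = 0 ->
    i (bend w r s)%:A * d (tb (0, rvec s)) = 0.
  move=> e dr; have := congr1 d (vertex_ray r s); rewrite e -/(0 : W) tbas0 hC hM dr mul0r addr0.
  move=> e2; have := congr1 i (vertex_ray r s); rewrite e -/(0 : W) tbas0 => <-.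
  by rewrite rmorphM mulrAC e2 mul0r.
have d3 := rel0 R0 R3 erefl dx.
have d5 := rel0 R2 R5 erefl dy.
have dR1 : i (bend w R0 R2)%:A * d (tb (0, rvec R1)) = 0.
  by rewrite (rel R0 R2 R1 erefl) dx dy mulr0 mul0r addr0.
pose k := i (bends w)%:A.
have kE : k = i (bend w R0 R3)%:A * i (bend w R2 R5)%:A * i (bend w R0 R2)%:A *
    i (bend w R3 R5)%:A by rewrite /k /bends !bM.
have kray r : k * d (tb (0, rvec r)) = 0.
  case: r.
  - by rewrite dx mulr0.
  - by rewrite kE mulrAC -[X in X * _]mulrA dR1 mulr0 mul0r.
  - by rewrite dy mulr0.
  - have -> : k * d (tb (0, rvec R3)) = i (bend w R2 R5)%:A * i (bend w R0 R2)%:A *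
      i (bend w R3 R5)%:A * (i (bend w R0 R3)%:A * d (tb (0, rvec R3))) by rewrite kE; ring.
    by rewrite d3 mulr0.
  - rewrite kE -mulrA (rel R3 R5 R4 erefl).
    have -> : i (bend w R0 R3)%:A * i (bend w R2 R5)%:A * i (bend w R0 R2)%:A *
      (i (tb (0, rvec R3)) * d (tb (0, rvec R5)) + d (tb (0, rvec R3)) * i (tb (0, rvec R5))) =
      i (bend w R0 R3)%:A * i (bend w R0 R2)%:A * i (tb (0, rvec R3)) *
        (i (bend w R2 R5)%:A * d (tb (0, rvec R5))) +
      i (bend w R2 R5)%:A * i (bend w R0 R2)%:A * i (tb (0, rvec R5)) *
        (i (bend w R0 R3)%:A * d (tb (0, rvec R3))) by ring.
    by rewrite d3 d5 !mulr0 addr0.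
  - have -> : k * d (tb (0, rvec R5)) = i (bend w R0 R3)%:A * i (bend w R0 R2)%:A *
      i (bend w R3 R5)%:A * (i (bend w R2 R5)%:A * d (tb (0, rvec R5))) by rewrite kE; ring.
    by rewrite d5 mulr0.
have kM y z : k * d y = 0 -> k * d z = 0 -> k * d (y * z) = 0.
  move=> hx hy; rewrite hM mulrDr mulrCA hy mulr0 add0r mulrA hx.
  by rewrite mul0r.
have k1 : k * d 1 = 0 by rewrite (derivation1 hd) mulr0.
have kX y n : k * d y = 0 -> k * d (y ^+ n) = 0.
  by move=> hx; elim: n => [|n IH]; rewrite ?expr0 // exprS; apply: kM.
have sc r : subcell (nf_cell f) (CT r) by rewrite vertex_cell.
have kN : k * d (tb (- 1, 0)) = 0.
  have := congr1 d vertex_unit; rewrite (derivation1 hd) hM d1 mul0r addr0 => e.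
  have e1 := congr1 i vertex_unit; rewrite rmorphM rmorph1 in e1.
  by rewrite -[d _]mul1r -e1 mulrAC e mul0r mulr0.
have kz (a : int) : k * d (tb (a, 0)) = 0.
  have pw (s : int) n : tb (s, 0) ^+ n = tb ((s, 0) *+ n).
    exact: (tb_coneX (v := (s, 0)) tmin n (sc R0) (cone0 R0)).
  case: a => n.
    have -> : (Posz n, 0) = ((1, 0) : W) *+ n.
      by apply: injective_projections; rewrite ?(raddfMn fst) ?(raddfMn snd) /= ?mul0rn // natz.
    by rewrite -pw; apply: kX; rewrite d1 mulr0.
  have -> : (Negz n, 0) = ((- 1, 0) : W) *+ n.+1.
    apply: injective_projections; rewrite ?(raddfMn fst) ?(raddfMn snd) /= ?mul0rn //.
    by rewrite NegzE mulNrn natz.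
  by rewrite -pw; apply: kX.
have kpos r u : cone r u -> k * d (tb (0, u)) = 0.
  move=> cu; have /andP [c1 c2] := cu; have e := cone_decomp cu.
  have cr : cone r (rvec r) by apply: cone_ray; rewrite inE eqxx.
  have cn : cone r (rvec (rnext r)) by apply: cone_ray; rewrite !inE eqxx orbT.
  have -> : tb (0, u) = tb (0, rvec r) ^+ `|rdet (rnext r) u|%N *
      tb (0, rvec (rnext r)) ^+ `|rdet r u|%N.
    rewrite !(tb_coneX tmin _ (sc r)) // (tb_cone tmin (sc r)) ?(raddfMn snd) ?coneM //.
    congr tbas; apply: injective_projections; first by rewrite /= !(raddfMn fst) /= !mul0rn.
    rewrite [LHS]e /= !(raddfMn snd) /= !pmulrn; congr (_ *~ _ + _ *~ _); lia.
  by apply: kM; apply: kX.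
elim/tind: x => [|x y hx hy|a [z u]].
- by rewrite (derivation0 hd) mulr0.
- by rewrite hD mulrDr hx hy addr0.
rewrite dZ mulrCA; have [r cu] := cone_cover u.
have -> : tb (z, u) = tb (z, 0) * tb (0, u).
  by rewrite (tb_cone tmin (sc r)) ?cone0 //; congr (tb (_, _)); rewrite ?addr0 ?add0r.
by rewrite kM ?mulr0 //; apply: kpos cu.
Qed.
End Derivation.
End VertexChart.

Lemma mderiv_map (A B : comNzRingType) n (f : {rmorphism A -> B}) (h : {mpoly A[n]}) j :
  mderiv j (map_mpoly f h) = map_mpoly f (mderiv j h).
Proof.
elim/mpoly_ring_ind: h => [c|k|g h Hg Hh|g h Hg Hh].
- by rewrite map_mpolyC !mderivC rmorph0.
- rewrite map_mpolyX !mderivX -!mul_mpolyC rmorphM /= map_mpolyC map_mpolyX.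
  by rewrite -(rmorph_nat f).
- by rewrite rmorphD !mderivD Hg Hh rmorphD.
- by rewrite rmorphM !mderivM Hg Hh rmorphD !rmorphM.
Qed.

Lemma map_mpoly_surj (A B : comNzRingType) n (f : {rmorphism A -> B}) :
  (forall b, exists a, f a = b) -> forall h, exists g : {mpoly A[n]}, map_mpoly f g = h.
Proof.
move=> fs; elim/mpoly_ring_ind => [c|k|_ _ [g <-] [h <-]|_ _ [g <-] [h <-]].
- by have [a <-] := fs c; exists a%:MP; rewrite map_mpolyC.
- by exists 'X_k; rewrite map_mpolyX.
- by exists (g + h); rewrite rmorphD.
- by exists (g * h); rewrite rmorphM.
Qed.

Section BaseChange.
Variables (G : finZmodType) (q : {additive (int * int)%type -> G}).
Variables (S B : comNzRingType) (f : {rmorphism S -> B}) (J : {mpoly S[#|G|]} -> Prop).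
Hypothesis hJ : is_ideal J.
Hypothesis fs : forall b, exists a, f a = b.
Local Notation J' := (ext_ideal (map_mpoly f) J).

Lemma ext_map_gen h : J' h -> exists2 g, J g & h = map_mpoly f g.
Proof.
apply: (gen_ideal_min (I := fun h => exists2 g, J g & h = map_mpoly f g));
  last by move=> _ [g Jg ->]; exists g.
split; first by exists 0; rewrite ?rmorph0 //; apply: (ideal0 hJ).
  by move=> _ _ [g Jg ->] [h' Jh ->]; exists (g + h'); rewrite ?rmorphD //; apply: idealD.
move=> a _ [g Jg ->]; have [b <-] := map_mpoly_surj fs a.
by exists (b * g); rewrite ?rmorphM //; apply: idealMl.
Qed.

Lemma ext_map_SR : (forall r, nonunit r -> nonunit (f r)) ->
  (forall h, ideal_sum (SR_ideal q (B := S)) (max_mul (M := {mpoly S[#|G|]})) h ->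
     ideal_sum J (max_mul (M := {mpoly S[#|G|]})) h) ->
  forall h, SR_ideal q h -> ideal_sum J' (max_mul (M := {mpoly B[#|G|]})) h.
Proof.
move=> fn cf; apply: gen_ideal_min.
  apply: ideal_sumP; first exact: gen_idealP.
  by split; [apply: max_mul0 | move=> *; apply: max_mulD | move=> *; apply: max_mul_mulr].
move=> _ [m mn ->].
have [|a [b [Ja mb e]]] := cf (xmon S m).
  exists (xmon S m), 0; rewrite addr0; split=> //; last exact: max_mul0.
  by apply: gen_ideal_sub; exists m.
exists (map_mpoly f a), (map_mpoly f b); split.
- by apply: gen_ideal_sub; exists a.
- exact: max_mul_map_mpoly.
- rewrite -rmorphD -e rmorph_prod; apply: eq_bigr => x _.
  by rewrite /= map_mpolyX.
Qed.
End BaseChange.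

(** * Smooth fibres *)

Lemma bends_rmorph (B B' : comNzRingType) (g : {rmorphism B -> B'}) (w : ray -> B) (w' : ray -> B') :
  (forall r, w' r = g (w r)) -> g (bends w) = bends w'.
Proof. by move=> h; rewrite /bends /bend -!(tm_rmorph _ h) !rmorphM. Qed.

Lemma eq_big_support (V : nmodType) (I : eqType) (s1 s2 : seq I) (F : I -> V) :
  uniq s1 -> uniq s2 -> (forall x, F x != 0 -> (x \in s1) && (x \in s2)) ->
  \sum_(x <- s1) F x = \sum_(x <- s2) F x.
Proof.
move=> u1 u2 h; have e s : \sum_(x <- s) F x = \sum_(x <- s | F x != 0) F x.
  by rewrite [RHS]big_mkcond; apply: eq_bigr => x _; case: eqP.
rewrite e [RHS]e -!(big_filter _ (fun x => F x != 0)); apply: perm_big; apply: uniq_perm.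
- exact: filter_uniq.
- exact: filter_uniq.
- by move=> x; rewrite !mem_filter; case: eqVneq => //= /h /andP [-> ->].
Qed.

Section Core.
Variables (G : finZmodType) (q : {additive (int * int)%type -> G}).
Hypothesis poly : polyhedral q.
Variables (C : fieldType) (R : comAlgType C) (J : {mpoly R[#|G|]} -> Prop).
Hypothesis J_versal : miniversal q J.
Variable iota : {lrmorphism {mpoly C[#|edge G|]} -> R}.
Hypothesis hc : is_completion (@base_ideal G q C)
  (gen_ideal (fun y => exists i : 'I_#|edge G|, y = 'X_i)) iota.
Hypothesis htoric : forall k (B : comAlgType C) (f : {lrmorphism R -> B})
  (fs : forall b, exists a, f a = b),
  (forall r, tpow (fun i => iota 'X_i) k.+1 r -> f r = 0) -> induces J f (toric_level poly hc fs).
Local Notation x := (fun i => iota 'X_i).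
Local Notation mR := (tpow x).
Local Notation te e := (iota (tvar C e)).
Local Notation S := {mpoly R[#|G|]}.
Local Notation n := #|G|.

Let bi2 := @base_ideal2 G q C.

Lemma J_ideal : is_ideal J. Proof. by case: J_versal => -[]. Qed.

Lemma S_noetherian : noetherian {mpoly R[#|G|]}.
Proof. exact: hilbert_mpoly (compl_noetherian hc). Qed.

Lemma homogeneous_generators : exists r (g : 'I_r -> S) (d : 'I_r -> nat),
  [/\ forall l, J (g l), forall l, g l \is (d l).-homog
    & forall h, J h -> exists a : 'I_r -> S, h = \sum_l a l * g l].
Proof.
have [Ji Jh _ _] : embedded_family q J by case: J_versal.
have [r [g [hg gen]]] := noetherian_gen
  (fun h => J h /\ exists d, h \is d.-homog) S_noetherian.
have /choice [d hd] : forall l, exists d, g l \is d.-homog by move=> l; have [] := hg l.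
exists r, g, d; split=> // [l|h hJ]; first by have [] := hg l.
apply: gen; rewrite (pihomog_partitionE (leqnn (msize h))).
apply: ideal_bigsum => [|k _]; first exact: gen_idealP.
by apply: gen_ideal_sub; split; [apply: Jh | exists k; apply: pihomogP].
Qed.

Definition vertex_face (p : G) : nonempty_face q.
Proof.
exists [set p]; apply/andP; split; first by apply/set0Pn; exists p; rewrite inE.
apply: (face_sub _ (cset_face poly p CV)); apply/fintype.subsetP => y; rewrite !inE => /eqP ->.
by rewrite eqxx.
Defined.

Definition kappa_at (p : G) : R := bends (wt q (fun e => - te e) p).

(** What is kept of the chart at p over level k, in a form that passes to products over k:
    generators and relations up to powers of x_p, and matrix identities that bound the corank of the
    Jacobian by 3 from both sides wherever [kappa_at p] is invertible. *)
Definition vertex_spec r (g : 'I_r -> S) p k (E : comNzRingType) (e : {rmorphism S -> E}) : Prop :=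
  [/\ forall z, exists N h, z * e (xvar R p) ^+ N = e h,
      forall h, e h = 0 -> exists N j, J j /\ forall m, mR k.+1 ((xvar R p ^+ N * h - j)@_m)
    & let A : 'M[E]_(n, r) := \matrix_(j, l) e (mderiv j (g l)) in
      exists (D : 'M[E]_(3, n)) (F : 'M[E]_(n, 3)) (b : 'M[E]_(3, n)) (c : 'M[E]_(r, n))
        (z : 'rV[E]_3) (w : E),
      [/\ D *m A = 0, D *m F = diag_mx z,
        e (kappa_at p)%:MP *: 1%:M = F *m b + A *m c
        & (z 0 0 * z 0 1 * z 0 2) * w = e (kappa_at p)%:MP]].

Lemma vertex_level r (g : 'I_r -> S) p k :
  (forall l, J (g l)) -> (forall h, J h -> exists a : 'I_r -> S, h = \sum_l a l * g l) ->
  exists (E : comNzRingType) (e : {rmorphism S -> E}), @vertex_spec r g p k E e.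
Proof.
move=> gJ Jgen; have [B [f [fs fk]]] := level_exists hc bi2 k.
have fk1 rr : mR k.+1 rr -> f rr = 0 by move/fk.
have [xi0 [_ _ xc0 xJ0]] := htoric fs fk1.
pose vf := vertex_face p; pose xi := xi0 vf.
have xc := xc0 vf; have xJ := xJ0 vf; rewrite -/xi in xc xJ.
have hB := surj_nil_local hc fs fk1.
have fn rr : nonunit rr -> nonunit (f rr).
  by move/(nonunit_mR hc bi2) => h; apply/(surj_nonunit hc fs).
pose J' := ext_ideal (map_mpoly f) J.
have hJ' : is_ideal J' by exact: gen_idealP.
have J'gen := ext_map_gen J_ideal fs (f := f).
have [_ _ _ cf] : embedded_family q J by case: J_versal.
have J'SR := ext_map_SR fn (fun h => (cf h).2) (f := f) (J := J) (q := q).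
pose idB := (idfun : {rmorphism B -> B}).
have evf h : ev f xi h = ev idfun xi (map_mpoly f h) by rewrite ev_comp.
have xJ' h : J' h -> ev idfun xi h = 0.
  by move/J'gen => [h' /xJ e ->]; rewrite -evf.
have Pp : \prod_(y in sval vf) xi y = xi p by rewrite big_set1.
pose E := chart (toric_level poly hc fs) vf.
exists E, (evm f xi).
have eE h : evm f xi h = ev f xi h by [].
split.
- move=> z; have [N [h e]] := section_gen hB xc z; have [h' hE] := map_mpoly_surj fs h.
  exists N, h'; rewrite !eE ev_xvar evf hE -e Pp; by [].
- move=> h; rewrite eE evf => /(section_rel hB hJ' J'SR xc xJ') [N /J'gen [j Jj e]].
  exists N, j; split=> // m; apply/fk; rewrite -mcoeff_map_mpoly rmorphB rmorphM rmorphXn /=.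
  by rewrite -e map_mpolyX (_ : xmon B (sval vf) = xvar B p) ?subrr ?mcoeff0 // /xmon big_set1.
move=> A; pose tm' := tpar_minors hc f.
have vfp : sval vf = [set p] by [].
pose tb (w : int * (int * int)) : E := tbas (tcoc tm' vf) w.
pose s1 : {additive (int * int)%type -> int} := fst.
pose s2 : {additive (int * int)%type -> int} := snd.
pose l0 : {additive (int * (int * int))%type -> int} := fst.
pose l' : {additive (int * (int * int))%type -> (int * int)%type} := snd.
pose l1 : {additive (int * (int * int))%type -> int} := s1 \o l'.
pose l2 : {additive (int * (int * int))%type -> int} := s2 \o l'.
pose lam (i : 'I_3) := if i == 0 then l0 else if i == 1 then l1 else l2.
pose wv (i : 'I_3) : int * (int * int) :=
  if i == 0 then (1, 0) else if i == 1 then (0, rvec R0) else (0, rvec R2).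
(* F holds the gradients of the degree coordinate and of the coordinates at R0 and R2, and D the
   values of the dual logarithmic derivations on the sections; hence D F is diagonal with these
   coordinates as entries. *)
have /choice [Fc hF] := fun i => gradient hB xc (tb (wv i)).
pose F : 'M[E]_(n, 3) := \matrix_(j, i) Fc i j.
pose dl i : E -> E := @dlog B _ (tcoc tm' vf) (lam i).
have dld i : derivation (idfun : {rmorphism E -> E}) (dl i) by exact: dlog_derivation.
pose D : 'M[E]_(3, n) := \matrix_(i, j) dl i (xi (enum_val j)).
have kE : evm f xi (kappa_at p)%:MP = (bends (wt q (tpar iota f) p))%:A.
  rewrite eE evC; congr (_%:A); apply: bends_rmorph => r0.
  reflexivity.
have J'span h : J' h -> exists a : 'I_r -> _, h = \sum_l a l * map_mpoly f (g l).
  move=> /J'gen [h' /Jgen [a ->] ->]; exists (fun l => map_mpoly f (a l)).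
  by rewrite rmorph_sum; apply: eq_bigr => l _; rewrite rmorphM.
have gJ' l : J' (map_mpoly f (g l)) by apply: gen_ideal_sub; exists (g l).
have [T [i [d [hd d1 d2]]]] := cotangent hB xc hJ' J'SR xJ' J'span gJ' F.
have dz m : d (tb (wv m)) = 0.
  by rewrite (hF m T i d hd) -[RHS](d1 m); apply: eq_bigr => j _; rewrite mxE.
have kap := vertex_kappa poly vfp hd (dz 0) (dz 1) (dz 2).
have AE : \matrix_(j, l) ev idfun xi (mderiv j (map_mpoly f (g l))) = A.
  by apply/matrixP => j l; rewrite !mxE mderiv_map -evf.
have /choice [bc hbc] : forall j0 : 'I_n, exists bc : 'cV[E]_3 * 'cV[E]_r,
    evm f xi (kappa_at p)%:MP *: delta_mx j0 0 = F *m bc.1 + A *m bc.2.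
  move=> j0; rewrite -AE; have [|b [c e]] := d2 (evm f xi (kappa_at p)%:MP *: delta_mx j0 0).
    rewrite (bigD1 j0) //= big1 => [|j jj]; last first.
      by rewrite !mxE (negbTE jj) mulr0 rmorph0 mul0r.
    by rewrite !mxE !eqxx mulr1 addr0 kE kap.
  by exists (b, c).
exists D, F, (\matrix_(i, j) (bc j).1 i 0), (\matrix_(l, j) (bc j).2 l 0),
  (\row_i tb (wv i)).
(* Multiplied by the diagonal entries, the three opposite elements give 1 and the bends of R0, R3
   and of R2, R5; the last factor supplies the other two bends. *)
exists (tb (- 1, 0) * tb (0, rvec R3) * tb (0, rvec R5) *
  (bend (wt q (tpar iota f) p) R0 R2 * bend (wt q (tpar iota f) p) R3 R5)%:A); split.
- apply/matrixP => i0 l; rewrite !mxE; under eq_bigr do rewrite !mxE.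
  have := derivation_chain (dld i0) xi (map_mpoly f (g l)).
  rewrite (xJ' _ (gJ' l)) (derivation0 (dld i0)) => e; rewrite [RHS]e; apply: eq_bigr => j _.
  by rewrite /= mderiv_map -evf mulrC.
- apply/matrixP => i0 m; rewrite !mxE; under eq_bigr do rewrite !mxE.
  have := hF m _ _ _ (dld i0); rewrite /dl /tb dlog_bas => e.
  rewrite (eq_bigr (fun j => Fc m j * dl i0 (xi (enum_val j)))) => [|j _]; last exact: mulrC.
  rewrite -[LHS]e /lam /wv; case: i0 {e} => [[|[|[|//]]] ?]; case: m => [[|[|[|//]]] ?];
    by rewrite /= ?scale1r ?scale0r.
- apply/matrixP => i0 j0; have /matrixP /(_ i0 0) := hbc j0; rewrite !mxE eqxx andbT => ->.
  by congr (_ + _); apply: eq_bigr => m _; congr (_ * _); rewrite [RHS]mxE.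
- rewrite !mxE kE /wv /=.
  have e0 := vertex_unit poly tm' vfp.
  have e1 := vertex_ray poly tm' vfp R0 R3; have e2 := vertex_ray poly tm' vfp R2 R5.
  rewrite -/(tb _) -/(tb _) in e0; rewrite -/(tb _) -/(tb _) in e1; rewrite -/(tb _) -/(tb _) in e2.
  set c1 := (_ * _)%:A; transitivity ((tb (1, 0) * tb (- 1, 0)) *
    (tb (0, rvec R0) * tb (0, rvec R3)) * (tb (0, rvec R2) * tb (0, rvec R5)) * c1); first by ring.
  rewrite e0 e1 e2 mul1r.
  have -> : tbas (tcoc tm' vf) (0, rvec R0 + rvec R3) = 1 by rewrite -tbas0.
  have AM (b c : B) : b%:A * c%:A = (b * c)%:A :> E by rewrite -scalerAl mul1r scalerA.
  by rewrite /c1 !AM /bends !mulrA.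
Qed.

Lemma coef_tpow k (h : S) : (forall m, mR k (h@_m)) ->
  tpow (fun i => (iota 'X_i)%:MP : S) k h.
Proof.
move=> hm; rewrite [h]mpolyE; apply: ideal_bigsum (tpowP _ _) _ => m _.
rewrite -mul_mpolyC; apply: idealMr (tpowP _ _) _.
exact: (tpow_morph (@mpolyC n R)).
Qed.

Section FieldLevel.
Variables (qh : S -> Prop) (p : G).
Hypothesis qh_prime : prime_ideal qh.
Hypothesis qhJ : forall h, J h -> qh h.
Hypothesis qh_vertex : forall N j c, qh j -> (forall m, mR 1 (c@_m)) -> xvar R p ^+ N <> j + c.
Hypothesis qh_kappa : ~ qh (kappa_at p)%:MP.
Variables (r : nat) (g : 'I_r -> S).
Hypothesis gJ : forall l, J (g l).
Hypothesis Jgen : forall h, J h -> exists a : 'I_r -> S, h = \sum_l a l * g l.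

(** In the product of the charts of all levels, elements that eventually lie in the extension of qh
    form an ideal. A field point that kills it and avoids the image of the complement of qh has
    exactly qh as its kernel in S, and inherits the identities of [vertex_spec]. *)
Lemma field_level : exists (L : fieldType) (g0 : {rmorphism S -> L}),
  (forall h, g0 h = 0 <-> qh h) /\
  \rank (kermx (\matrix_(j < n, l < r) g0 (mderiv j (g l)))) = 3%N.
Proof.
have [hq q1 qM] := qh_prime.
have [E [e He]] : exists (E : nat -> comNzRingType) (e : forall k, {rmorphism S -> E k}),
    forall k, @vertex_spec r g p k (E k) (e k).
  pose HE k := cid (vertex_level p k gJ Jgen).
  by exists (fun k => sval (HE k)), (fun k => sval (cid (svalP (HE k)))) => k; apply: svalP.
have gen k z : exists N h, z * e k (xvar R p) ^+ N = e k h.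
  by have [h _ _] := He k; apply: (h z).
have rel k h : e k h = 0 -> exists N j, J j /\ forall m, mR k.+1 ((xvar R p ^+ N * h - j)@_m).
  by have [_ h' _] := He k; apply: (h' h).
have mat k := let: And3 _ _ h := He k in h.
clear He.
pose Pi := dprod E; pose evP : {rmorphism S -> Pi} := dlift e.
pose Qk k := gen_ideal (fun y => exists2 s, qh s & y = e k s).
pose nid (y : Pi) := exists k0, forall k, (k0 <= k)%N -> Qk k (dproj k y).
have nidP : is_ideal nid.
  split.
  - by exists 0%N => k _; rewrite rmorph0; apply: (ideal0 (gen_idealP _)).
  - move=> y y' [k h] [k' h']; exists (maxn k k') => l; rewrite geq_max => /andP [kl kl'].
    by rewrite rmorphD; apply: idealD (gen_idealP _) (h _ kl) (h' _ kl').
  - move=> y y' [k h]; exists k => l kl; rewrite rmorphM.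
    exact: idealMl (gen_idealP _) (h _ kl).
pose Sg y := exists2 h, ~ qh h & y = evP h.
have Sg1 : Sg 1 by exists 1; rewrite ?rmorph1.
have SgM y y' : Sg y -> Sg y' -> Sg (y * y').
  by move=> [h nh ->] [h' nh' ->]; exists (h * h'); rewrite ?rmorphM // => /qM [].
have disj y : Sg y -> ~ nid y.
  (* If h is eventually in the extension of qh, then for every large k a power of x_p, depending on
     k, times h lies in qh up to order k. Krull's theorem then puts a power of x_p into the sum of
     qh and the extended maximal ideal, against [qh_vertex]. *)
  move=> [h nh ->] [k0 hk0].
  have /choice [M hM] : forall k, exists M, (k0 <= k)%N ->
      exists2 P : {mpoly S[#|edge G|]}, P \is k.-homog &
        qh (P.@[fun i => (iota 'X_i)%:MP] - xvar R p ^+ M * h).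
    move=> k; case: (leqP k0 k) => [/hk0|]; last by exists 0%N.
    rewrite /dproj /evP /= /dlift => -[l [c [y0 [hy ye]]]].
    have /choice [s hs] : forall i, exists s, qh s /\ y0 i = e k s.
      by move=> i; have [s s1 s2] := hy i; exists s.
    have /choice [Ng hNg] : forall i, exists Ng : nat * S, c i * e k (xvar R p) ^+ Ng.1 = e k Ng.2.
      by move=> i; have [N [g' e']] := gen k (c i); exists (N, g').
    pose N := (\sum_i (Ng i).1)%N.
    pose g' i := (Ng i).2 * xvar R p ^+ (\sum_(j | j != i) (Ng j).1)%N.
    have := @rel k (xvar R p ^+ N * h - \sum_i g' i * s i).
    rewrite rmorphB rmorphM rmorphXn /= ye rmorph_sum mulr_sumr -sumrB big1 => [|i _]; last first.
      rewrite rmorphM /= /g' rmorphM rmorphXn /= -hNg /N (bigD1 i) //= exprD.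
      by have [_ ->] := hs i; ring.
    move=> /(_ erefl) [N' [j [Jj hj]]]; exists (N' + N)%N => _.
    have [|P hP Pe] := @coef_tpow k (xvar R p ^+ N' * (xvar R p ^+ N * h - \sum_i g' i * s i) - j).
      by move=> m; apply: tpowS.
    exists P => //; rewrite Pe.
    have -> : xvar R p ^+ N' * (xvar R p ^+ N * h - \sum_i g' i * s i) - j - xvar R p ^+ (N' + N) * h =
        - (xvar R p ^+ N' * (\sum_i g' i * s i)) - j by rewrite exprD; ring.
    apply: idealB => //; last exact: qhJ.
    apply: idealN => //; apply: idealMl => //; apply: ideal_bigsum => // i _; apply: idealMl => //.
    by have [] := hs i.
  have [N [m [f [c [_ _ hcj hq']]]]] := krull S_noetherian hq (s := fun k => xvar R p ^+ M k) hM.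
  case: (qM _ _ hq') => // {}hq'.
  apply: (@qh_vertex (M N) _ (\sum_j c j * xvar R p ^+ M (f j)) hq'); last by rewrite subrK.
  have [B [f0 [f0s f0k]]] := level_exists hc bi2 0.
  have coefI (h' : S) : (forall m, mR 1 (h'@_m)) <-> map_mpoly f0 h' = 0.
    split=> [h1|h1 m'].
      by apply/mpolyP => m'; rewrite mcoeff_map_mpoly mcoeff0; apply/f0k.
    by apply/f0k; rewrite -mcoeff_map_mpoly h1 mcoeff0.
  apply/coefI; rewrite rmorph_sum big1 // => j _; rewrite rmorphM /=.
  suff -> : map_mpoly f0 (c j) = 0 by rewrite mul0r.
  move: (hcj j); apply: (gen_ideal_min (I := fun c => map_mpoly f0 c = 0)).
    split; first exact: rmorph0.
      by move=> u v hu hv; rewrite rmorphD /= hu hv addr0.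
    by move=> u v hv; rewrite rmorphM /= hv mulr0.
  move=> _ [i ->]; rewrite map_mpolyC /= (_ : f0 _ = 0) ?mpolyC0 //.
  by apply/f0k; apply: (tpow1 x).
have [L [chi [chin chiS]]] := field_avoiding nidP Sg1 SgM disj.
pose g0 : {rmorphism S -> L} := chi \o evP.
have g0E h : g0 h = chi (evP h) by [].
have g0k h : g0 h = 0 <-> qh h.
  split=> [g0h|qhh].
    by apply: contrapT => nh; have /eqP := chiS (evP h) (ex_intro2 _ _ h nh erefl); apply.
  apply: chin; exists 0%N => k _; apply: gen_ideal_sub; exists h => //.
exists L, g0; split=> //.
pose A : 'M[Pi]_(n, r) := \matrix_(j, l) evP (mderiv j (g l)).
pose kp : Pi := evP (kappa_at p)%:MP.
have [D [F [b [c [z [w [h1 h2 h3 h4]]]]]]] : exists (D : 'M[Pi]_(3, n)) (F : 'M[Pi]_(n, 3))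
    (b : 'M[Pi]_(3, n)) (c : 'M[Pi]_(r, n)) (z : 'rV[Pi]_3) (w : Pi),
    [/\ D *m A = 0, D *m F = diag_mx z, kp *: 1%:M = F *m b + A *m c
      & (z 0 0 * z 0 1 * z 0 2) * w = kp].
  pose tup k := ('M[E k]_(3, n) * 'M[E k]_(n, 3) * 'M[E k]_(3, n) * 'M[E k]_(r, n) *
    'rV[E k]_3 * E k)%type.
  pose spec k (u : tup k) := let: (D, F, b, c, z, w) := u in
    let A : 'M[E k]_(n, r) := \matrix_(j, l) e k (mderiv j (g l)) in
    [/\ D *m A = 0, D *m F = diag_mx z, e k (kappa_at p)%:MP *: 1%:M = F *m b + A *m c
      & (z 0 0 * z 0 1 * z 0 2) * w = e k (kappa_at p)%:MP].
  have Hu k := cid (let: ex_intro D (ex_intro F (ex_intro b (ex_intro c (ex_intro z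
    (ex_intro w h))))) := mat k in ex_intro (@spec k) (D, F, b, c, z, w) h).
  pose u k := sval (Hu k); have hu k : spec k (u k) := svalP (Hu k).
  pose glue m1 m2 (M : forall k, 'M[E k]_(m1, m2)) : 'M[Pi]_(m1, m2) :=
    \matrix_(i, j) ((fun k => M k i j) : Pi).
  have glueE m1 m2 (M : forall k, 'M[E k]_(m1, m2)) k : map_mx (dproj k) (glue m1 m2 M) = M k.
    by apply/matrixP => i j; rewrite !mxE.
  have AE k : map_mx (dproj k) A = \matrix_(j, l) e k (mderiv j (g l)).
    by apply/matrixP => i j; rewrite !mxE.
  exists (glue _ _ (fun k => (u k).1.1.1.1.1)), (glue _ _ (fun k => (u k).1.1.1.1.2)),
    (glue _ _ (fun k => (u k).1.1.1.2)), (glue _ _ (fun k => (u k).1.1.2)),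
    (glue _ _ (fun k => (u k).1.2)), ((fun k => (u k).2) : Pi).
  split.
  - apply: dprod_mxP => k; rewrite map_mxM map_mx0 !glueE AE.
    by have := hu k; case: (u k) => [[[[[? ?] ?] ?] ?] ?] [].
  - apply: dprod_mxP => k; rewrite map_mxM map_diag_mx !glueE.
    by have := hu k; case: (u k) => [[[[[? ?] ?] ?] ?] ?] [].
  - apply: dprod_mxP => k; rewrite map_mxD !map_mxM map_mxZ map_mx1 !glueE AE.
    by have := hu k; case: (u k) => [[[[[? ?] ?] ?] ?] ?] [].
  - apply: dprodP => k; rewrite -[LHS]/(dproj k _) !rmorphM /= !mxE.
    change ((u k).1.2 0 0 * (u k).1.2 0 1 * (u k).1.2 0 2 * (u k).2 = e k (kappa_at p)%:MP).
    by have := hu k; case: (u k) => [[[[[? ?] ?] ?] ?] ?] [].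
have chik : chi kp != 0 by apply: chiS; exists (kappa_at p)%:MP.
have AE : \matrix_(j < n, l < r) g0 (mderiv j (g l)) = map_mx chi A.
  by apply/matrixP => j l; rewrite !mxE.
rewrite AE; apply/eqP; rewrite eqn_leq; apply/andP; split.
  (* A vector v with v A = 0 satisfies kappa v = v F b, so the kernel lies in the span of the three
     rows of b. Conversely, the rows of D lie in the kernel and are independent, as D F is
     invertible. *)
  have : (kermx (map_mx chi A) <= map_mx chi b)%MS.
    apply/row_subP => i; set v := row i _.
    have vA : v *m map_mx chi A = 0 by rewrite /v -row_mul mulmx_ker row0.
    have := congr1 (map_mx chi) h3; rewrite map_mxD !map_mxM map_mxZ map_mx1 => e3.
    have : v = (chi kp)^-1 *: (v *m (chi kp *: 1%:M)).
      by rewrite -scalemxAr mulmx1 scalerA mulVf // scale1r.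
    rewrite e3 mulmxDr [v *m (_ *m map_mx chi c)]mulmxA vA mul0mx addr0 mulmxA => ->.
    by rewrite scalemx_sub // submxMl.
  move/mxrankS/leq_trans; apply; exact: rank_leq_row.
have DA : (map_mx chi D <= kermx (map_mx chi A))%MS.
  by apply/sub_kermxP; rewrite -map_mxM h1 map_mx0.
apply: leq_trans (mxrankS DA).
have zn i : chi (z 0 i) != 0.
  have : chi (z 0 0) * chi (z 0 1) * chi (z 0 2) != 0.
    by apply: contra chik; rewrite -h4 !rmorphM => /eqP ->; rewrite mul0r.
  rewrite !mulf_eq0 !negb_or => /andP [/andP [z0 z1] z2].
  by case: i => [[|[|[|//]]] ?]; [move: z0|move: z1|move: z2]; congr (chi (z 0 _) != 0); apply: val_inj.
have : map_mx chi D *m map_mx chi F \in unitmx.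
  rewrite -map_mxM h2 map_diag_mx unitmxE det_diag unitfE.
  by apply/prodf_neq0 => i _; rewrite mxE.
by move/mxrank_unit => {1}<-; apply: mxrankM_maxl.
Qed.
End FieldLevel.
End Core.

Lemma tm_neq0 (D : idomainType) (w : ray -> D) e : (forall r, w r != 0) -> tm w e != 0.
Proof. by move=> h; rewrite /tm /hexp /hmon !mulf_neq0 // expf_neq0. Qed.

Lemma big_max_lt (I : finType) (m N : I -> nat) :
  (\sum_i N i <= \sum_i m i)%N -> (exists i : I, true) -> exists i, (N i <= m i)%N.
Proof.
move=> h [i0 _]; apply: contrapT => no; suff : (\sum_i m i < \sum_i N i)%N by lia.
have lt i : (m i < N i)%N by rewrite ltnNge; apply/negP => le; apply: no; exists i.
by rewrite (bigD1 i0) // [X in (_ < X)%N](bigD1 i0) //= -addSn leq_add // leq_sum // => i _; apply: ltnW.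
Qed.

Section ConeMap.
Variables (R : comNzRingType) (n : nat) (K : fieldType) (psi : {rmorphism R -> K}) (a : 'rV[K]_n).

(** Restriction to the line through a in the affine cone. Its kernel is the homogeneous prime of the
    projective point, whereas a single vector on the line need not specialise to the closed
    fibre. *)
Definition cone_map : {rmorphism {mpoly R[n]} -> {poly K}} :=
  mmap (polyC \o psi) (fun j => a 0 j *: 'X).

Lemma cone_mapE h : cone_map h =
  \sum_(m <- msupp h) (psi h@_m * mmap1 (a 0) m) *: 'X^(mdeg m).
Proof.
apply: eq_bigr => m _; rewrite -mul_polyC polyCM -mulrA; congr (_ * _).
rewrite /mmap1 mdegE expr_sum rmorph_prod -big_split; apply: eq_bigr => i _ /=.
by rewrite -mul_polyC exprMn polyC_exp.
Qed.

Lemma meval_map_mpoly h :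
  (map_mpoly psi h).@[a 0] = \sum_(m <- msupp h) psi h@_m * mmap1 (a 0) m.
Proof.
rewrite {1}[h]mpolyE (rmorph_sum (map_mpoly psi)) (rmorph_sum (meval (a 0))).
by apply: eq_bigr => m _ /=; rewrite map_mpolyZ mevalZ map_mpolyX [X in _ * X]mmapX.
Qed.

Lemma cone_map_homog h d : h \is d.-homog -> cone_map h = (map_mpoly psi h).@[a 0] *: 'X^d.
Proof.
move=> /dhomogP hd; rewrite cone_mapE meval_map_mpoly scaler_suml !big_seq.
by apply: eq_bigr => m /hd /= ->.
Qed.

Lemma coef_cone_map h d : (cone_map h)`_d =
  \sum_(m : 'X_{1..n < d.+1}) psi h@_m * (if mdeg m == d then mmap1 (a 0) m else 0).
Proof.
rewrite cone_mapE coef_sum.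
under eq_bigr do rewrite coefZ coefXn eq_sym -mulrA mulr_natr mulrb.
rewrite -(big_map (fun m : 'X_{1..n < d.+1} => m : 'X_{1..n}) xpredT
  (fun m => psi h@_m * (if mdeg m == d then mmap1 (a 0) m else 0))) /=.
apply: eq_big_support; first exact: msupp_uniq.
  by rewrite map_inj_uniq ?index_enum_uniq //; apply: val_inj.
move=> m; case: (mdeg m =P d) => [md|]; last by rewrite mulr0 eqxx.
rewrite mulf_eq0 negb_or => /andP [hm _]; apply/andP; split.
  by apply: contraNT hm; rewrite mcoeff_msupp negbK => /eqP ->; rewrite rmorph0.
have lt : (mdeg m < d.+1)%N by rewrite md.
by apply/mapP; exists (BMultinom lt) => //; rewrite mem_index_enum.
Qed.

Lemma cone_kernel_prime : prime_ideal (fun h => cone_map h = 0).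
Proof.
split; last by move=> u v /eqP; rewrite rmorphM mulf_eq0 => /orP [] /eqP; [left|right].
  split; first exact: rmorph0.
    by move=> u v hu hv; rewrite rmorphD /= hu hv addr0.
  by move=> u v hv; rewrite rmorphM /= hv mulr0.
by rewrite rmorph1 => /eqP; rewrite oner_eq0.
Qed.
End ConeMap.

Section SmoothPoint.
Variables (G : finZmodType) (q : {additive (int * int)%type -> G}).
Hypothesis poly : polyhedral q.
Variables (C : fieldType) (R : comAlgType C) (J : {mpoly R[#|G|]} -> Prop).
Hypothesis J_versal : miniversal q J.
Variable iota : {lrmorphism {mpoly C[#|edge G|]} -> R}.
Hypothesis hc : is_completion (@base_ideal G q C)
  (gen_ideal (fun y => exists i : 'I_#|edge G|, y = 'X_i)) iota.
Hypothesis htoric : forall k (B : comAlgType C) (f : {lrmorphism R -> B})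
  (fs : forall b, exists a, f a = b),
  (forall r, tpow (fun i => iota 'X_i) k.+1 r -> f r = 0) -> induces J f (toric_level poly hc fs).
Local Notation x := (fun i => iota 'X_i).
Local Notation mR := (tpow x).
Local Notation te e := (iota (tvar C e)).
Local Notation S := {mpoly R[#|G|]}.
Local Notation n := #|G|.

Let bi2 := @base_ideal2 G q C.

Section LocalVertex.
Variables (K : fieldType) (psi : {rmorphism R -> K}) (a : 'rV[K]_n).

(* Otherwise the monomials of a large degree D, evaluated at a, satisfy a linear system
   with matrix 1 - M, where M has entries in the maximal ideal, so they all vanish. *)
Lemma local_vertex : a != 0 -> exists p, forall N j c, cone_map psi a j = 0 ->
  (forall m, mR 1 (c@_m)) -> xvar R p ^+ N <> j + c.
Proof.
move=> a0; apply: contrapT => no.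
have [B [f0 [f0s f0k]]] := level_exists hc bi2 0.
have coefI (h : S) : (forall m, mR 1 (h@_m)) <-> map_mpoly f0 h = 0.
  split=> [h1|h1 m'].
    by apply/mpolyP => m'; rewrite mcoeff_map_mpoly mcoeff0; apply/f0k.
  by apply/f0k; rewrite -mcoeff_map_mpoly h1 mcoeff0.
have /choice [N hN] : forall i : 'I_n, exists N, exists c : S,
    map_mpoly f0 c = 0 /\ cone_map psi a ('X_i ^+ N) = cone_map psi a c.
  move=> i; apply: contrapT => h; apply: no; exists (enum_val i) => N j c j0 /coefI c0 e.
  apply: h; exists N, c; split=> //.
  by move: e; rewrite /xvar enum_valK => ->; rewrite rmorphD /= j0 add0r.
(* In degree D every monomial is divisible by some X_i^(N i). *)
pose D := (\sum_i N i)%N.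
have /choice [c hcc] : forall m : 'X_{1..n < D.+1}, exists c : S,
    map_mpoly f0 c = 0 /\ (mdeg m = D -> cone_map psi a 'X_[m] = cone_map psi a c).
  move=> m; case: (mdeg m =P D) => [mD|]; last by exists 0; rewrite rmorph0.
  have [i Ni] : exists i, (N i <= (m : 'X_{1..n}) i)%N.
    apply: big_max_lt; first by move: mD; rewrite mdegE => ->.
    by case: (pickP (fun i : 'I_n => a 0 i != 0)) => [i _|z]; [exists i|
      case/eqP: a0; apply/rowP => i; rewrite mxE; apply/eqP/negbNE/negbT/z].
  have [c [c0 ce]] := hN i; pose m' := ((m : 'X_{1..n}) - U_(i) *+ N i)%MM.
  have e : 'X_[m] = 'X_i ^+ N i * 'X_[m'] :> S.
    rewrite mpolyXn -mpolyXD; congr 'X_[_]; rewrite addmC submK //.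
    apply/mnm_lepP => j; rewrite mulmnE mnm1E; case: eqVneq => [<-|]; lia.
  exists (c * 'X_[m']); split; first by rewrite rmorphM /= c0 mul0r.
  by move=> _; rewrite e !rmorphM /= ce.
pose I := 'X_{1..n < D.+1}; pose s := #|{: I}|.
pose vm (m : I) := if mdeg m == D then mmap1 (a 0) m else 0.
pose cm (m m' : I) := if mdeg m == D then (c m)@_m' else 0.
pose v : 'cV[K]_s := \col_i vm (enum_val i).
pose M : 'M[R]_s := \matrix_(i, j) cm (enum_val i) (enum_val j).
have vE : v = map_mx psi M *m v.
  apply/colP => i; rewrite mxE [RHS]mxE; set m : I := enum_val i.
  rewrite /vm; case: (mdeg m =P D) => [mD|mD]; last first.
    rewrite big1 // => j _; rewrite 2!mxE -/m /cm.
    by case: (mdeg m =P D) => // _; rewrite rmorph0 mul0r.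
  have [_ /(_ mD) e] := hcc m; have := congr1 (fun h : {poly K} => h`_D) e.
  rewrite cone_mapE msuppX big_seq1 mcoeffX eqxx rmorph1 mul1r mD coefZ coefXn eqxx mulr1 => ->.
  rewrite coef_cone_map (reindex (@enum_val I predT)) /=; last first.
    by apply: onW_bij; apply: enum_val_bij.
  by apply: eq_bigr => j _; rewrite !mxE -/m /cm /vm mD eqxx.
have [u du] : exists u, \det (1%:M - M) * u = 1.
  have /(unit_1B hc) [u] : mR 1 (1 - \det (1%:M - M)).
    apply/f0k; rewrite rmorphB rmorph1 -det_map_mx map_mxB map_mx1 /=.
    suff -> : map_mx f0 M = 0 by rewrite subr0 det1 subrr.
    apply/matrixP => i j; rewrite !mxE /cm; case: (_ =P D) => _; last exact: rmorph0.
    have [/coefI h _] := hcc (enum_val i); exact/f0k.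
  by rewrite opprB addrC subrK; exists u.
have v0 : v = 0.
  have h : map_mx psi (1%:M - M) *m v = 0 by rewrite map_mxB map_mx1 mulmxBl mul1mx -vE subrr.
  have := congr1 (mulmx (map_mx psi (\adj (1%:M - M)))) h.
  rewrite mulmx0 mulmxA -map_mxM mul_adj_mx map_scalar_mx mul_scalar_mx => e.
  by rewrite -[v]scale1r -(rmorph1 psi) -du rmorphM mulrC -scalerA e scaler0.
case/eqP: a0; apply/rowP => i; rewrite mxE.
have mD : mdeg (U_(i) *+ D)%MM = D by rewrite mdegMn mdeg1 mul1n.
have lt : (mdeg (U_(i) *+ D)%MM < D.+1)%N by rewrite mD.
have /colP /(_ (enum_rank (BMultinom lt : I))) := v0; rewrite !mxE enum_rankK /vm mD eqxx.
rewrite -[mmap1 _ _]mul1r -(rmorph1 (@idfun K)) => e.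
have : ('X_i ^+ D : {mpoly K[n]}).@[a 0] = 0.
  by rewrite mpolyXn [LHS]mmapX; move: e; rewrite rmorph1 mul1r.
by rewrite rmorphXn /= mevalXU => /eqP; rewrite expf_eq0 => /andP [_ /eqP].
Qed.
End LocalVertex.

Lemma deriv_homog (d : nat) (j : 'I_n) (h : S) : h \is d.-homog -> mderiv j h \is (d.-1).-homog.
Proof.
move=> /dhomogP hd; apply/dhomogP => m; rewrite mcoeff_msupp mcoeff_deriv => h0.
have /hd /= : (m + U_(j))%MM \in msupp h.
  by rewrite mcoeff_msupp; apply: contra_neq h0 => ->; rewrite mul0rn.
by rewrite mdegD mdeg1 addn1 => <-.
Qed.

Lemma tangent_jacobian (K : fieldType) (psi : {rmorphism R -> K}) r (g : 'I_r -> S)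
    (JK : {mpoly K[n]} -> Prop) (a : 'rV[K]_n) :
  (forall l, (map_mpoly psi (g l)).@[a 0] = 0) -> (forall l, JK (map_mpoly psi (g l))) ->
  (forall h, JK h -> exists b : 'I_r -> {mpoly K[n]}, h = \sum_l b l * map_mpoly psi (g l)) ->
  forall v : 'rV[K]_n, (v <= kermx (\matrix_(j, l) (map_mpoly psi (mderiv j (g l))).@[a 0]))%MS <->
    forall h, JK h -> \sum_i (mderiv i h).@[a 0] * v 0 i = 0.
Proof.
move=> ga JKg JKgen v; set B := \matrix_(_, _) _; split.
  move=> /sub_kermxP vB h /JKgen [b ->].
  have e i : ((\sum_l b l * map_mpoly psi (g l))^`M(i)).@[a 0] = \sum_l (b l).@[a 0] * B i l.
    rewrite (raddf_sum (mderiv i)) (rmorph_sum (meval (a 0))); apply: eq_bigr => l _ /=.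
    by rewrite mderivM mevalD !mevalM ga mulr0 add0r mxE mderiv_map.
  under eq_bigr do rewrite e mulr_suml.
  rewrite exchange_big big1 // => l _; under eq_bigr do rewrite -mulrA.
  rewrite -mulr_sumr; have /rowP /(_ l) := vB; rewrite !mxE => {}e.
  by rewrite (eq_bigr (fun i => v 0 i * B i l)) ?e ?mulr0 // => i _; rewrite mulrC.
move=> h; apply/sub_kermxP/rowP => l; rewrite !mxE -[RHS](h _ (JKg l)).
by apply: eq_bigr => i _; rewrite mxE mderiv_map mulrC.
Qed.

(** The corank from [field_level] is transported twice: to K(X), since only the kernel of the map
    from S matters, and from the line to the point a, since by homogeneity the Jacobian on the line
    is the one at a with columns scaled by powers of X. *)
Lemma smooth_point (K : fieldType) (psi : {rmorphism R -> K}) r (g : 'I_r -> S)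
    (d : 'I_r -> nat) (JK : {mpoly K[n]} -> Prop) (a : 'rV[K]_n) :
  (forall l, J (g l)) -> (forall l, g l \is (d l).-homog) ->
  (forall h, J h -> exists b : 'I_r -> S, h = \sum_l b l * g l) ->
  (forall l, JK (map_mpoly psi (g l))) ->
  (forall h, JK h -> exists b : 'I_r -> {mpoly K[n]}, h = \sum_l b l * map_mpoly psi (g l)) ->
  (forall e, psi (te e) != 0) -> proj_point JK a -> smooth_at JK a.
Proof.
move=> gJ gd Jgen JKg JKgen tn [a0 aJ].
have ga l : (map_mpoly psi (g l)).@[a 0] = 0 by apply: aJ.
have [p hp] := local_vertex psi a0.
pose F := cone_map psi a.
have FJ h : J h -> F h = 0.
  move=> /Jgen [b ->]; rewrite rmorph_sum big1 // => l _; rewrite rmorphM /=.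
  by rewrite [X in _ * X](cone_map_homog psi a (gd l)) ga scale0r mulr0.
have Fk : ~ F (kappa_at q iota p)%:MP = 0.
  rewrite [F _]mmapC => /eqP; rewrite polyC_eq0; apply/negP.
  rewrite /kappa_at (@bends_rmorph _ _ psi _ (fun r0 => psi (wt q (fun e => - te e) p r0))) //.
  have tn0 e : tm (fun r0 => psi (wt q (fun e => - te e) p r0)) e != 0.
    by apply: tm_neq0 => r0; rewrite /wt rmorphN oppr_eq0.
  by rewrite /bends /bend; do !apply: mulf_neq0 => //.
have [L [g0 [g0k rk]]] := @field_level G q poly C R J J_versal iota hc htoric
  (fun h => F h = 0) p (cone_kernel_prime psi a) FJ hp Fk r g gJ Jgen.
pose A : 'M[S]_(n, r) := \matrix_(j, l) mderiv j (g l).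
pose B : 'M[K]_(n, r) := \matrix_(j, l) (map_mpoly psi (mderiv j (g l))).@[a 0].
pose tf : {rmorphism {poly K} -> {fraction {poly K}}} := @tofrac {poly K}.
pose g1 : {rmorphism S -> {fraction {poly K}}} := tf \o F.
pose cK : {rmorphism K -> {fraction {poly K}}} := tf \o polyC.
have rA : \rank (map_mx g0 A) = \rank (map_mx g1 A).
  apply: rank_map_kernel => h; rewrite g0k /g1 /=; split=> [->|/eqP]; first exact: rmorph0.
  by rewrite tofrac_eq0 => /eqP.
have rB : \rank (map_mx g1 A) = \rank B.
  pose T : 'rV[{fraction {poly K}}]_r := \row_l tf ('X ^+ (d l).-1).
  have -> : map_mx g1 A = map_mx cK B *m diag_mx T.
    apply/matrixP => j l; rewrite mul_mx_diag !mxE /g1 /= -/(tf _).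
    by rewrite [F _](cone_map_homog psi a (deriv_homog j (gd l))) -mul_polyC rmorphM.
  rewrite mxrankMfree ?mxrank_map // row_free_unit unitmxE det_diag unitfE.
  by apply/prodf_neq0 => l _; rewrite mxE tofrac_eq0 expf_neq0 ?polyX_eq0.
have r3 : \rank (kermx B) = 3%N.
  rewrite mxrank_ker -rB -rA -mxrank_ker; rewrite -[RHS]rk; congr (\rank (kermx _)).
  by apply/matrixP => j l; rewrite !mxE.
have [W Wf WE] : exists2 W : 'M[K]_(3, n), row_free W & (W :=: kermx B)%MS.
  have [] := (row_base_free (kermx B), eq_row_base (kermx B)).
  by move: (row_base _); rewrite r3 => W; exists W.
exists W; split=> // v; rewrite WE; exact: tangent_jacobian.
Qed.
End SmoothPoint.

(** * Singular fibres *)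

Module BuildRmorphisms.
Section BuildRmorphism.
Variables (A B : comNzRingType) (u : A -> B).
Hypotheses (uB : zmod_morphism u) (uM : monoid_morphism u).

Let u' (_ : unit) := u.
HB.instance Definition _ := GRing.isZmodMorphism.Build A B (u' tt) uB.
HB.instance Definition _ := GRing.isMonoidMorphism.Build A B (u' tt) uM.

Lemma build_rmorphism : exists v : {rmorphism A -> B}, v =1 u.
Proof. by exists (u' tt). Qed.
End BuildRmorphism.
End BuildRmorphisms.
Import BuildRmorphisms.

(** * Points and tangent vectors of twisted algebras *)

Section TwistedFunctional.
Variables (B : comNzRingType) (W : zmodType) (c : cocycle B W).

Definition tfun (F : W -> B) (x : twisted c) : B := \sum_(w <- tsupp x) tcoef w x * F w.

Lemma tfun_sup F (s : seq W) x : uniq s -> {subset tsupp x <= s} ->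
  tfun F x = \sum_(w <- s) tcoef w x * F w.
Proof.
move=> us xs; apply: eq_big_support => // [|w]; first exact: tsupp_uniq.
case: (eqVneq (tcoef w x) 0) => [->|]; first by rewrite mul0r eqxx.
by rewrite tcoef_supp => wx _; rewrite wx xs.
Qed.

Lemma tfun_bas F w : tfun F (tbas c w) = F w.
Proof.
rewrite (@tfun_sup F [:: w]) // => [|v].
  by rewrite big_seq1 tcoef_bas eqxx mul1r.
by rewrite -tcoef_supp tcoef_bas inE [v == w]eq_sym; case: (w == v); rewrite ?eqxx.
Qed.

Lemma tfunP F a x y : tfun F (a *: x + y) = a * tfun F x + tfun F y.
Proof.
pose s := undup (tsupp x ++ tsupp y ++ tsupp (a *: x + y)).
have sub z : z \in [:: x; y; a *: x + y] -> {subset tsupp z <= s}.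
  by rewrite !inE => /or3P [] /eqP -> w wz; rewrite mem_undup !mem_cat wz ?orbT.
rewrite !(@tfun_sup F s) ?undup_uniq //; try by apply: sub; rewrite !inE eqxx ?orbT.
rewrite mulr_sumr -big_split; apply: eq_bigr => w _ /=.
by rewrite tcoefD tcoefZ mulrDl mulrA.
Qed.

Lemma tfun0 F : tfun F 0 = 0.
Proof. by apply: (addrI (tfun F 0)); have := tfunP F 1 0 0; rewrite scale1r mul1r !addr0 => <-. Qed.
Lemma tfunD F x y : tfun F (x + y) = tfun F x + tfun F y.
Proof. by have := tfunP F 1 x y; rewrite scale1r mul1r. Qed.
Lemma tfunZ F a x : tfun F (a *: x) = a * tfun F x.
Proof. by have := tfunP F a x 0; rewrite tfun0 !addr0. Qed.

Lemma tfun_leibniz (F D D' : W -> B) :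
  (forall v w, c v w * D (v + w) = F v * D' w + D v * F w) ->
  (forall x y, tfun D (x * y) = tfun F x * tfun D' y + tfun D x * tfun F y).
Proof.
move=> h x y; elim/tind: x => [|x x' hx hx'|a u].
- by rewrite mul0r !tfun0 !mul0r addr0.
- by rewrite mulrDl !tfunD hx hx' !mulrDl addrACA.
rewrite -scalerAl !tfunZ -!mulrA -mulrDr; congr (_ * _).
elim/tind: y => [|y y' hy hy'|b v]; first by rewrite mulr0 !tfun0 !mulr0 addr0.
  by rewrite mulrDr !tfunD hy hy' !mulrDr addrACA.
by rewrite -scalerAr tbasM !tfunZ !tfun_bas h; ring.
Qed.

Lemma tfun_rmorphism F : F 0 = 1 -> (forall v w, c v w * F (v + w) = F v * F w) ->
  exists i : {rmorphism twisted c -> B}, forall x, i x = tfun F x.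
Proof.
move=> F0 FM.
have fB : zmod_morphism (tfun F).
  by move=> x y; rewrite tfunD -scaleN1r tfunZ mulN1r.
have fM : monoid_morphism (tfun F).
  split=> [|x y]; first by rewrite -(tbas0 c) tfun_bas.
  have z D : tfun (fun _ => 0) D = 0 by rewrite /tfun big1 // => w _; rewrite mulr0.
  elim/tind: x => [|x x' hx hx'|a u]; first by rewrite mul0r tfun0 mul0r.
    by rewrite mulrDl !tfunD hx hx' mulrDl.
  rewrite -scalerAl !tfunZ -!mulrA; congr (_ * _).
  elim/tind: y => [|y y' hy hy'|b v]; first by rewrite mulr0 !tfun0 mulr0.
    by rewrite mulrDr !tfunD hy hy' mulrDr.
  by rewrite -scalerAr tbasM !tfunZ !tfun_bas FM; ring.
exact: build_rmorphism fB fM.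
Qed.

Lemma tfun_derivation F D (i : {rmorphism twisted c -> B}) : (forall x, i x = tfun F x) ->
  D 0 = 0 -> (forall v w, c v w * D (v + w) = F v * D w + D v * F w) -> derivation i (tfun D).
Proof.
move=> iE D0 h; split=> [x y|x y|b]; first exact: tfunD.
  by rewrite (tfun_leibniz h) !iE.
by rewrite tfunZ -(tbas0 c) tfun_bas D0 mulr0.
Qed.
End TwistedFunctional.

Lemma edge_tm (B : comNzRingType) (w : ray -> B) s u v :
  tm w (phi (CE s) u + phi (CE s) v - phi (CE s) (u + v)) =
  w s ^+ `|(ipos (rdet s u) + ipos (rdet s v) - ipos (rdet s u + rdet s v))%R|%N.
Proof.
case: u v => [x y] [z t]; set k := `|_|%N.
suff -> : phi (CE s) (x, y) + phi (CE s) (z, t) - phi (CE s) ((x, y) + (z, t)) =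
    match s with R0 => (k%:Z, (k%:Z, (0, 0))) | R1 => (0, (0, (0, k%:Z)))
    | R2 => (k%:Z, (0, (k%:Z, 0))) | R3 => (0, (k%:Z, (0, 0)))
    | R4 => (k%:Z, (0, (0, k%:Z))) | R5 => (0, (0, (k%:Z, 0))) end.
  by rewrite -(tm_ray w s k); case: (s).
by rewrite /k; case: (s); rewrite /= /ipos /rdet /=; repeat congr pair; rewrite /=; lia.
Qed.

Section EdgeChart.
Variables (G : finZmodType) (q : {additive (int * int)%type -> G}).
Hypothesis poly : polyhedral q.
Variables (C : fieldType) (B : comAlgType C) (t : edge G -> B).
Hypothesis tmin : minor_relations q t.
Local Notation W := (int * (int * int))%type.
Variables (f : nonempty_face q) (e : edge G).
Hypotheses (fe : sval f = edge_ends q e) (te0 : t e = 0).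
Local Notation b := (bpt (sval f)).
Local Notation E := (tchart tmin f).
Local Notation tb w := (tbas (tcoc tmin f) w).

(* The ring map is evaluation at the point (1, 1) of the double curve, where the chart
   is the product of a two-dimensional torus and a node, as t e = 0. *)
Lemma edge_node : exists (i : {rmorphism E -> B}) (d : 'I_4 -> E -> B) (z : 'I_4 -> E),
  [/\ forall a, i a%:A = a, i (tb (1, 0)) = 1, forall k, derivation i (d k)
    & forall k l, d k (z l) = (k == l)%:R].
Proof.
have [s es] : exists s, eray q b s = e by apply: flag_ex; rewrite -fe; apply: nf_in.
have cE : nf_cell f = CE s.
  have fE : sval f = cset q b (CE s).
    by rewrite [LHS]fe -es edge_ends_eray; apply/setP => x; rewrite !inE /= orbF.
  by rewrite /nf_cell {1}fE (cellof_cset poly).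
(* [D 0] selects the weights parallel to the edge and gives the evaluation; [D 1] and [D (-1)]
   select the weights at distance one on either side. With t e = 0 the cocycle is 0 for weights
   strictly on opposite sides of the edge and 1 otherwise. *)
pose D (a : int) (w : W) : B := (rdet s w.2 == a)%:R.
have coE v w : tcoc tmin f v w =
    (ipos (rdet s v.2) + ipos (rdet s w.2) - ipos (rdet s v.2 + rdet s w.2) == 0)%:R.
  apply: etrans (cstE _ _ _ _ _ _) _; rewrite cE edge_tm /wt es te0 expr0n.
  by congr (_%:R); rewrite absz_eq0.
have dD v w : rdet s (v + w) = rdet s v + rdet s w by exact: rdetD.
have Dh a v w : a \in [:: 0; 1; -1] -> tcoc tmin f v w * D a (v + w) =
    if a == 0 then D 0 v * D 0 w else D 0 v * D a w + D a v * D 0 w.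
  rewrite coE /D /= dD !inE; set x := rdet s v.2; set y := rdet s w.2.
  move=> /or3P [] /eqP -> /=; rewrite -!natrM -?natrD; congr (_%:R); rewrite !mulnb;
    rewrite /ipos; lia.
have [i iE] : exists i : {rmorphism E -> B}, forall x, i x = tfun (D 0) x.
  apply: tfun_rmorphism => [|v w]; last exact: (@Dh 0).
  by rewrite /D /rdet /= !mulr0 subrr eqxx.
(* Directions 0 and 1 belong to the torus, 2 and 3 to the branches of the node; the weights [z] are
   dual to them. *)
pose d (k : 'I_4) : W -> B := match val k with
  | 0 => fun w => D 0 w * w.1%:~R
  | 1 => fun w => D 0 w * (- rdet (rnext s) w.2)%:~R
  | 2 => D 1 | _ => D (-1) end.
pose z (k : 'I_4) : W := match val k with
  | 0 => (1, 0) | 1 => (0, rvec s) | 2 => (0, rvec (rnext s)) | _ => (0, - rvec (rnext s)) end.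
exists i, (fun k => tfun (d k)), (fun k => tb (z k)).
have D00 : D 0 0 = 1 by rewrite /D /rdet /= !mulr0 subrr eqxx.
have D0a a : a != 0 -> D a 0 = 0.
  by rewrite /D /rdet /= !mulr0 subrr eq_sym => /negbTE ->.
split.
- by move=> a; rewrite iE tfunZ -(tbas0 (tcoc tmin f)) tfun_bas D00 mulr1.
- by rewrite iE tfun_bas /D /rdet /= !mulr0 subrr eqxx.
- move=> k; apply: tfun_derivation iE _ _.
    have rd0 r : rdet r (0 : W).2 = 0 by rewrite /rdet /= !mulr0 subrr.
    case: k => [[|[|[|[|//]]]] ?]; rewrite /d /=; [exact: mulr0 | | exact: D0a | exact: D0a].
    by rewrite rd0 oppr0 mulr0.
  move=> v w; case: k => [[|[|[|[|//]]]] ?]; rewrite /d /=.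
  + by rewrite mulrA (@Dh 0) //= rmorphD /=; ring.
  + by rewrite mulrA (@Dh 0) //= rdetD opprD rmorphD /=; ring.
  + exact: (@Dh 1).
  + exact: (@Dh (-1)).
move=> k l; rewrite tfun_bas /d /z /D.
by case: k => [[|[|[|[|//]]]] ?]; case: l => [[|[|[|[|//]]]] ?]; case: (s) => /=;
  rewrite /rdet /= ?(mulr1n, mulr0n, mul0r, mul1r).
Qed.
End EdgeChart.

(** A minor that survives under f also survives under g, so rank is semicontinuous. *)
Lemma rank_map_le (A : comNzRingType) (K L : fieldType)
    (f : {rmorphism A -> K}) (g : {rmorphism A -> L}) m n (M : 'M[A]_(m, n)) :
  (forall x, g x = 0 -> f x = 0) -> (\rank (map_mx f M) <= \rank (map_mx g M))%N.
Proof.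
move=> fg; have [u [v [h _]]] := rank_minor (map_mx f M); apply: (@minor_rank _ _ _ _ _ u v).
by move: h; rewrite !map_mxsub_unit; apply: contra_neq => /fg.
Qed.

Lemma map_mpoly_comp (A B D : comNzRingType) n (f : {rmorphism A -> B}) (g : {rmorphism B -> D})
    (h : {mpoly A[n]}) : map_mpoly g (map_mpoly f h) = map_mpoly (g \o f) h.
Proof. by apply/mpolyP => m; rewrite !mcoeff_map_mpoly. Qed.

(* A linear relation over L with a nonzero right hand side in A can be solved over A up to
   a denominator; hence a power of x outside the kernel of g0 remains outside the ideal
   that the kernel generates over L. *)
Lemma kernel_extension (A : comNzRingType) n (L D : fieldType) (f : {rmorphism A -> L})
    (g0 : {rmorphism {mpoly A[n]} -> D}) (y : {mpoly A[n]}) :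
  (forall c, g0 c%:MP = 0 <-> f c = 0) -> g0 y != 0 ->
  ~ gen_ideal (fun z => exists2 h, g0 h = 0 & z = map_mpoly f h) (map_mpoly f y).
Proof.
move=> fk y0 [k [c [z [hz ye]]]].
have /choice [h hh] : forall i, exists h, g0 h = 0 /\ z i = map_mpoly f h.
  by move=> i; have [h h1 h2] := hz i; exists h.
pose b := (\sum_i msize (c i))%N; pose I := ('I_k * 'X_{1..n < b})%type.
pose w (j : I) : {mpoly A[n]} := 'X_[j.2] * h j.1; pose s := #|{: I}|.
pose ms := msupp y ++ flatten [seq msupp (w j) | j <- enum {: I}].
pose M : 'M[A]_(s, size ms) := \matrix_(j, l) (w (enum_val j))@_(nth 0%MM ms l).
pose bv : 'rV[A]_(size ms) := \row_l y@_(nth 0%MM ms l).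
pose cf (j : I) : L := (c j.1)@_(j.2 : 'X_{1..n}).
pose cv : 'rV[L]_s := \row_j cf (enum_val j).
have e : map_mx f bv = cv *m map_mx f M.
  apply/rowP => l; rewrite !mxE -mcoeff_map_mpoly ye raddf_sum /=; set m := nth _ _ _.
  transitivity (\sum_(j : I) (cf j *: map_mpoly f (w j))@_m); last first.
    rewrite (reindex (@enum_val I predT)) /=; last by apply: onW_bij; apply: enum_val_bij.
    by apply: eq_bigr => j _; rewrite mcoeffZ !mxE mcoeff_map_mpoly.
  rewrite -(pair_bigA _ (fun i (m' : 'X_{1..n < b}) =>
    (cf (i, m') *: map_mpoly f (w (i, m')))@_m)) /=; apply: eq_bigr => i _.
  have ci : (msize (c i) <= b)%N by rewrite /b (bigD1 i) //= leq_addr.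
  rewrite -raddf_sum {1}(mpolywE ci) mulr_suml; congr (_@__); apply: eq_bigr => m' _.
  by have [_ ->] := hh i; rewrite /w rmorphM /= map_mpolyX scalerAl.
have bM : (map_mx f bv <= map_mx f M)%MS by rewrite e submxMl.
have [d [t [fd0 /rowP h0]]] := solve_denominator bM.
pose H := d *: y - \sum_j t 0 j *: w (enum_val j).
have Hc m : f H@_m = 0.
  case: (boolP (m \in ms)) => mm.
    have lt : (index m ms < size ms)%N by rewrite index_mem.
    have := h0 (Ordinal lt); rewrite !mxE /= nth_index // /H mcoeffB mcoeffZ => <-; congr (f (_ - _)).
    by rewrite (raddf_sum (mcoeff m)) /=; apply: eq_bigr => j _; rewrite mcoeffZ !mxE /= nth_index.
  suff -> : H@_m = 0 by rewrite rmorph0.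
  move: mm; rewrite mem_cat negb_or mcoeff_msupp negbK => /andP [/eqP ym mf].
  rewrite /H mcoeffB mcoeffZ ym mulr0 (raddf_sum (mcoeff m)) big1 ?subrr // => j _ /=.
  apply/eqP; rewrite mcoeffZ; apply: contraNT mf => nz; apply/flatten_mapP.
  exists (enum_val j); first by rewrite mem_enum.
  by rewrite mcoeff_msupp; apply: contraNneq nz => ->; rewrite mulr0.
have H0 : g0 H = 0.
  rewrite [H]mpolyE rmorph_sum big1 // => m _; rewrite -mul_mpolyC rmorphM.
  by have /fk -> := Hc m; rewrite mul0r.
move: H0; rewrite /H rmorphB rmorph_sum big1 ?subr0 => [|j _].
  rewrite -mul_mpolyC rmorphM => /eqP; rewrite mulf_eq0 (negbTE y0) orbF => /eqP /fk d0.
  by rewrite d0 eqxx in fd0.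
rewrite -mul_mpolyC !rmorphM; have [-> _] := hh (enum_val j).1; by rewrite !mulr0.
Qed.

Section SingularPoint.
Variables (G : finZmodType) (q : {additive (int * int)%type -> G}).
Hypothesis poly : polyhedral q.
Variables (C : fieldType) (R : comAlgType C) (J : {mpoly R[#|G|]} -> Prop).
Hypothesis J_versal : miniversal q J.
Variable iota : {lrmorphism {mpoly C[#|edge G|]} -> R}.
Hypothesis hc : is_completion (@base_ideal G q C)
  (gen_ideal (fun y => exists i : 'I_#|edge G|, y = 'X_i)) iota.
Hypothesis htoric : forall k (B : comAlgType C) (f : {lrmorphism R -> B})
  (fs : forall b, exists a, f a = b),
  (forall r, tpow (fun i => iota 'X_i) k.+1 r -> f r = 0) -> induces J f (toric_level poly hc fs).
Local Notation x := (fun i => iota 'X_i).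
Local Notation mR := (tpow x).
Local Notation te e := (iota (tvar C e)).
Local Notation S := {mpoly R[#|G|]}.
Local Notation n := #|G|.

Let bi2 := @base_ideal2 G q C.

Lemma edge_face_subproof e : (edge_ends q e != finset.set0) && Defs.face q (edge_ends q e).
Proof.
have [s es] : exists s, eray q e.1 s = e by apply: flag_ex; rewrite !inE eqxx.
apply/andP; split; first by apply/set0Pn; exists e.1; rewrite !inE eqxx.
rewrite -es edge_ends_eray; have -> : [set e.1; nb q e.1 s] = cset q e.1 (CE s).
  by apply/setP => y; rewrite !inE /= orbF.
exact: (cset_face poly).
Qed.
Definition edge_face e : nonempty_face q := exist _ (edge_ends q e) (edge_face_subproof e).

Section EdgeDirection.
Variables (Q : R -> Prop) (e : edge G).
Hypotheses (Qp : prime_ideal Q) (Qe : Q (te e)).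
Variables (r : nat) (g : 'I_r -> S).
Hypothesis gJ : forall l, J (g l).
Local Notation b := (bpt (edge_ends q e)).

(** The counterpart of [vertex_spec] at an edge whose parameter lies in Q, already modulo Q: a point
    of the family over the quotient of R by Q and the power k + 1, with four independent tangent
    vectors. *)
Definition edge_spec k (B : comNzRingType) (ep : {rmorphism S -> B}) : Prop :=
  [/\ forall h, J h -> ep h = 0, forall c, ep c%:MP = 0 <-> ideal_sum Q (mR k.+1) c,
      exists u, ep (xvar R b) * u = 1
    & exists (D : 'M[B]_(4, n)) (F : 'M[B]_(n, 4)),
      D *m (\matrix_(j, l) ep (mderiv j (g l))) = 0 /\ D *m F = 1%:M].

Lemma edge_level k : exists (B : comNzRingType) (ep : {rmorphism S -> B}), @edge_spec k B ep.
Proof.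
have [hQ _ _] := Qp.
have hI : is_ideal (ideal_sum Q (mR k.+1)) by apply: ideal_sumP (tpowP _ _).
have I1 : ~ ideal_sum Q (mR k.+1) 1.
  move=> [c [d [/(prime_sub_mR hc bi2 Qp) c1 /(@tpow_leq _ _ _ 1) d1 e1]]].
  by apply: (notin_mR1 hc bi2); rewrite e1; apply: idealD (tpowP _ _) c1 (d1 _).
have [B [f [fs fk]]] := quotient_algebra hI I1.
have fk1 c : mR k.+1 c -> f c = 0 by move=> h; apply/fk; apply: ideal_sumr.
have [xi0 [_ _ xc0 xJ0]] := htoric fs fk1.
pose vf := edge_face e; pose xi := xi0 vf.
have xc := xc0 vf; have xJ := xJ0 vf; rewrite -/xi in xc xJ.
have hB := surj_nil_local hc fs fk1.
pose tm' := tpar_minors hc f.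
have t0 : tpar iota f e = 0.
  by rewrite /tpar rmorphN; apply/eqP; rewrite oppr_eq0; apply/eqP/fk; apply: ideal_suml (tpowP _ _) _.
have [i [d [z [iA ib di dz]]]] := @edge_node G q poly C B _ tm' vf e erefl t0.
have /choice [Fc hF] := fun l => gradient hB xc (z l).
have evf h : ev f xi h = ev idfun xi (map_mpoly f h) by rewrite (ev_comp f).
have [ep epE] : exists ep : {rmorphism S -> B}, forall h, ep h = i (ev f xi h).
  by exists (i \o evm f xi).
exists B, ep; split.
- by move=> h /xJ xh; rewrite epE xh rmorph0.
- by move=> c; rewrite epE (evC f) iA; apply: fk.
- have [v hv] := section_unit hB xc.
  rewrite (bigD1 b) /= in hv; last exact: (nf_in vf).
  exists (i (v * \prod_(y in edge_ends q e | y != b) xi y)); rewrite epE (ev_xvar f) -rmorphM.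
  by rewrite mulrCA (hv : v * (xi b * _) = 1) rmorph1.
exists (\matrix_(m, j) d m (xi (enum_val j))), (\matrix_(j, l) i (Fc l j)); split.
  apply/matrixP => m l; rewrite !mxE; under eq_bigr do rewrite !mxE.
  have := derivation_chain (di m) xi (map_mpoly f (g l)).
  rewrite -evf (xJ _ (gJ l)) (derivation0 (di m)) => e0; rewrite [RHS]e0; apply: eq_bigr => j _.
  by rewrite epE mderiv_map -evf mulrC.
apply/matrixP => m l; rewrite !mxE; under eq_bigr do rewrite !mxE.
rewrite -dz (hF l _ _ _ (di m)); apply: eq_bigr => j _; exact: mulrC.
Qed.

(** The points of all levels combine to a field point over Q because Q is closed: an element that
    lies in Q up to every order lies in Q. *)
Lemma singular_field : exists (L : fieldType) (g0 : {rmorphism S -> L}),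
  [/\ forall h, J h -> g0 h = 0, forall c, g0 c%:MP = 0 <-> Q c, g0 (xvar R b) != 0
    & (4 <= \rank (kermx (\matrix_(j < n, l < r) g0 (mderiv j (g l)))))%N].
Proof.
have [hQ Q1 QM] := Qp.
have [E [ep hE]] : exists (E : nat -> comNzRingType) (ep : forall k, {rmorphism S -> E k}),
    forall k, @edge_spec k (E k) (ep k).
  pose HE k := cid (edge_level k).
  by exists (fun k => sval (HE k)), (fun k => sval (cid (svalP (HE k)))) => k; apply: svalP.
have epJ k h : J h -> ep k h = 0 by have [h1 _ _ _] := hE k; apply: (h1 h).
have epQ k c : ep k c%:MP = 0 <-> ideal_sum Q (mR k.+1) c by have [_ h1 _ _] := hE k; apply: (h1 c).
have epu k : exists u, ep k (xvar R b) * u = 1 by have [_ _ h1 _] := hE k; exact: h1.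
have mat k : exists DF : 'M[E k]_(4, n) * 'M[E k]_(n, 4),
    DF.1 *m (\matrix_(j, l) ep k (mderiv j (g l))) = 0 /\ DF.1 *m DF.2 = 1%:M.
  by have [_ _ _ [D [F h1]]] := hE k; exists (D, F).
clear hE.
pose Pi := dprod E; pose evP : {rmorphism S -> Pi} := dlift ep.
pose nid (y : Pi) := exists k0, forall k, (k0 <= k)%N -> dproj k y = 0.
have nidP : is_ideal nid.
  split.
  - by exists 0%N => k _; rewrite rmorph0.
  - move=> y y' [k h] [k' h']; exists (maxn k k') => l; rewrite geq_max => /andP [kl kl'].
    by rewrite rmorphD /= h // h' // addr0.
  - by move=> y y' [k h]; exists k => l kl; rewrite rmorphM /= h // mulr0.
pose Sg y := exists2 c, ~ Q c & y = evP c%:MP.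
have Sg1 : Sg 1 by exists 1; rewrite ?mpolyC1 ?rmorph1.
have SgM y y' : Sg y -> Sg y' -> Sg (y * y').
  by move=> [h nh ->] [h' nh' ->]; exists (h * h'); rewrite ?mpolyCM ?rmorphM // => /QM [].
have disj y : Sg y -> ~ nid y.
  move=> [c nc ->] [k0 hk]; apply: nc; apply: (ideal_closed hc) => // k.
  have /epQ [c1 [c2 [Qc1 c2m ->]]] : ep (maxn k0 k) c%:MP = 0 by apply: hk; apply: leq_maxl.
  exists c2; last by rewrite addrK.
  by apply: tpow_leq c2m; apply: leqW; apply: leq_maxr.
have [L [chi [chin chiS]]] := field_avoiding nidP Sg1 SgM disj.
pose g0 : {rmorphism S -> L} := chi \o evP.
have g0E h : g0 h = chi (evP h) by [].
exists L, g0; split.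
- by move=> h Jh; rewrite g0E; apply: chin; exists 0%N => k _; apply: epJ.
- move=> c; split=> [g0c|Qc].
    by apply: contrapT => nc; have /eqP := chiS _ (ex_intro2 _ _ c nc erefl); apply.
  by rewrite g0E; apply: chin; exists 0%N => k _; apply/epQ; apply: ideal_suml (tpowP _ _) Qc.
- pose u k := sval (cid (epu k)); have hu k : ep k (xvar R b) * u k = 1 := svalP (cid (epu k)).
  have : evP (xvar R b) * (u : Pi) = 1 by apply: dprodP => k; apply: hu.
  move=> /(congr1 chi); rewrite rmorphM rmorph1 -g0E => e1; apply/eqP => e0.
  by move/eqP: e1; rewrite e0 mul0r eq_sym oner_eq0.
pose Hm k := cid (mat k); pose Dk k := (sval (Hm k)).1; pose Fk k := (sval (Hm k)).2.
have hD k : Dk k *m (\matrix_(j, l) ep k (mderiv j (g l))) = 0 by case: (svalP (Hm k)).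
have hDF k : Dk k *m Fk k = 1%:M by case: (svalP (Hm k)).
clearbody Dk Fk.
pose glue m1 m2 (M : forall k, 'M[E k]_(m1, m2)) : 'M[Pi]_(m1, m2) :=
  \matrix_(i, j) ((fun k => M k i j) : Pi).
have glueE m1 m2 (M : forall k, 'M[E k]_(m1, m2)) k : map_mx (dproj k) (glue m1 m2 M) = M k.
  by apply/matrixP => i j; rewrite !mxE.
pose A : 'M[Pi]_(n, r) := \matrix_(j, l) evP (mderiv j (g l)).
have AE k : map_mx (dproj k) A = \matrix_(j, l) ep k (mderiv j (g l)).
  by apply/matrixP => i j; rewrite !mxE.
have DA : glue _ _ Dk *m A = 0.
  by apply: dprod_mxP => k; rewrite map_mxM map_mx0 !glueE AE hD.
have DF : glue _ _ Dk *m glue _ _ Fk = 1%:M.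
  by apply: dprod_mxP => k; rewrite map_mxM map_mx1 !glueE hDF.
have -> : \matrix_(j < n, l < r) g0 (mderiv j (g l)) = map_mx chi A.
  by apply/matrixP => j l; rewrite !mxE.
have sub : (map_mx chi (glue _ _ Dk) <= kermx (map_mx chi A))%MS.
  by apply/sub_kermxP; rewrite -map_mxM DA map_mx0.
apply: leq_trans (mxrankS sub); rewrite -{1}(mxrank1 L 4) -(map_mx1 chi) -DF map_mxM.
exact: mxrankM_maxl.
Qed.

(** The point of [singular_field] lies over Q and has to be combined with the residue field of Q'.
    By [kernel_extension] the coordinate x_b can be kept nonzero in the process, and the rank of the
    Jacobian can only drop. *)
Lemma singular_transfer (R' : comNzRingType) (h : {rmorphism R -> R'}) (Q' : R' -> Prop) :
  prime_ideal Q' -> (forall c, Q c <-> Q' (h c)) ->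
  exists (K : fieldType) (psi : {rmorphism R' -> K}) (a : 'rV[K]_n),
  [/\ forall c, psi c = 0 <-> Q' c, a != 0,
      forall l, (map_mpoly (psi \o h) (g l)).@[a 0] = 0
    & (4 <= \rank (kermx (\matrix_(j < n, l < r)
        (map_mpoly (psi \o h) (mderiv j (g l))).@[a 0%R])))%N].
Proof.
move=> Qp' QQ; have [L [g0 [g0J g0Q g0x rk]]] := singular_field.
have [L0 [ps psk]] := prime_residue_field Qp'.
pose f : {rmorphism R -> L0} := ps \o h.
have fk c : g0 c%:MP = 0 <-> f c = 0 by rewrite g0Q QQ -psk.
pose nid := gen_ideal (fun z => exists2 h, g0 h = 0 & z = map_mpoly f h).
pose Sg y := exists N, y = map_mpoly f (xvar R b ^+ N).
have Sg1 : Sg 1 by exists 0%N; rewrite expr0 rmorph1.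
have SgM y y' : Sg y -> Sg y' -> Sg (y * y').
  by move=> [N ->] [N' ->]; exists (N + N')%N; rewrite exprD rmorphM.
have disj y : Sg y -> ~ nid y.
  by move=> [N ->]; apply: kernel_extension => //; rewrite rmorphXn expf_neq0.
have [K [chi [chin chiS]]] := field_avoiding (gen_idealP _) Sg1 SgM disj.
pose psi : {rmorphism R' -> K} := chi \o @mpolyC n L0 \o ps.
pose a : 'rV[K]_n := \row_j chi 'X_j.
have aE u : (map_mpoly (psi \o h) u).@[a 0] = chi (map_mpoly f u).
  rewrite meval_map_mpoly [in RHS](mpolyE u) (rmorph_sum (map_mpoly f)) (rmorph_sum chi).
  apply: eq_bigr => m _ /=.
  rewrite map_mpolyZ map_mpolyX -mul_mpolyC rmorphM; congr (_ * _).
  rewrite mpolyXE_id rmorph_prod; apply: eq_bigr => j _; by rewrite rmorphXn mxE.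
have g1k u : g0 u = 0 -> chi (map_mpoly f u) = 0.
  by move=> u0; apply: chin; apply: gen_ideal_sub; exists u.
exists K, psi, a; split.
- move=> c; rewrite -psk /psi /=; split=> [/eqP|->]; last by rewrite mpolyC0 rmorph0.
  by rewrite -[chi _]/((chi \o @mpolyC n L0) _) fmorph_eq0 => /eqP.
- have := chiS _ (ex_intro _ 1%N erefl); rewrite expr1 /xvar map_mpolyX => nz.
  by apply: contraNneq nz => a0; have /rowP /(_ (enum_rank b)) := a0; rewrite !mxE => ->.
- by move=> l; rewrite aE; apply/g1k/g0J.
pose A : 'M[S]_(n, r) := \matrix_(j, l) mderiv j (g l).
pose g1 : {rmorphism S -> K} := chi \o map_mpoly f.
have -> : \matrix_(j < n, l < r) (map_mpoly (psi \o h) (mderiv j (g l))).@[a 0] = map_mx g1 A.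
  by apply/matrixP => j l; rewrite !mxE aE.
apply: leq_trans rk _; have -> : \matrix_(j < n, l < r) g0 (mderiv j (g l)) = map_mx g0 A.
  by apply/matrixP => j l; rewrite !mxE.
by rewrite !mxrank_ker leq_sub2l // rank_map_le.
Qed.
End EdgeDirection.

Lemma pullback_span (R' : comNzRingType) (h : {rmorphism R -> R'}) (K : fieldType)
    (psi : {rmorphism R' -> K}) r (g : 'I_r -> S) :
  (forall l, J (g l)) -> (forall u, J u -> exists b : 'I_r -> S, u = \sum_l b l * g l) ->
  let JK v := exists2 u, pullback_family h J u & v = map_mpoly psi u in
  (forall l, JK (map_mpoly (psi \o h) (g l))) /\
  forall v, JK v -> exists b : 'I_r -> {mpoly K[n]}, v = \sum_l b l * map_mpoly (psi \o h) (g l).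
Proof.
move=> gJ Jgen JK; split=> [l|v [u hu ->]].
  exists (map_mpoly h (g l)); last by rewrite map_mpoly_comp.
  by apply: gen_ideal_sub; exists (g l).
move: u hu; apply: gen_ideal_min.
  split.
  - by exists (fun=> 0); rewrite rmorph0 big1 // => l _; rewrite mul0r.
  - move=> u u' [b bE] [b' bE']; exists (fun l => b l + b' l); rewrite rmorphD /= bE bE' -big_split.
    by apply: eq_bigr => l _; rewrite mulrDl.
  - move=> c u [b bE]; exists (fun l => map_mpoly psi c * b l); rewrite rmorphM /= bE mulr_sumr.
    by apply: eq_bigr => l _; rewrite mulrA.
move=> _ [u /Jgen [b ->] ->]; exists (fun l => map_mpoly (psi \o h) (b l)).
by rewrite map_mpoly_comp rmorph_sum; apply: eq_bigr => l _; rewrite rmorphM.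
Qed.

(** The base change along h lets one statement serve both for R itself and for the normalization of
    S. A singular point is one where the kernel of the Jacobian, of rank at least 4, cannot fit into
    a space of rank 3. *)
Theorem smooth_fibreP (R' : comNzRingType) (h : {rmorphism R -> R'}) (Q' : R' -> Prop) :
  prime_ideal Q' -> smooth_fibre (pullback_family h J) Q' <-> forall e, ~ Q' (h (te e)).
Proof.
move=> Qp'; have [r [g [d [gJ gd Jgen]]]] := homogeneous_generators J_versal hc.
split=> [sm e Qe|tn K psi psik JK a].
  have Qp : prime_ideal (fun c => Q' (h c)).
    have [[Q0 QD QM] Q1 QP] := Qp'; split; last by move=> c c'; rewrite rmorphM => /QP.
      split; first by rewrite rmorph0.
        by move=> c c' hc1 hc2; rewrite rmorphD; apply: QD.
      by move=> c c' hc1; rewrite rmorphM; apply: QM.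
    by rewrite rmorph1.
  have [K [psi [a [psik a0 ga rk]]]] := @singular_transfer _ e Qp Qe r g gJ R' h Q' Qp' (fun=> iff_refl _).
  have [JKg JKgen] := pullback_span h psi gJ Jgen.
  have pa : proj_point (fun v => exists2 u, pullback_family h J u & v = map_mpoly psi u) a.
    split=> // v /JKgen [b ->]; rewrite rmorph_sum big1 // => l _ /=.
    by rewrite mevalM ga mulr0.
  have [W [Wf WE]] := sm K psi psik a pa.
  have sub : (kermx (\matrix_(j < n, l < r) (map_mpoly (psi \o h) (mderiv j (g l))).@[a 0]) <= W)%MS.
    apply/row_subP => i; apply/WE; apply/(tangent_jacobian ga JKg JKgen).
    exact: row_sub.
  by have := leq_trans rk (leq_trans (mxrankS sub) (rank_leq_row W)).
move=> pa; have [JKg JKgen] := pullback_span h psi gJ Jgen.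
apply: (@smooth_point G q poly C R J J_versal iota hc htoric K (psi \o h) r g d JK a) => // e.
by apply/eqP => /psik; apply: tn.
Qed.

Lemma pullback_id : pullback_family (idfun : {rmorphism R -> R}) J = J.
Proof.
have Jid := J_ideal J_versal.
have e (u : S) : map_mpoly (idfun : {rmorphism R -> R}) u = u.
  by apply/mpolyP => m; rewrite mcoeff_map_mpoly.
apply/funext => u; apply/propext; split.
  by apply: gen_ideal_min => // _ [v Jv ->]; rewrite e.
by move=> Ju; apply: gen_ideal_sub; exists u; rewrite ?e.
Qed.

Corollary smooth_fibre_idP (Q : R -> Prop) :
  prime_ideal Q -> smooth_fibre J Q <-> forall e, ~ Q (te e).
Proof. by move=> /(smooth_fibreP (idfun : {rmorphism R -> R})); rewrite pullback_id. Qed.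
End SingularPoint.

(** * Lattice ideals *)

Section Lex.
Variables (F : realFieldType) (N : nat).
Implicit Types u v w : 'rV[F]_N.

(** The lexicographic order provides leading terms with respect to the torsion-free group of
    exponents modulo the saturation. *)
Definition lexpos u := exists2 i, 0 < u 0 i & forall j : 'I_N, (j < i)%N -> u 0 j = 0.

Lemma lexposD u v : lexpos u -> lexpos v -> lexpos (u + v).
Proof.
move=> [i ui u0] [j vj v0]; case: (ltngtP i j) => ij.
- exists i => [|k ki]; rewrite mxE; first by rewrite v0 // addr0.
  by rewrite u0 // v0 ?addr0 // (ltn_trans ki).
- exists j => [|k ki]; rewrite mxE; first by rewrite u0 // add0r.
  by rewrite v0 // u0 ?addr0 // (ltn_trans ki).
have {}ij : i = j by apply: val_inj.
by subst j; exists i => [|k ki]; rewrite mxE ?addr_gt0 // u0 // v0 // addr0.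
Qed.

Lemma lexpos0 : ~ lexpos 0.
Proof. by case=> i; rewrite mxE ltxx. Qed.

Lemma lexpos_total u : [\/ u = 0, lexpos u | lexpos (- u)].
Proof.
case: (pickP (fun i : 'I_N => u 0 i != 0)) => [i0 h0|h]; last first.
  by constructor 1; apply/rowP => i; rewrite mxE; apply/eqP/negbNE/negbT/h.
have [i hi imin] := @arg_minnP _ i0 (fun i => u 0 i != 0) (fun i => val i) h0.
have lt (j : 'I_N) : (j < i)%N -> u 0 j = 0.
  by move=> ji; apply/eqP; apply: contraTT ji => /imin; rewrite -leqNgt.
move: hi; rewrite neq_lt => /orP [ui|ui]; [constructor 3|constructor 2]; exists i => // [|j /lt].
  by rewrite mxE oppr_gt0.
by rewrite mxE => ->; rewrite oppr0.
Qed.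

Lemma lex_max (T : eqType) (s : seq T) (d : T -> 'rV[F]_N) x0 : x0 \in s ->
  exists2 m, m \in s & forall x, x \in s -> d x = d m \/ lexpos (d m - d x).
Proof.
elim: s x0 => // y [|z s] IH x0 _.
  by exists y; rewrite ?mem_head // => x; rewrite inE => /eqP ->; left.
have [m ms hm] := IH z (mem_head _ _).
have [e|p|p] := lexpos_total (d y - d m).
- exists m => [|x]; first by rewrite inE ms orbT.
  rewrite inE => /predU1P [->|/hm //]; left; apply/eqP; by rewrite -subr_eq0 e.
- exists y => [|x]; first exact: mem_head.
  rewrite inE => /predU1P [->|/hm [->|h]]; [by left|by right|right].
  by rewrite -(subrK (d m) (d y)) -addrA; apply: lexposD.
- exists m => [|x]; first by rewrite inE ms orbT.
  by rewrite inE => /predU1P [->|/hm //]; right; rewrite -opprB.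
Qed.
End Lex.

Section MonomialFunctional.
Variables (A : comNzRingType) (n : nat) (lam : 'X_{1..n} -> A).
Implicit Types f g : {mpoly A[n]}.

Definition monfun f : A := \sum_(m <- msupp f) f@_m * lam m.

Lemma monfun_sup (s : seq 'X_{1..n}) f : uniq s -> {subset msupp f <= s} ->
  monfun f = \sum_(m <- s) f@_m * lam m.
Proof.
move=> us fs; apply: eq_big_support => // m.
case: (eqVneq f@_m 0) => [->|]; first by rewrite mul0r eqxx.
by rewrite -mcoeff_msupp => mf _; rewrite mf fs.
Qed.

Lemma monfunP a f g : monfun (a *: f + g) = a * monfun f + monfun g.
Proof.
pose s := undup (msupp f ++ msupp g ++ msupp (a *: f + g)).
have sub h : h \in [:: f; g; a *: f + g] -> {subset msupp h <= s}.
  by rewrite !inE => /or3P [] /eqP -> w wz; rewrite mem_undup !mem_cat wz ?orbT.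
rewrite !(@monfun_sup s) ?undup_uniq //; try by apply: sub; rewrite !inE eqxx ?orbT.
rewrite mulr_sumr -big_split; apply: eq_bigr => w _ /=.
by rewrite mcoeffD mcoeffZ mulrDl mulrA.
Qed.

Lemma monfunX m : monfun 'X_[m] = lam m.
Proof. by rewrite /monfun msuppX big_seq1 mcoeffX eqxx mul1r. Qed.
Lemma monfun0 : monfun 0 = 0.
Proof. by rewrite /monfun msupp0 big_nil. Qed.
Lemma monfunZ a f : monfun (a *: f) = a * monfun f.
Proof. by have := monfunP a f 0; rewrite monfun0 !addr0. Qed.
Lemma monfunD f g : monfun (f + g) = monfun f + monfun g.
Proof. by have := monfunP 1 f g; rewrite scale1r mul1r. Qed.
Lemma monfun_sum (I : Type) (s : seq I) (P : pred I) (F : I -> {mpoly A[n]}) :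
  monfun (\sum_(i <- s | P i) F i) = \sum_(i <- s | P i) monfun (F i).
Proof. exact: (big_morph monfun monfunD monfun0). Qed.
End MonomialFunctional.

Module Lattices.
Section LatticeIdeal.
Variables (G : finZmodType) (q : {additive (int * int)%type -> G}) (C : fieldType).
Local Notation V := {ffun edge G -> int}.
Local Notation P := {mpoly C[#|edge G|]}.
Local Notation N := #|edge G|.
Local Notation sat := (saturation q).

Lemma binomial_latticeP : zmod_closed (fun v : V => `[< binomial_lattice q v >]).
Proof.
split.
  apply/asboolP; exists (fun _ _ _ => 0); rewrite big1 // => p _; rewrite big1 // => a _.
  by rewrite big1 // => b _; rewrite mulr0z.
move=> u v /asboolP [c ->] /asboolP [d ->]; apply/asboolP.
exists (fun p a b => c p a b - d p a b); rewrite -sumrB; apply: eq_bigr => p _.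
rewrite -sumrB; apply: eq_bigr => a _; rewrite -sumrB; apply: eq_bigr => b _.
by rewrite mulrzBr.
Qed.

Lemma binomial_minor p a b : binomial_lattice q (minor_vector q p a b).
Proof.
exists (fun p' a' b' => ((p', a', b') == (p, a, b))%:R).
rewrite (bigD1 p) //= (bigD1 a) //= (bigD1 b) //= eqxx mulr1z big1 ?addr0 => [|b' bb]; last first.
  by rewrite xpair_eqE (negbTE bb) andbF mulr0z.
rewrite big1 ?addr0 => [|a' aa]; last first.
  by rewrite big1 // => b' _; rewrite !xpair_eqE (negbTE aa) andbF mulr0z.
rewrite big1 ?addr0 // => p' pp; rewrite big1 // => a' _; rewrite big1 // => b' _.
by rewrite !xpair_eqE (negbTE pp) mulr0z.
Qed.

Lemma binomial_ind (S : V -> Prop) : S 0 -> (forall u v, S u -> S v -> S (u + v)) ->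
  (forall v, S v -> S (- v)) -> (forall p a b, S (minor_vector q p a b)) ->
  forall v, binomial_lattice q v -> S v.
Proof.
move=> S0 SD SN Sm v [c ->].
have Sz u k : S u -> S (u *~ k).
  move=> Su; case: k => k; rewrite ?NegzE ?mulrNz -?pmulrn.
    by elim: k => [|k IH]; rewrite ?mulr0n // mulrS; apply: SD.
  by apply: SN; elim: k => [|k IH]; rewrite ?mulr1n // mulrS; apply: SD.
by do 3!(apply: (big_ind S) => // ? _); apply: Sz.
Qed.

(* The rational cokernel of the lattice: its kernel on integral vectors is the saturation. *)
Definition lat_mx : 'M[rat]_(#|{: G * 'I_3 * 'I_3}|, N) :=
  \matrix_(i, e) (minor_vector q (enum_val i).1.1 (enum_val i).1.2 (enum_val i).2 (enum_val e))%:~R.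
Definition vrow (v : V) : 'rV[rat]_N := \row_e (v (enum_val e))%:~R.
Definition ldeg (v : V) : 'rV[rat]_N := vrow v *m cokermx lat_mx.

Lemma vrow_additive : zmod_morphism vrow.
Proof. by move=> u v; apply/rowP => e; rewrite !mxE !ffunE rmorphB. Qed.
HB.instance Definition _ := GRing.isZmodMorphism.Build V 'rV[rat]_N vrow vrow_additive.
Lemma vrow_inj : injective vrow.
Proof.
move=> u v /rowP h; apply/ffunP => e; have := h (enum_rank e); rewrite !mxE enum_rankK.
exact: intr_inj.
Qed.

Lemma ldeg_additive : zmod_morphism ldeg.
Proof. by move=> u v; rewrite /ldeg raddfB mulmxBl. Qed.
HB.instance Definition _ := GRing.isZmodMorphism.Build V 'rV[rat]_N ldeg ldeg_additive.

Lemma lattice_row (c : G -> 'I_3 -> 'I_3 -> int) :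
  vrow (\sum_p \sum_a \sum_b minor_vector q p a b *~ c p a b) =
  (\row_i (c (enum_val i).1.1 (enum_val i).1.2 (enum_val i).2)%:~R) *m lat_mx.
Proof.
rewrite pair_bigA pair_bigA /= raddf_sum /=.
apply/rowP => e; rewrite [RHS]mxE summxE (reindex (@enum_val {: G * 'I_3 * 'I_3} predT)) /=; last first.
  by apply: onW_bij; apply: enum_val_bij.
apply: eq_bigr => i _; rewrite !mxE -rmorphM /=; congr (_%:~R).
by rewrite ffunMzE -mulrzr intz mulrC.
Qed.

Lemma ldeg_sat v : ldeg v = 0 <-> sat v.
Proof.
split=> [h|[d d0 [c cE]]].
  have /submxP [c cE] : (vrow v <= lat_mx)%MS by rewrite submxE; apply/eqP.
  pose d := \prod_i denq (c 0 i).
  have d0 : d != 0 by apply/prodf_neq0 => i _; apply: denq_neq0.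
  have cint i : exists k : int, c 0 i * d%:~R = k%:~R.
    exists (numq (c 0 i) * \prod_(j | j != i) denq (c 0 j)).
    rewrite /d (bigD1 i) //= !rmorphM /= mulrA; congr (_ * _).
    by rewrite -{1}(divq_num_den (c 0 i)) divfK // intr_eq0 denq_neq0.
  have /choice [k kE] := cint.
  exists d => //; exists (fun p a b => k (enum_rank (p, a, b))).
  apply: vrow_inj; rewrite lattice_row raddfMz /= cE -scaler_int scalemxAl; congr (_ *m _).
  apply/rowP => i; rewrite !mxE mulrC kE; congr (k _)%:~R.
  by rewrite -[LHS]enum_valK; congr enum_rank; case: (enum_val i) => [[]].
have : ldeg (v *~ d) = 0 by rewrite cE /ldeg lattice_row -mulmxA mulmx_coker mulmx0.
rewrite raddfMz /= -scaler_int => /eqP; rewrite scaler_eq0 intr_eq0 (negbTE d0) => /eqP.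
exact.
Qed.

Lemma sat0 : sat 0. Proof. by apply/ldeg_sat; rewrite raddf0. Qed.
Lemma satD u v : sat u -> sat v -> sat (u + v).
Proof. by move=> /ldeg_sat hu /ldeg_sat hv; apply/ldeg_sat; rewrite raddfD /= hu hv addr0. Qed.
Lemma satN v : sat v -> sat (- v).
Proof. by move=> /ldeg_sat hv; apply/ldeg_sat; rewrite raddfN /= hv oppr0. Qed.
Lemma satB u v : sat u -> sat v -> sat (u - v).
Proof. by move=> hu hv; apply: satD => //; apply: satN. Qed.
Lemma lattice_sat v : binomial_lattice q v -> sat v.
Proof. by move=> h; exists 1; rewrite ?mulr1z. Qed.

(** The minors are homogeneous, and passing to the saturation preserves this since integers have no
    torsion. Hence lattice ideals are homogeneous ([lat_homog]). *)
Lemma sat_sum v : sat v -> \sum_e v e = 0.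
Proof.
have s0 u : binomial_lattice q u -> \sum_e u e = 0.
  apply: (binomial_ind (S := fun u : V => \sum_e u e = 0)).
  - by rewrite big1 // => e _; rewrite ffunE.
  - by move=> {}u w hu hw; under eq_bigr do rewrite ffunE; rewrite big_split /= hu hw addr0.
  - by move=> {}u hu; under eq_bigr do rewrite ffunE; rewrite sumrN hu oppr0.
  move=> p a b; have one e0 : \sum_e (e == e0)%:R = 1 :> int.
    by rewrite (bigD1 e0) //= eqxx big1 ?addr0 // => e /negbTE ->.
  under eq_bigr do rewrite !ffunE.
  by rewrite 2!sumrB big_split /= !one.
move=> [d d0 /s0]; under eq_bigr do rewrite ffunMzE -mulrzr intz.
by rewrite -mulr_suml => /eqP; rewrite mulf_eq0 (negbTE d0) orbF => /eqP.
Qed.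
End LatticeIdeal.
End Lattices.
Import Lattices.

Section LatticePrime.
Variables (G : finZmodType) (q : {additive (int * int)%type -> G}) (C : fieldType).
Local Notation V := {ffun edge G -> int}.
Local Notation P := {mpoly C[#|edge G|]}.
Local Notation N := #|edge G|.
Local Notation sat := (saturation q).
Variable rho : V -> C.
Hypothesis rhoP : sat_character q rho.
Implicit Types (f g : P) (m : 'X_{1..N}) (u v w : V).

Definition mvec m : V := [ffun e => (m (enum_rank e))%:Z].
Definition mpos v : 'X_{1..N} := [multinom `|Num.max (v (enum_val i)) 0|%N | i < N].

Lemma mvecD m m' : mvec (m + m')%MM = mvec m + mvec m'.
Proof. by apply/ffunP => e; rewrite !ffunE mnmDE PoszD. Qed.
Lemma mvec0 : mvec 0%MM = 0.
Proof. by apply/ffunP => e; rewrite !ffunE mnm0E. Qed.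
Lemma mvec_mpos v : mvec (mpos v) - mvec (mpos (- v)) = v.
Proof.
have h u e : mvec (mpos u) e = `|Num.max (u e) 0|%N%:Z by rewrite ffunE mnmE enum_rankK.
have hN u e : (- u) e = - u e by rewrite ffunE.
apply/ffunP => e; rewrite [LHS]ffunE hN !h hN; move: (v e) => x.
by case: (ltrP x 0) => hx; case: (ltrP (- x) 0) => hy; lia.
Qed.
Lemma mvec_sum m : \sum_e mvec m e = (mdeg m)%:Z.
Proof.
rewrite mdegE (reindex (@enum_val (edge G) predT)) /=; last by apply: onW_bij; apply: enum_val_bij.
rewrite -[RHS]natz natr_sum; apply: eq_bigr => i _; rewrite ffunE enum_valK.
by rewrite natz.
Qed.

Lemma tmon_posE v : tmon_pos C v = 'X_[mpos v].
Proof.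
rewrite /tmon_pos mpolyXE_id (reindex (@enum_val (edge G) predT)) /=; last first.
  by apply: onW_bij; apply: enum_val_bij.
by apply: eq_bigr => i _; rewrite /tvar enum_valK mnmE.
Qed.

Lemma rho0 : rho 0 = 1.
Proof. by case: rhoP => _ _ h; apply: h; have [/asboolP] := binomial_latticeP q. Qed.
Lemma rhoD u v : sat u -> sat v -> rho (u + v) = rho u * rho v.
Proof. by case: rhoP => _ h _; apply: h. Qed.
Definition lat_gen f := exists2 v, sat v & f = tmon_pos C v - rho v *: tmon_pos C (- v).
Definition lat_ideal := gen_ideal lat_gen.
Lemma lat_idealP : is_ideal lat_ideal. Proof. exact: gen_idealP. Qed.

(** The coefficient of a monomial in the class of u modulo the saturation, compared with u through
    rho. Together the [Lam u] describe the quotient algebra class by class, and the lattice ideal is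
    their common kernel ([lat_ideal_Lam], [lat_Lam]). *)
Definition lam u m : C := if `[< sat (mvec m - u) >] then rho (mvec m - u) else 0.
Definition Lam u f : C := monfun (lam u) f.

Lemma lam_equiv u m m' : sat (mvec m - mvec m') -> lam u m = rho (mvec m - mvec m') * lam u m'.
Proof.
move=> h; have e : mvec m - u = (mvec m - mvec m') + (mvec m' - u) by rewrite addrA subrK.
rewrite /lam; case: asboolP => [h1|h1]; case: asboolP => [h2|h2].
- by rewrite e rhoD.
- by case: h2; have := satB h1 h; rewrite e [X in sat X]addrC addKr.
- by case: h1; rewrite e; apply: satD.
- by rewrite mulr0.
Qed.

Lemma lat_ideal_Lam u f : lat_ideal f -> Lam u f = 0.
Proof.
move=> hf; move: f hf u; apply: (gen_ideal_min (I := fun f => forall u, Lam u f = 0)).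
  split.
  - by move=> u; rewrite /Lam monfun0.
  - by move=> g h hg hh u; rewrite /Lam monfunD -/(Lam _ _) hg -/(Lam _ _) hh addr0.
  move=> a g hg u; rewrite [a]mpolyE mulr_suml /Lam monfun_sum big1 // => m _.
  rewrite -scalerAl monfunZ (_ : monfun _ _ = 0) ?mulr0 //.
  rewrite -[RHS](hg (u - mvec m)) /Lam [in LHS](mpolyE g) mulr_sumr monfun_sum.
  apply: eq_bigr => m' _; rewrite -scalerAr monfunZ -mpolyXD monfunX; congr (_ * _).
  by rewrite /lam mvecD (_ : mvec m + mvec m' - u = mvec m' - (u - mvec m)) // opprB addrA [mvec m' + _]addrC.
move=> _ [v sv ->] u; rewrite !tmon_posE -scaleNr addrC /Lam monfunP !monfunX.
rewrite (@lam_equiv u (mpos v) (mpos (- v))) mvec_mpos //.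
by rewrite mulNr addNr.
Qed.

Lemma mon_equiv m m' : sat (mvec m - mvec m') ->
  lat_ideal ('X_[m] - rho (mvec m - mvec m') *: 'X_[m']).
Proof.
move=> h; set v : V := mvec m - mvec m'; pose d := (m - mpos v)%MM.
have vE e : v e = (m (enum_rank e))%:Z - (m' (enum_rank e))%:Z by rewrite !ffunE.
have le1 : (mpos v <= m)%MM.
  apply/mnm_lepP => i; rewrite mnmE vE enum_valK; lia.
have m'E : m' = (d + mpos (- v))%MM.
  apply/mnmP => i; rewrite mnmDE mnmBE !mnmE !ffunE !enum_valK; lia.
have mE : m = (d + mpos v)%MM by rewrite submK.
rewrite {1}mE {1}m'E !mpolyXD scalerAr -mulrBr -!tmon_posE.
by apply: idealMl lat_idealP _; apply: gen_ideal_sub; exists v.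
Qed.

(* Modulo the ideal every polynomial is a combination of pairwise inequivalent monomials. *)
Lemma lat_normal f : exists2 g, lat_ideal (f - g) &
  forall m m', m \in msupp g -> m' \in msupp g -> sat (mvec m - mvec m') -> m = m'.
Proof.
pose r m := nth 0%MM (msupp f) (find (fun m' => `[< sat (mvec m - mvec m') >]) (msupp f)).
have rP m : m \in msupp f -> r m \in msupp f /\ sat (mvec m - mvec (r m)).
  move=> mf; have hs : has (fun m' => `[< sat (mvec m - mvec m') >]) (msupp f).
    by apply/hasP; exists m => //; apply/asboolP; rewrite subrr; apply: sat0.
  split; first by rewrite mem_nth // -has_find.
  by apply/asboolP; apply: (nth_find 0%MM hs).
have r_eq m m' : sat (mvec m - mvec m') -> r m = r m'.
  move=> h; rewrite /r; congr nth; apply: eq_find => m0; apply/asboolP/asboolP => h0.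
    by have := satB h0 h; rewrite opprB addrC addrA subrK.
  by have := satD h h0; rewrite addrA subrK.
pose g := \sum_(m <- msupp f) (f@_m * rho (mvec m - mvec (r m))) *: 'X_[r m] : P.
have gs m : m \in msupp g -> exists2 m0, m0 \in msupp f & m = r m0.
  rewrite mcoeff_msupp /g raddf_sum /= => nz.
  apply: contrapT => no; move/eqP: nz; apply; rewrite big_seq big1 // => m0 m0f.
  rewrite mcoeffZ mcoeffX; case: eqP => [e|]; last by rewrite mulr0.
  by case: no; exists m0.
exists g.
  rewrite {1}[f]mpolyE /g -sumrB big_seq; apply: ideal_bigsum lat_idealP _ => m mf.
  rewrite -scalerA -scalerBr -(mul_mpolyC f@_m); apply: idealMl lat_idealP _.
  by apply: mon_equiv; case: (rP m mf).
move=> _ _ /gs [m mf ->] /gs [m' mf' ->] h; apply: r_eq.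
have [_ h1] := rP m mf; have [_ h2] := rP m' mf'.
have := satB (satD h1 h) h2; rewrite opprB !addrA subrK.
by rewrite subrK.
Qed.

Lemma Lam_single u g m : m \in msupp g -> sat (mvec m - u) ->
  (forall m', m' \in msupp g -> sat (mvec m' - u) -> m' = m) ->
  Lam u g = g@_m * rho (mvec m - u).
Proof.
move=> mg mu one; rewrite /Lam /monfun (bigD1_seq m) ?msupp_uniq //= big_seq_cond big1 ?addr0.
  by rewrite /lam asboolT.
move=> m' /andP [m'g ne]; rewrite /lam; case: asboolP => [/(one _ m'g) e|]; last by rewrite mulr0.
by rewrite e eqxx in ne.
Qed.

Lemma lat_Lam f : (forall u, Lam u f = 0) -> lat_ideal f.
Proof.
move=> h; have [g fg inj] := lat_normal f.
have hg u : Lam u g = 0.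
  have := lat_ideal_Lam u fg; rewrite -scaleN1r addrC /Lam monfunP -!/(Lam _ _) h addr0 mulN1r.
  by move/eqP; rewrite oppr_eq0 => /eqP.
suff g0 : g = 0 by rewrite g0 subr0 in fg.
apply/eqP; rewrite -msupp_eq0; case E : (msupp g) => [|m s] //.
have mg : m \in msupp g by rewrite E mem_head.
have ss : sat (mvec m - mvec m) by rewrite subrr; apply: sat0.
have := @Lam_single (mvec m) g m mg ss (fun m' h1 h2 => inj _ _ h1 mg h2).
rewrite hg subrr rho0 mulr1 => /esym/eqP.
by rewrite mcoeff_eq0 mg.
Qed.

(** The quotient is graded by a torsion-free group with one-dimensional pieces. For f' and g' in
    normal form, only the product of their leading monomials lies in the sum of the leading classes,
    so its coefficient cannot cancel. *)
Theorem lat_prime : prime_ideal lat_ideal.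
Proof.
split; first exact: lat_idealP.
  move/(lat_ideal_Lam 0); rewrite -mpolyX0 /Lam monfunX /lam mvec0 subrr asboolT ?rho0; last exact: sat0.
  by move/eqP; rewrite oner_eq0.
move=> f g fg; have [f' ff' injf] := lat_normal f; have [g' gg' injg] := lat_normal g.
apply: contrapT => no.
have f0 : f' != 0 by apply/eqP => e; apply: no; left; rewrite e subr0 in ff'.
have g0 : g' != 0 by apply/eqP => e; apply: no; right; rewrite e subr0 in gg'.
have fg' : lat_ideal (f' * g').
  have -> : f' * g' = f * g - (f * (g - g') + g' * (f - f')) by ring.
  by apply: idealB lat_idealP fg _; apply: idealD lat_idealP _ _; apply: idealMl lat_idealP _.
have lead (h : P) : h != 0 -> exists2 m, m \in msupp h & forall m', m' \in msupp h ->
    ldeg q (mvec m') = ldeg q (mvec m) \/ lexpos (ldeg q (mvec m) - ldeg q (mvec m')).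
  rewrite -msupp_eq0; case E : (msupp h) => [|m0 s] // _; rewrite -E.
  by apply: (lex_max (fun m => ldeg q (mvec m)) (x0 := m0)); rewrite E mem_head.
have [a af amax] := lead f' f0; have [b bg bmax] := lead g' g0.
have := lat_ideal_Lam (mvec a + mvec b) fg'.
rewrite [f']mpolyE [g']mpolyE mulr_suml /Lam monfun_sum.
have lamE m m' : m \in msupp f' -> m' \in msupp g' -> (m, m') != (a, b) ->
    lam (mvec a + mvec b) (m + m')%MM = 0.
  move=> mf mg ne; rewrite /lam mvecD; case: asboolP => // /ldeg_sat.
  rewrite opprD addrACA raddfD !raddfB /= => e.
  have {}e : (ldeg q (mvec a) - ldeg q (mvec m)) + (ldeg q (mvec b) - ldeg q (mvec m')) = 0.
    by rewrite -oppr0 -e opprD !opprB.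
  have [ea|pa] := amax m mf; have [eb|pb] := bmax m' mg.
  - case/eqP: ne; congr pair; [apply: injf | apply: injg] => //; apply/ldeg_sat;
      by rewrite raddfB /= ?ea ?eb subrr.
  - by move: pb; rewrite ea subrr add0r in e; rewrite e => /lexpos0.
  - by move: pa; rewrite eb subrr addr0 in e; rewrite e => /lexpos0.
  - by have := lexposD pa pb; rewrite e => /lexpos0.
rewrite (bigD1_seq a) ?msupp_uniq //= [X in _ + X]big1_seq ?addr0; last first.
  move=> m /andP [ma mf]; rewrite mulr_sumr monfun_sum big1_seq // => m' /andP [_ mg].
  rewrite -scalerAl -scalerAr !monfunZ -mpolyXD monfunX lamE ?mulr0 //.
  by rewrite xpair_eqE (negbTE ma).
rewrite mulr_sumr monfun_sum (bigD1_seq b) ?msupp_uniq //= [X in _ + X]big1_seq ?addr0; last first.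
  move=> m' /andP [mb mg]; rewrite -scalerAl -scalerAr !monfunZ -mpolyXD monfunX lamE ?mulr0 //.
  by rewrite xpair_eqE (negbTE mb) andbF.
rewrite -scalerAl -scalerAr !monfunZ -mpolyXD monfunX /lam mvecD subrr asboolT ?rho0; last exact: sat0.
move/eqP; rewrite mulr1 mulf_eq0; apply/negP; rewrite negb_or.
by rewrite !mcoeff_eq0 !negbK af bg.
Qed.

Lemma lam_deg u m : sat (mvec m - u) -> (mdeg m)%:Z = \sum_e u e.
Proof.
move/sat_sum => h; apply/eqP; rewrite -mvec_sum -subr_eq0 -sumrB; apply/eqP; rewrite -[RHS]h.
by apply: eq_bigr => e _; rewrite [RHS]ffunE [(- u) e]ffunE.
Qed.

Lemma lat_homog f k : lat_ideal f -> lat_ideal (pihomog mdeg k f).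
Proof.
move=> hf; apply: lat_Lam => u.
suff -> : Lam u (pihomog mdeg k f) = if \sum_e u e == k%:Z then Lam u f else 0.
  by rewrite lat_ideal_Lam // if_same.
rewrite [f]mpolyE (raddf_sum (pihomog mdeg k)) /Lam !monfun_sum /=.
have pE m c : pihomog mdeg k (c *: 'X_[m] : P) = (if mdeg m == k then c else 0) *: 'X_[m].
  by rewrite linearZ /= pihomogX; case: ifP; rewrite ?scaler0 ?scale0r.
case: eqP => uk.
  apply: eq_bigr => m _; rewrite pE !monfunZ monfunX /lam; case: (mdeg m =P k) => // mk.
  rewrite mul0r; case: asboolP => [/lam_deg mu|_]; last by rewrite mulr0.
  by case: mk; apply/eqP; rewrite -eqz_nat mu uk.
rewrite big1 // => m _; rewrite pE monfunZ monfunX /lam; case: (mdeg m =P k) => [mk|]; last by rewrite mul0r.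
case: asboolP => [/lam_deg mu|_]; last by rewrite mulr0.
by case: uk; rewrite -mu mk.
Qed.

Lemma lat_base f : base_ideal q f -> lat_ideal f.
Proof.
apply: gen_ideal_min lat_idealP _ f => f [p [a [b ->]]]; apply: lat_Lam => u.
set e1 := (p, a); set e2 := (p - _, b); set e3 := (p, b); set e4 := (p - _, a).
have vE e : mvec U_(enum_rank e)%MM = [ffun e' => (e' == e)%:R].
  by apply/ffunP => e'; rewrite !ffunE mnm1E (inj_eq enum_rank_inj) eq_sym natz.
have mE : mvec (U_(enum_rank e1) + U_(enum_rank e2))%MM -
    mvec (U_(enum_rank e3) + U_(enum_rank e4))%MM = minor_vector q p a b.
  by rewrite !mvecD !vE opprD addrA.
have h := binomial_minor q p a b.
rewrite /tvar -!mpolyXD -scaleN1r addrC /Lam monfunP !monfunX.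
rewrite (@lam_equiv u (U_(enum_rank e1) + U_(enum_rank e2))%MM (U_(enum_rank e3) + U_(enum_rank e4))%MM) mE; last exact: lattice_sat.
by case: rhoP => _ _ ->; rewrite // mul1r mulN1r addNr.
Qed.

Lemma lat_tvar e : ~ lat_ideal (tvar C e).
Proof.
move/(lat_ideal_Lam (mvec U_(enum_rank e)%MM)); rewrite /Lam monfunX /lam subrr asboolT ?rho0; last exact: sat0.
by move/eqP; rewrite oner_eq0.
Qed.
End LatticePrime.

(** * Main components *)

Section MainComponents.
Variables (G : finZmodType) (q : {additive (int * int)%type -> G}).
Variables (C : fieldType) (R : comAlgType C).
Variable iota : {lrmorphism {mpoly C[#|edge G|]} -> R}.
Hypothesis hc : is_completion (@base_ideal G q C)
  (gen_ideal (fun y => exists i : 'I_#|edge G|, y = 'X_i)) iota.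
Local Notation x := (fun i => iota 'X_i).
Local Notation mR := (tpow x).
Local Notation te e := (iota (tvar C e)).
Local Notation P := {mpoly C[#|edge G|]}.
Local Notation V := {ffun edge G -> int}.
Local Notation MC rho := (main_component q iota rho).

Let bi2 := @base_ideal2 G q C.

Lemma MC_ideal rho : is_ideal (MC rho). Proof. exact: gen_idealP. Qed.

Section Character.
Variable rho : V -> C.
Hypothesis rhoP : sat_character q rho.

Lemma lat_MC f : lat_ideal q rho f -> MC rho (iota f).
Proof.
apply: (gen_ideal_min (I := fun f => MC rho (iota f))) => [|g hg]; last first.
  by apply: gen_ideal_sub; exists g.
have hI := MC_ideal rho; split.
- by rewrite rmorph0; apply: ideal0.
- by move=> a b ha hb; rewrite rmorphD; apply: idealD.
- by move=> a b hb; rewrite rmorphM; apply: idealMl.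
Qed.

(** Initial forms of the extended ideal stay in the lattice ideal: coefficients in R can be replaced
    by polynomials up to order d + 1, and the lattice ideal is homogeneous and contains the
    minors. *)
Lemma MC_homog d (H : P) c : H \is d.-homog -> MC rho c -> mR d.+1 (iota H - c) ->
  lat_ideal q rho H.
Proof.
move=> hH [k [a [g [hg ->]]]] hz.
have /choice [h hh] : forall i, exists h, lat_gen q rho h /\ g i = iota h.
  by move=> i; have [h h1 h2] := hg i; exists h.
have /choice [p hp] := fun i => compl_approx hc d.+1 (a i).
have : mR d.+1 (iota (H - \sum_i p i * h i)).
  rewrite rmorphB rmorph_sum.
  have -> : iota H - \sum_i iota (p i * h i) = (iota H - \sum_i a i * g i) + \sum_i (a i - iota (p i)) * g i.
    rewrite -[RHS]addrA; congr (_ + _); rewrite addrC -sumrB -sumrN; apply: eq_bigr => i _.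
    by have [_ ->] := hh i; rewrite rmorphM /=; ring.
  apply: idealD (tpowP _ _) hz _; apply: ideal_bigsum (tpowP _ _) _ => i _.
  exact: idealMr (tpowP _ _) (hp i).
move=> /(compl_kernel hc) [b [z [hb hzz e]]].
have z0 : pihomog mdeg d z = 0.
  move/mX_tpow: hzz => hzz; rewrite pihomogE big1_seq // => m /andP [/eqP md /hzz].
  by rewrite md ltnn.
have -> : H = pihomog mdeg d (\sum_i p i * h i + b).
  rewrite -{1}(pihomog_dE hH) -[in LHS](subrK (\sum_i p i * h i) H) e addrAC pihomogD z0 addr0.
  by rewrite [b + _]addrC.
apply: lat_homog => //; apply: idealD (lat_idealP _ _) _ (lat_base rhoP hb).
apply: ideal_bigsum (lat_idealP _ _) _ => i _; apply: idealMl (lat_idealP _ _) _.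
by apply: gen_ideal_sub; case: (hh i).
Qed.

(** Since ideals are closed, the order of r modulo the ideal is bounded. A representative of the
    largest order k has a leading form outside the lattice ideal, for otherwise its order could be
    raised. *)
Lemma MC_lead r : ~ MC rho r -> exists k (F : P) c,
  [/\ F \is k.-homog, ~ lat_ideal q rho F, MC rho c & mR k.+1 (r - iota F - c)].
Proof.
move=> nr; have hI := MC_ideal rho.
have hk : exists k, `[< ~ exists2 y, mR k y & MC rho (r - y) >].
  apply: contrapT => no; apply: nr; apply: (ideal_closed hc) => // k.
  by apply: contrapT => h; apply: no; exists k; apply/asboolP.
case: (ex_minnP hk) => -[|k] /asboolP hn hmin.
  by case: hn; exists r; [apply: tpow0 | rewrite subrr; apply: ideal0].
have [y hy hry] : exists2 y, mR k y & MC rho (r - y).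
  by apply: contrapT => h; have := hmin k; rewrite ltnn => /(_ (asboolT h)).
have [F hF hyF] := compl_lead hc hy.
exists k, F, (r - y); split=> //.
  move=> /lat_MC MF; apply: hn; exists (y - iota F) => //.
  by rewrite opprB addrA; rewrite addrAC; apply: idealD.
by rewrite (_ : r - iota F - _ = y - iota F) //; ring.
Qed.

Lemma homog_mR d (F : P) : F \is d.-homog -> mR d (iota F).
Proof.
by move=> /dhomogP hF; apply: iota_tpow; apply/mX_tpow => m /hF /= ->.
Qed.

(** If r and s lie outside, the product of their leading forms modulo the ideal is the leading form
    of an element congruent to r s, and it avoids the lattice ideal because that is prime. *)
Theorem MC_prime : prime_ideal (MC rho).
Proof.
have hI := MC_ideal rho; have [_ lat1 latM] := lat_prime rhoP; split=> // [M1|r s rs].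
  apply: lat1; apply: (@MC_homog 0 1 1) => //; first exact: dhomog1.
  by rewrite rmorph1 subrr; apply: ideal0 (tpowP _ _).
apply: contrapT => no.
have [k [F [c [hF nF hc1 hz]]]] : exists k (F : P) c,
    [/\ F \is k.-homog, ~ lat_ideal q rho F, MC rho c & mR k.+1 (r - iota F - c)].
  by apply: MC_lead => h; apply: no; left.
have [l [H [c' [hH nH hc2 hz']]]] : exists k (F : P) c,
    [/\ F \is k.-homog, ~ lat_ideal q rho F, MC rho c & mR k.+1 (s - iota F - c)].
  by apply: MC_lead => h; apply: no; right.
suff /latM [] : lat_ideal q rho (F * H) by [].
apply: (@MC_homog (k + l) _ ((r - c) * (s - c'))); first exact: dhomogM.
  have -> : (r - c) * (s - c') = r * s - (c * (s - c') + c' * r) by ring.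
  by apply: idealB => //; apply: idealD => //; apply: idealMr.
set z := r - _ - _ in hz; set z' := s - _ - _ in hz'.
have -> : iota (F * H) - (r - c) * (s - c') = - (z * (s - c') + iota F * z').
  by rewrite rmorphM /= /z /z'; ring.
apply: idealN (tpowP _ _) _; apply: idealD (tpowP _ _) _ _.
  have -> : s - c' = iota H + z' by rewrite /z'; ring.
  rewrite -addSn; apply: tpowM => //; apply: idealD (tpowP _ _) (homog_mR hH) _.
  exact: tpowS.
by rewrite -addnS; apply: tpowM => //; apply: homog_mR.
Qed.

(** Only the linear part counts, so this applies to every system of coordinates that agrees with
    iota modulo the square of the maximal ideal. *)
Lemma MC_avoid r e : mR 2 (r - te e) -> ~ MC rho r.
Proof.
move=> h hr; apply: (@lat_tvar G q C rho rhoP e); apply: (@MC_homog 1 _ r) => //.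
  by rewrite dhomogX /= mdeg1.
by rewrite -opprB; apply: idealN (tpowP _ _) h.
Qed.
End Character.

Hypothesis roots_of_unity : forall k, (0 < k)%N -> exists s : seq C,
  'X^k - 1 = \prod_(z <- s) ('X - z%:P).

(** In the residue field at Q the coordinates are invertible, so integral exponent vectors have
    values there. The minors give the value 1 on the lattice, hence roots of unity on its
    saturation; these lie in C because X^k - 1 splits, and they define rho. *)
Lemma MC_of_prime Q : prime_ideal Q -> (forall e, ~ Q (te e)) ->
  exists rho, sat_character q rho /\ forall r, MC rho r -> Q r.
Proof.
move=> Qp Qt; have [F [psi psik]] := prime_residue_field Qp.
pose xe e := psi (te e).
have xe0 e : xe e != 0 by apply/eqP => /psik; apply: Qt.
pose xv (v : V) := \prod_e xe e ^ (v e).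
have xvD u v : xv (u + v) = xv u * xv v.
  by rewrite -big_split; apply: eq_bigr => e _; rewrite ffunE expfzDr.
have xv0 : xv 0 = 1 by rewrite /xv big1 // => e _; rewrite ffunE expr0z.
have xvN0 v : xv v != 0 by apply/prodf_neq0 => e _; rewrite expfz_neq0.
have xvN v : xv (- v) = (xv v)^-1.
  by apply: (mulfI (xvN0 v)); rewrite -xvD subrr xv0 mulfV.
have xvd e : xv [ffun e' => (e' == e)%:R] = xe e.
  rewrite /xv (bigD1 e) //= ffunE eqxx expr1z big1 ?mulr1 // => e' /negbTE ee.
  by rewrite ffunE ee expr0z.
have xvL v : binomial_lattice q v -> xv v = 1.
  apply: (binomial_ind (S := fun v => xv v = 1)) => // [u w hu hw|u hu|p a b].
  - by rewrite xvD hu hw mulr1.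
  - by rewrite xvN hu invr1.
  rewrite /minor_vector !xvD !xvN !xvd; have := @te_minors G q C R iota hc p a b.
  move=> /(congr1 psi); rewrite !rmorphM -!/(xe _) => ->.
  by rewrite -[_ * _ / _ / _]mulrA -invfM mulfV // mulf_neq0.
pose emb : {rmorphism C -> F} := psi \o in_alg R.
have embZ c r : psi (c *: r) = emb c * psi r by rewrite -(mulr_algl c r) rmorphM.
have root v : saturation q v -> exists c, xv v = emb c.
  move=> [d d0 /xvL hd].
  have xvz k : xv (v *~ k) = xv v ^ k.
    have nat n : xv (v *+ n) = xv v ^+ n.
      by elim: n => [|n IH]; rewrite ?mulr0n // mulrS xvD IH exprS.
    by case: k => n; rewrite ?NegzE ?mulrNz ?xvN -pmulrn nat.
  have {}hd : xv v ^+ `|d|%N = 1.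
    move: hd; rewrite xvz; case: (d) => n //; rewrite NegzE => /(congr1 (fun z => z^-1)).
    by rewrite invr1 => <-; rewrite -exprnN invrK.
  have d1 : (0 < `|d|)%N by rewrite absz_gt0.
  have [s hs] := roots_of_unity d1.
  have : (map_poly emb ('X^`|d|%N - 1)).[xv v] = 0.
    by rewrite rmorphB rmorph1 rmorphXn /= map_polyX !hornerE hd subrr.
  rewrite hs rmorph_prod horner_prod => /eqP; rewrite prodf_seq_eq0 => /hasP [z _].
  rewrite rmorphB /= map_polyX map_polyC !hornerE subr_eq0 => /eqP ->.
  by exists z.
have /choice [rho hrho] : forall v, exists c, saturation q v -> xv v = emb c.
  move=> v; case: (pselect (saturation q v)) => [/root [c hcv]|]; [by exists c | by exists 0].
have embI : injective emb by exact: fmorph_inj.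
exists rho; split.
  split=> [v hv|u v hu hv|v hv].
  - by rewrite -(fmorph_eq0 emb) -hrho.
  - by apply: embI; rewrite (rmorphM emb) -(hrho _ hu) -(hrho _ hv) -(hrho _ (satD hu hv)).
  - by apply: embI; rewrite (rmorph1 emb) -(hrho _ (lattice_sat hv)) xvL.
have [hQ _ _] := Qp.
apply: gen_ideal_min => // _ [_ [v sv ->] ->]; apply/psik.
have tE u : psi (iota (tmon_pos C u)) = \prod_e xe e ^+ `|Num.max (u e) 0|%N.
  by rewrite !rmorph_prod; apply: eq_bigr => e _; rewrite !rmorphXn.
rewrite rmorphB /= linearZ /= rmorphB /= embZ !tE -hrho // /xv -big_split.
apply/eqP; rewrite subr_eq0; apply/eqP; apply: eq_bigr => e _; rewrite ffunE.
rewrite !exprnP -[RHS]expfzDr //; congr (_ ^ _); move: (v e) => k.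
by case: (ltrP k 0) => hk; case: (ltrP (- k) 0) => hk'; lia.
Qed.

(** A prime J' below contains some [MC rho']. If rho and rho' differed at v, the difference of the
    two binomials of v would be a nonzero multiple of a monomial inside [MC rho], which is prime and
    contains no coordinate. *)
Theorem MC_minimal rho : sat_character q rho -> minimal_prime (MC rho).
Proof.
move=> rhoP; have pr := MC_prime rhoP; have [hI _ _] := pr; split=> // J' Jp JM.
have av e : ~ MC rho (te e).
  by apply: (@MC_avoid rho rhoP _ e); rewrite subrr; apply: ideal0 (tpowP _ _).
have [rho' [rhoP' sub]] := MC_of_prime Jp (fun e h => av e (JM _ h)).
have gen rho0 v : saturation q v -> MC rho0 (iota (tmon_pos C v - rho0 v *: tmon_pos C (- v))).
  by move=> sv; apply: gen_ideal_sub; exists (tmon_pos C v - rho0 v *: tmon_pos C (- v)) => //; exists v.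
have eq v : saturation q v -> rho v = rho' v.
  move=> sv; apply/eqP; rewrite -subr_eq0; apply: contrapT => /negP ne.
  have : MC rho (iota ((rho v - rho' v) *: tmon_pos C (- v))).
    have -> : (rho v - rho' v) *: tmon_pos C (- v) =
        (tmon_pos C v - rho' v *: tmon_pos C (- v)) - (tmon_pos C v - rho v *: tmon_pos C (- v)) :> P.
      by rewrite scalerBl; ring.
    by rewrite rmorphB; apply: idealB; [|apply: JM; apply: sub; apply: gen|apply: gen].
  rewrite linearZ /= => h1; have : MC rho ((rho v - rho' v)^-1 *: ((rho v - rho' v) *: iota (tmon_pos C (- v)))).
    by rewrite -mulr_algl; apply: idealMl hI _.
  rewrite scalerA mulVf // scale1r rmorph_prod.
  apply: prime_ideal_prod => // e _; rewrite rmorphXn => /(prime_idealX pr); exact: av.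
move=> r; apply: (gen_ideal_min (I := J')); first by case: Jp.
move=> _ [_ [v sv ->] ->]; apply: sub; rewrite eq //; exact: gen.
Qed.
End MainComponents.

(** * The toric monoid *)

Lemma complex_unity_roots (Rr : realType) k : (0 < k)%N -> exists s : seq Rr[i],
  'X^k - 1 = \prod_(z <- s) ('X - z%:P).
Proof.
move=> k0; have [s hs] := closed_field_poly_normal ('X^k - 1 : {poly Rr[i]}).
exists s; rewrite [LHS]hs (_ : lead_coef _ = 1) ?scale1r //.
by rewrite -polyC1 lead_coefXnsubC.
Qed.

Lemma toric_monoid_column (Rr : realType) (G : finZmodType)
    (q : {additive (int * int)%type -> G}) e : toric_monoid q Rr (A_column q e).
Proof.
split; [exists (fun e' => (e' == e)%:R) | exists (fun e' => (e' == e)%:R); split].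
- rewrite (bigD1 e) //= eqxx mulr1z big1 ?addr0 // => e' /negbTE ->; exact: mulr0z.
- by move=> e'; rewrite ler0n.
move=> i; rewrite (bigD1 e) //= eqxx mul1r big1 ?addr0 // => e' /negbTE ->; exact: mul0r.
Qed.

(* A multiple of the sum of all columns is interior to the cone, so it dominates v. *)
Lemma toric_monoid_complement (Rr : realType) (G : finZmodType)
    (q : {additive (int * int)%type -> G}) v : toric_monoid q Rr v ->
  exists N : nat, toric_monoid q Rr ((\sum_e A_column q e) *+ N - v).
Proof.
move=> [[c cE] [d [d0 dE]]].
have [N hN] : exists N : nat, forall e, d e <= N%:R.
  have [N hN] : exists N : nat, \sum_e d e <= N%:R.
    exists (Num.bound (\sum_e d e)); apply/ltW/archi_boundP; exact: sumr_ge0.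
  exists N => e; apply: le_trans hN; rewrite (bigD1 e) //= lerDl.
  by apply: sumr_ge0.
exists N; split.
  exists (fun e => N%:Z - c e); rewrite cE -sumrMnl -sumrB; apply: eq_bigr => e _.
  by rewrite mulrzBr pmulrn.
exists (fun e => N%:R - d e); split=> [e|i]; first by rewrite subr_ge0.
have -> : (((\sum_e A_column q e) *+ N - v) i)%:~R =
    (\sum_e (A_column q e i)%:~R) * N%:R - (v i)%:~R :> Rr.
  rewrite ffunE ffunMnE sum_ffunE [(- v) i]ffunE rmorphB rmorphMn rmorph_sum /= mulr_natr.
  by [].
by rewrite dE mulr_suml -sumrB; apply: eq_bigr => e _; rewrite mulrBl mulrC.
Qed.

(** By [toric_monoid_complement] the character of any v in the monoid divides a power of the product
    of the characters of the columns. *)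
Lemma in_torusP (Rr : realType) (G : finZmodType) (q : {additive (int * int)%type -> G})
    (C : fieldType) (P : comAlgType C) (chi : char_lattice G -> P) (Rt : comAlgType C)
    (kappa : {lrmorphism P -> Rt}) (Q : Rt -> Prop) :
  monoid_algebra (toric_monoid q Rr) chi -> prime_ideal Q ->
  in_torus q Rr chi kappa Q <-> forall e, ~ Q (kappa (chi (A_column q e))).
Proof.
move=> [chi0 chiM _ _] Qp; split=> [h e|h v hv Qv]; first exact/h/toric_monoid_column.
have tD u w : toric_monoid q Rr u -> toric_monoid q Rr w -> toric_monoid q Rr (u + w).
  move=> [[c cE] [d [d0 dE]]] [[c' cE'] [d' [d0' dE']]]; split.
    exists (fun e => c e + c' e); rewrite cE cE' -big_split; apply: eq_bigr => e _.
    by rewrite mulrzDr.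
  exists (fun e => d e + d' e); split=> [e|i]; first by rewrite addr_ge0.
  rewrite ffunE rmorphD /= dE dE' -big_split; apply: eq_bigr => e _.
  by rewrite mulrDl.
have t0 : toric_monoid q Rr 0.
  split; [exists (fun=> 0) | exists (fun=> 0); split=> // i].
    by rewrite big1 // => e _; rewrite mulr0z.
  by rewrite ffunE big1 // => e _; rewrite mul0r.
have [N hw] := toric_monoid_complement hv; set w := _ - v in hw.
have chi_sum (s : seq (edge G)) : toric_monoid q Rr (\sum_(e <- s) A_column q e) /\
    chi (\sum_(e <- s) A_column q e) = \prod_(e <- s) chi (A_column q e).
  elim: s => [|e s [IH1 IH2]]; first by rewrite !big_nil.
  have te := toric_monoid_column Rr q e.
  by rewrite !big_cons -IH2 chiM //; split=> //; apply: tD.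
have [ts es] := chi_sum (index_enum (edge G)); set S := \sum_(e <- _) _ in ts es.
have chiX k : toric_monoid q Rr (S *+ k) /\ chi (S *+ k) = chi S ^+ k.
  elim: k => [|k [IH1 IH2]]; first by rewrite mulr0n expr0.
  by rewrite mulrS exprS -IH2 chiM //; split=> //; apply: tD.
have [hQ _ _] := Qp; have : Q (kappa (chi S ^+ N)).
  have [_ <-] := chiX N; rewrite -(subrK v (S *+ N)) chiM // rmorphM.
  exact: idealMl.
rewrite rmorphXn => /(prime_idealX Qp); rewrite es rmorph_prod.
by apply: prime_ideal_prod => // e _; apply: h.
Qed.

Theorem theorem5p4 (Rr : realType)
    (G : finZmodType) (q : {additive (int * int)%type -> G})
    (q_surj : forall p : G, exists x, q x = p) (T_polyhedral : polyhedral q)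
    (R : comAlgType Rr[i]) (J : {mpoly R[#|G|]} -> Prop)
    (J_versal : miniversal q J)
    (iota : {lrmorphism {mpoly Rr[i][#|edge G|]} -> R})
    (iota_coord : versal_coordinates q J iota) :
  (forall P : R -> Prop,
     smoothing_component J P <->
     exists rho : {ffun edge G -> int} -> Rr[i],
       sat_character q rho /\ (forall r, P r <-> main_component q iota rho r)) /\
  (exists iota' : {lrmorphism {mpoly Rr[i][#|edge G|]} -> R},
     versal_coordinates q J iota' /\
     forall (P : comAlgType Rr[i]) (chi : char_lattice G -> P) (Rt : comAlgType Rr[i])
         (kappa : {lrmorphism P -> Rt}) (j : {lrmorphism R -> Rt}),
       normalization_of_S q Rr iota' chi kappa j ->
       forall Q : Rt -> Prop, prime_ideal Q ->
         (discriminant (pullback_family j J) Q <-> ~ in_torus q Rr chi kappa Q)).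
Proof.
have [iota' [hc' [coord' close htoric]]] := toric_coordinates T_polyhedral J_versal iota_coord.
have hc : is_completion (@base_ideal G q Rr[i])
    (gen_ideal (fun y => exists i : 'I_#|edge G|, y = 'X_i)) iota.
  by case: iota_coord; rewrite t_idealE.
have bi2 := @base_ideal2 G q Rr[i].
have roots := @complex_unity_roots Rr.
have fibre := smooth_fibre_idP J_versal htoric.
have mRE k r : tpow (fun i => iota 'X_i) k r -> tpow (fun i => iota' 'X_i) k r.
  apply: tpow_gen_mono => i; apply/(nonunit_mR hc' bi2)/(nonunit_mR hc bi2).
  exact: (tpow1 (fun i => iota 'X_i)).
split=> [P|].
- split=> [[[Pp Pmin] [f nPf Pf]]|[rho [rhoP PE]]].
    (* Smoothness is detected by the coordinates iota'. By minimality P is a main component for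
       iota'; as such it avoids the coordinates of iota too, and so it is a main component for
       iota. *)
    have nP e : ~ P (iota' (tvar _ e)).
      by move: e; apply/(fibre P Pp); apply: Pf.
    have [rho' [rhoP' sub']] := MC_of_prime hc' roots Pp nP.
    have PM := Pmin _ (MC_prime hc' rhoP') sub'.
    have nP' e : ~ P (iota (tvar _ e)).
      move=> /PM; apply: (MC_avoid hc' rhoP' (e := e)); rewrite -opprB.
      by apply: idealN (tpowP _ _) _; apply/mRE/close.
    have [rho [rhoP sub]] := MC_of_prime hc roots Pp nP'.
    exists rho; split=> // r; split; last exact: sub.
    exact: (Pmin _ (MC_prime hc rhoP) sub).
  have -> : P = main_component q iota rho by apply/funext => r; apply/propext.
  have Mp := MC_prime hc rhoP; split; first exact: MC_minimal hc roots rho rhoP.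
  (* Smooth fibres are those where no coordinate of iota' vanishes. The product is nonzero on S_rho,
     although rho refers to iota, because the two systems agree to first order. *)
  exists (\prod_e iota' (tvar _ e)).
    by apply: prime_ideal_prod => // e _; apply: (MC_avoid hc rhoP (e := e)); apply: close.
  move=> Q Qp sub nQ; apply/(fibre Q Qp) => e Qe; apply: nQ.
  by rewrite (bigD1 e) //=; have [hQ _ _] := Qp; apply: idealMr.
exists iota'; split=> // P chi Rt kappa j [hchi _ jE] Q Qp.
have fib := smooth_fibreP J_versal htoric j Qp.
rewrite (in_torusP kappa hchi Qp); split=> [[_ ns] h|h].
  by apply: ns; apply/fib => e Qe; apply: (h e); rewrite -(jE e).
by split=> // /fib sm; apply: h => e; rewrite -(jE e); apply: sm.
Qed.
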